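(* Let $0<\lambda\leq 1$, let $s$ be a complex number with $\mathrm{Re}(s)=\frac12$, and let $k\geq 0$ be an integer. Then the limit in the norm of $K=L^2(]0,\infty[,dt)$ $$Y^\lambda_{s,k}:=\lim_{\substack{w\to s\\ \mathrm{Re}(w)<1/2}} V^{-1}Q_\lambda V(\psi_{w,k})$$ exists. Moreover, for every $\theta$ with $\lambda\leq\theta\leq 1$, $$(D_\theta(A),Y^\lambda_{s,k})=\left(-\frac{d}{ds}\right)^k\left(\theta^{s-\frac12}Z(s)\right).$$
   Context: $K=L^2(]0,\infty[,dt)$ over $\mathbb{C}$, with scalar product $(f,g)=\int_0^\infty f\overline{g}\,dt$ (linear in the first argument, conjugate-linear in the second). The Mellin transform $\widehat f(s)=\int_0^\infty f(t)t^{s-1}\,dt$ is an isometry from $K$ onto $L^2(\{s=\frac12+i\tau\},\frac{d\tau}{2\pi})$. $V$ is the unitary operator on $K$ which in Mellin variables is multiplication by $V(s)=\left(\frac{s}{1-s}\right)^3\frac{\zeta(1-s)}{\zeta(s)}$ on the line $\mathrm{Re}(s)=\frac12$, where $\zeta$ is the Riemann zeta function. $Q_\lambda$ is the orthogonal projection of $K$ onto $L^2([\lambda,\infty[,dt)$ (multiplication by the indicator of $[\lambda,\infty[$). $\chi$ is the indicator function of $]0,1]$, and for $w\in\mathbb{C}$ with $\mathrm{Re}(w)<\frac12$ and integer $k\ge0$, $\psi_{w,k}(t)=(\log(1/t))^k\,t^{-w}\chi(t)$. For $\theta>0$, $D_\theta f(t)=\theta^{-1/2}f(t/\theta)$. $A(t)=[1/t]\log(t)+\log([1/t]!)+[1/t]$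 for $t>0$ (where $[x]$ is the integer part; $A$ vanishes for $t>1$), and $Z(s)=\frac{s-1}{s}\frac{\zeta(s)}{s}$, which is the Mellin transform of $A$. For a function of $s=\frac12+i\tau$ on the critical line, $\frac{d}{ds}$ means $\frac1i\frac{d}{d\tau}$. *)

(* Defs.v *)
From HB Require Import structures.
From mathcomp Require Import all_boot all_order all_algebra.
From mathcomp Require Import complex.
From mathcomp Require Import all_classical all_reals all_analysis.

Set Implicit Arguments.
Unset Strict Implicit.
Unset Printing Implicit Defensive.
Import Order.TTheory GRing.Theory Num.Theory.
Import numFieldNormedType.Exports.
Local Open Scope classical_set_scope.
Local Open Scope ring_scope.
Local Open Scope complex_scope.

Section Defs.
Variable R : realType.
Local Notation C := (R[i]).
(* [Re] and [Im] of Num are [C]-valued; these are the real-valued projections. *)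
Local Notation Re := (@complex.Re R).
Local Notation Im := (@complex.Im R).
Local Notation normc := (@Normc.normc R).
Local Notation mu := (@lebesgue_measure R).
Implicit Types (f g F : R -> C) (s w z : C) (t tau theta lambda : R).

Definition cexp z : C := (expR (Re z))%:C * (cos (Im z) +i* sin (Im z)).

(* [t ^ z]; meaningful for [0 < t] only. *)
Definition cpow t z : C := cexp ((ln t)%:C * z).

Definition ccvg (u : nat -> C) z := normc (u n - z) @[n --> \oo] --> (0 : R).

Definition analytic_at (h : C -> C) s :=
  exists (a : nat -> C) (r : R), 0 < r /\
    forall z, normc (z - s) < r ->
      ccvg (fun N => \sum_(n < N) a n * (z - s) ^+ n) (h z).

(* The analytic continuation of the Dirichlet series to the half-plane
   [0 < Re s], punctured at the pole [1].  By the identity theorem these two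
   clauses determine [h] there; values elsewhere are never used. *)
Definition is_zeta (h : C -> C) :=
  (forall s, 0 < Re s -> s != 1 -> analytic_at h s) /\
  (forall s, 1 < Re s ->
     ccvg (fun N => \sum_(n < N) cpow n.+1%:R (- s)) (h s)).

Definition zeta : C -> C := xget (fun=> 0) is_zeta.

Definition cintegral (D : set R) f : C :=
  (\int[mu]_(t in D) Re (f t)) +i* (\int[mu]_(t in D) Im (f t)).

Definition L2norm (D : set R) f : \bar R :=
  Lnorm mu 2%:E (fun t => (normc (f t) * \1_D t)%:E).

(* Elements of L^2(D) are represented by functions on [R], of which only the
   restriction to [D], up to a null set, matters. *)
Definition L2 (D : set R) : set (R -> C) := [set f : R -> C |
  [/\ measurable_fun D (Re \o f), measurable_fun D (Im \o f)
    & (L2norm D f < +oo)%E]].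

Definition posline : set R := `]0, +oo[.

Definition K : set (R -> C) := L2 posline.

Definition inner f g : C := cintegral posline (fun t => f t * conjc (g t)).

Definition crit tau : C := 2^-1 +i* tau.

(* The Mellin--Plancherel transform, as a function of [tau] in
   [s = 1/2 + i tau]: for a general [f] in [K] the integral need not converge
   absolutely, and the transform is the L^2 limit of the truncated integrals
   (the constant factor 1/(2 pi) in the measure is immaterial here). *)
Definition mellin_trunc (n : nat) f tau : C :=
  cintegral `[n.+1%:R^-1, n.+1%:R] (fun t => f t * cpow t (crit tau - 1)).

Definition is_mellin f F :=
  L2 setT F /\
  L2norm setT (fun tau => mellin_trunc n f tau - F tau) @[n --> \oo] --> 0%E.

Definition mellin f : R -> C := xget (fun=> 0) (is_mellin f).

Definition Vsymbol s : C := (s / (1 - s)) ^+ 3 * (zeta (1 - s) / zeta s).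

(* [V] and its inverse, up to null sets.  The zeros of [zeta] on the critical
   line form a null set, so that the convention [x / 0 = 0] is harmless. *)
Definition V f : R -> C := xget (fun=> 0) [set g : R -> C | K g /\
  ae_eq mu setT (mellin g) (fun tau => Vsymbol (crit tau) * mellin f tau)].

Definition Vinv g : R -> C := xget (fun=> 0) [set f : R -> C | K f /\
  ae_eq mu posline (V f) g].

Definition Q lambda f : R -> C := fun t => (\1_(`[lambda, +oo[) t)%:C * f t.

Definition psi w (k : nat) : R -> C :=
  fun t => ((ln t^-1) ^+ k)%:C * cpow t (- w) * (\1_(`]0, 1]) t)%:C.

Definition dilation theta f : R -> C :=
  fun t => ((Num.sqrt theta)^-1)%:C * f (t / theta).

Definition A : R -> C := fun t =>
  let n := Num.truncn t^-1 in (n%:R * ln t + ln (n`!)%:R + n%:R)%:C.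

Definition Z s : C := (s - 1) / s * (zeta s / s).

(* [d/ds = (1/i) d/dtau] along the critical line; only the values of [h] on
   that line are used. *)
Definition dds (h : C -> C) s : C :=
  (0 +i* 1)^-1 * (derive1 (fun tau => Re (h (crit tau))) (Im s) +i*
           derive1 (fun tau => Im (h (crit tau))) (Im s)).

(* [Y] is a representative, up to null sets, of the limit in [K]. *)
Definition is_Ylim lambda s (k : nat) (Y : R -> C) :=
  K Y /\
  forall eps : R, 0 < eps -> exists2 delta : R, 0 < delta &
    forall w, Re w < 2^-1 -> normc (w - s) < delta ->
      (L2norm posline
        (fun t => Vinv (Q lambda (V (psi w k))) t - Y t)%R < eps%:E)%E.

End Defs.

(* Main.v *)
(* Under [t = exp x] the Mellin transform on the critical line becomes the Fourier
   transform on the real line, and Plancherel's theorem makes [V] unitary.  The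
   functional equation, obtained on the critical line by comparing the partial sums
   of the sawtooth series with the sine integral, exhibits [V(s) / s] as the
   transform of a function [phi] that is [O(exp (- |x| / 4))].  Hence [V psi_{w,k}]
   is a combination of the integrals of [v ^ k exp (- (1/2 - w) v) phi (x + v)] over
   [v > 0].  For [x >= ln lambda] these converge up to [Re w = 1/2] and are
   Lipschitz in [w], with a square integrable constant, so the limit exists because
   [V] is an isometry.
   For the scalar product, [V(s) Z(s) = Z(1 - s)] shows that [V] maps [D_theta A] to
   a function vanishing for [t < theta].  The projection therefore has no effect
   on the product of [V D_theta A] with [V psi_{w,k}], which is the product of
   [D_theta A] with [psi_{w,k}], and [w] may tend to [s] under the integral. *)
From HB Require Import structures.
Require Import Defs.
From mathcomp Require Import all_boot all_order all_algebra.
From mathcomp Require Import complex.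
From mathcomp Require Import all_classical all_reals all_analysis.
From mathcomp Require Import ring lra.
From mathcomp Require Import measurable_realfun.
Set Implicit Arguments.
Unset Strict Implicit.
Unset Printing Implicit Defensive.
Import Order.TTheory GRing.Theory Num.Theory.
Import numFieldNormedType.Exports.
Local Open Scope classical_set_scope.
Local Open Scope ring_scope.
Local Open Scope complex_scope.

(** The multiplier [V] has modulus 1 on the line, so it is not the transform of an integrable
    function; dividing by [s] gives one, and the lost factor returns as [(s - w) + w], whose first
    summand lowers the order of the pole at [w]. The functional equation rests on one kernel,
    [sin (2 pi t) / (pi t)]: the [n]-th sawtooth harmonic divided by [t] is its dilate by [n], so
    the partial sums carry the partial sums of [n ^ (- s)], which diverge on the line. The sine
    integral supplies the missing term [N ^ (1 - s) / (1 - s)] and also cancels the constant 1/2 of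
    the sawtooth, leaving the limit [- {t}], whose transform is [zeta (1 - s) / (1 - s)]. Bounds
    uniform in [N] at both ends of the half-line allow dominated convergence. [V], its inverse and
    the Mellin transform are chosen by [xget], hence known up to null sets only; they are handled
    through the relation [is_fourier], and solving for them takes surjectivity of the Plancherel
    transform. The rate 1/4 stands for any rate below the 1/2 of the averaging kernel [avgexp]. The
    constant [planch] enters through its sign only. *)

Section Complex.
Variable R : realType.
Local Notation C := (R[i]).
Local Notation Re := (@complex.Re R).
Local Notation Im := (@complex.Im R).
Local Notation normc := (@Normc.normc R).
Implicit Types (x y : R) (z w : C).

(** * Complex numbers over [R], the norm [normc] and the complex exponential *)

Lemma ReD z w : Re (z + w) = Re z + Re w. Proof. by case: z w => [a b] [c d]. Qed.
Lemma ImD z w : Im (z + w) = Im z + Im w. Proof. by case: z w => [a b] [c d]. Qed.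
Lemma ReN z : Re (- z) = - Re z. Proof. by case: z. Qed.
Lemma ImN z : Im (- z) = - Im z. Proof. by case: z. Qed.
Lemma ReB z w : Re (z - w) = Re z - Re w. Proof. by rewrite ReD ReN. Qed.
Lemma ImB z w : Im (z - w) = Im z - Im w. Proof. by rewrite ImD ImN. Qed.
Lemma cReM z w : Re (z * w) = Re z * Re w - Im z * Im w.
Proof. by case: z w => [a b] [c d]. Qed.
Lemma cImM z w : Im (z * w) = Re z * Im w + Im z * Re w.
Proof. by case: z w => [a b] [c d]. Qed.
Lemma ReC x : Re x%:C = x. Proof. by []. Qed.
Lemma ImC x : Im x%:C = 0. Proof. by []. Qed.
Lemma Re0 : Re 0 = 0. Proof. by []. Qed.
Lemma Im0 : Im 0 = 0. Proof. by []. Qed.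
Lemma Re1 : Re 1 = 1. Proof. by []. Qed.
Lemma Im1 : Im 1 = 0. Proof. by []. Qed.
Lemma ReJ z : Re (conjc z) = Re z. Proof. by case: z. Qed.
Lemma ImJ z : Im (conjc z) = - Im z. Proof. by case: z. Qed.
Lemma Rei x y : Re (x +i* y) = x. Proof. by []. Qed.
Lemma Imi x y : Im (x +i* y) = y. Proof. by []. Qed.

Definition reimE := (ReD, ImD, ReN, ImN, cReM, cImM, ReC, ImC, Re0, Im0, Re1, Im1,
  ReJ, ImJ, Rei, Imi).

Lemma ceq z w : Re z = Re w -> Im z = Im w -> z = w.
Proof. by case: z w => [a b] [c d] /= -> ->. Qed.

Lemma ReMC x z : Re (x%:C * z) = x * Re z. Proof. by rewrite !reimE; ring. Qed.
Lemma ImMC x z : Im (x%:C * z) = x * Im z. Proof. by rewrite !reimE; ring. Qed.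

Lemma normc_sqr z : normc z ^+ 2 = Re z ^+ 2 + Im z ^+ 2.
Proof. by case: z => a b; rewrite /= sqr_sqrtr // addr_ge0 // sqr_ge0. Qed.

Lemma normc_ge0 z : 0 <= normc z. Proof. by case: z => a b; exact: sqrtr_ge0. Qed.

Lemma normc_le_sqr z x : 0 <= x -> (normc z <= x) = (Re z ^+ 2 + Im z ^+ 2 <= x ^+ 2).
Proof. by move=> x0; rewrite -normc_sqr ler_sqr ?nnegrE ?normc_ge0. Qed.

Lemma normc_eq z x : 0 <= x -> Re z ^+ 2 + Im z ^+ 2 = x ^+ 2 -> normc z = x.
Proof.
move=> x0 h; apply/eqP.
by rewrite -(@eqrXn2 _ 2) ?normc_ge0 // normc_sqr h.
Qed.

Lemma normcD z w : normc (z + w) <= normc z + normc w.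
Proof. exact: (@le_normcD R z w). Qed.

Lemma normcN z : normc (- z) = normc z.
Proof. by case: z => a b; rewrite /= !sqrrN. Qed.

Lemma normcB z w : normc (z - w) <= normc z + normc w.
Proof. by rewrite -(normcN w) normcD. Qed.

Lemma normcBC z w : normc (z - w) = normc (w - z).
Proof. by rewrite -normcN opprB. Qed.

Lemma normcM z w : normc (z * w) = normc z * normc w.
Proof. exact: Normc.normcM. Qed.

Lemma normcC x : normc x%:C = `|x|.
Proof. by rewrite /= expr0n /= addr0 sqrtr_sqr. Qed.

Lemma normcMC x z : normc (x%:C * z) = `|x| * normc z.
Proof. by rewrite normcM normcC. Qed.

Lemma normcJ z : normc (conjc z) = normc z.
Proof. by case: z => a b; rewrite /= sqrrN. Qed.

Lemma normcX z n : normc (z ^+ n) = normc z ^+ n.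
Proof.
elim: n => [|n IH]; first by rewrite !expr0 Normc.normc1.
by rewrite !exprS normcM IH.
Qed.

Lemma normcV z : normc z^-1 = (normc z)^-1.
Proof. exact: Normc.normcV. Qed.

Lemma normc_eq0 z : (normc z == 0) = (z == 0).
Proof.
apply/eqP/eqP => [/Normc.eq0_normc//|->]; exact: Normc.normc0.
Qed.

Lemma normc_gt0 z : (0 < normc z) = (z != 0).
Proof. by rewrite lt_def normc_ge0 andbT normc_eq0. Qed.

Lemma Re_le_normc z : `|Re z| <= normc z.
Proof.
by rewrite -ler_sqr ?nnegrE ?normc_ge0 // normc_sqr real_normK ?num_real// lerDl sqr_ge0.
Qed.

Lemma Im_le_normc z : `|Im z| <= normc z.
Proof.
by rewrite -ler_sqr ?nnegrE ?normc_ge0 // normc_sqr real_normK ?num_real// lerDr sqr_ge0.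
Qed.

Lemma normc_le_ReIm z : normc z <= `|Re z| + `|Im z|.
Proof.
rewrite normc_le_sqr ?addr_ge0 // sqrrD !real_normK ?num_real//.
by rewrite -addrA (addrC (_ *+ 2)) addrA lerDl mulrn_wge0 // mulr_ge0.
Qed.

Lemma normc_sum (I : Type) (r : seq I) (P : pred I) (F : I -> C) :
  normc (\sum_(i <- r | P i) F i) <= \sum_(i <- r | P i) normc (F i).
Proof.
elim/big_ind2 : _ => //; first by rewrite Normc.normc0.
by move=> x1 x2 y1 y2 h1 h2; rewrite (le_trans (normcD _ _)) // lerD.
Qed.

Lemma normc_tri a z w : normc (z - w) <= normc (z - a) + normc (a - w).
Proof. by rewrite -[z - w](subrKA a) normcD. Qed.

(* Young's inequality replaces Minkowski's inequality throughout. *)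
Lemma normcD_sqr z w (e : R) : 0 < e ->
  normc (z + w) ^+ 2 <= (1 + e) * normc z ^+ 2 + (1 + e^-1) * normc w ^+ 2.
Proof.
move=> e0.
have h : normc (z + w) ^+ 2 <= (normc z + normc w) ^+ 2.
  by rewrite ler_sqr ?nnegrE ?normcD // ?addr_ge0 ?normc_ge0.
apply: le_trans h _; move: (normc z) (normc w) => a b.
rewrite -subr_ge0.
rewrite (_ : _ - _ = e^-1 * (e * a - b) ^+ 2); last by field; exact: lt0r_neq0.
by rewrite mulr_ge0 ?sqr_ge0 // invr_ge0 ltW.
Qed.

Lemma normcD_sqr2 z w : normc (z + w) ^+ 2 <= 2 * normc z ^+ 2 + 2 * normc w ^+ 2.
Proof.
have := @normcD_sqr z w 1 ltr01; rewrite invr1 (_ : 1 + 1 = 2 :> R) //.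
Qed.

Definition cis x : C := cos x +i* sin x.

Lemma cisD x y : cis (x + y) = cis x * cis y.
Proof. by apply: ceq; rewrite !reimE /= ?cosD ?sinD; ring. Qed.

Lemma cis0 : cis 0 = 1.
Proof. by rewrite /cis cos0 sin0. Qed.

Lemma normc_cis x : normc (cis x) = 1.
Proof. by apply: normc_eq => //=; rewrite cos2Dsin2 expr1n. Qed.

Lemma conj_cis x : conjc (cis x) = cis (- x).
Proof. by rewrite /cis cosN sinN. Qed.

Lemma cexpE z : cexp z = (expR (Re z))%:C * cis (Im z). Proof. by []. Qed.

Lemma cexpD z w : cexp (z + w) = cexp z * cexp w.
Proof. by rewrite !cexpE ReD ImD expRD cisD; apply: ceq; rewrite !reimE; ring. Qed.

Lemma cexp0 : cexp (0 : C) = 1.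
Proof. by rewrite cexpE /= expR0 cis0 mulr1. Qed.

Lemma normc_cexp z : normc (cexp z) = expR (Re z).
Proof. by rewrite cexpE normcMC normc_cis mulr1 ger0_norm ?expR_ge0. Qed.

Lemma cexpC x : cexp x%:C = (expR x)%:C.
Proof. by rewrite cexpE /= cis0 mulr1. Qed.

Lemma cexpJ z : cexp (conjc z) = conjc (cexp z).
Proof. by rewrite !cexpE ReJ ImJ -conj_cis; apply: ceq; rewrite !reimE; ring. Qed.

Lemma cpow1 (z : C) : cpow (1 : R) z = 1.
Proof. by rewrite /cpow ln1 mul0r cexp0. Qed.

Lemma normc_cpow x z : normc (cpow x z) = expR (ln x * Re z).
Proof. by rewrite /cpow normc_cexp !reimE; congr expR; ring. Qed.

(** Complex conjugation acts on the critical line as [s -> 1 - s]; this is what makes both quotients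
    in [Vsymbol] unimodular there. *)
Lemma conjc_crit x : conjc (crit x) = 1 - crit x.
Proof. have h : 2^-1 = 1 - 2^-1 :> R by field.
by apply: ceq; rewrite /crit !reimE; [exact: h|ring]. Qed.

Lemma conjcK z : conjc (conjc z) = z.
Proof. by case: z => a b; rewrite /= opprK. Qed.

Lemma conjcD z w : conjc (z + w) = conjc z + conjc w.
Proof. by apply: ceq; rewrite !reimE //; ring. Qed.

Lemma conjcM z w : conjc (z * w) = conjc z * conjc w.
Proof. by apply: ceq; rewrite !reimE; ring. Qed.

Lemma conjcN z : conjc (- z) = - conjc z.
Proof. by apply: ceq; rewrite !reimE. Qed.

Lemma conjcC x : conjc x%:C = x%:C.
Proof. by apply: ceq; rewrite !reimE ?oppr0. Qed.

Lemma mulc_conj z : z * conjc z = (normc z ^+ 2)%:C.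
Proof. by rewrite normc_sqr; apply: ceq; rewrite !reimE; ring. Qed.

End Complex.

(** * Integrals of real functions over the whole line *)

Section RealIntegral.
Variable R : realType.
Local Notation mu := (@lebesgue_measure R).
Implicit Types f g h : R -> R.

(** All integrals run over the whole line, a domain being an indicator factor of the integrand.
    [rint] is the real value, to be used under [I1]; [nint] is the extended value, to be used for
    nonnegative functions whose integrability is still to be proved. *)
Definition mf f := measurable_fun [set: R] f.
Definition I1 f := mu.-integrable [set: R] (EFin \o f).
Definition rint f : R := (\int[mu]_x f x)%R.
Definition nint f : \bar R := (\int[mu]_x (f x)%:E)%E.

Lemma cvg_EFin2 (u : nat -> R) (l : R) : u n @[n --> \oo] --> l ->
  (u n)%:E @[n --> \oo] --> l%:E.
Proof.
by move=> h; apply: (@cvg_EFin _ _ _ _ (fun n => (u n)%:E) l) => //; exact: nearW.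
Qed.

Lemma ae_S (P Q : R -> Prop) : (forall x, P x -> Q x) ->
  {ae mu, forall x, P x} -> {ae mu, forall x, Q x}.
Proof. by move=> PQ; apply: (@filterS _ _ (ae_filter_ringOfSetsType mu)). Qed.

Lemma ae_I (P Q : R -> Prop) : {ae mu, forall x, P x} -> {ae mu, forall x, Q x} ->
  {ae mu, forall x, P x /\ Q x}.
Proof. by move=> p q; apply: (@filterI _ _ (ae_filter_ringOfSetsType mu)). Qed.

Lemma mfE f : measurable_fun [set: R] (fun x => (f x)%:E) <-> mf f.
Proof. exact: measurable_EFinP. Qed.

Lemma I1_mf f : I1 f -> mf f.
Proof. by move=> /measurable_int/measurable_EFinP. Qed.

Lemma mf_cst (r : R) : mf (fun=> r). Proof. exact: measurable_cst. Qed.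
Lemma mf_id : mf (fun x => x). Proof. exact: measurable_id. Qed.
Lemma mf_comp f g : mf f -> mf g -> mf (fun x => f (g x)).
Proof. by move=> hf hg; apply: (measurableT_comp hf hg). Qed.
Lemma mf_continuous f : continuous f -> mf f.
Proof. exact: continuous_measurable_fun. Qed.
Lemma mfD f g : mf f -> mf g -> mf (fun x => f x + g x).
Proof. exact: measurable_funD. Qed.
Lemma mfM f g : mf f -> mf g -> mf (fun x => f x * g x).
Proof. exact: measurable_funM. Qed.
Lemma mfN f : mf f -> mf (fun x => - f x).
Proof. by move=> h; apply: mf_comp => //; exact: measurable_funN. Qed.
Lemma mfB f g : mf f -> mf g -> mf (fun x => f x - g x).
Proof. exact: measurable_funB. Qed.
Lemma mf_norm f : mf f -> mf (fun x => `|f x|).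
Proof. by move=> h; apply: mf_comp => //; exact: normr_measurable. Qed.
Lemma mfX f n : mf f -> mf (fun x => f x ^+ n).
Proof. exact: measurable_funX. Qed.
Lemma mf_indic (A : set R) : measurable A -> mf (\1_A).
Proof. by move=> h; exact: measurable_indic. Qed.
Lemma mf_affine (a b : R) : mf (fun x => a * x + b).
Proof. by apply: mfD (mf_cst b); apply: mfM (mf_cst a) mf_id. Qed.
Lemma mf_expR f : mf f -> mf (fun x => expR (f x)).
Proof. by apply: mf_comp; exact: measurable_expR. Qed.
Lemma mf_cos f : mf f -> mf (fun x => cos (f x)).
Proof. by apply: mf_comp; apply: mf_continuous; exact: continuous_cos. Qed.
Lemma mf_sin f : mf f -> mf (fun x => sin (f x)).
Proof. by apply: mf_comp; apply: mf_continuous; exact: continuous_sin. Qed.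
Lemma mf_sum (I : Type) (s : seq I) (h : I -> R -> R) :
  (forall i, mf (h i)) -> mf (fun x => \sum_(i <- s) h i x).
Proof. by move=> hh; apply: measurable_sum. Qed.
Lemma mf_cvg (h : nat -> R -> R) f : (forall n, mf (h n)) ->
  (forall x, h n x @[n --> \oo] --> f x) -> mf f.
Proof. by move=> hh hc; apply: (measurable_fun_cvg hh) => x _; exact: hc. Qed.

Lemma le_I1 f g : mf f -> I1 g -> (forall x, `|f x| <= g x) -> I1 f.
Proof.
move=> hf hg fg; apply: le_integrable hg => //; first exact/mfE.
by move=> x _ /=; rewrite lee_fin (le_trans (fg x)) // ler_norm.
Qed.

Lemma I1_norm f : I1 f -> I1 (fun x => `|f x|).
Proof. by move=> h; apply: (integrable_abse h). Qed.
Lemma I1D f g : I1 f -> I1 g -> I1 (fun x => f x + g x).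
Proof. by move=> hf hg; have := integrableD measurableT hf hg; exact. Qed.
Lemma I1Z (a : R) f : I1 f -> I1 (fun x => a * f x).
Proof. by move=> hf; have := integrableZl measurableT a hf; exact. Qed.
Lemma I1N f : I1 f -> I1 (fun x => - f x).
Proof.
by move=> /(I1Z (-1)); rewrite (_ : (fun x => -1 * f x) = fun x => - f x) //; apply/funext => x; rewrite mulN1r.
Qed.
Lemma I1B f g : I1 f -> I1 g -> I1 (fun x => f x - g x).
Proof. by move=> hf hg; apply: I1D => //; exact: I1N. Qed.
Lemma I1_0 : I1 (fun=> 0).
Proof. exact: integrable0. Qed.
Lemma I1_sum (I : Type) (s : seq I) (h : I -> R -> R) :
  (forall i, I1 (h i)) -> I1 (fun x => \sum_(i <- s) h i x).
Proof.
move=> hh; elim: s => [|i s IH].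
  by rewrite (_ : (fun _ => _) = fun=> 0) ?I1_0 //; apply/funext => x; rewrite big_nil.
rewrite (_ : (fun _ => _) = fun x => h i x + \sum_(i <- s) h i x); first exact: I1D.
by apply/funext => x; rewrite big_cons.
Qed.
Lemma I1Mb f b (B : R) : I1 f -> mf b -> (forall x, `|b x| <= B) -> I1 (fun x => f x * b x).
Proof.
move=> hf hb bB; apply: (@le_I1 _ (fun x => B * `|f x|)).
- by apply: mfM => //; exact: I1_mf.
- by apply: I1Z; exact: I1_norm.
- by move=> x; rewrite normrM mulrC ler_wpM2r.
Qed.

Lemma rintE f : I1 f -> (rint f)%:E = nint f.
Proof. by move=> h; rewrite /rint /Rintegral fineK //; exact: integrable_fin_num. Qed.

Lemma rintD f g : I1 f -> I1 g -> rint (fun x => f x + g x) = rint f + rint g.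
Proof. exact: RintegralD. Qed.
Lemma rintB f g : I1 f -> I1 g -> rint (fun x => f x - g x) = rint f - rint g.
Proof. exact: RintegralB. Qed.
Lemma rintZ (a : R) f : I1 f -> rint (fun x => a * f x) = a * rint f.
Proof. by move=> h; exact: RintegralZl. Qed.
Lemma rintN f : I1 f -> rint (fun x => - f x) = - rint f.
Proof.
move=> h; rewrite -mulN1r -rintZ //.
by congr rint; apply/funext => x; rewrite mulN1r.
Qed.
Lemma rint0 : rint (fun=> 0) = 0.
Proof. by rewrite /rint /Rintegral integral0. Qed.
Lemma rint_sum (I : Type) (s : seq I) (h : I -> R -> R) :
  (forall i, I1 (h i)) -> rint (fun x => \sum_(i <- s) h i x) = \sum_(i <- s) rint (h i).
Proof.
move=> hh; elim: s => [|i s IH].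
  by rewrite big_nil -[RHS]rint0; congr rint; apply/funext => x; rewrite big_nil.
rewrite big_cons -IH -rintD //; last exact: I1_sum.
by congr rint; apply/funext => x; rewrite big_cons.
Qed.
Lemma le_rint f g : I1 f -> I1 g -> (forall x, f x <= g x) -> rint f <= rint g.
Proof. by move=> hf hg fg; exact: le_Rintegral. Qed.
Lemma rint_ge0 f : (forall x, 0 <= f x) -> 0 <= rint f.
Proof. by move=> f0; exact: Rintegral_ge0. Qed.
Lemma rint_norm f : I1 f -> `|rint f| <= rint (fun x => `|f x|).
Proof. by move=> h; exact: le_normr_Rintegral. Qed.
Lemma eq_rint f g : (forall x, f x = g x) -> rint f = rint g.
Proof. by move=> /funext ->. Qed.
Lemma ae_rint f g : mf f -> mf g -> ae_eq mu setT f g -> rint f = rint g.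
Proof.
move=> hf hg fg; rewrite /rint /Rintegral; congr fine; apply: ae_eq_integral => //.
- exact/mfE.
- exact/mfE.
- by apply: filterS fg => x /= /[apply] ->.
Qed.
Lemma ae_I1 f g : mf g -> ae_eq mu setT f g -> I1 f -> I1 g.
Proof.
move=> hg fg hf; apply/integrableP; split; first exact/mfE.
have /integrableP[m lt] := hf; apply: le_lt_trans lt.
rewrite le_eqVlt; apply/orP; left; apply/eqP; apply: ae_eq_integral => //.
- by apply: measurableT_comp => //; exact/mfE.
- by apply: measurableT_comp => //; exact/mfE/I1_mf.
- by apply: filterS fg => x /= /[apply] ->.
Qed.

Lemma nint_ge0 f : (forall x, 0 <= f x) -> (0 <= nint f)%E.
Proof. by move=> f0; apply: integral_ge0 => x _; rewrite lee_fin. Qed.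

Lemma le_nint f g : mf f -> mf g -> (forall x, 0 <= f x <= g x) -> (nint f <= nint g)%E.
Proof.
move=> hf hg fg; apply: ge0_le_integral => //; try exact/mfE.
all: by move=> x _; rewrite lee_fin; case/andP: (fg x) => h1 h2 //; exact: le_trans h1 h2.
Qed.

Lemma I1P f : mf f -> (nint (fun x => `|f x|%R) < +oo)%E -> I1 f.
Proof. by move=> hf lt; apply/integrableP; split => //; exact/mfE. Qed.

Lemma I1P0 f : mf f -> (forall x, 0 <= f x) -> (nint f < +oo)%E -> I1 f.
Proof.
move=> hf f0 lt; apply: I1P => //; rewrite (_ : (fun x => `|f x|) = f) //.
by apply/funext => x; rewrite ger0_norm.
Qed.

Lemma I1_lty f : I1 f -> (nint f < +oo)%E.
Proof. by move=> h; rewrite -rintE // ltry. Qed.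

Lemma nintD f g : mf f -> mf g -> (forall x, 0 <= f x) -> (forall x, 0 <= g x) ->
  nint (fun x => f x + g x) = (nint f + nint g)%E.
Proof.
move=> hf hg f0 g0; rewrite -ge0_integralD //.
- by move=> x _; rewrite lee_fin.
- exact/mfE.
- by move=> x _; rewrite lee_fin.
- exact/mfE.
Qed.

Lemma nintZ (a : R) f : mf f -> (forall x, 0 <= f x) -> 0 <= a ->
  nint (fun x => a * f x) = (a%:E * nint f)%E.
Proof.
move=> hf f0 a0; rewrite -ge0_integralZl //.
- exact/mfE.
- by move=> x _; rewrite lee_fin.
Qed.

Lemma eq_nint f g : (forall x, f x = g x) -> nint f = nint g.
Proof. by move=> /funext ->. Qed.

Lemma ae_nint f g : mf f -> mf g -> ae_eq mu setT f g -> nint f = nint g.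
Proof.
move=> hf hg fg; apply: ae_eq_integral => //; try exact/mfE.
by apply: filterS fg => x /= /[apply] ->.
Qed.

Lemma nint_eq0 f : mf f -> (forall x, 0 <= f x) -> nint f = 0 -> ae_eq mu setT f (cst 0).
Proof.
move=> hf f0 h.
have : (\int[mu]_x `|(f x)%:E| = 0)%E.
  by rewrite -[RHS]h; apply: eq_integral => x _; rewrite gee0_abs // lee_fin.
move=> /(ae_eq_integral_abs mu measurableT ((mfE f).2 hf)).
by apply: filterS => x /= /[apply] -[].
Qed.

(** Fatou's lemma with an eventual bound in place of a lower limit. It serves where no dominating
    function is at hand: both halves of Plancherel's theorem, completeness, integrability on a
    ray. *)
Lemma nint_fatou (f_ : nat -> R -> R) f (M : \bar R) : (forall n, mf (f_ n)) ->
  (forall n x, 0 <= f_ n x) -> mf f ->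
  {ae mu, forall x, f_ n x @[n --> \oo] --> f x} ->
  (\forall n \near \oo, (nint (f_ n) <= M)%E) -> (nint f <= M)%E.
Proof.
move=> mf_ f0 mff cv bd.
have := @fatou _ _ _ mu setT measurableT (fun n x => (f_ n x)%:E)
  (fun n => (mfE _).2 (mf_ n)) (fun n x _ => f0 n x).
set A := (X in (X <= _)%E -> _); set B := (X in (_ <= X)%E -> _).
have -> : A = nint f.
  apply: ae_eq_integral => //.
  (* Lower limits are opposites of upper limits of the opposite functions, whose measurability
     follows termwise. *)
  - have -> : (fun x : R => limn_einf ((fun (n : nat) (x0 : R) => (f_ n x0)%:E)^~ x)) =
      (fun x => (- limn_esup (fun n => (- f_ n x)%:E))%E).
      by apply/funext => x; rewrite -limn_einfN; congr limn_einf; apply/funext => n /=; rewrite opprK.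
    apply: measurableT_comp => //; apply: measurable_fun_limn_esup => n.
    by apply/mfE; exact: mfN.
  - exact/mfE.
  apply: ae_S cv => x /= cvx _.
  have h : (f_ n x)%:E @[n --> \oo] --> (f x)%:E by exact: cvg_EFin2.
  by have [-> _] := cvg_limn_einf_sup h.
move=> /le_trans; apply.
case: bd => N _ bd.
rewrite /B limn_einf_lim; apply: lime_le; first exact: is_cvg_einfs.
near=> n; apply: ge_ereal_inf; exists (nint (f_ n)); last by apply: bd; near: n; exists N.
by exists n => /=.
Unshelve. all: by end_near. Qed.

Lemma rint_dct (f_ : nat -> R -> R) f g : (forall n, mf (f_ n)) -> mf f -> I1 g ->
  {ae mu, forall x, f_ n x @[n --> \oo] --> f x} ->
  (forall n x, `|f_ n x| <= g x) ->
  I1 f /\ rint (f_ n) @[n --> \oo] --> rint f.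
Proof.
move=> mf_ mff hg cv bd.
have := @dominated_convergence _ _ _ mu setT measurableT (fun n x => (f_ n x)%:E)
  (fun x => (f x)%:E) (EFin \o g) (fun n => (mfE _).2 (mf_ n)) ((mfE f).2 mff).
case.
- by apply: ae_S cv => x cvx _; exact: cvg_EFin2.
- exact: hg.
- by apply: aeW => x n _ /=; rewrite lee_fin.
move=> h1 _ h2; split; first exact: h1.
have I1n n : I1 (f_ n) by apply: (le_I1 (mf_ n) hg) => x; exact: bd.
have h3 : (rint (f_ n))%:E @[n --> \oo] --> (rint f)%:E.
  by rewrite rintE // ; under eq_fun do rewrite rintE //.
by apply: (fine_cvg h3).
Qed.

End RealIntegral.

(** * Change of variables *)

Lemma indic_itvE (R : realType) (i : interval R) (x : R) :
  \1_([set` i]) x = (x \in i)%:R :> R.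
Proof. by rewrite indicE; congr (_%:R); congr nat_of_bool; apply/idP/idP => [/set_mem|/mem_set]. Qed.

Import HBNNSimple.

Section Substitution.
Variable R : realType.
Local Notation mu := (@lebesgue_measure R).
Implicit Types f g h : R -> R.

Lemma nint_indic (A : set R) : measurable A -> nint (\1_A) = mu A.
Proof.
move=> mA; rewrite /nint (@integral_indic _ _ _ mu setT measurableT A mA).
by congr (mu _); apply/seteqP; split => x; [case|split].
Qed.

Section Density.
Variables (phi w : R -> R).
Hypotheses (mphi : mf phi) (mw : mf w) (w0 : forall x, 0 <= w x).

(** The image under [phi] of the measure of density [w]. Agreement with Lebesgue measure on
    half-open intervals, which is the hypothesis [hab] below, forces equality on all measurable
    sets. *)
Let nu (A : set (measurableTypeR R)) : \bar R := (\int[mu]_(x in phi @^-1` A) (w x)%:E)%E.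

Let mpre A : measurable A -> measurable (phi @^-1` A).
Proof. by move=> mA; rewrite -[X in measurable X]setTI; exact: mphi. Qed.

Let nu0 : nu set0 = 0%E.
Proof. by rewrite /nu preimage_set0 integral_set0. Qed.

Let nu_ge0 A : (0 <= nu A)%E.
Proof. by apply: integral_ge0 => x _; rewrite lee_fin. Qed.

Let nu_sigma : semi_sigma_additive nu.
Proof.
move=> /= F mF tF mUF; rewrite /nu; apply: cvg_toP.
  apply: ereal_nondecreasing_is_cvgn => m n mn.
  apply: lee_sum_nneg_natr => // k _ _.
  by apply: integral_ge0 => /= x Fkx; rewrite lee_fin.
rewrite preimage_bigcup ge0_integral_bigcup//=.
- by move=> k; exact: (mpre (mF k)).
- by apply: measurable_funTS; exact/mfE.
- by move=> x _; rewrite lee_fin.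
- apply/trivIsetP => i j _ _ ij; rewrite -preimage_setI.
  by move/trivIsetP: tF => /(_ i j Logic.I Logic.I ij) ->; rewrite preimage_set0.
Qed.

HB.instance Definition _ := isMeasure.Build _ _ _ nu nu0 nu_ge0 nu_sigma.

Let nuE A : measurable A -> nu A = nint (fun x => \1_A (phi x) * w x).
Proof.
move=> mA; rewrite /nu integral_mkcond; apply: eq_integral => x _ /=.
rewrite /patch indicE (_ : (x \in _) = (phi x \in A)); last by apply/idP/idP; rewrite !inE.
by case: (phi x \in A); rewrite ?mul1r ?mul0r.
Qed.

Hypothesis hab : forall a b : R, a <= b ->
  nint (fun x => \1_(`]a, b]) (phi x) * w x) = (b - a)%:E.

Let muE (A : set R) : measurable A -> mu A = nint (fun x => \1_A (phi x) * w x).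
Proof.
move=> mA; rewrite -nuE //; apply: lebesgue_measure_unique => // _ [[a b] _ <-] /=.
rewrite nuE //; have [ab|ba] := leP a b.
  rewrite hab // lebesgue_measure_itv /= lte_fin.
  by case: ltgtP ab => // -> _; rewrite subrr.
rewrite set_itv_ge ?bnd_simp -?leNgt ?ltW // measure0.
by under eq_nint do rewrite indic0 mul0r; rewrite /nint integral0.
Qed.

Let msum (n : nat) (c : 'I_n -> R) (g : 'I_n -> R -> R) : (forall i, mf (g i)) ->
  (forall i x, 0 <= g i x) -> (forall i, 0 <= c i) ->
  nint (fun x => \sum_(i < n) c i * g i x) = (\sum_(i < n) (c i)%:E * nint (g i))%E.
Proof.
move=> mg g0 c0; rewrite /nint; under eq_integral do rewrite -sumEFin.
rewrite ge0_integral_sum //; last 2 first.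
- by move=> i; apply/mfE; apply: mfM => //; exact: mf_cst.
- by move=> i x _; rewrite lee_fin mulr_ge0.
by apply: eq_bigr => i _; exact: nintZ.
Qed.

Let nint_subst_nnsfun (h : {nnsfun R >-> R}) :
  nint h = nint (fun x => h (phi x) * w x).
Proof.
pose s : seq R := finmap.enum_fset (fset_set (h @` setT)).
have sE := fimfunEord h.
rewrite /= -/s in sE.
pose A i := h @^-1` [set s`_i].
have mA i : measurable (A i) by exact: measurable_sfunP.
have s0 (i : 'I_(size s)) : 0 <= s`_i.
  have : s`_i \in s by rewrite mem_nth.
  by rewrite in_fset_set // inE => -[x _ <-].
rewrite (@eq_nint _ _ _ (fun x => sE x)).
under [RHS]eq_nint => x do rewrite sE mulr_suml.
under [RHS]eq_nint => x do under eq_bigr do rewrite -mulrA.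
rewrite msum; [|by move=> i; exact: (mf_indic (mA i))|by []|by []].
rewrite msum; [|by move=> i; apply: mfM => //; apply: mf_comp => //; exact: (mf_indic (mA i))
  |by move=> i x; rewrite mulr_ge0|by []].
apply: eq_bigr => i _; congr (_ * _)%E.
by rewrite -[RHS](muE (mA i)); exact: (nint_indic (mA i)).
Qed.

(* A nonnegative density [w] for [phi] against Lebesgue measure only has to be
   checked on intervals. *)
Lemma nint_subst f : mf f -> (forall x, 0 <= f x) ->
  nint f = nint (fun x => f (phi x) * w x).
Proof.
move=> mff f0; have mfe : measurable_fun setT (fun x => (f x)%:E) by exact/mfE.
pose h_ := nnsfun_approx measurableT mfe.
have hc x : (h_ n x)%:E @[n --> \oo] --> (f x)%:E.
  by apply: (@cvg_nnsfun_approx _ _ _ _ measurableT _ mfe) => // y _; rewrite lee_fin.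
have hd x m n : (m <= n)%N -> h_ m x <= h_ n x by move=> mn; exact/lefP/nd_nnsfun_approx.
have c1 : nint (h_ n) @[n --> \oo] --> nint f.
  rewrite (_ : nint f = (\int[mu]_x limn (fun n => (h_ n x)%:E))%E); last first.
    by apply: eq_integral => x _; apply/esym/cvg_lim => //; exact: hc.
  apply: cvg_monotone_convergence => //.
  - by move=> n; apply/mfE; exact: measurable_funP.
  - by move=> n x _; rewrite lee_fin.
  - by move=> x _ m n mn; rewrite lee_fin; exact: hd.
have c2 : nint (fun x => h_ n (phi x) * w x) @[n --> \oo] --> nint (fun x => f (phi x) * w x).
  rewrite (_ : nint (fun x => f (phi x) * w x) =
    (\int[mu]_x limn (fun n => (h_ n (phi x) * w x)%:E))%E); last first.
    apply: eq_integral => x _; apply/esym/cvg_lim => //.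
    apply: cvg_EFin2; apply: cvgM; [exact: (fine_cvg (hc (phi x)))|exact: cvg_cst].
  apply: cvg_monotone_convergence => //.
  - by move=> n; apply/mfE; apply: mfM => //; apply: mf_comp => //; exact: measurable_funP.
  - by move=> n x _; rewrite lee_fin mulr_ge0.
  - by move=> x _ m n mn; rewrite lee_fin ler_wpM2r // hd.
apply: (cvg_unique _ c1) => //.
rewrite (_ : (fun n => nint (h_ n)) = fun n => nint (fun x => h_ n (phi x) * w x)) //.
by apply/funext => n; exact: nint_subst_nnsfun.
Qed.

End Density.

Lemma nint_itv (a b : R) : a <= b -> nint (\1_(`]a, b]) : R -> R) = (b - a)%:E.
Proof.
move=> ab; rewrite nint_indic // lebesgue_measure_itv /= lte_fin.
by case: ltgtP ab => // -> _; rewrite subrr.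
Qed.

Lemma nint_affine (a b : R) f : a != 0 -> mf f -> (forall x, 0 <= f x) ->
  nint (fun x => f (a * x + b)) = (`|a|^-1%:E * nint f)%E.
Proof.
move=> a0 mff f0.
have n0 : 0 < `|a| by rewrite normr_gt0.
rewrite [nint f](@nint_subst (fun x => a * x + b) (fun=> `|a|)) //.
- rewrite -nintZ //; first last.
  + by move=> x; rewrite mulr_ge0.
  + by apply: mfM (mf_cst _); apply: mf_comp => //; exact: mf_affine.
  by apply: eq_nint => x; rewrite mulrCA mulVf ?mulr1 // gt_eqF.
- exact: mf_affine.
- exact: mf_cst.
move=> c d cd.
have [ap|an|a00] := ltgtP 0 a; last by rewrite a00 eqxx in a0.
- rewrite (@eq_nint _ _ (fun x => `|a| * \1_(`](c - b) / a, (d - b) / a]) x)); last first.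
    move=> x; rewrite mulrC; congr (_ * _); rewrite !indic_itvE !in_itv /=.
    congr (_%:R); rewrite ltr_pdivrMr // ler_pdivlMr //; congr (nat_of_bool (_ && _)).
      by apply/idP/idP; lra.
    by apply/idP/idP; lra.
  rewrite nintZ //; last exact: mf_indic.
  rewrite nint_itv; last by rewrite ler_pM2r ?invr_gt0 // lerB.
  by rewrite -EFinM gtr0_norm //; congr (_%:E); field.
- (* the image interval is half-open on the other side *)
  rewrite (@eq_nint _ _ (fun x => `|a| * \1_(`[(d - b) / a, (c - b) / a[) x)); last first.
    move=> x; rewrite mulrC; congr (_ * _); rewrite !indic_itvE !in_itv /=.
    rewrite andbC ltr_ndivlMr // ler_ndivrMr //; congr ((nat_of_bool (_ && _))%:R).
      by apply/idP/idP; lra.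
    by apply/idP/idP; lra.
  rewrite nintZ //; last exact: mf_indic.
  rewrite nint_indic // lebesgue_measure_itv /= lte_fin.
  have dc : (d - b) / a <= (c - b) / a by rewrite ler_nM2r ?invr_lt0 // lerB.
  rewrite ltr0_norm //; case: ltgtP dc => // [_ _|e _].
    by rewrite -EFinD -EFinM; congr (_%:E); field.
  rewrite mule0; congr (_%:E).
  have : (c - b) / a * a = (d - b) / a * a by rewrite e.
  by rewrite !divfK //; lra.
Qed.

Lemma I1_affine (a b : R) f : a != 0 -> I1 f -> I1 (fun x => f (a * x + b)).
Proof.
move=> a0 hf; apply: I1P.
  by apply: mf_comp; [exact: I1_mf|exact: mf_affine].
rewrite (@nint_affine a b (fun x => `|f x|)) //; last by apply: mf_norm; exact: I1_mf.
by apply: lte_mul_pinfty; rewrite ?lee_fin //; exact/I1_lty/I1_norm.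
Qed.

Lemma rint_affine (a b : R) f : a != 0 -> I1 f ->
  rint (fun x => f (a * x + b)) = `|a|^-1 * rint f.
Proof.
move=> a0 hf.
(* [nint_affine] treats nonnegative functions, so [f] is written as a difference of two nonnegative
   integrable ones. *)
pose p x := `|f x| + f x; pose q x := `|f x|.
have fE x : f x = p x - q x by rewrite /p /q; lra.
have p0 x : 0 <= p x by rewrite /p; have := ler_norm (- f x); rewrite normrN; lra.
have q0 x : 0 <= q x by exact: normr_ge0.
have Iq : I1 q by exact: I1_norm.
have Ip : I1 p by exact: I1D.
have main g : I1 g -> (forall x, 0 <= g x) ->
    rint (fun x => g (a * x + b)) = `|a|^-1 * rint g.
  move=> Ig g0; apply: EFin_inj.
  by rewrite rintE ?I1_affine // nint_affine ?EFinM ?rintE //; exact: I1_mf.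
rewrite (@eq_rint _ _ (fun x => p (a * x + b) - q (a * x + b))) ?rintB ?I1_affine //.
by rewrite (@eq_rint _ f (fun x => p x - q x)) // rintB // !main // mulrBr.
Qed.

Lemma rint_shift (b : R) f : I1 f -> rint (fun x => f (x + b)) = rint f.
Proof.
move=> hf; have := rint_affine b (oner_neq0 R) hf; rewrite normr1 invr1 mul1r => <-.
by apply: eq_rint => x; rewrite mul1r.
Qed.

Lemma rint_sub (b : R) f : I1 f -> rint (fun x => f (b - x)) = rint f.
Proof.
move=> hf; have a0 : -1 != 0 :> R by rewrite oppr_eq0 oner_neq0.
have := rint_affine b a0 hf; rewrite normrN1 invr1 mul1r => <-.
by apply: eq_rint => x; rewrite mulN1r addrC.
Qed.

Lemma I1_sub (b : R) f : I1 f -> I1 (fun x => f (b - x)).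
Proof.
move=> hf; have a0 : -1 != 0 :> R by rewrite oppr_eq0 oner_neq0.
have := I1_affine b a0 hf; congr I1.
by apply/funext => x; rewrite mulN1r addrC.
Qed.

Lemma I1_shift (b : R) f : I1 f -> I1 (fun x => f (x + b)).
Proof.
move=> hf; have := I1_affine b (oner_neq0 R) hf; congr I1.
by apply/funext => x; rewrite mul1r.
Qed.

Lemma nint_sub (b : R) f : mf f -> (forall x, 0 <= f x) -> nint (fun x => f (b - x)) = nint f.
Proof.
move=> hf f0; have a0 : -1 != 0 :> R by rewrite oppr_eq0 oner_neq0.
have := nint_affine b a0 hf f0; rewrite normrN1 invr1 mul1e => <-.
by apply: eq_nint => x; rewrite mulN1r addrC.
Qed.

Lemma nint_shift (b : R) f : mf f -> (forall x, 0 <= f x) -> nint (fun x => f (x + b)) = nint f.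
Proof.
move=> hf f0; have := nint_affine b (oner_neq0 R) hf f0; rewrite normr1 invr1 mul1e => <-.
by apply: eq_nint => x; rewrite mul1r.
Qed.

End Substitution.

(** * Fubini's theorem and Gram kernels *)

Section RealFubini.
Variable R : realType.
Local Notation mu := (@lebesgue_measure R).
Implicit Types (f g : R -> R) (F G : R -> R -> R).

Definition mf2 F := measurable_fun [set: R * R] (fun z : R * R => F z.1 z.2).

Lemma mf2_fst f : mf f -> mf2 (fun x _ => f x).
Proof. by move=> h; apply: (measurableT_comp h); exact: measurable_fst. Qed.
Lemma mf2_snd f : mf f -> mf2 (fun _ y => f y).
Proof. by move=> h; apply: (measurableT_comp h); exact: measurable_snd. Qed.
Lemma mf2_comp f F : mf f -> mf2 F -> mf2 (fun x y => f (F x y)).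
Proof. by move=> h hF; exact: (measurableT_comp h hF). Qed.
Lemma mf2D F G : mf2 F -> mf2 G -> mf2 (fun x y => F x y + G x y).
Proof. exact: measurable_funD. Qed.
Lemma mf2B F G : mf2 F -> mf2 G -> mf2 (fun x y => F x y - G x y).
Proof. exact: measurable_funB. Qed.
Lemma mf2M F G : mf2 F -> mf2 G -> mf2 (fun x y => F x y * G x y).
Proof. exact: measurable_funM. Qed.
Lemma mf2_swap F : mf2 F -> mf2 (fun x y => F y x).
Proof.
move=> h; apply: (@measurableT_comp _ _ _ _ _ _ _ _ (fun z : R * R => (z.2, z.1)) h).
apply: measurable_fun_pair.
- exact: measurable_snd.
- exact: measurable_fst.
Qed.
Lemma mf2_x F x : mf2 F -> mf (F x).
Proof.
move=> h; apply: (@measurableT_comp _ _ _ _ _ _ _ _ (fun y : R => (x, y)) h).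
by apply: measurable_fun_pair; [exact: measurable_cst|exact: measurable_id].
Qed.

Lemma tonelli F : mf2 F -> (forall x y, 0 <= F x y) ->
  (\int[mu]_x nint (F x) = \int[mu]_y nint (F ^~ y))%E.
Proof.
move=> mF F0.
apply: (@fubini_tonelli _ _ _ _ _ mu mu (fun z : R * R => (F z.1 z.2)%:E)).
- exact/measurable_EFinP.
- by move=> z; rewrite lee_fin.
Qed.

Lemma rfubini F g : mf2 F -> I1 g ->
  (forall x, nint (fun y => `|F x y|%R) <= (g x)%:E)%E ->
  [/\ I1 (fun x => rint (F x)), I1 (fun y => rint (F ^~ y)),
    rint (fun x => rint (F x)) = rint (fun y => rint (F ^~ y)) &
    {ae mu, forall x, I1 (F x)} /\ {ae mu, forall y, I1 (F ^~ y)}].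
Proof.
move=> mF Ig hF.
pose E (z : R * R) := (F z.1 z.2)%:E.
have mE : measurable_fun setT E by exact/measurable_EFinP.
have mE' : measurable_fun setT (fun z => `|E z|)%E by exact: measurableT_comp.
have lt : (\int[mu]_x nint (fun y => `|F x y|%R) < +oo)%E.
  apply: le_lt_trans (I1_lty Ig).
  apply: ge0_le_integral => //.
  - by move=> x _; exact: integral_ge0.
  - apply: (@measurable_fun_fubini_tonelli_F _ _ _ _ _ mu (fun z => `|E z|)%E) => // z; exact: abse_ge0.
  - by apply/mfE; exact: I1_mf.
have IE : (mu \x mu)%E.-integrable setT E by exact/(integrable12ltyP mu mu mE).
pose E' (z : R * R) := (F z.2 z.1)%:E.
have mE2 : measurable_fun setT E' by apply/measurable_EFinP; exact: (mf2_swap mF).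
have IE2 : (mu \x mu)%E.-integrable setT E'.
  apply/(integrable12ltyP mu mu mE2).
  rewrite -(@tonelli (fun x y => `|F x y|)) //.
  by apply: (mf2_comp _ mF); exact: normr_measurable.
(* The inner integrals are extended reals, finite almost everywhere only; [fine] alters them on a
   null set. *)
have key (e : R -> \bar R) : mu.-integrable setT e -> I1 (fun x => fine (e x)) /\
    (rint (fun x => fine (e x)))%:E = (\int[mu]_x e x)%E.
  move=> Ie.
  have mfe : mf (fun x => fine (e x)).
    by apply: (@measurableT_comp _ _ _ _ _ _ (@fine R)) => //; exact: measurable_int Ie.
  have h : I1 (fun x => fine (e x)).
    apply: le_integrable Ie => //; first exact/mfE.
    by move=> x _ /=; case: (e x) => [r| |] /=; rewrite ?normr0 ?leey ?lexx.
  split => //; rewrite rintE //; apply: ae_eq_integral => //.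
  - exact/mfE.
  - exact: measurable_int Ie.
  - have := integrable_ae measurableT Ie.
    apply: (@filterS _ _ (ae_filter_ringOfSetsType mu)) => x /= h1 _.
    by rewrite fineK //; exact: h1.
have [k1 k2] := key _ (integrable_fubini_F IE).
have [k3 k4] := key _ (integrable_fubini_F IE2).
split; [exact: k1|exact: k3| |split].
- apply: EFin_inj; etransitivity; first exact: k2.
  by etransitivity; last exact/esym/k4; exact: (Fubini IE).
- exact: (ae_integrable1 IE).
- exact: (ae_integrable2 IE).
Qed.


Lemma rfubini_prod F g w : mf2 F -> I1 g -> I1 w -> (forall x y, `|F x y| <= g x * w y) ->
  [/\ I1 (fun x => rint (F x)), I1 (fun y => rint (F ^~ y)),
    rint (fun x => rint (F x)) = rint (fun y => rint (F ^~ y)) &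
    {ae mu, forall x, I1 (F x)} /\ {ae mu, forall y, I1 (F ^~ y)}].
Proof.
move=> mF Ig Iw hF.
apply: (rfubini (g := fun x => `|g x| * rint (fun y => `|w y|)) mF).
  have -> : (fun x => `|g x| * rint (fun y => `|w y|)) = fun x => rint (fun y => `|w y|) * `|g x|.
    by apply/funext => x; rewrite mulrC.
  by apply: I1Z; exact: I1_norm.
move=> x; rewrite EFinM rintE; last exact: I1_norm.
rewrite -nintZ //; last by apply: mf_norm; exact: I1_mf.
apply: le_nint.
- by apply: mf_norm; exact: mf2_x.
- by apply: mfM (mf_cst _) _; apply: mf_norm; exact: I1_mf.
- by move=> y; rewrite normr_ge0 (le_trans (hF x y)) // -normrM ler_norm.
Qed.

(** Holds even where the inner integral diverges: the integrals of the positive and negative parts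
    are measurable in [x] by Tonelli's theorem, and so is [fine] of their difference, whatever
    default it takes. *)
Lemma mf_rint F : mf2 F -> mf (fun x => rint (F x)).
Proof.
move=> mF; pose E (z : R * R) := (F z.1 z.2)%:E.
have mE : measurable_fun setT E by exact/measurable_EFinP.
have h (G : R * R -> \bar R) : measurable_fun setT G -> (forall z, 0 <= G z)%E ->
    measurable_fun [set: R] (fun x => \int[mu]_y G (x, y))%E.
  by move=> mG G0; have := @measurable_fun_fubini_tonelli_F _ _ _ _ _ mu G mG G0; exact.
have -> : (fun x => rint (F x)) =
    (fun x => fine (\int[mu]_y (E^\+ (x, y)) - \int[mu]_y (E^\- (x, y)))%E).
  apply/funext => x; rewrite /rint /Rintegral integralE.
  by congr (fine (_ - _)); apply: eq_integral => y _; rewrite ?funeposE ?funenegE.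
apply: (@measurableT_comp _ _ _ _ _ _ (@fine R)) => //.
apply: emeasurable_funB.
- by apply: h; [exact: measurable_funepos|move=> z; exact: funepos_ge0].
- by apply: h; [exact: measurable_funeneg|move=> z; exact: funeneg_ge0].
Qed.

(* The kernel [k] may be any bounded measurable one: sines and cosines give the
   Fourier transform, an indicator gives a moving average. *)
Lemma gram (h rho : R -> R) (k : R -> R -> R) (B : R) :
  I1 h -> I1 rho -> mf2 k -> (forall x t, `|k x t| <= B) ->
  let K x y := rint (fun t => rho t * (k x t * k y t)) in
  [/\ I1 (fun t => rho t * rint (fun x => h x * k x t) ^+ 2),
    rint (fun t => rho t * rint (fun x => h x * k x t) ^+ 2) =
      rint (fun x => h x * rint (fun y => h y * K x y)),
    I1 (fun x => h x * rint (fun y => h y * K x y)) &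
    forall x, I1 (fun y => h y * K x y)].
Proof.
move=> Ih Ir mk kB K.
have B0 : 0 <= B by apply: le_trans (kB 0 0).
have mh := I1_mf Ih; have mr := I1_mf Ir.
pose H := rint (fun x => `|h x|).
have Ihk t : I1 (fun x => h x * k x t).
  by apply: (I1Mb Ih (B := B)) => //; exact: (mf2_x t (mf2_swap mk)).
(* One factor of the square stays the bounded function [S] while the other is opened as an integral
   over [x]; once the order is exchanged, [S] is opened in its turn over [y]. *)
pose S t := rint (fun x => h x * k x t).
have mS : mf S.
  apply: mf_rint; apply: mf2M; [exact: mf2_snd|exact: mf2_swap].
have SB t : `|S t| <= B * H.
  apply: (le_trans (rint_norm (Ihk t))); rewrite -rintZ; last exact: I1_norm.
  apply: le_rint; [exact: I1_norm|by apply: I1Z; exact: I1_norm|].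
  by move=> x; rewrite normrM mulrC ler_wpM2r.
have IrS : I1 (fun t => rho t * S t) by exact: (I1Mb Ir mS SB).
have [j1 j3 j2 _] := @rfubini_prod (fun t x => rho t * S t * (h x * k x t))
  (fun t => `|rho t * S t|) (fun x => B * `|h x|)
  (mf2M (mf2_fst (mfM mr mS)) (mf2M (mf2_snd mh) (mf2_swap mk)))
  (I1_norm IrS) (I1Z _ (I1_norm Ih))
  (fun t x => ltac:(rewrite normrM ler_wpM2l // normrM mulrC ler_wpM2r //)).
have e1 : (fun t => rho t * rint (fun x => h x * k x t) ^+ 2) =
    (fun t => rint (fun x => rho t * S t * (h x * k x t))).
  by apply/funext => t; rewrite rintZ // -/(S t); ring.
have e2 x : rint (fun t => rho t * S t * (h x * k x t)) =
    rint (fun t => h x * rint (fun y => rho t * k x t * (h y * k y t))).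
  apply: eq_rint => t; rewrite rintZ // -/(S t); ring.
have Irk x : I1 (fun t => rho t * k x t) by apply: (I1Mb Ir (mf2_x x mk) (kB x)).
have e3 x y : rint (fun t => rho t * k x t * (h y * k y t)) = h y * K x y.
  have -> : (fun t => rho t * k x t * (h y * k y t)) = (fun t => h y * (rho t * k x t * k y t)).
    by apply/funext => t; ring.
  rewrite rintZ; last exact: (I1Mb (Irk x) (mf2_x y mk) (kB y)).
  by congr (_ * _); apply: eq_rint => t; rewrite mulrA.
have i123 x : [/\ I1 (fun t => rint (fun y => rho t * k x t * (h y * k y t))),
    I1 (fun y => h y * K x y) &
    rint (fun t => rint (fun y => rho t * k x t * (h y * k y t))) = rint (fun y => h y * K x y)].
  have [i1 i3 i2 _] := @rfubini_prod (fun t y => rho t * k x t * (h y * k y t))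
    (fun t => `|rho t * k x t|) (fun x => B * `|h x|)
    (mf2M (mf2_fst (I1_mf (Irk x))) (mf2M (mf2_snd mh) (mf2_swap mk)))
    (I1_norm (Irk x)) (I1Z _ (I1_norm Ih))
    (fun t x => ltac:(rewrite normrM ler_wpM2l // normrM mulrC ler_wpM2r //)).
  split; first exact: i1.
  - by move: i3; congr I1; apply/funext => y; exact: e3.
  - by rewrite i2; apply: eq_rint => y; exact: e3.
have e4 x : rint (fun t => rho t * S t * (h x * k x t)) = h x * rint (fun y => h y * K x y).
  by have [i1 _ i2] := i123 x; rewrite e2 rintZ ?i2.
rewrite e1; split; first exact: j1.
- by rewrite j2; apply: eq_rint => x; exact: e4.
- by move: j3; congr I1; apply/funext => x; exact: e4.
- by move=> x; have [] := i123 x.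
Qed.

End RealFubini.

(** * Complex-valued integrals, convergence and Fubini, componentwise *)

Section ComplexIntegral.
Variable R : realType.
Local Notation C := (R[i]).
Local Notation Re := (@complex.Re R).
Local Notation Im := (@complex.Im R).
Local Notation normc := (@Normc.normc R).
Local Notation mu := (@lebesgue_measure R).
Implicit Types (f g : R -> C) (F G : R -> R -> C).

Lemma ccvgP (u : nat -> C) z : ccvg u z <->
  Re (u n) @[n --> \oo] --> Re z /\ Im (u n) @[n --> \oo] --> Im z.
Proof.
split=> [h|[h1 h2]].
  split; apply/cvgrPdist_lt => e e0; move/cvgrPdist_lt: h => /(_ e e0);
    apply: filterS => n /=; rewrite sub0r normrN ger0_norm ?normc_ge0 // => h.
  - by rewrite distrC -ReB (le_lt_trans (Re_le_normc _)).
  - by rewrite distrC -ImB (le_lt_trans (Im_le_normc _)).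
have h : `|Re (u n) - Re z| + `|Im (u n) - Im z| @[n --> \oo] --> (0 : R).
  rewrite -[X in _ --> X](addr0 (0 : R)).
  by apply: cvgD; apply/norm_cvg0P; apply/subr_cvg0.
apply: (squeeze_cvgr _ (cvg_cst 0) h); apply: nearW => n.
by rewrite normc_ge0 /= (le_trans (normc_le_ReIm _)) // ReB ImB.
Qed.

Lemma ccvg_unique (u : nat -> C) z w : ccvg u z -> ccvg u w -> z = w.
Proof.
move=> /ccvgP[h1 h2] /ccvgP[h3 h4]; apply: ceq.
- exact: (cvg_unique _ h1 h3).
- exact: (cvg_unique _ h2 h4).
Qed.

Lemma ccvg_cst z : @ccvg R (fun=> z) z.
Proof. by apply/ccvgP; split; exact: cvg_cst. Qed.

Lemma ccvgD (u v : nat -> C) z w : ccvg u z -> ccvg v w -> ccvg (fun n => u n + v n) (z + w).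
Proof.
move=> /ccvgP[h1 h2] /ccvgP[h3 h4]; apply/ccvgP; rewrite ReD ImD; split.
- by under eq_fun do rewrite ReD; exact: cvgD.
- by under eq_fun do rewrite ImD; exact: cvgD.
Qed.

Lemma ccvgM (u v : nat -> C) z w : ccvg u z -> ccvg v w -> ccvg (fun n => u n * v n) (z * w).
Proof.
move=> /ccvgP[h1 h2] /ccvgP[h3 h4]; apply/ccvgP; rewrite cReM cImM; split.
- by under eq_fun do rewrite cReM; apply: cvgB; apply: cvgM.
- by under eq_fun do rewrite cImM; apply: cvgD; apply: cvgM.
Qed.

Lemma ccvgN (u : nat -> C) z : ccvg u z -> ccvg (fun n => - u n) (- z).
Proof.
move=> h; rewrite -mulN1r; have := ccvgM (ccvg_cst (-1)) h.
by under eq_fun do rewrite mulN1r.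
Qed.

Lemma ccvgB (u v : nat -> C) z w : ccvg u z -> ccvg v w -> ccvg (fun n => u n - v n) (z - w).
Proof. by move=> h1 /ccvgN; exact: ccvgD. Qed.

Lemma ccvg_dist (u : nat -> C) (e : nat -> R) z : e n @[n --> \oo] --> (0 : R) ->
  (forall n, normc (u n - z) <= e n) -> ccvg u z.
Proof.
move=> he h; apply: (squeeze_cvgr _ (cvg_cst 0) he); apply: nearW => n.
by rewrite normc_ge0 h.
Qed.

Definition cmf f := mf (fun x => Re (f x)) /\ mf (fun x => Im (f x)).
Definition cL1 f := I1 (fun x => Re (f x)) /\ I1 (fun x => Im (f x)).
Definition cint f : C := rint (fun x => Re (f x)) +i* rint (fun x => Im (f x)).

Lemma cL1_cmf f : cL1 f -> cmf f.
Proof. by move=> [h1 h2]; split; exact: I1_mf. Qed.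
Lemma cmf_cst (c : C) : cmf (fun=> c).
Proof. by split; exact: mf_cst. Qed.
Lemma cmf_real (f : R -> R) : mf f -> cmf (fun x => (f x)%:C).
Proof. by split => //; exact: mf_cst. Qed.
Lemma cmfD f g : cmf f -> cmf g -> cmf (fun x => f x + g x).
Proof.
move=> [h1 h2] [h3 h4]; split.
- by under eq_fun do rewrite ReD; exact: mfD.
- by under eq_fun do rewrite ImD; exact: mfD.
Qed.
Lemma cmfM f g : cmf f -> cmf g -> cmf (fun x => f x * g x).
Proof.
move=> [h1 h2] [h3 h4]; split.
- by under eq_fun do rewrite cReM; apply: mfB; exact: mfM.
- by under eq_fun do rewrite cImM; apply: mfD; exact: mfM.
Qed.
Lemma cmfN f : cmf f -> cmf (fun x => - f x).
Proof.
move=> h; have := cmfM (cmf_cst (-1)) h.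
by under eq_fun do rewrite mulN1r.
Qed.
Lemma cmfB f g : cmf f -> cmf g -> cmf (fun x => f x - g x).
Proof. by move=> h1 /cmfN; exact: cmfD. Qed.
Lemma cmfJ f : cmf f -> cmf (fun x => conjc (f x)).
Proof.
move=> [h1 h2]; split; first by under eq_fun do rewrite ReJ.
by under eq_fun do rewrite ImJ; exact: mfN.
Qed.
Lemma cmf_comp f (phi : R -> R) : cmf f -> mf phi -> cmf (fun x => f (phi x)).
Proof.
by move=> [h1 h2] hp; split; [exact: (mf_comp h1 hp)|exact: (mf_comp h2 hp)].
Qed.
Lemma cmf_cis (phi : R -> R) : mf phi -> cmf (fun x => cis (phi x)).
Proof. by move=> h; split => /=; [exact: mf_cos|exact: mf_sin]. Qed.
Lemma cmf_cexp (phi : R -> C) : cmf phi -> cmf (fun x => cexp (phi x)).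
Proof.
move=> [h1 h2]; apply: cmfM; last exact: cmf_cis.
by apply: cmf_real; exact: mf_expR.
Qed.
Lemma cmf_sum (I : Type) (s : seq I) (h : I -> R -> C) :
  (forall i, cmf (h i)) -> cmf (fun x => \sum_(i <- s) h i x).
Proof.
move=> hh; elim: s => [|i s IH].
  by under eq_fun do rewrite big_nil; exact: cmf_cst.
by under eq_fun do rewrite big_cons; exact: cmfD.
Qed.
Lemma mf_sqr_normc f : cmf f -> mf (fun x => normc (f x) ^+ 2).
Proof.
by move=> [h1 h2]; under eq_fun do rewrite normc_sqr; apply: mfD; exact: mfX.
Qed.
Lemma mf_normc f : cmf f -> mf (fun x => normc (f x)).
Proof.
move=> [h1 h2].
have -> : (fun x => normc (f x)) = (fun x => Num.sqrt (Re (f x) ^+ 2 + Im (f x) ^+ 2)).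
  by apply/funext => x; case: (f x).
apply: mf_comp; last by apply: mfD; exact: mfX.
by apply: mf_continuous; exact: sqrt_continuous.
Qed.
Lemma le_cL1 f (g : R -> R) : cmf f -> I1 g -> (forall x, normc (f x) <= g x) -> cL1 f.
Proof.
move=> [h1 h2] hg fg; split; apply: (le_I1 _ hg) => // x.
- exact: (le_trans (Re_le_normc _)).
- exact: (le_trans (Im_le_normc _)).
Qed.

Lemma I1_normc f : cL1 f -> I1 (fun x => normc (f x)).
Proof.
move=> [h1 h2]; apply: (@le_I1 _ _ (fun x => `|Re (f x)| + `|Im (f x)|)).
- by apply: mf_normc; split; exact: I1_mf.
- by apply: I1D; exact: I1_norm.
- by move=> x; rewrite ger0_norm ?normc_ge0 // normc_le_ReIm.
Qed.

Lemma cL1D f g : cL1 f -> cL1 g -> cL1 (fun x => f x + g x).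
Proof.
move=> [h1 h2] [h3 h4]; split.
- by under eq_fun do rewrite ReD; exact: I1D.
- by under eq_fun do rewrite ImD; exact: I1D.
Qed.
Lemma cL1Mb f g (B : R) : cL1 f -> cmf g -> (forall x, normc (g x) <= B) ->
  cL1 (fun x => f x * g x).
Proof.
move=> h1 h2 h3; apply: (@le_cL1 _ (fun x => B * normc (f x))).
- by apply: cmfM => //; exact: cL1_cmf.
- by apply: I1Z; exact: I1_normc.
- by move=> x; rewrite normcM mulrC ler_wpM2r ?normc_ge0.
Qed.
Lemma cL1Z (c : C) f : cL1 f -> cL1 (fun x => c * f x).
Proof.
move=> h; have := cL1Mb (B := normc c) h (cmf_cst c) (fun=> lexx _).
by under eq_fun do rewrite mulrC.
Qed.
Lemma cL1N f : cL1 f -> cL1 (fun x => - f x).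
Proof. by move=> /(cL1Z (-1)); under eq_fun do rewrite mulN1r. Qed.
Lemma cL1B f g : cL1 f -> cL1 g -> cL1 (fun x => f x - g x).
Proof. by move=> h1 /cL1N; exact: cL1D. Qed.
Lemma cL1_real (f : R -> R) : I1 f -> cL1 (fun x => (f x)%:C).
Proof. by split => //; exact: I1_0. Qed.
Lemma cL1_sum (I : Type) (s : seq I) (h : I -> R -> C) :
  (forall i, cL1 (h i)) -> cL1 (fun x => \sum_(i <- s) h i x).
Proof.
move=> hh; elim: s => [|i s IH].
  by under eq_fun do rewrite big_nil; split; exact: I1_0.
by under eq_fun do rewrite big_cons; exact: cL1D.
Qed.
Lemma eq_cint f g : (forall x, f x = g x) -> cint f = cint g.
Proof. by move=> /funext ->. Qed.
Lemma ae_cint f g : cmf f -> cmf g -> {ae mu, forall x, f x = g x} -> cint f = cint g.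
Proof.
move=> [h1 h2] [h3 h4] fg; rewrite /cint; congr (_ +i* _);
  by apply: ae_rint => //; apply: ae_S fg => x /= ->.
Qed.
Lemma cintD f g : cL1 f -> cL1 g -> cint (fun x => f x + g x) = cint f + cint g.
Proof.
move=> [h1 h2] [h3 h4]; apply: ceq; rewrite !reimE -?rintD //;
  by apply: eq_rint => x; rewrite !reimE.
Qed.
Lemma cintZ (c : C) f : cL1 f -> cint (fun x => c * f x) = c * cint f.
Proof.
move=> [h1 h2]; apply: ceq; rewrite !reimE -?rintZ // -?rintB -?rintD; try exact: I1Z.
- by apply: eq_rint => x; rewrite !reimE.
- by apply: eq_rint => x; rewrite !reimE.
Qed.
Lemma cintN f : cL1 f -> cint (fun x => - f x) = - cint f.
Proof. by move=> h; rewrite -mulN1r -cintZ //; apply: eq_cint => x; rewrite mulN1r. Qed.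
Lemma cintB f g : cL1 f -> cL1 g -> cint (fun x => f x - g x) = cint f - cint g.
Proof. by move=> hf hg; rewrite cintD ?cintN //; exact: cL1N. Qed.
Lemma cintJ f : cL1 f -> cint (fun x => conjc (f x)) = conjc (cint f).
Proof.
move=> [h1 h2]; apply: ceq; rewrite !reimE -?rintN //; apply: eq_rint => x; exact: ReJ || exact: ImJ.
Qed.
Lemma cint_real (f : R -> R) : cint (fun x => (f x)%:C) = (rint f)%:C.
Proof. by apply: ceq; rewrite !reimE //= rint0. Qed.
Lemma cint_sum (I : Type) (s : seq I) (h : I -> R -> C) :
  (forall i, cL1 (h i)) -> cint (fun x => \sum_(i <- s) h i x) = \sum_(i <- s) cint (h i).
Proof.
move=> hh; elim: s => [|i s IH].
  rewrite big_nil; transitivity (cint (fun=> (0 : R)%:C)).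
    by apply: eq_cint => x; rewrite big_nil.
  by rewrite cint_real rint0.
rewrite big_cons -IH -cintD //; last exact: cL1_sum.
by apply: eq_cint => x; rewrite big_cons.
Qed.

(** Real and imaginary parts are estimated separately, at the cost of the factor 2. The 4 of
    [cauchy_schwarz] and the 2 beside [normc w] in [exp_sum_defect] come from here. *)
Lemma normc_cint f (g : R -> R) : cL1 f -> I1 g -> (forall x, normc (f x) <= g x) ->
  normc (cint f) <= 2 * rint g.
Proof.
move=> hf hg fg.
apply: (le_trans (normc_le_ReIm _)); rewrite !reimE mulrDl mul1r.
case: hf => h1 h2.
apply: lerD.
- apply: (le_trans (rint_norm h1)); apply: le_rint => //; first exact: I1_norm.
  by move=> x; apply: (le_trans (Re_le_normc _)).
- apply: (le_trans (rint_norm h2)); apply: le_rint => //; first exact: I1_norm.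
  by move=> x; apply: (le_trans (Im_le_normc _)).
Qed.

Lemma cdct (f_ : nat -> R -> C) f (g : R -> R) : (forall n, cmf (f_ n)) -> cmf f -> I1 g ->
  {ae mu, forall x, ccvg (fun n => f_ n x) (f x)} ->
  (forall n x, normc (f_ n x) <= g x) ->
  cL1 f /\ ccvg (fun n => cint (f_ n)) (cint f).
Proof.
move=> mf_ [h1 h2] hg cv bd.
have [i1 c1] := @rint_dct _ (fun n x => Re (f_ n x)) (fun x => Re (f x)) g
  (fun n => (mf_ n).1) h1 hg (ae_S (fun x (h : ccvg _ _) => ((ccvgP _ _).1 h).1) cv)
  (fun n x => le_trans (Re_le_normc _) (bd n x)).
have [i2 c2] := @rint_dct _ (fun n x => Im (f_ n x)) (fun x => Im (f x)) g
  (fun n => (mf_ n).2) h2 hg (ae_S (fun x (h : ccvg _ _) => ((ccvgP _ _).1 h).2) cv)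
  (fun n x => le_trans (Im_le_normc _) (bd n x)).
by split; [split|apply/ccvgP].
Qed.

Lemma cint_shift (b : R) f : cL1 f -> cint (fun x => f (x + b)) = cint f.
Proof.
move=> [h1 h2]; rewrite /cint; congr (_ +i* _).
- exact: (rint_shift b h1).
- exact: (rint_shift b h2).
Qed.
Lemma cint_sub (b : R) f : cL1 f -> cint (fun x => f (b - x)) = cint f.
Proof.
move=> [h1 h2]; rewrite /cint; congr (_ +i* _).
- exact: (rint_sub b h1).
- exact: (rint_sub b h2).
Qed.
Lemma cL1_shift (b : R) f : cL1 f -> cL1 (fun x => f (x + b)).
Proof. by move=> [h1 h2]; split; [exact: (I1_shift b h1)|exact: (I1_shift b h2)]. Qed.
Lemma cL1_sub (b : R) f : cL1 f -> cL1 (fun x => f (b - x)).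
Proof. by move=> [h1 h2]; split; [exact: (I1_sub b h1)|exact: (I1_sub b h2)]. Qed.

Definition cmf2 F := mf2 (fun x y => Re (F x y)) /\ mf2 (fun x y => Im (F x y)).

Lemma cmf2_fst f : cmf f -> cmf2 (fun x _ => f x).
Proof. by move=> [h1 h2]; split; [exact: (mf2_fst h1)|exact: (mf2_fst h2)]. Qed.
Lemma cmf2_snd f : cmf f -> cmf2 (fun _ y => f y).
Proof. by move=> [h1 h2]; split; [exact: (mf2_snd h1)|exact: (mf2_snd h2)]. Qed.
Lemma cmf2M F G : cmf2 F -> cmf2 G -> cmf2 (fun x y => F x y * G x y).
Proof.
move=> [h1 h2] [h3 h4]; rewrite /cmf2; split.
- have -> : (fun x y => Re (F x y * G x y)) =
    (fun x y => Re (F x y) * Re (G x y) - Im (F x y) * Im (G x y)).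
    by apply/funext => x; apply/funext => y; rewrite cReM.
  by apply: mf2B; exact: mf2M.
- have -> : (fun x y => Im (F x y * G x y)) =
    (fun x y => Re (F x y) * Im (G x y) + Im (F x y) * Re (G x y)).
    by apply/funext => x; apply/funext => y; rewrite cImM.
  by apply: mf2D; exact: mf2M.
Qed.
Lemma cmf2_comp f (F : R -> R -> R) : cmf f -> mf2 F -> cmf2 (fun x y => f (F x y)).
Proof. by move=> [h1 h2] hF; split; [exact: (mf2_comp h1 hF)|exact: (mf2_comp h2 hF)]. Qed.
Lemma cmf2_cis (F : R -> R -> R) : mf2 F -> cmf2 (fun x y => cis (F x y)).
Proof. by move=> h; apply: (cmf2_comp _ h); exact: cmf_cis (@mf_id R). Qed.
Lemma cmf2_swap F : cmf2 F -> cmf2 (fun x y => F y x).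
Proof. by move=> [h1 h2]; split; [exact: (mf2_swap h1)|exact: (mf2_swap h2)]. Qed.
Lemma cmf2_x F x : cmf2 F -> cmf (F x).
Proof. by move=> [h1 h2]; split; [exact: (mf2_x x h1)|exact: (mf2_x x h2)]. Qed.
Lemma cmf_cint F : cmf2 F -> cmf (fun x => cint (F x)).
Proof. by move=> [h1 h2]; split; [exact: (mf_rint h1)|exact: (mf_rint h2)]. Qed.

Lemma cfubini F (g : R -> R) : cmf2 F -> I1 g ->
  (forall x, nint (fun y => normc (F x y)) <= (g x)%:E)%E ->
  [/\ cL1 (fun x => cint (F x)), cL1 (fun y => cint (F ^~ y)),
    cint (fun x => cint (F x)) = cint (fun y => cint (F ^~ y)) &
    {ae mu, forall x, cL1 (F x)} /\ {ae mu, forall y, cL1 (F ^~ y)}].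
Proof.
move=> mF Ig hF.
have [a1 a2 a3 [a4 a5]] := @rfubini _ (fun x y => Re (F x y)) g mF.1 Ig
  (fun x => le_trans (le_nint (mf_norm (mf2_x x mF.1)) (mf_normc (cmf2_x x mF))
     (fun y => ltac:(by rewrite normr_ge0 Re_le_normc))) (hF x)).
have [b1 b2 b3 [b4 b5]] := @rfubini _ (fun x y => Im (F x y)) g mF.2 Ig
  (fun x => le_trans (le_nint (mf_norm (mf2_x x mF.2)) (mf_normc (cmf2_x x mF))
     (fun y => ltac:(by rewrite normr_ge0 Im_le_normc))) (hF x)).
split; [by split|by split|by apply: ceq|split].
- by apply: ae_S (ae_I a4 b4).
- by apply: ae_S (ae_I a5 b5).
Qed.

Lemma cfubini_prod F (g w : R -> R) : cmf2 F -> I1 g -> I1 w ->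
  (forall x y, normc (F x y) <= g x * w y) ->
  [/\ cL1 (fun x => cint (F x)), cL1 (fun y => cint (F ^~ y)),
    cint (fun x => cint (F x)) = cint (fun y => cint (F ^~ y)) &
    {ae mu, forall x, cL1 (F x)} /\ {ae mu, forall y, cL1 (F ^~ y)}].
Proof.
move=> mF Ig Iw hF.
have [a1 a2 a3 [a4 a5]] := @rfubini_prod _ (fun x y => Re (F x y)) g w mF.1 Ig Iw
  (fun x y => le_trans (Re_le_normc _) (hF x y)).
have [b1 b2 b3 [b4 b5]] := @rfubini_prod _ (fun x y => Im (F x y)) g w mF.2 Ig Iw
  (fun x y => le_trans (Im_le_normc _) (hF x y)).
split; [by split|by split|by apply: ceq|split].
- by apply: ae_S (ae_I a4 b4).
- by apply: ae_S (ae_I a5 b5).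
Qed.

End ComplexIntegral.

(** * The fundamental theorem of calculus on segments and on a ray *)

Section Calculus.
Variable R : realType.
Local Notation C := (R[i]).
Local Notation Re := (@complex.Re R).
Local Notation Im := (@complex.Im R).
Local Notation normc := (@Normc.normc R).
Local Notation mu := (@lebesgue_measure R).
Implicit Types (f F g : R -> R) (x : R) (z w : C).

Lemma patchM f (A : set R) : (f \_ A) = (fun x => f x * \1_A x).
Proof.
by apply/funext => x; rewrite /patch indicE; case: (x \in A); rewrite ?mulr1 ?mulr0.
Qed.

Lemma rint_in f (A : set R) : rint (fun x => f x * \1_A x) = (\int[mu]_(x in A) f x)%R.
Proof. by rewrite Rintegral_mkcond patchM. Qed.

Lemma I1_in f (A : set R) : measurable A ->
  I1 (fun x => f x * \1_A x) <-> mu.-integrable A (EFin \o f).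
Proof.
move=> mA; have h := @integrable_mkcond _ _ _ mu A (EFin \o f) mA.
by rewrite restrict_EFin patchM in h; split => /h.
Qed.

Lemma ftc_itv f F (a b : R) : a <= b ->
  (forall x : R, a <= x <= b -> is_derive x 1 F (f x)) ->
  (forall x : R, a <= x <= b -> {for x, continuous f}) ->
  I1 (fun x => f x * \1_(`[a, b]) x) /\ rint (fun x => f x * \1_(`[a, b]) x) = F b - F a.
Proof.
move=> ab dF cf.
have cw : {within `[a, b], continuous f}.
  apply: continuous_in_subspaceT => x; rewrite inE /= in_itv /= => xab; exact: cf.
have Iab : mu.-integrable `[a, b] (EFin \o f).
  by apply: continuous_compact_integrable => //; exact: segment_compact.
split; first exact/I1_in.
rewrite rint_in; have [lab|] := ltP a b; last first.
  move=> ba; have <- : a = b by apply/eqP; rewrite eq_le ab ba.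
  by rewrite subrr set_itv1 Rintegral_set1.
have dcF x : a <= x <= b -> {for x, continuous F}.
  move=> h; apply: differentiable_continuous.
  by apply/derivable1_diffP; have [] := dF x h.
rewrite /Rintegral (continuous_FTC2 (F := F) lab cw) //.
- split.
  + move=> x; rewrite in_itv /= => /andP[h1 h2]; have [] := dF x; last by [].
    by rewrite !ltW.
  + by apply: cvg_at_right_filter; apply: dcF; rewrite lexx ab.
  + by apply: cvg_at_left_filter; apply: dcF; rewrite lexx ab.
- move=> x; rewrite in_itv /= => /andP[h1 h2]; rewrite derive1E.
  by apply: derive_val; apply: dF; rewrite !ltW.
Qed.

Lemma cvg_indic_ray (x : R) : \1_(`[0, n%:R]) x @[n --> \oo] --> (\1_(`[0, +oo[) x : R).
Proof.
apply: cvg_near_cst; have xN := archi_boundP (normr_ge0 x).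
exists (Num.bound `|x|) => // n /= Nn; rewrite !indic_itvE !in_itv /= andbT.
case: (0 <= x) => //=; rewrite (_ : x <= n%:R) //.
by rewrite (le_trans (ler_norm x)) // (le_trans (ltW xN)) // ler_nat.
Qed.

Lemma indic_le1 (A : set R) x : 0 <= (\1_A x : R) <= 1.
Proof. by rewrite indicE; case: (x \in A); rewrite ?ler01 ?lexx. Qed.

(** Exhaustion by the segments [[0, n]], with the absolute value of the integrand as dominating
    function; hence the limit of [F] is asked along integers only. *)
Lemma ftc_ray f F (l : R) : (forall x : R, 0 <= x -> is_derive x 1 F (f x)) ->
  (forall x : R, 0 <= x -> {for x, continuous f}) ->
  I1 (fun x => f x * \1_(`[0, +oo[) x) -> F n%:R @[n --> \oo] --> l ->
  rint (fun x => f x * \1_(`[0, +oo[) x) = l - F 0.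
Proof.
move=> dF cf If cF.
have h n : I1 (fun x => f x * \1_(`[0, n%:R]) x) /\
    rint (fun x => f x * \1_(`[0, n%:R]) x) = F n%:R - F 0.
  by apply: ftc_itv => // x /andP[x0 _]; [exact: dF|exact: cf].
have cv (x : R) : f x * \1_(`[0, n%:R]) x @[n --> \oo] --> f x * \1_(`[0, +oo[) x.
  by apply: cvgM; [exact: cvg_cst|exact: cvg_indic_ray].
have bd n (x : R) : `|f x * \1_(`[0, n%:R]) x| <= `|f x * \1_(`[0, +oo[) x|.
  rewrite !normrM ler_wpM2l // !indic_itvE !in_itv /= andbT.
  case: (0 <= x) => /=; [by case: (x <= _); rewrite ?normr0 // normr1|by rewrite normr0].
have [_ c] : I1 (fun x => f x * \1_(`[0, +oo[) x) /\
    rint (fun x => f x * \1_(`[0, n%:R]) x) @[n --> \oo] -->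
    rint (fun x => f x * \1_(`[0, +oo[) x).
  apply: (rint_dct _ _ (I1_norm If)).
  - by move=> n; exact: I1_mf (h n).1.
  - exact: I1_mf If.
  - by apply: aeW => x; exact: cv.
  - by move=> n x; exact: bd.
apply: (cvg_unique _ c) => //.
have -> : (fun n => rint (fun x => f x * \1_(`[0, n%:R]) x)) = (fun n => F n%:R - F 0).
  by apply/funext => n; case: (h n).
by apply: cvgB => //; exact: cvg_cst.
Qed.

Definition cder (f : R -> C) (x : R) (z : C) :=
  is_derive x 1 (fun y => Re (f y)) (Re z) /\ is_derive x 1 (fun y => Im (f y)) (Im z).

Lemma cder_cst (c : C) x : cder (fun=> c) x 0.
Proof. by split; exact: is_derive_cst. Qed.

Lemma cder_eq (f : R -> C) x z w : cder f x z -> z = w -> cder f x w.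
Proof. by move=> h <-. Qed.

Lemma cderD (f g : R -> C) x z w : cder f x z -> cder g x w -> cder (fun y => f y + g y) x (z + w).
Proof.
move=> [h1 h2] [h3 h4]; split.
- by under eq_fun do rewrite ReD; rewrite ReD; exact: is_deriveD.
- by under eq_fun do rewrite ImD; rewrite ImD; exact: is_deriveD.
Qed.

Lemma is_deriveM1 f g (x df dg : R) : is_derive x 1 f df -> is_derive x 1 g dg ->
  is_derive x 1 (fun y => f y * g y) (f x * dg + df * g x).
Proof.
move=> hf hg; have := is_deriveM hf hg.
by rewrite (_ : _ *: _ + _ *: _ = f x * dg + df * g x) // /GRing.scale /=; ring.
Qed.

Lemma cderM (f g : R -> C) x z w : cder f x z -> cder g x w ->
  cder (fun y => f y * g y) x (f x * w + z * g x).
Proof.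
move=> [h1 h2] [h3 h4]; split.
- under eq_fun do rewrite cReM.
  apply: (@is_derive_eq _ _ _ _ _ _ _ _ (is_deriveB (is_deriveM1 h1 h3) (is_deriveM1 h2 h4))).
  by rewrite !reimE; ring.
- under eq_fun do rewrite cImM.
  apply: (@is_derive_eq _ _ _ _ _ _ _ _ (is_deriveD (is_deriveM1 h1 h4) (is_deriveM1 h2 h3))).
  by rewrite !reimE; ring.
Qed.

Lemma cder_real f x d : is_derive x 1 f d -> cder (fun y => (f y)%:C) x d%:C.
Proof. by move=> h; split => //; exact: is_derive_cst. Qed.

Lemma cder_cis (a : R) x : cder (fun y => cis (a * y)) x ((0 +i* a) * cis (a * x)).
Proof.
have h : is_derive x 1 (fun y => a * y) a.
  apply: (@is_derive_eq _ _ _ _ _ _ _ _ (is_deriveM1 (is_derive_cst a x 1) (is_derive_id x 1))).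
  by rewrite /=; ring.
split => /=.
- apply: (@is_derive_eq _ _ _ _ _ _ _ _ (is_derive1_comp (is_derive_cos (a * x)) h)); rewrite /=; ring.
- apply: (@is_derive_eq _ _ _ _ _ _ _ _ (is_derive1_comp (is_derive_sin (a * x)) h)); rewrite /=; ring.
Qed.

Lemma cder_cexp (z : C) x : cder (fun y => cexp (y%:C * z)) x (z * cexp (x%:C * z)).
Proof.
have e y : cexp (y%:C * z) = (expR (Re z * y))%:C * cis (Im z * y).
  by rewrite cexpE ReMC ImMC mulrC !(mulrC y) mulrC.
have h : is_derive x 1 (fun y => Re z * y) (Re z).
  apply: (@is_derive_eq _ _ _ _ _ _ _ _ (is_deriveM1 (is_derive_cst (Re z) x 1) (is_derive_id x 1))).
  by rewrite /=; ring.
have h2 : is_derive x 1 (fun y => expR (Re z * y)) (Re z * expR (Re z * x)).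
  by apply: (@is_derive_eq _ _ _ _ _ _ _ _ (is_derive1_comp (is_derive_expR (Re z * x)) h)); rewrite /=; ring.
have -> : (fun y => cexp (y%:C * z)) = (fun y => (expR (Re z * y))%:C * cis (Im z * y)).
  by apply/funext.
apply: cder_eq; first exact: cderM (cder_real h2) (cder_cis (Im z) x).
by rewrite /= e; apply: ceq; rewrite !reimE /=; ring.
Qed.

Definition cctn (f : R -> C) x :=
  {for x, continuous (fun y => Re (f y))} /\ {for x, continuous (fun y => Im (f y))}.

Lemma cder_cctn (f : R -> C) x z : cder f x z -> cctn f x.
Proof.
have aux g (y d : R) : is_derive y 1 g d -> {for y, continuous g}.
  by move=> -[d1 _]; apply: differentiable_continuous; exact/derivable1_diffP.
by move=> [h1 h2]; split; [exact: aux h1|exact: aux h2].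
Qed.

Lemma cftc_itv (f F : R -> C) (a b : R) : a <= b ->
  (forall x : R, a <= x <= b -> cder F x (f x)) -> (forall x : R, a <= x <= b -> cctn f x) ->
  cL1 (fun x => f x * (\1_(`[a, b]) x)%:C) /\
  cint (fun x => f x * (\1_(`[a, b]) x)%:C) = F b - F a.
Proof.
move=> ab dF cf.
have [i1 e1] := ftc_itv ab (fun x h => (dF x h).1) (fun x h => (cf x h).1).
have [i2 e2] := ftc_itv ab (fun x h => (dF x h).2) (fun x h => (cf x h).2).
have r1 : (fun x => Re (f x * (\1_(`[a, b]) x)%:C)) = (fun x => Re (f x) * \1_(`[a, b]) x).
  by apply/funext => x; rewrite !reimE mulr0 subr0.
have r2 : (fun x => Im (f x * (\1_(`[a, b]) x)%:C)) = (fun x => Im (f x) * \1_(`[a, b]) x).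
  by apply/funext => x; rewrite !reimE mulr0 add0r.
split; first by split; rewrite ?r1 ?r2.
by apply: ceq; rewrite /cint !reimE ?r1 ?r2 ?e1 ?e2.
Qed.

Lemma cftc_ray (f F : R -> C) (l : C) : (forall x : R, 0 <= x -> cder F x (f x)) ->
  (forall x : R, 0 <= x -> cctn f x) ->
  cL1 (fun x => f x * (\1_(`[0, +oo[) x)%:C) -> ccvg (fun n => F n%:R) l ->
  cint (fun x => f x * (\1_(`[0, +oo[) x)%:C) = l - F 0.
Proof.
move=> dF cf [i1 i2] /ccvgP[c1 c2].
have r1 : (fun x => Re (f x * (\1_(`[0, +oo[) x)%:C)) = (fun x => Re (f x) * \1_(`[0, +oo[) x).
  by apply/funext => x; rewrite !reimE mulr0 subr0.
have r2 : (fun x => Im (f x * (\1_(`[0, +oo[) x)%:C)) = (fun x => Im (f x) * \1_(`[0, +oo[) x).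
  by apply/funext => x; rewrite !reimE mulr0 add0r.
rewrite r1 in i1; rewrite r2 in i2.
have e1 := ftc_ray (fun x h => (dF x h).1) (fun x h => (cf x h).1) i1 c1.
have e2 := ftc_ray (fun x h => (dF x h).2) (fun x h => (cf x h).2) i2 c2.
by apply: ceq; rewrite /cint !reimE ?r1 ?r2 ?e1 ?e2.
Qed.

End Calculus.

(** * Exponential integrals on a ray, and the substitution [x = ln t] *)

Section Exponentials.
Variable R : realType.
Local Notation C := (R[i]).
Local Notation Re := (@complex.Re R).
Local Notation Im := (@complex.Im R).
Local Notation normc := (@Normc.normc R).
Local Notation mu := (@lebesgue_measure R).
Implicit Types (f F g : R -> R) (x a b : R) (z w : C).

Definition ray x : R := \1_(`[0, +oo[) x.

Lemma rayE x : ray x = (0 <= x)%R%:R.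
Proof. by rewrite /ray indic_itvE in_itv /= andbT. Qed.

Let eqle (a b : R) : a = b -> a <= b. Proof. by move=> ->. Qed.

Lemma mf_ray : mf ray.
Proof. exact: mf_indic. Qed.

(** The integrals over [[0, n]] are increments of [F], all at most [M]; Fatou's lemma passes to the
    ray. *)
Lemma I1_ray f F (M : R) : (forall x : R, 0 <= x -> is_derive x 1 F (f x)) ->
  (forall x : R, 0 <= x -> {for x, continuous f}) -> mf f ->
  (forall x, 0 <= x -> 0 <= f x) -> (forall x, 0 <= x -> F x - F 0 <= M) ->
  I1 (fun x => f x * ray x).
Proof.
move=> dF cf mff f0 FM.
have h n : I1 (fun x => f x * \1_(`[0, n%:R]) x) /\
    rint (fun x => f x * \1_(`[0, n%:R]) x) = F n%:R - F 0.
  by apply: ftc_itv => // x /andP[x0 _]; [exact: dF|exact: cf].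
apply: I1P0.
- by apply: mfM => //; exact: mf_ray.
- move=> x; rewrite rayE; case: (leP 0 x) => x0; last by rewrite mulr0.
  by rewrite mulr1 f0.
apply: (@le_lt_trans _ _ M%:E); last exact: ltry.
apply: (@nint_fatou _ (fun n x => f x * \1_(`[0, n%:R]) x)).
- by move=> n; exact: I1_mf (h n).1.
- move=> n x; rewrite indic_itvE in_itv /=; case: (leP 0 x) => x0; last by rewrite mulr0.
  by rewrite mulr_ge0 ?f0.
- by apply: mfM => //; exact: mf_ray.
- by apply: aeW => x; apply: cvgM; [exact: cvg_cst|exact: cvg_indic_ray].
- by apply: nearW => n; rewrite -rintE; [rewrite (h n).2 lee_fin FM|exact: (h n).1].
Qed.

Lemma is_derive_lin a x : is_derive x 1 (fun y => a * y) a.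
Proof.
apply: (@is_derive_eq _ _ _ _ _ _ _ _ (is_deriveM1 (is_derive_cst a x 1) (is_derive_id x 1))).
by rewrite /=; ring.
Qed.

Lemma is_derive_expRM a x : is_derive x 1 (fun y => expR (a * y)) (a * expR (a * x)).
Proof.
apply: (@is_derive_eq _ _ _ _ _ _ _ _ (is_derive1_comp (is_derive_expR (a * x)) (is_derive_lin a x))).
by rewrite /=; ring.
Qed.

Lemma is_derive_continuous f x (d : R) : is_derive x 1 f d -> {for x, continuous f}.
Proof. by move=> -[d1 _]; apply: differentiable_continuous; exact/derivable1_diffP. Qed.

Lemma I1_expR a : 0 < a -> I1 (fun x => expR (- a * x) * ray x).
Proof.
move=> a0; apply: (@I1_ray _ (fun x => - a^-1 * expR (- a * x)) a^-1).
- move=> x _.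
  apply: (@is_derive_eq _ _ _ _ _ _ _ _ (is_deriveM1 (is_derive_cst (- a^-1) x 1) (is_derive_expRM (- a) x))).
  by rewrite /=; field; exact: lt0r_neq0.
- by move=> x _; exact: is_derive_continuous (is_derive_expRM (- a) x).
- by apply: mf_expR; apply: mfM (mf_cst _) (@mf_id R).
- by move=> x _; exact: expR_ge0.
- move=> x x0; rewrite mulr0 expR0 mulr1 opprK gerDr mulNr oppr_le0.
  by rewrite mulr_ge0 ?expR_ge0 // invr_ge0 ltW.
Qed.

(** Each power of [x] costs half of the remaining rate: [y <= expR y] absorbs one factor at rate
    [b / 2], and the induction hypothesis absorbs the others at rate [b / 2]. *)
Lemma expR_pow_bound k b : 0 < b -> exists2 c, 0 < c & forall x, 0 <= x -> x ^+ k <= c * expR (b * x).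
Proof.
elim: k b => [|k IH] b b0.
  by exists 1 => // x x0; rewrite expr0 mul1r -expR0 ler_expR mulr_ge0 // ltW.
have b2 : 0 < b / 2 by rewrite divr_gt0.
have [c c0 hc] := IH _ b2; exists (c * (b / 2)^-1); first by rewrite mulr_gt0 // invr_gt0.
move=> x x0; rewrite exprS.
have h : x <= (b / 2)^-1 * expR (b / 2 * x).
  rewrite mulrC ler_pdivlMr // mulrC.
  by apply: le_trans (expR_ge1Dx _); rewrite lerDr.
apply: (le_trans (ler_pM x0 (exprn_ge0 _ x0) h (hc _ x0))).
by rewrite mulrACA -expRD (mulrC (_^-1) c); apply: eqle; congr (_ * expR _); field.
Qed.

Lemma I1_pexp k a : 0 < a -> I1 (fun x => x ^+ k * expR (- a * x) * ray x).
Proof.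
move=> a0; have a2 : 0 < a / 2 by rewrite divr_gt0.
have [c c0 hc] := expR_pow_bound k a2.
apply: (@le_I1 _ _ (fun x => c * (expR (- (a / 2) * x) * ray x))).
- apply: mfM mf_ray; apply: mfM; first exact: mfX (@mf_id R).
  by apply: mf_expR; apply: mfM (mf_cst _) (@mf_id R).
- by apply: I1Z; exact: I1_expR.
- move=> x; rewrite rayE; case: (leP 0 x) => x0; last by rewrite !mulr0 normr0.
  rewrite !mulr1 ger0_norm ?mulr_ge0 ?exprn_ge0 ?expR_ge0 //.
  apply: (le_trans (ler_wpM2r (expR_ge0 _) (hc x x0))).
  by rewrite -(mulrA c) -expRD; apply: eqle; congr (_ * expR _); field.
Qed.

Lemma pexp_cvg0 k a : 0 < a -> exists2 e : nat -> R, e n @[n --> \oo] --> (0 : R) &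
  forall n, n%:R ^+ k * expR (- a * n%:R) <= e n.
Proof.
move=> a0; have [c c0 hc] := expR_pow_bound k a0; have [d d0 hd] := expR_pow_bound k.+1 a0.
exists (fun n => (c + d) * harmonic n).
  by rewrite -[X in _ --> X](mulr0 (c + d)); apply: cvgM; [exact: cvg_cst|exact: cvg_harmonic].
move=> n; rewrite /harmonic ler_pdivlMr ?ltr0n // mulrAC mulNr expRN ler_pdivrMr ?expR_gt0 //.
rewrite -natr1 mulrDr mulr1 -exprSr mulrDl addrC lerD ?hc ?hd ?ler0n //.
Qed.

(** This kernel occurs in three roles: the reflected logarithmic form of [psi], the exponential
    weight in the integral [Mz] for zeta, and the continued integrals [Eint]. *)
Definition pexp k z x : C := (x ^+ k)%:C * cexp (x%:C * - z).

Lemma normc_pexp k z x : 0 <= x -> normc (pexp k z x) = x ^+ k * expR (- Re z * x).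
Proof.
move=> x0; rewrite normcMC ger0_norm ?exprn_ge0 // normc_cexp ReMC ReN.
by rewrite (mulrC x).
Qed.

Lemma cmf_id : cmf (fun x => x%:C).
Proof. exact: cmf_real (@mf_id R). Qed.

Lemma cmf_pexp k z : cmf (pexp k z).
Proof.
apply: cmfM; first exact: cmf_real (mfX _ (@mf_id R)).
by apply: cmf_cexp; apply: cmfM cmf_id (cmf_cst _).
Qed.

Lemma cL1_pexp k z : 0 < Re z -> cL1 (fun x => pexp k z x * (ray x)%:C).
Proof.
move=> z0; apply: (le_cL1 _ (I1_pexp k z0)).
  by apply: cmfM (cmf_pexp k z) (cmf_real mf_ray).
move=> x; rewrite mulrC normcMC rayE; case: (leP 0 x) => x0.
  by rewrite normr1 mul1r mulr1 normc_pexp.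
by rewrite normr0 mul0r mulr0.
Qed.

Lemma is_derive_pow k x : is_derive x 1 (fun y : R => y ^+ k) (k%:R * x ^+ k.-1).
Proof.
elim: k => [|k IH].
  rewrite mul0r (_ : (fun y : R => y ^+ 0) = cst 1) //; exact: is_derive_cst.
rewrite (_ : (fun y : R => y ^+ k.+1) = (fun y => y * y ^+ k)); last first.
  by apply/funext => y; rewrite exprS.
apply: (@is_derive_eq _ _ _ _ _ _ _ _ (is_deriveM1 (is_derive_id x 1) IH)).
case: k {IH} => [|k] /=; first by rewrite !expr0; ring.
by rewrite -[in RHS]natr1 exprS; ring.
Qed.

Lemma cder_pexp k z x : cder (pexp k z) x (k%:R * pexp k.-1 z x - z * pexp k z x).
Proof.
apply: cder_eq; first exact: cderM (cder_real (is_derive_pow k x)) (cder_cexp (- z) x).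
by rewrite /pexp rmorphM /= rmorph_nat; ring.
Qed.

Lemma ccvg_pexp k z : 0 < Re z -> @ccvg R (fun n => pexp k z n%:R) 0.
Proof.
move=> z0; have [e e0 he] := pexp_cvg0 k z0.
by apply: (ccvg_dist e0) => n; rewrite subr0 normc_pexp ?ler0n // he.
Qed.

(** Laplace transform of a power. The derivative of [pexp j z] integrates over the ray to
    [- pexp j z 0], which is -1 for [j = 0] and 0 otherwise; this is the recursion in [k]. *)
Lemma cint_pexp k z : 0 < Re z -> cint (fun x => pexp k z x * (ray x)%:C) = k`!%:R / z ^+ k.+1.
Proof.
move=> z0; have zn0 : z != 0 by apply/eqP => zz; rewrite zz ltxx in z0.
have key j : cint (fun x => (j%:R * pexp j.-1 z x - z * pexp j z x) * (ray x)%:C) = - pexp j z 0.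
  rewrite (cftc_ray (F := pexp j z) (l := 0)) ?sub0r //.
  - by move=> x _; exact: cder_pexp.
  - move=> x _; apply: cder_cctn.
    apply: cderD; first by apply: cderM (cder_cst _ _) (cder_pexp _ _ _).
    have -> : (fun y => - (z * pexp j z y)) = (fun y => - z * pexp j z y).
      by apply/funext => y; rewrite mulNr.
    by apply: cderM (cder_cst _ _) (cder_pexp _ _ _).
  - under eq_fun do rewrite mulrBl -(mulrA j%:R) -(mulrA z).
    by apply: cL1B; apply: cL1Z; exact: cL1_pexp.
  - exact: ccvg_pexp.
have key2 j : j%:R * cint (fun x => pexp j.-1 z x * (ray x)%:C) -
    z * cint (fun x => pexp j z x * (ray x)%:C) = - pexp j z 0.
  rewrite -key -!cintZ; try exact: cL1_pexp.
  rewrite -cintB; try (by apply: cL1Z; exact: cL1_pexp).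
  by apply: eq_cint => x; rewrite mulrBl !mulrA.
elim: k => [|k IH].
  have := key2 0%N; rewrite mul0r sub0r /pexp expr0 mul0r cexp0 mulr1 => /oppr_inj h.
  by rewrite expr1 fact0 mul1r; apply: (mulfI zn0); rewrite h divff.
have p0 : pexp k.+1 z 0 = 0 by rewrite /pexp exprS mul0r mul0r.
have := key2 k.+1; rewrite /= IH p0 oppr0 => /subr0_eq h.
apply: (mulfI zn0); rewrite -h factS natrM (exprS z k.+1).
have w0 : z ^+ k.+1 != 0 by rewrite expf_neq0.
move: (k.+1%:R : C) (k`!%:R : C) (z ^+ k.+1) w0 => u v w w0; field.
by rewrite zn0 w0.
Qed.

Lemma mf_inv_pos : mf (fun t : R => if 0 < t then t^-1 else 0).
Proof.
have -> : (fun t : R => if 0 < t then t^-1 else 0) = (fun t => expR (- ln t) * \1_(`]0, +oo[) t).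
  apply/funext => t; rewrite indic_itvE in_itv /= andbT.
  by case: ltP => t0; [rewrite expRN lnK ?posrE // mulr1|rewrite mulr0].
apply: mfM; last exact: mf_indic.
by apply: mf_expR; apply: mfN; exact: measurable_ln.
Qed.

(** The density [1 / t] on [t > 0] has [ln] as primitive, so the interval condition of [nint_subst]
    becomes the fundamental theorem on [[expR a, expR b]]. *)
Lemma nint_ln f : mf f -> (forall x, 0 <= f x) ->
  nint f = nint (fun t => f (ln t) * (if 0 < t then t^-1 else 0)).
Proof.
move=> mff f0; apply: nint_subst => //.
- exact: measurable_ln.
- exact: mf_inv_pos.
- by move=> t; case: ifP => // t0; rewrite invr_ge0 ltW.
move=> a b ab.
have [i1 e1] := @ftc_itv R (fun t => t^-1) (@ln R) (expR a) (expR b) (ltac:(by rewrite ler_expR))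
  (fun t h => is_derive1_ln (lt_le_trans (expR_gt0 a) (proj1 (andP h))))
  (fun t h => inv_continuous (lt0r_neq0 (lt_le_trans (expR_gt0 a) (proj1 (andP h))))).
rewrite !expRK in e1; rewrite -e1 rintE //; apply: ae_nint.
- apply: mfM mf_inv_pos; apply: mf_comp; last exact: measurable_ln.
  exact: mf_indic.
- exact: I1_mf.
(* The preimage of []a, b]] is half-open, whereas the fundamental theorem integrates over the closed
   segment; the two differ at [expR a] only. *)
exists [set expR a]; split => //=; first exact: lebesgue_measure_set1.
move=> t /= h; apply: contrapT => ta; apply: h => _.
rewrite !indic_itvE !in_itv /=; case: ifPn => t0; last first.
  rewrite mulr0 (_ : (expR a <= t) = false) ?mulr0 //.
  by apply/negbTE; rewrite -ltNge (le_lt_trans _ (expR_gt0 a)) // leNgt.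
have e2 : t = expR (ln t) by rewrite lnK.
have ua : a != ln t by apply/eqP => e; apply: ta; rewrite e2 -e.
move: (ln t) e2 ua => u -> ua.
by rewrite !ler_expR mulrC lt_neqAle ua.
Qed.

End Exponentials.

(** * The Fejer kernel and its cosine transform *)

Section FejerKernel.
Variable R : realType.
Local Notation mu := (@lebesgue_measure R).
Implicit Types (f F g : R -> R) (x a b u v t : R).

Lemma lipschitz_itv f F (a b B : R) : a <= b ->
  (forall x, a <= x <= b -> is_derive x 1 F (f x)) ->
  (forall x, a <= x <= b -> {for x, continuous f}) ->
  (forall x, a <= x <= b -> `|f x| <= B) -> `|F b - F a| <= B * (b - a).
Proof.
move=> ab dF cf fB; have [i1 <-] := ftc_itv ab dF cf.
have [i2 e2] := @ftc_itv R (fun=> B) (fun x => B * x) a b ab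
  (fun x _ => is_derive_lin B x) (fun x _ => @cst_continuous _ _ B x).
rewrite mulrBr -e2; apply: le_trans (rint_norm i1) _.
apply: le_rint => //; first exact: I1_norm.
move=> x; rewrite normrM indic_itvE in_itv /=; case: (boolP (a <= x <= b)) => h; last by rewrite normr0 !mulr0.
by rewrite normr1 !mulr1 fB.
Qed.

Lemma is_derive_seq F x (d : R) (e : nat -> R) : is_derive x 1 F d ->
  (forall n, e n != 0) -> e n @[n --> \oo] --> (0 : R) ->
  (F (x + e n) - F x) / e n @[n --> \oo] --> d.
Proof.
move=> [dF <-] e0 ec.
have h : h^-1 *: (F (h *: 1 + x) - F x) @[h --> 0^'] --> 'D_1 F x by exact: dF.
have ec' : e n @[n --> \oo] --> (0 : R)^'.
  move=> A [r /= r0 hA]; move/cvgrPdist_lt: ec => /(_ _ r0).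
  by apply: filterS => n /= hn; apply: hA => //; exact: e0.
apply: cvg_trans (cvg_comp _ _ ec' h).
rewrite (_ : (fun n => (F (x + e n) - F x) / e n) =
  (fun h => h^-1 *: (F (h *: 1 + x) - F x)) \o e) //.
apply/funext => n /=; rewrite [RHS]mulrC; congr ((F _ - _) / _).
by rewrite addrC; congr (_ + _); rewrite /GRing.scale /= mulr1.
Qed.

Lemma sin_le_norm x : `|sin x| <= `|x|.
Proof.
wlog x0 : x / 0 <= x.
  move=> H; case: (leP 0 x) => h; first exact: H.
  by rewrite -normrN -(normrN x) -sinN; apply: H; rewrite oppr_ge0 ltW.
have := @lipschitz_itv cos sin 0 x 1 x0 (fun y _ => is_derive_sin y)
  (fun y _ => @continuous_cos R y).
rewrite sin0 !subr0 mul1r (ger0_norm x0); apply.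
by move=> y _; exact: cos_max.
Qed.

Lemma cos_half x : 1 - cos x = 2 * sin (x / 2) ^+ 2.
Proof.
rewrite {1}(_ : x = (x / 2) *+ 2); last by rewrite mulr2n; field.
rewrite cos_mulr2n mulr2n; have := cos2Dsin2 (x / 2); lra.
Qed.

Lemma cos_le1' x : 0 <= 1 - cos x <= 2.
Proof. by have := cos_max x; rewrite ler_norml => /andP[h1 h2]; apply/andP; split; lra. Qed.

Lemma one_sub_cos_le x : 1 - cos x <= x ^+ 2.
Proof.
rewrite cos_half.
have h : sin (x / 2) ^+ 2 <= (x / 2) ^+ 2.
  by rewrite -[leLHS]real_normK ?num_real // -[leRHS]real_normK ?num_real // ler_sqr ?nnegrE // sin_le_norm.
apply: le_trans (ler_wpM2l _ h) _ => //; rewrite expr2 (expr2 x).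
have := sqr_ge0 x; rewrite expr2; lra.
Qed.

Lemma I1_cauchy : I1 (fun t : R => (1 + t ^+ 2)^-1).
Proof.
pose f t : R := (1 + t ^+ 2)^-1.
have p t : 0 < 1 + t ^+ 2 by rewrite ltr_pwDl // sqr_ge0.
have cf t : {for t, continuous f}.
  apply: continuousV; first exact: lt0r_neq0.
  by apply: continuousD; [exact: cst_continuous|exact: is_derive_continuous (is_derive_pow 2 t)].
have h : I1 (fun t => f t * ray t).
  apply: (@I1_ray _ f (@atan R) (pi / 2)).
  - by move=> t _.
  - exact: mf_continuous.
  - by move=> t _; rewrite invr_ge0 ltW.
  - by move=> t _; rewrite atan0 subr0 ltW // atan_ltpi2.
have h2 := I1_sub 0 h.
apply: (le_I1 _ (I1D h h2)); first exact: mf_continuous.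
move=> t; rewrite ger0_norm; last by rewrite invr_ge0 ltW.
rewrite !rayE sub0r /f sqrrN oppr_ge0 -mulrDr.
have q : 0 <= (1 + t ^+ 2)^-1 by rewrite invr_ge0 ltW.
rewrite -[leLHS]mulr1 ler_wpM2l //.
by case: (leP 0 t) => t0; rewrite ?lerDl ?ler0n // (ltW t0) add0r.
Qed.

(** The Fejer kernel without normalising factor. At [t = 0] it takes the value 0 in place of the
    limit [u ^+ 2 / 2], so pointwise limits are taken at [t != 0]. *)
Definition fejer u t : R := (1 - cos (u * t)) / t ^+ 2.

Lemma mf_inv_sqr : mf (fun t : R => (t ^+ 2)^-1).
Proof.
have -> : (fun t : R => (t ^+ 2)^-1) =
  (fun t : R => if t == 0 then 0 else expR (- ln (t ^+ 2))).
  apply/funext => t; case: eqP => [->|/eqP t0]; first by rewrite expr0n invr0.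
  by rewrite expRN lnK // posrE exprn_even_gt0.
apply: measurable_fun_ifT.
- by apply: measurable_fun_eqr => //; exact: measurable_cst.
- exact: mf_cst.
- by apply: mf_expR; apply: mfN; apply: (mf_comp (@measurable_ln R)); exact: mfX (@mf_id R).
Qed.

Lemma fejer_ge0 u t : 0 <= fejer u t.
Proof. by rewrite divr_ge0 ?sqr_ge0 //; case/andP: (cos_le1' (u * t)). Qed.

Lemma mf_fejer u : mf (fejer u).
Proof.
apply: mfM mf_inv_sqr; apply: mfB (mf_cst _) _; apply: mf_cos.
exact: mfM (mf_cst _) (@mf_id R).
Qed.

Lemma I1_fejer u : I1 (fejer u).
Proof.
apply: (le_I1 (mf_fejer u) (I1Z (u ^+ 2 + 2) I1_cauchy)) => t.
have p : 0 < 1 + t ^+ 2 by rewrite ltr_pwDl // sqr_ge0.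
rewrite ger0_norm ?fejer_ge0 // ler_pdivlMr // /fejer.
have [->|t0] := eqVneq t 0.
  by rewrite mulr0 cos0 subrr !mul0r addr_ge0 // sqr_ge0.
rewrite mulrAC ler_pdivrMr ?exprn_even_gt0 //.
rewrite [leLHS]mulrDr mulr1 [leRHS]mulrDl.
have h1 := one_sub_cos_le (u * t); rewrite exprMn in h1.
apply: lerD => //; apply: ler_wpM2r; first exact: sqr_ge0.
by case/andP: (cos_le1' (u * t)).
Qed.

(** Classically the number [pi]; kept as a symbol known to be positive. *)
Definition fejer_cst : R := rint (fejer 1).

(** Scaling: [fejer u t] is [u ^+ 2] times [fejer 1] at [u t], and the substitution returns
    [1 / |u|]. *)
Lemma rint_fejer u : rint (fejer u) = `|u| * fejer_cst.
Proof.
have [->|u0] := eqVneq u 0.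
  rewrite normr0 mul0r; transitivity (rint (fun _ : R => 0 : R)); last exact: rint0.
  apply: eq_rint => t.
  by rewrite /fejer mul0r cos0 subrr mul0r.
have n0 : `|u| != 0 by rewrite normr_eq0.
have h := rint_affine 0 u0 (I1_fejer 1).
have -> : rint (fejer u) = rint (fun t => u ^+ 2 * fejer 1 (u * t + 0)).
  apply: eq_rint => t; rewrite /fejer addr0 mul1r exprMn; case: (eqVneq t 0) => [->|t0].
    by rewrite mulr0 cos0 subrr !mul0r mulr0.
  by field; rewrite t0 u0.
rewrite rintZ; last exact: I1_affine (I1_fejer 1).
by rewrite h -/fejer_cst -(real_normK (num_real u)); field.
Qed.

Lemma fejer_cst_gt0 : 0 < fejer_cst.
Proof.
rewrite lt_def rint_ge0 ?andbT; last by move=> t; exact: fejer_ge0.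
apply/eqP => e0.
have n0 : nint (fejer 1) = 0%E by rewrite -rintE ?[rint _]e0 //; exact: I1_fejer.
have [N [mN N0 hN]] := nint_eq0 (mf_fejer 1) (fejer_ge0 1) n0.
(* A zero integral would make [fejer 1] vanish off a null set, but it is positive on []0, 1[], since
   [t / 2] stays below [pi / 2] there. *)
suff : (mu (`]0%R, 1%R[%classic : set R) <= mu N)%E.
  by rewrite N0 lebesgue_measure_itv /= lte01 oppr0 adde0 lee_fin leNgt ltr01.
apply: le_measure; rewrite ?inE //.
move=> t /=; rewrite in_itv /= => /andP[t0 t1]; apply: hN => /= h.
have := h Logic.I; apply/eqP; rewrite /cst /fejer mul1r mulf_neq0 ?invr_eq0 ?expf_neq0 ?lt0r_neq0 //.
rewrite cos_half mulr_gt0 // exprn_gt0 // sin_gt0_pihalf //.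
have := @pihalf_ge1 R; move: (pi / 2) => p hp; apply/andP; split; lra.
Qed.

(* The cosine transform of [fejer e] is the second difference of [v |-> |v|]. *)
Lemma rint_fejer_cos (e v : R) :
  I1 (fun t => fejer e t * cos (v * t)) /\
  rint (fun t => fejer e t * cos (v * t)) =
  fejer_cst / 2 * (`|v + e| + `|v - e| - 2 * `|v|).
Proof.
split.
  apply: (I1Mb (I1_fejer e) (B := 1)).
    by apply: mf_cos; exact: mfM (mf_cst _) (@mf_id R).
  by move=> t; exact: cos_max.
transitivity (rint (fun t => 2^-1 * (fejer (v + e) t + fejer (v - e) t) - fejer v t)).
  apply: eq_rint => t; rewrite /fejer (mulrBl t) (mulrDl v) cosB cosD.
  by move: ((t ^+ 2)^-1) => i; field.
rewrite rintB; [|by apply: I1Z; apply: I1D; exact: I1_fejer|exact: I1_fejer].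
rewrite rintZ; last by apply: I1D; exact: I1_fejer.
rewrite rintD; [|exact: I1_fejer|exact: I1_fejer].
by rewrite !rint_fejer; field.
Qed.

(** For [t != 0] the left side is the square of [sin y / y] at [y = e t / 2]. With [fejer_cvg1] it
    shows that these weights tend to 1 from below as [e] tends to 0. *)
Lemma fejer_le1 e t : e != 0 -> 2 / e ^+ 2 * fejer e t <= 1.
Proof.
move=> e0; have [->|t0] := eqVneq t 0.
  by rewrite /fejer mulr0 cos0 subrr mul0r mulr0.
have p : 0 < (e * t / 2) ^+ 2 by rewrite exprn_even_gt0 //= !mulf_neq0 ?invr_neq0.
have -> : 2 / e ^+ 2 * fejer e t = sin (e * t / 2) ^+ 2 / (e * t / 2) ^+ 2.
  by rewrite /fejer cos_half; field; rewrite t0 e0.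
rewrite ler_pdivrMr // mul1r.
by rewrite -[leLHS]real_normK ?num_real // -[leRHS]real_normK ?num_real // ler_sqr ?nnegrE // sin_le_norm.
Qed.

Lemma fejer_cvg1 (e : nat -> R) t : t != 0 -> (forall n, e n != 0) ->
  e n @[n --> \oo] --> (0 : R) ->
  2 / e n ^+ 2 * fejer (e n) t @[n --> \oo] --> (1 : R).
Proof.
move=> t0 e0 ec.
pose f n := e n * t / 2.
have f0 n : f n != 0 by rewrite /f !mulf_neq0 ?invr_neq0.
have fc : f n @[n --> \oo] --> (0 : R).
  rewrite -[X in _ --> X](mul0r (2^-1)) -[X in X * _](mul0r t).
  by apply: cvgM (cvg_cst _); apply: cvgM (cvg_cst _).
have h := is_derive_seq (is_derive_sin 0) f0 fc.
rewrite cos0 in h.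
have -> : (fun n => 2 / e n ^+ 2 * fejer (e n) t) =
    (fun n => ((sin (0 + f n) - sin 0) / f n) * ((sin (0 + f n) - sin 0) / f n)).
  apply/funext => n; rewrite add0r sin0 subr0 /f /fejer cos_half.
  by field; rewrite t0 e0.
by rewrite -[X in _ --> X](mulr1 1); exact: cvgM.
Qed.

End FejerKernel.

(** * Plancherel's theorem for real functions of compact support *)

Section RealPlancherel.
Variable R : realType.
Local Notation mu := (@lebesgue_measure R).
Implicit Types (f F g h : R -> R) (x a b u v t : R).

(** The overlap of two windows of length [e] is the larger of [e - |x - y|] and 0, that is, half the
    second difference of the absolute value. The same second difference is the transform computed in
    [rint_fejer_cos]. *)
Lemma tent (e x y : R) : 0 < e ->
  rint (fun t => \1_(`[x - e, x[) t * \1_(`[y - e, y[) t) =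
  2^-1 * (`|x - y + e| + `|x - y - e| - 2 * `|x - y|).
Proof.
move=> e0.
wlog xy : x y / x <= y.
  move=> H; case: (leP x y) => [|/ltW] h; first exact: H.
  rewrite (eq_rint (g := fun t => \1_(`[y - e, y[) t * \1_(`[x - e, x[) t)); last by move=> t; rewrite mulrC.
  rewrite H // -(normrN (x - y)) -(normrN (x - y + e)) -(normrN (x - y - e)) !opprD !opprK !(addrC (- x)); ring.
rewrite (ler0_norm (x := x - y)) ?subr_le0 // (ler0_norm (x := x - y - e)); last by lra.
have [le|lt] := leP (y - e) x.
  rewrite ger0_norm; last by lra.
  rewrite (eq_rint (g := \1_(`[y - e, x[))); last first.
    move=> t; rewrite !indic_itvE !in_itv /= -natrM mulnb; congr (nat_of_bool _)%:R.
    by apply/idP/idP; lra.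
  apply: EFin_inj; rewrite rintE; last first.
    apply: I1P0; [exact: mf_indic|by move=> t; case/andP: (indic_le1 (`[y - e, x[) t)|].
    by rewrite nint_indic // lebesgue_measure_itv /=; case: ifP => // _; rewrite ltry.
  rewrite nint_indic // lebesgue_measure_itv /= lte_fin; case: ltP => h.
    by rewrite -EFinD; congr (_%:E); lra.
  by congr (_%:E); lra.
rewrite ltr0_norm; last by lra.
rewrite (eq_rint (g := fun=> 0)) ?rint0; first by lra.
move=> t; rewrite !indic_itvE !in_itv /= -natrM mulnb.
by rewrite (_ : (_ && _) = false) //; apply/negbTE/negP; lra.
Qed.

Definition cos_tr h t := rint (fun x => h x * cos (t * x)).
Definition sin_tr h t := rint (fun x => h x * sin (t * x)).

Lemma mf2_trig (c : R -> R) : mf c -> mf2 (fun x t : R => c (t * x)).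
Proof.
by move=> hc; apply: mf2_comp hc _; apply: mf2M; [exact: mf2_snd (@mf_id R)|exact: mf2_fst (@mf_id R)].
Qed.

Lemma mf_cos_tr h : mf h -> mf (cos_tr h).
Proof.
move=> mh; apply: mf_rint; apply: mf2M; first exact: mf2_snd.
by apply: mf2_swap; apply: mf2_trig; apply: mf_cos (@mf_id R).
Qed.

Lemma mf_sin_tr h : mf h -> mf (sin_tr h).
Proof.
move=> mh; apply: mf_rint; apply: mf2M; first exact: mf2_snd.
by apply: mf2_swap; apply: mf2_trig; apply: mf_sin (@mf_id R).
Qed.

(** For fixed [t] this is the integral of [h] over []t, t + e]]. The window is attached to [x] to
    match the shape of the kernel in [gram]. *)
Definition avg (e : R) h t := rint (fun x => h x * \1_(`[x - e, x[) t).

Lemma mf2_window (e : R) : mf2 (fun x t : R => \1_(`[x - e, x[) t).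
Proof.
have -> : (fun x t : R => \1_(`[x - e, x[) t) = (fun x t : R => \1_(`]0, e]) (x - t)) :> (R -> R -> R).
  apply/funext => x; apply/funext => t; rewrite !indic_itvE !in_itv /=; congr (nat_of_bool _)%:R.
  by apply/idP/idP; lra.
apply: mf2_comp; first exact: mf_indic.
by apply: mf2B; [exact: mf2_fst (@mf_id R)|exact: mf2_snd (@mf_id R)].
Qed.

Let window_sub (e M x t : R) : 0 < e -> `|x| <= M -> x - e <= t < x -> - (M + e) <= t <= M + e.
Proof.
move=> e0; rewrite ler_norml => /andP[a1 a2] /andP[a3 a4].
by apply/andP; split; lra.
Qed.

(** By [gram] both sides are quadratic forms in [h], and it is enough to compare kernels. Since
    [cos a cos b + sin a sin b = cos (a - b)], the left kernel is the second difference of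
    [rint_fejer_cos], and by [tent] so is the right one. The indicator supplies the integrable
    weight that [gram] requires; it equals 1 wherever the average can be nonzero. *)
Lemma fejer_gram (e M : R) h : 0 < e -> I1 h -> (forall x, M < `|x| -> h x = 0) ->
  I1 (fun t => fejer e t * (cos_tr h t ^+ 2 + sin_tr h t ^+ 2)) /\
  rint (fun t => fejer e t * (cos_tr h t ^+ 2 + sin_tr h t ^+ 2)) =
  @fejer_cst R * rint (fun t => \1_(`[- (M + e), M + e]) t * avg e h t ^+ 2) /\
  I1 (fun t => \1_(`[- (M + e), M + e]) t * avg e h t ^+ 2).
Proof.
move=> e0 Ih hM.
pose rho : R -> R := \1_(`[- (M + e), M + e]).
have Irho : I1 rho.
  apply: I1P0; [exact: mf_indic|by move=> t; case/andP: (indic_le1 (`[- (M + e), M + e]) t)|].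
  by rewrite nint_indic // lebesgue_measure_itv /=; case: ifP => // _; rewrite ltry.
have Iin (k : R -> R) : mf k -> (forall t, `|k t| <= 1) -> I1 (fun t => fejer e t * k t).
  by move=> mk k1; exact: (I1Mb (I1_fejer e) mk k1).
have mc (y : R) : mf (fun t => cos (t * y)) by apply: mf_cos; apply: mfM (@mf_id R) (mf_cst y).
have ms (y : R) : mf (fun t => sin (t * y)) by apply: mf_sin; apply: mfM (@mf_id R) (mf_cst y).
have le11 (p q : R) : `|p| <= 1 -> `|q| <= 1 -> `|p * q| <= 1.
  by move=> p1 q1; rewrite normrM mulr_ile1.
have K x y : rint (fun t => fejer e t * (cos (t * x) * cos (t * y))) +
    rint (fun t => fejer e t * (sin (t * x) * sin (t * y))) =
    @fejer_cst R * rint (fun t => \1_(`[x - e, x[) t * \1_(`[y - e, y[) t).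
  rewrite tent // mulrA -(rint_fejer_cos e (x - y)).2 -rintD.
  - by apply: eq_rint => t; rewrite -mulrDr -cosB -mulrBr (mulrC t).
  - apply: (Iin (fun t => cos (t * x) * cos (t * y))) => [|t]; first exact: mfM.
    by apply: le11; exact: cos_max.
  - apply: (Iin (fun t => sin (t * x) * sin (t * y))) => [|t]; first exact: mfM.
    by apply: le11; exact: sin_max.
have K2 x y : h x != 0 -> rint (fun t => rho t * (\1_(`[x - e, x[) t * \1_(`[y - e, y[) t)) =
    rint (fun t => \1_(`[x - e, x[) t * \1_(`[y - e, y[) t).
  move=> hx; have [xM|Mx] := leP `|x| M; last by rewrite (hM x) // eqxx in hx.
  apply: eq_rint => t; rewrite mulrA; congr (_ * _).
  rewrite -[RHS]mul1r /rho !indic_itvE !in_itv /=.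
  have [h1|h1] := boolP (x - e <= t < x); last by rewrite !mulr0.
  by rewrite (window_sub e0 xM h1).
have [i1 e1 o1 n1] := @gram R h (fejer e) (fun x t => cos (t * x)) 1 Ih (I1_fejer e)
  (mf2_trig (mf_cos (@mf_id R))) (fun x t => cos_max _).
have [i2 e2 o2 n2] := @gram R h (fejer e) (fun x t => sin (t * x)) 1 Ih (I1_fejer e)
  (mf2_trig (mf_sin (@mf_id R))) (fun x t => sin_max _).
have [i3 e3 o3 n3] := @gram R h rho (fun x t => \1_(`[x - e, x[) t) 1 Ih Irho (mf2_window e)
  (fun x t => ltac:(by have /andP[h0 h1] := indic_le1 (`[x - e, x[) t; rewrite ger0_norm)).
have s1 : (fun t => fejer e t * (cos_tr h t ^+ 2 + sin_tr h t ^+ 2)) =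
    (fun t => fejer e t * cos_tr h t ^+ 2 + fejer e t * sin_tr h t ^+ 2).
  by apply/funext => t; rewrite mulrDr.
rewrite s1; split; first exact: (I1D i1 i2).
split; last exact: i3.
rewrite (rintD i1 i2) e1 e2 e3 -(rintD o1 o2) -(rintZ _ o3); apply: eq_rint => x.
rewrite -mulrDr mulrCA.
have [->|hx] := eqVneq (h x) 0; first by rewrite !mul0r.
congr (_ * _); rewrite -(rintD (n1 x) (n2 x)) -(rintZ _ (n3 x)).
by apply: eq_rint => y; rewrite -mulrDr mulrCA K (K2 _ _ hx).
Qed.

(* Jensen's inequality on the window, whose length is [e]. *)
Lemma nint_avg (e : R) h : 0 < e -> I1 h -> I1 (fun x => h x ^+ 2) ->
  (nint (fun t => (e^-1 * avg e h t) ^+ 2)%R <= nint (fun x => h x ^+ 2)%R)%E.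
Proof.
move=> e0 Ih Ih2; have mh := I1_mf Ih.
have mw t : mf (fun x => \1_(`[x - e, x[) t) by exact: (mf2_x t (mf2_swap (mf2_window e))).
have w01 t x : 0 <= (\1_(`[x - e, x[) t : R) <= 1 by exact: indic_le1.
have wB t x : `|\1_(`[x - e, x[) t : R| <= 1 by have /andP[a1 a2] := w01 t x; rewrite ger0_norm.
have Iw t : I1 (fun x => \1_(`[x - e, x[) t) /\ rint (fun x => \1_(`[x - e, x[) t) = e.
  have -> : (fun x => \1_(`[x - e, x[) t) = (\1_(`]t, t + e]) : R -> R).
    apply/funext => x; rewrite !indic_itvE !in_itv /=; congr (nat_of_bool _)%:R.
    by apply/idP/idP; lra.
  have h1 : I1 (\1_(`]t, t + e]) : R -> R).
    apply: I1P0; [exact: mf_indic|by move=> y; case/andP: (indic_le1 (`]t, t + e]) y)|].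
    by rewrite nint_itv ?ltry // lerDl ltW.
  split => //; apply: EFin_inj; rewrite rintE // nint_itv ?lerDl ?ltW //.
  by congr (_%:E); ring.
pose q t := rint (fun x => h x ^+ 2 * \1_(`[x - e, x[) t).
have jensen t : (e^-1 * avg e h t) ^+ 2 <= e^-1 * q t.
  have [I1w ew] := Iw t; pose a := e^-1 * avg e h t.
  have I1hw : I1 (fun x => h x * \1_(`[x - e, x[) t) by exact: (I1Mb Ih (mw t) (wB t)).
  have I1h2w : I1 (fun x => h x ^+ 2 * \1_(`[x - e, x[) t) by exact: (I1Mb Ih2 (mw t) (wB t)).
  have : 0 <= rint (fun x => (h x - a) ^+ 2 * \1_(`[x - e, x[) t).
    by apply: rint_ge0 => x; rewrite mulr_ge0 ?sqr_ge0 //; case/andP: (w01 t x).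
  have -> : rint (fun x => (h x - a) ^+ 2 * \1_(`[x - e, x[) t) =
      q t - 2 * a * avg e h t + a ^+ 2 * e.
    rewrite -{3}ew /q /avg -!rintZ // -rintB //; last exact: I1Z.
    rewrite -rintD //; [|by apply: I1B => //; exact: I1Z|exact: I1Z].
    by apply: eq_rint => x; ring.
  have -> : avg e h t = e * a by rewrite /a mulrA divff ?mul1r // lt0r_neq0.
  rewrite -/a => H.
  rewrite mulKf ?lt0r_neq0 // mulrC ler_pdivlMr //; move: H; rewrite !expr2; lra.
have mq : mf q by apply: mf_rint; apply: mf2M; [exact: mf2_snd (mfX _ mh)|exact: mf2_swap (mf2_window e)].
have mavg : mf (avg e h) by apply: mf_rint; apply: mf2M; [exact: mf2_snd|exact: mf2_swap (mf2_window e)].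
apply: (@le_trans _ _ (nint (fun t => e^-1 * q t))).
  apply: le_nint; [by apply: mfX; exact: mfM (mf_cst _) mavg|exact: mfM (mf_cst _) mq|].
  by move=> t; rewrite sqr_ge0 jensen.
rewrite nintZ //; last 2 first.
- by move=> t; apply: rint_ge0 => x; rewrite mulr_ge0 ?sqr_ge0 //; case/andP: (w01 t x).
- by rewrite invr_ge0 ltW.
have -> : nint q = (\int[mu]_t nint (fun x => h x ^+ 2 * \1_(`[x - e, x[) t)%R)%E.
  by apply: eq_integral => t _; rewrite rintE //; exact: (I1Mb Ih2 (mw t) (wB t)).
rewrite (@tonelli R (fun t x => h x ^+ 2 * \1_(`[x - e, x[) t)); last 2 first.
- by apply: mf2M; [exact: mf2_snd (mfX _ mh)|exact: mf2_swap (mf2_window e)].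
- by move=> t x; rewrite mulr_ge0 ?sqr_ge0 //; case/andP: (w01 t x).
have -> : (\int[mu]_x nint (fun t => h x ^+ 2 * \1_(`[x - e, x[) t)%R = nint (fun x => e * h x ^+ 2)%R)%E.
  apply: eq_integral => x _.
  rewrite nintZ; [|exact: mf_indic|by move=> t; case/andP: (indic_le1 (`[x - e, x[) t)|exact: sqr_ge0].
  rewrite nint_indic // lebesgue_measure_itv /= lte_fin ltrBlDr ltrDl e0 -EFinD -EFinM.
  by congr (_%:E); ring.
rewrite nintZ ?(ltW e0) //; [|exact: mfX|by move=> x; exact: sqr_ge0].
by rewrite muleA -EFinM mulVf ?mul1e // lt0r_neq0.
Qed.

(** [avg (e n) h t] is an increment of a primitive of [h], so this is Lebesgue's differentiation
    theorem. *)
Lemma avg_cvg h (e : nat -> R) : I1 h -> (forall n, 0 < e n) -> e n @[n --> \oo] --> (0 : R) ->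
  {ae mu, forall t, (e n)^-1 * avg (e n) h t @[n --> \oo] --> h t}.
Proof.
move=> Ih e0 ec; have mh := I1_mf Ih.
pose F x := (\int[mu]_(t in `]-oo, x]) h t)%R.
have Iy y : mu.-integrable `]-oo, y] (EFin \o h) by apply: integrableS Ih.
have loc : locally_integrable [set: R] h by apply: open_integrable_locally => //; exact: openT.
have FE t n : F (t + e n) - F t = avg (e n) h t.
  rewrite /F -!rint_in -rintB; [|exact/I1_in|exact/I1_in].
  apply: eq_rint => x; rewrite -mulrBr; congr (_ * _); rewrite !indic_itvE !in_itv /=.
  have := e0 n; move: (e n) => d d0.
  have [h1|h1] := leP x t.
    by rewrite (_ : x <= t + d) ?andbF ?subrr //; apply: (le_trans h1); rewrite lerDl ltW.
  by rewrite subr0 andbT -lerBlDr.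
have := FTC1Ny Iy loc; rewrite -/F; apply: ae_S => t [dF Ft].
have dF' : is_derive t 1 F (h t) by apply: (DeriveDef dF); rewrite -derive1E; exact: Ft.
have := is_derive_seq dF' (fun n => lt0r_neq0 (e0 n)) ec.
by under eq_fun do rewrite FE mulrC.
Qed.

(** Classically [2 pi], the constant of the Fourier transform taken with no prefactor. *)
Definition planch : R := 2 * @fejer_cst R.

Lemma planch_gt0 : 0 < planch.
Proof. by rewrite mulr_gt0 // fejer_cst_gt0. Qed.

(** [fejer_gram] times [2 / e ^+ 2] is an exact identity for every [e]; let [e] tend to 0. Fatou's
    lemma gives each inequality: on one side Jensen's inequality bounds the averages, on the other
    [fejer_le1] bounds the weights. Finiteness of the left side is part of the conclusion, whence
    [nint]. *)
Lemma real_plancherel (M : R) h : I1 h -> I1 (fun x => h x ^+ 2) ->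
  (forall x, M < `|x| -> h x = 0) ->
  nint (fun t => cos_tr h t ^+ 2 + sin_tr h t ^+ 2) = (planch%:E * nint (fun x => h x ^+ 2)%R)%E.
Proof.
move=> Ih Ih2 hM; have mh := I1_mf Ih.
pose S t := cos_tr h t ^+ 2 + sin_tr h t ^+ 2.
have mS : mf S by apply: mfD; apply: mfX; [exact: mf_cos_tr|exact: mf_sin_tr].
have S0 t : 0 <= S t by rewrite addr_ge0 // sqr_ge0.
pose e (n : nat) : R := harmonic n.
have e0 n : 0 < e n by exact: harmonic_gt0.
have ec : e n @[n --> \oo] --> (0 : R) by exact: cvg_harmonic.
have mavg d : mf (avg d h).
  by apply: mf_rint; apply: mf2M; [exact: mf2_snd|exact: mf2_swap (mf2_window d)].
have key n : nint (fun t => 2 / e n ^+ 2 * fejer (e n) t * S t) =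
    nint (fun t => planch * ((e n)^-1 * avg (e n) h t) ^+ 2).
  have G := fejer_gram (e0 n) Ih hM.
  have c0 : 0 <= 2 / e n ^+ 2 by rewrite divr_ge0 // sqr_ge0.
  transitivity (nint (fun t => 2 / e n ^+ 2 * (fejer (e n) t * S t))).
    by apply: eq_nint => t; exact: (esym (mulrA _ _ _)).
  rewrite (@nintZ _ (2 / e n ^+ 2) (fun t => fejer (e n) t * S t)
    (mfM (mf_fejer (e n)) mS) (fun t => mulr_ge0 (fejer_ge0 _ _) (S0 t)) c0).
  rewrite -(rintE G.1) G.2.1 -EFinM mulrA EFinM (rintE G.2.2) -nintZ; first last.
  - by rewrite mulr_ge0 // ltW // fejer_cst_gt0.
  - by move=> t; rewrite mulr_ge0 ?sqr_ge0 //; case/andP: (indic_le1 (`[- (M + e n), M + e n]) t).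
  - exact: I1_mf G.2.2.
  apply: eq_nint => t; rewrite indic_itvE in_itv /=.
  have [h1|h1] := boolP (- (M + e n) <= t <= M + e n).
    by rewrite mul1r /planch; field; exact: lt0r_neq0.
  have -> : avg (e n) h t = 0.
    transitivity (rint (fun _ : R => 0 : R)); last exact: rint0.
    apply: eq_rint => x; have [xM|Mx] := leP `|x| M; last by rewrite hM // mul0r.
    rewrite indic_itvE in_itv /= (_ : (_ <= _ < _) = false) ?mulr0 //.
    by apply/negbTE; apply: contra h1; exact: window_sub.
  by rewrite mulr0 expr0n /= !mulr0.
have p0 := ltW planch_gt0.
have mA n : mf (fun t => ((e n)^-1 * avg (e n) h t) ^+ 2) by apply: mfX; exact: mfM (mf_cst _) (mavg _).
have mK n : mf (fun t => 2 / e n ^+ 2 * fejer (e n) t * S t).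
  by apply: mfM mS; apply: mfM (mf_cst _) (mf_fejer _).
have K0 n t : 0 <= 2 / e n ^+ 2 * fejer (e n) t * S t.
  by rewrite !mulr_ge0 ?fejer_ge0 // invr_ge0 sqr_ge0.
apply/eqP; rewrite eq_le; apply/andP; split.
- apply: (@nint_fatou _ (fun n t => 2 / e n ^+ 2 * fejer (e n) t * S t)) => //.
    have : {ae mu, forall t : R, t != 0}.
      exists [set 0]; split => //=; first exact: lebesgue_measure_set1.
      by move=> t /= ht; apply: contrapT => t0; apply: ht; apply/eqP.
    apply: ae_S => t t0; rewrite -[X in _ --> X]mul1r; apply: cvgM; last exact: cvg_cst.
    by apply: fejer_cvg1 => // n; exact: lt0r_neq0.
  apply: nearW => n; rewrite key nintZ //; last by move=> t; exact: sqr_ge0.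
  by apply: lee_wpmul2l; rewrite ?lee_fin //; exact: nint_avg.
- rewrite -nintZ //; [|exact: mfX|by move=> x; exact: sqr_ge0].
  apply: (@nint_fatou _ (fun n t => planch * ((e n)^-1 * avg (e n) h t) ^+ 2)).
  + by move=> n; exact: mfM (mf_cst _) (mA n).
  + by move=> n t; rewrite mulr_ge0 // sqr_ge0.
  + by apply: mfM (mf_cst _) _; exact: mfX.
  + apply: ae_S (avg_cvg Ih e0 ec) => t ct; apply: cvgM; first exact: cvg_cst.
    by under eq_fun do rewrite expr2; rewrite expr2; exact: cvgM.
  apply: nearW => n; rewrite -key; apply: le_nint => //.
  move=> t; rewrite K0 /= -[leRHS]mul1r ler_wpM2r //.
  by apply: fejer_le1; exact: lt0r_neq0.
Qed.

End RealPlancherel.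

(** * Square integrable functions, with squared norm [N2] *)

Section L2Space.
Variable R : realType.
Local Notation C := (R[i]).
Local Notation Re := (@complex.Re R).
Local Notation Im := (@complex.Im R).
Local Notation normc := (@Normc.normc R).
Local Notation mu := (@lebesgue_measure R).
Implicit Types (f g u v : R -> C) (a : R).

Definition cL2 f := cmf f /\ I1 (fun x => normc (f x) ^+ 2).
Definition N2 f : R := rint (fun x => normc (f x) ^+ 2).

Lemma N2_ge0 f : 0 <= N2 f.
Proof. by apply: rint_ge0 => x; exact: sqr_ge0. Qed.

Lemma eq_N2 f g : (forall x, f x = g x) -> N2 f = N2 g.
Proof. by move=> /funext ->. Qed.

Lemma N2E f : cL2 f -> (N2 f)%:E = nint (fun x => normc (f x) ^+ 2).
Proof. by move=> h; exact: rintE h.2. Qed.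

Lemma le_cL2 f (g : R -> R) : cmf f -> I1 g -> (forall x, normc (f x) ^+ 2 <= g x) -> cL2 f.
Proof.
move=> mff Ig fg; split => //; apply: (le_I1 _ Ig); first exact: mf_sqr_normc.
by move=> x; rewrite ger0_norm ?sqr_ge0.
Qed.

Lemma cL2_le f g : cmf f -> cL2 g -> (forall x, normc (f x) <= normc (g x)) ->
  cL2 f /\ N2 f <= N2 g.
Proof.
move=> mff [mg Ig] fg.
have h x : normc (f x) ^+ 2 <= normc (g x) ^+ 2 by rewrite ler_sqr ?nnegrE ?normc_ge0.
have hf : cL2 f by exact: (le_cL2 mff Ig h).
by split => //; apply: le_rint => //; exact: hf.2.
Qed.

Lemma cL2D f g : cL2 f -> cL2 g ->
  cL2 (fun x => f x + g x) /\ N2 (fun x => f x + g x) <= 2 * N2 f + 2 * N2 g.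
Proof.
move=> [m1 i1] [m2 i2].
have I : I1 (fun x => 2 * normc (f x) ^+ 2 + 2 * normc (g x) ^+ 2) by apply: I1D; exact: I1Z.
have h x : normc (f x + g x) ^+ 2 <= 2 * normc (f x) ^+ 2 + 2 * normc (g x) ^+ 2.
  exact: normcD_sqr2.
have hL : cL2 (fun x => f x + g x) by exact: (le_cL2 (cmfD m1 m2) I h).
split => //; rewrite /N2 -!rintZ // -rintD; [|exact: I1Z|exact: I1Z].
by apply: le_rint => //; exact: hL.2.
Qed.

Lemma cL2Z (c : C) f : cL2 f ->
  cL2 (fun x => c * f x) /\ N2 (fun x => c * f x) = normc c ^+ 2 * N2 f.
Proof.
move=> [m i].
have e : (fun x => normc (c * f x) ^+ 2) = (fun x => normc c ^+ 2 * normc (f x) ^+ 2).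
  by apply/funext => x; rewrite normcM exprMn.
split; last by rewrite /N2 e rintZ.
by split; [exact: cmfM (cmf_cst c) m|rewrite e; exact: I1Z].
Qed.

Lemma cL2N f : cL2 f -> cL2 (fun x => - f x) /\ N2 (fun x => - f x) = N2 f.
Proof.
move=> [m i].
have e : (fun x => normc (- f x) ^+ 2) = (fun x => normc (f x) ^+ 2).
  by apply/funext => x; rewrite normcN.
by split; [split; [exact: cmfN|rewrite e]|rewrite /N2 e].
Qed.

Lemma cL2B f g : cL2 f -> cL2 g ->
  cL2 (fun x => f x - g x) /\ N2 (fun x => f x - g x) <= 2 * N2 f + 2 * N2 g.
Proof. by move=> hf /cL2N[hg <-]; exact: cL2D. Qed.

Lemma cL2J f : cL2 f -> cL2 (fun x => conjc (f x)) /\ N2 (fun x => conjc (f x)) = N2 f.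
Proof.
move=> [m i].
have e : (fun x => normc (conjc (f x)) ^+ 2) = (fun x => normc (f x) ^+ 2).
  by apply/funext => x; rewrite normcJ.
by split; [split; [exact: cmfJ|rewrite e]|rewrite /N2 e].
Qed.

Lemma N2BC f g : N2 (fun x => f x - g x) = N2 (fun x => g x - f x).
Proof. by apply: eq_rint => x; rewrite normcBC. Qed.

Lemma N2_eq0 f : cL2 f -> N2 f = 0 -> {ae mu, forall x, f x = 0}.
Proof.
move=> [m i] h.
have := @nint_eq0 _ _ (mf_sqr_normc m) (fun x => sqr_ge0 _) (ltac:(by rewrite -rintE // -/(N2 f) h)).
by apply: ae_S => x /= /(_ Logic.I) /eqP; rewrite sqrf_eq0 normc_eq0 => /eqP.
Qed.

Lemma ae_N2 f g : cmf g -> cL2 f -> {ae mu, forall x, f x = g x} -> cL2 g /\ N2 f = N2 g.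
Proof.
move=> mg [m i] fg.
have h : ae_eq mu setT (fun x => normc (f x) ^+ 2) (fun x => normc (g x) ^+ 2).
  by apply: ae_S fg => x /= ->.
split; first by split => //; exact: (ae_I1 (mf_sqr_normc mg) h i).
exact: (ae_rint (mf_sqr_normc m) (mf_sqr_normc mg) h).
Qed.

Lemma cL2M f g : cL2 f -> cL2 g -> cL1 (fun x => f x * g x).
Proof.
move=> [m1 i1] [m2 i2]; apply: (le_cL1 (cmfM m1 m2) (I1D i1 i2)) => x.
rewrite normcM; have := sqr_ge0 (normc (f x) - normc (g x)).
have := sqr_ge0 (normc (f x) + normc (g x)).
rewrite !expr2; move: (normc (f x)) (normc (g x)) => p q; lra.
Qed.

(** The right side is smallest at [a = sqrt (U / V)]; the choice [X / (2 V)] gives the same bound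
    without a root. For [V = 0] a large [a] contradicts [X > 0]. *)
Let disc (X U V : R) : 0 <= X -> 0 <= U -> 0 <= V ->
  (forall a, 0 < a -> X <= a^-1 * U + a * V) -> X ^+ 2 <= 4 * U * V.
Proof.
move=> X0 U0 V0 H.
have [->|Xp] := eqVneq X 0; first by rewrite expr0n /= !mulr_ge0.
have {Xp} X1 : 0 < X by rewrite lt_def Xp.
have [V1|Vn] := eqVneq V 0.
  have a0 : 0 < 2 * U / X + 1 by rewrite ltr_wpDl // divr_ge0 ?mulr_ge0 // ltW.
  have := H _ a0; rewrite V1 mulr0 addr0 ler_pdivlMl // mulrDl mul1r divfK ?lt0r_neq0 //.
  by move=> h; exfalso; lra.
have {Vn} Vp : 0 < V by rewrite lt_def Vn.
have a0 : 0 < X / (2 * V) by rewrite divr_gt0 // mulr_gt0.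
have := H _ a0.
have -> : (X / (2 * V))^-1 * U + X / (2 * V) * V = 2 * V * U / X + X / 2.
  by field; rewrite !lt0r_neq0.
rewrite -lerBlDr ler_pdivlMr // expr2; lra.
Qed.

(** The bound [2 p q <= p ^+ 2 / a + a q ^+ 2] is integrated, then [disc] optimises over [a]. *)
Lemma cauchy_schwarz f g : cL2 f -> cL2 g -> normc (cint (fun x => f x * g x)) ^+ 2 <= 4 * N2 f * N2 g.
Proof.
move=> hf hg; have [m1 i1] := hf; have [m2 i2] := hg.
apply: disc; rewrite ?normc_ge0 ?N2_ge0 // => a a0.
have a1 : 0 < a^-1 by rewrite invr_gt0.
have e : a^-1 * N2 f + a * N2 g =
    2 * rint (fun x => 2^-1 * (a^-1 * normc (f x) ^+ 2 + a * normc (g x) ^+ 2)).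
  rewrite rintZ; last by apply: I1D; exact: I1Z.
  rewrite rintD; [|exact: I1Z|exact: I1Z].
  by rewrite !rintZ // mulrA mulfV ?mul1r.
rewrite e; apply: normc_cint; first exact: cL2M.
- by apply: I1Z; apply: I1D; exact: I1Z.
move=> x; rewrite normcM.
move: (normc (f x)) (normc (g x)) => p q; rewrite -subr_ge0.
rewrite (_ : _ - _ = 2^-1 * a^-1 * (p - a * q) ^+ 2); last by field; exact: lt0r_neq0.
by rewrite mulr_ge0 ?sqr_ge0 // mulr_ge0 // ltW.
Qed.

Definition L2cvg (f_ : nat -> R -> C) f := [/\ forall n, cL2 (f_ n), cL2 f &
  N2 (fun x => f_ n x - f x) @[n --> \oo] --> (0 : R)].

Lemma cvg0_le (u v : nat -> R) : (forall n, 0 <= u n <= v n) -> v n @[n --> \oo] --> (0 : R) ->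
  u n @[n --> \oo] --> (0 : R).
Proof. by move=> h; apply: squeeze_cvgr (cvg_cst 0); exact: nearW. Qed.

Lemma cvg0_22 (u v : nat -> R) : u n @[n --> \oo] --> (0 : R) -> v n @[n --> \oo] --> (0 : R) ->
  2 * u n + 2 * v n @[n --> \oo] --> (0 : R).
Proof.
move=> hu hv; have -> : 0 = 2 * 0 + 2 * 0 :> R by ring.
by apply: cvgD; apply: cvgM => //; exact: cvg_cst.
Qed.

Let cvg0_sqr (u : nat -> R) : (forall n, 0 <= u n) -> u n ^+ 2 @[n --> \oo] --> (0 : R) ->
  u n @[n --> \oo] --> (0 : R).
Proof.
move=> u0 h.
have -> : u = Num.sqrt \o (fun n => u n ^+ 2).
  by apply/funext => n /=; rewrite sqrtr_sqr ger0_norm.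
rewrite -(@sqrtr0 R); exact: (cvg_comp _ _ h (@sqrt_continuous R 0)).
Qed.

(** The error is [(f_n - f) (g_n - g) + (f_n - f) g + f (g_n - g)], and the Cauchy-Schwarz
    inequality sends each term to 0. *)
Lemma L2cvg_pairing (f_ g_ : nat -> R -> C) f g : L2cvg f_ f -> L2cvg g_ g ->
  ccvg (fun n => cint (fun x => f_ n x * g_ n x)) (cint (fun x => f x * g x)).
Proof.
move=> [hf_ hf cf] [hg_ hg cg].
have df n : cL2 (fun x => f_ n x - f x) by exact: (cL2B (hf_ n) hf).1.
have dg n : cL2 (fun x => g_ n x - g x) by exact: (cL2B (hg_ n) hg).1.
have p1 : ccvg (fun n => cint (fun x => (f_ n x - f x) * (g_ n x - g x))) 0.
  rewrite /ccvg; under eq_fun do rewrite subr0.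
  apply: cvg0_sqr => [n|]; first exact: normc_ge0.
  apply: (@cvg0_le _ (fun n => 4 * N2 (fun x => f_ n x - f x) * N2 (fun x => g_ n x - g x))).
    by move=> n; rewrite sqr_ge0 cauchy_schwarz.
  rewrite -[X in _ --> X](mulr0 (4 * 0)); apply: cvgM => //; apply: cvgM => //; exact: cvg_cst.
have p2 : ccvg (fun n => cint (fun x => (f_ n x - f x) * g x)) 0.
  rewrite /ccvg; under eq_fun do rewrite subr0.
  apply: cvg0_sqr => [n|]; first exact: normc_ge0.
  apply: (@cvg0_le _ (fun n => 4 * N2 (fun x => f_ n x - f x) * N2 g)).
    by move=> n; rewrite sqr_ge0 cauchy_schwarz.
  rewrite -[X in _ --> X](mul0r (N2 g)) -[X in X * _](mulr0 4).
  by apply: cvgM (cvg_cst _); apply: cvgM => //; exact: cvg_cst.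
have p3 : ccvg (fun n => cint (fun x => f x * (g_ n x - g x))) 0.
  rewrite /ccvg; under eq_fun do rewrite subr0.
  apply: cvg0_sqr => [n|]; first exact: normc_ge0.
  apply: (@cvg0_le _ (fun n => 4 * N2 f * N2 (fun x => g_ n x - g x))).
    by move=> n; rewrite sqr_ge0 cauchy_schwarz.
  by rewrite -[X in _ --> X](mulr0 (4 * N2 f)); apply: cvgM => //; exact: cvg_cst.
have := ccvgD (ccvgD (ccvgD p1 p2) p3) (ccvg_cst (cint (fun x => f x * g x))).
rewrite !add0r; congr ccvg; apply/funext => n.
have q1 := cL2M (df n) (dg n); have q2 := cL2M (df n) hg.
have q3 := cL2M hf (dg n); have q4 := cL2M hf hg.
rewrite -(cintD q1 q2) -(cintD (cL1D q1 q2) q3) -(cintD (cL1D (cL1D q1 q2) q3) q4).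
by apply: eq_cint => x; ring.
Qed.

Lemma cint_N2 f : cint (fun x => f x * conjc (f x)) = (N2 f)%:C.
Proof. by rewrite -cint_real; apply: eq_cint => x; exact: mulc_conj. Qed.

Lemma L2cvgJ (f_ : nat -> R -> C) f : L2cvg f_ f ->
  L2cvg (fun n x => conjc (f_ n x)) (fun x => conjc (f x)).
Proof.
move=> [h1 h2 h3]; split => [n||]; [exact: (cL2J (h1 n)).1|exact: (cL2J h2).1|].
rewrite (_ : (fun n => N2 _) = (fun n => N2 (fun x => f_ n x - f x))) //.
apply/funext => n; rewrite -(cL2J (cL2B (h1 n) h2).1).2.
by apply: eq_N2 => x; rewrite conjcD conjcN.
Qed.

Lemma L2cvg_N2 (f_ : nat -> R -> C) f : L2cvg f_ f -> N2 (f_ n) @[n --> \oo] --> N2 f.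
Proof.
move=> h; have /ccvgP[] := L2cvg_pairing h (L2cvgJ h).
by rewrite cint_N2 ReC => c _; move: c; under eq_fun do rewrite cint_N2 ReC.
Qed.

Lemma L2cvg_unique (f_ : nat -> R -> C) f g : L2cvg f_ f -> L2cvg f_ g ->
  {ae mu, forall x, f x = g x}.
Proof.
move=> [h1 h2 h3] [_ h5 h6].
have h : N2 (fun x => f x - g x) = 0.
  apply/eqP; rewrite eq_le N2_ge0 andbT.
  have c : 2 * N2 (fun x => f_ n x - f x) + 2 * N2 (fun x => f_ n x - g x) @[n --> \oo] --> (0 : R).
    exact: cvg0_22.
  have -> : N2 (fun x => f x - g x) = lim (cst (N2 (fun x => f x - g x)) n @[n --> \oo]) by rewrite lim_cst.
  rewrite -(cvg_lim _ c) //; apply: ler_lim; [exact: is_cvg_cst|by apply/cvg_ex; exists 0|].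
  apply: nearW => n /=.
  have [_] := cL2B (cL2B (h1 n) h5).1 (cL2B (h1 n) h2).1.
  rewrite addrC; apply: le_trans; rewrite le_eqVlt; apply/orP; left; apply/eqP.
  by apply: eq_N2 => x; ring.
have := N2_eq0 (cL2B h2 h5).1 h; apply: ae_S => x /eqP.
by rewrite subr_eq0 => /eqP.
Qed.

Lemma L2cvgD (f_ g_ : nat -> R -> C) f g : L2cvg f_ f -> L2cvg g_ g ->
  L2cvg (fun n x => f_ n x + g_ n x) (fun x => f x + g x).
Proof.
move=> [h1 h2 h3] [h4 h5 h6]; split => [n||]; [exact: (cL2D _ _).1|exact: (cL2D _ _).1|].
apply: (@cvg0_le _ (fun n => 2 * N2 (fun x => f_ n x - f x) + 2 * N2 (fun x => g_ n x - g x))).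
  move=> n; rewrite N2_ge0 /=.
  have [_] := cL2D (cL2B (h1 n) h2).1 (cL2B (h4 n) h5).1.
  apply: le_trans; rewrite le_eqVlt; apply/orP; left; apply/eqP.
  by apply: eq_N2 => x; ring.
exact: cvg0_22.
Qed.

Lemma L2cvgZ (c : C) (f_ : nat -> R -> C) f : L2cvg f_ f ->
  L2cvg (fun n x => c * f_ n x) (fun x => c * f x).
Proof.
move=> [h1 h2 h3]; split => [n||]; [exact: (cL2Z _ _).1|exact: (cL2Z _ _).1|].
rewrite (_ : (fun n => N2 _) = (fun n => normc c ^+ 2 * N2 (fun x => f_ n x - f x))).
  by rewrite -[X in _ --> X](mulr0 (normc c ^+ 2)); apply: cvgM => //; exact: cvg_cst.
apply/funext => n; rewrite -(cL2Z _ (cL2B (h1 n) h2).1).2.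
by apply: eq_N2 => x; rewrite mulrBr.
Qed.

End L2Space.

(** * The Fourier-Plancherel transform on the line *)

Section Fourier.
Variable R : realType.
Local Notation C := (R[i]).
Local Notation Re := (@complex.Re R).
Local Notation Im := (@complex.Im R).
Local Notation normc := (@Normc.normc R).
Local Notation mu := (@lebesgue_measure R).
Local Notation c0 := (planch R).
Implicit Types (f g u v F G : R -> C) (a : R).

(** The positive sign matches the Mellin kernel [t ^ (s - 1)] at [s = 1/2 + i tau]. *)
Definition FT f (t : R) : C := cint (fun x => f x * cis (t * x)).

Lemma cmf_lin a : cmf (fun x : R => cis (a * x)).
Proof. by apply: cmf_cis; exact: mfM (mf_cst a) (@mf_id R). Qed.

Lemma cL1_cis f a : cL1 f -> cL1 (fun x => f x * cis (a * x)).
Proof. by move=> hf; apply: (cL1Mb (B := 1) hf (cmf_lin a)) => x; rewrite normc_cis. Qed.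

Lemma cmf2_FT f : cmf f -> cmf2 (fun t x : R => f x * cis (t * x)).
Proof.
move=> mff; apply: cmf2M; first exact: cmf2_snd.
by apply: cmf2_cis; apply: mf2M; [exact: mf2_fst (@mf_id R)|exact: mf2_snd (@mf_id R)].
Qed.

Lemma cmf_FT f : cmf f -> cmf (FT f).
Proof. by move=> mff; exact: cmf_cint (cmf2_FT mff). Qed.

Lemma FTD f g : cL1 f -> cL1 g -> FT (fun x => f x + g x) = (fun t => FT f t + FT g t).
Proof.
move=> hf hg; apply/funext => t; rewrite /FT -(cintD (cL1_cis t hf) (cL1_cis t hg)).
by apply: eq_cint => x; rewrite mulrDl.
Qed.

Lemma FTZ (c : C) f : cL1 f -> FT (fun x => c * f x) = (fun t => c * FT f t).
Proof.
move=> hf; apply/funext => t; rewrite /FT -(cintZ c (cL1_cis t hf)).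
by apply: eq_cint => x; rewrite mulrA.
Qed.

Lemma FTB f g : cL1 f -> cL1 g -> FT (fun x => f x - g x) = (fun t => FT f t - FT g t).
Proof.
move=> hf hg; apply/funext => t; rewrite /FT -(cintB (cL1_cis t hf) (cL1_cis t hg)).
by apply: eq_cint => x; rewrite mulrBl.
Qed.

Lemma FT_shift f (b t : R) : cL1 f -> FT (fun x => f (x - b)) t = cis (t * b) * FT f t.
Proof.
move=> hf; rewrite /FT -(cintZ _ (cL1_cis t hf)).
rewrite -(cint_shift (- b) (cL1Z (cis (t * b)) (cL1_cis t hf))).
apply: eq_cint => x; rewrite mulrCA -cisD; congr (_ * cis _); ring.
Qed.

Lemma FT_opp f (t : R) : cL1 f -> FT (fun x => f (- x)) t = FT f (- t).
Proof.
move=> hf; rewrite /FT -(cint_sub 0 (cL1_cis (- t) hf)).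
by apply: eq_cint => x; rewrite sub0r mulrNN.
Qed.

(* The cross terms in [|FT f t| ^ 2 + |FT f (- t)| ^ 2] cancel, which reduces the
   identity to the real and imaginary parts of [f]. *)
Lemma compact_plancherel f (M : R) : cL2 f -> (forall x, M < `|x| -> f x = 0) ->
  [/\ cL1 f, cL2 (FT f) & N2 (FT f) = c0 * N2 f].
Proof.
move=> [mff If] fM.
have I1M : I1 (\1_(`[- M, M]) : R -> R).
  apply: I1P0; [exact: mf_indic|by move=> t; case/andP: (indic_le1 (`[- M, M]) t)|].
  by rewrite nint_indic // lebesgue_measure_itv /=; case: ifP => // _; rewrite ltry.
(* On the support [|f| <= 1 + |f| ^+ 2], so compact support turns square integrability into
   integrability. *)
have Lf : cL1 f.
  apply: (le_cL1 mff (I1D I1M If)) => x; have [xM|Mx] := leP `|x| M; last first.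
    by rewrite fM // Normc.normc0 addr_ge0 ?sqr_ge0 //; case/andP: (indic_le1 (`[- M, M]) x).
  rewrite indic_itvE in_itv /= -ler_norml xM (_ : true%:R = 1 :> R) //; have := normc_ge0 (f x).
  have := sqr_ge0 (normc (f x) - 1); rewrite !expr2; move: (normc _) => p; lra.
have part (p : C -> R) : (p = Re \/ p = Im) -> [/\ I1 (fun x => p (f x)),
   I1 (fun x => p (f x) ^+ 2) & forall x, M < `|x| -> p (f x) = 0].
  move=> hp; have pL : I1 (fun x => p (f x)) by case: hp Lf => -> [].
  have pn z : `|p z| <= normc z by case: hp => ->; [exact: Re_le_normc|exact: Im_le_normc].
  split => //.
    apply: (le_I1 _ If); first exact: mfX (I1_mf pL).
    by move=> x; rewrite ger0_norm ?sqr_ge0 // -[leLHS]real_normK ?num_real // ler_sqr ?nnegrE ?normc_ge0.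
  by move=> x Mx; rewrite fM //; case: hp => ->.
pose a x := Re (f x); pose b x := Im (f x).
have [Ia Ia2 aM] := part Re (or_introl erefl).
have [Ib Ib2 bM] := part Im (or_intror erefl).
have pa := real_plancherel Ia Ia2 aM; have pb := real_plancherel Ib Ib2 bM.
have Icos (h : R -> R) (t : R) : I1 h -> I1 (fun x => h x * cos (t * x)).
  move=> Ih; apply: (I1Mb Ih (B := 1)); last by move=> x; exact: cos_max.
  by apply: mf_cos; exact: mfM (mf_cst t) (@mf_id R).
have Isin (h : R -> R) (t : R) : I1 h -> I1 (fun x => h x * sin (t * x)).
  move=> Ih; apply: (I1Mb Ih (B := 1)); last by move=> x; exact: sin_max.
  by apply: mf_sin; exact: mfM (mf_cst t) (@mf_id R).
have eR t : Re (FT f t) = cos_tr a t - sin_tr b t.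
  rewrite /FT /cint Rei -(rintB (Icos _ t Ia) (Isin _ t Ib)).
  by apply: eq_rint => x; rewrite cReM.
have eI t : Im (FT f t) = sin_tr a t + cos_tr b t.
  rewrite /FT /cint Imi -(rintD (Isin _ t Ia) (Icos _ t Ib)).
  by apply: eq_rint => x; rewrite cImM.
have cN (h : R -> R) (t : R) : cos_tr h (- t) = cos_tr h t by apply: eq_rint => x; rewrite mulNr cosN.
have sN (h : R -> R) (t : R) : I1 h -> sin_tr h (- t) = - sin_tr h t.
  move=> Ih; rewrite /sin_tr -rintN; last exact: Isin.
  by apply: eq_rint => x; rewrite mulNr sinN mulrN.
have sq t : normc (FT f t) ^+ 2 + normc (FT f (- t)) ^+ 2 =
    2 * (cos_tr a t ^+ 2 + sin_tr a t ^+ 2) + 2 * (cos_tr b t ^+ 2 + sin_tr b t ^+ 2).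
  by rewrite !normc_sqr !eR !eI !cN !sN //; ring.
have mF := cmf_FT mff.
have mq (h : R -> R) : I1 h -> mf (fun t => cos_tr h t ^+ 2 + sin_tr h t ^+ 2).
  by move=> /I1_mf mh; apply: mfD; apply: mfX; [exact: mf_cos_tr|exact: mf_sin_tr].
have q0 (h : R -> R) (t : R) : 0 <= cos_tr h t ^+ 2 + sin_tr h t ^+ 2 by rewrite addr_ge0 ?sqr_ge0.
pose n := nint (fun t => normc (FT f t) ^+ 2).
have p0 : 0 <= c0 by exact: ltW (planch_gt0 R).
(* The integral [n] is invariant under [t -> - t], so the pointwise identity [sq] yields twice the
   claim. As [n] might be infinite, its finiteness is read off from the sum. *)
have key : (n + n)%E = (2 * (c0 * N2 f))%:E.
  have e1 : n = nint (fun t => normc (FT f (0 - t)) ^+ 2).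
    apply/esym; apply: (@nint_sub _ 0 (fun t => normc (FT f t) ^+ 2)); first exact: mf_sqr_normc.
    by move=> t; exact: sqr_ge0.
  rewrite [X in (_ + X)%E]e1 /n {e1 n}.
  rewrite -nintD; [|exact: mf_sqr_normc|apply: mf_sqr_normc; apply: cmf_comp mF _; exact: mfB (mf_cst _) (@mf_id R)|
    by move=> t; exact: sqr_ge0|by move=> t; exact: sqr_ge0].
  have -> : nint (fun t => normc (FT f t) ^+ 2 + normc (FT f (0 - t)) ^+ 2) =
      nint (fun t => 2 * (cos_tr a t ^+ 2 + sin_tr a t ^+ 2) + 2 * (cos_tr b t ^+ 2 + sin_tr b t ^+ 2)).
    by apply: eq_nint => t; rewrite sub0r sq.
  rewrite nintD; [|exact: mfM (mf_cst _) (mq _ Ia)|exact: mfM (mf_cst _) (mq _ Ib)|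
    by move=> t; rewrite mulr_ge0|by move=> t; rewrite mulr_ge0].
  rewrite nintZ; [|exact: mq|by move=> t|by []].
  rewrite nintZ; [|exact: mq|by move=> t|by []].
  rewrite pa pb -(rintE Ia2) -(rintE Ib2) -!EFinM -EFinD; congr (_%:E).
  rewrite -mulrDr -mulrDr -(rintD Ia2 Ib2); congr (_ * (_ * _)).
  by apply: eq_rint => x; rewrite normc_sqr.
have n0 : (0 <= n)%E by apply: nint_ge0 => t; exact: sqr_ge0.
have nE : n = (c0 * N2 f)%:E.
  case: (n) key n0 => [r| |] //=; rewrite -EFinD => -[h] _; congr (_%:E); lra.
have IF : I1 (fun t => normc (FT f t) ^+ 2).
  apply: I1P0; [exact: mf_sqr_normc|by move=> t; exact: sqr_ge0|by rewrite -/n nE ltry].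
split => //; apply: EFin_inj; rewrite -nE; exact: rintE.
Qed.

(** The cut-off [ln n.+1%:R] is the image of the segment [[1 / (n + 1), n + 1]] of [mellin_trunc]
    under [x = ln t]. *)
Definition tr (n : nat) f x : C := f x * (\1_(`[- ln n.+1%:R, ln n.+1%:R]) x)%:C.

Lemma trE n f x : tr n f x = if `|x| <= ln n.+1%:R then f x else 0.
Proof.
by rewrite /tr indic_itvE in_itv /= -ler_norml; case: ifP => _; rewrite ?mulr1 ?mulr0.
Qed.

Lemma cmf_tr n f : cmf f -> cmf (tr n f).
Proof. by move=> mff; apply: cmfM mff _; apply: cmf_real; exact: mf_indic. Qed.

Lemma normc_tr n f x : normc (tr n f x) <= normc (f x).
Proof. by rewrite trE; case: ifP => // _; rewrite Normc.normc0 normc_ge0. Qed.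

Lemma normc_Btr n f x : normc (f x - tr n f x) <= normc (f x).
Proof.
by rewrite trE; case: ifP => _; rewrite ?subrr ?subr0 // Normc.normc0 normc_ge0.
Qed.

Lemma tr_near f x : \forall n \near \oo, tr n f x = f x.
Proof.
have h := archi_boundP (expR_ge0 `|x|).
exists (Num.bound (expR `|x|)) => // n /= hn.
rewrite trE ifT // -ler_expR lnK ?posrE ?ltr0n //.
by rewrite (le_trans (ltW h)) // ler_nat leqW.
Qed.

Lemma cL2_tr n f : cL2 f -> cL2 (tr n f).
Proof. by move=> hf; have [] := cL2_le (cmf_tr n hf.1) hf (normc_tr n f). Qed.

Lemma tr_out n f x : ln n.+1%:R < `|x| -> tr n f x = 0.
Proof. by move=> h; rewrite trE leNgt h. Qed.

Lemma tr_plancherel n f : cL2 f -> [/\ cL1 (tr n f), cL2 (FT (tr n f)) & N2 (FT (tr n f)) = c0 * N2 (tr n f)].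
Proof. by move=> hf; exact: (compact_plancherel (cL2_tr n hf) (@tr_out n f)). Qed.

Lemma cvg_tr f : cL2 f -> L2cvg (tr ^~ f) f.
Proof.
move=> hf; split => //; first by move=> n; exact: cL2_tr.
have -> : (fun n => N2 (fun x => tr n f x - f x)) = (fun n => N2 (fun x => f x - tr n f x)).
  by apply/funext => n; rewrite N2BC.
have hB n : cL2 (fun x => f x - tr n f x) by exact: (cL2B hf (cL2_tr n hf)).1.
rewrite -(@rint0 R).
apply: (@rint_dct _ (fun n x => normc (f x - tr n f x) ^+ 2) (fun _ => 0) (fun x => normc (f x) ^+ 2) _ _ _ _ _).2.
- by move=> n; exact: I1_mf (hB n).2.
- exact: mf_cst.
- exact: hf.2.
- apply: aeW => x; apply: cvg_near_cst; have := tr_near f x; apply: filterS => n ->.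
  by rewrite subrr Normc.normc0 expr0n.
- by move=> n x; rewrite ger0_norm ?sqr_ge0 // ler_sqr ?nnegrE ?normc_ge0 // normc_Btr.
Qed.

Lemma trB_plancherel n m f : cL2 f ->
  N2 (fun t => FT (tr n f) t - FT (tr m f) t) = c0 * N2 (fun x => tr n f x - tr m f x).
Proof.
move=> hf; have [l1 _ _] := tr_plancherel n hf; have [l2 _ _] := tr_plancherel m hf.
rewrite -FTB //.
have [] := @compact_plancherel (fun x => tr n f x - tr m f x) (Num.max (ln n.+1%:R) (ln m.+1%:R)) => //.
  by have [] := cL2B (cL2_tr n hf) (cL2_tr m hf).
by move=> x; rewrite gt_max => /andP[h1 h2]; rewrite !tr_out // subrr.
Qed.

(* Almost everywhere convergence holds because [\sum 4 ^ k |g (k + 1) - g k| ^ 2]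
   is integrable, hence finite almost everywhere. *)
Lemma riesz_fischer (g : nat -> R -> C) (K : R) : (forall k, cL2 (g k)) ->
  (forall k, N2 (fun x => g k.+1 x - g k x) <= K * 16^-1 ^+ k) ->
  exists2 G, cmf G & {ae mu, forall x, ccvg (fun k => g k x) (G x)}.
Proof.
move=> hg hK.
have K0 : 0 <= K by have := hK 0%N; rewrite expr0 mulr1; apply: le_trans; exact: N2_ge0.
pose d k x := g k.+1 x - g k x.
have hd k : cL2 (d k) by exact: (cL2B (hg _) (hg _)).1.
pose e x : \bar R := (\sum_(0 <= k <oo) (4 ^+ k * normc (d k x) ^+ 2)%:E)%E.
have md k : mf (fun x => 4 ^+ k * normc (d k x) ^+ 2) by exact: mfM (mf_cst _) (I1_mf (hd k).2).
have e0 k x : (0 <= (4 ^+ k * normc (d k x) ^+ 2)%:E)%E by rewrite lee_fin mulr_ge0 ?sqr_ge0 ?exprn_ge0.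
have Ie : (\int[mu]_x e x < +oo)%E.
  rewrite integral_nneseries //; last by move=> k; exact/mfE.
  apply: (@le_lt_trans _ _ (\sum_(0 <= k <oo) (K * 4^-1 ^+ k)%:E)%E).
    apply: lee_nneseries => //; first by move=> k _ _; apply: integral_ge0.
    move=> k _; have -> : (\int[mu]_x (4 ^+ k * normc (d k x) ^+ 2)%:E)%E = (4 ^+ k * N2 (d k))%:E.
      rewrite EFinM (N2E (hd k)) -nintZ ?exprn_ge0 //; first exact: I1_mf (hd k).2.
      by move=> x; exact: sqr_ge0.
    rewrite lee_fin; apply: (le_trans (ler_wpM2l _ (hK k))); first exact: exprn_ge0.
    rewrite mulrCA -exprMn (_ : 4 * 16^-1 = 4^-1 :> R) //; lra.
  have cg : cvgn (series (geometric K (4^-1 : R))).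
    by apply: is_cvg_geometric_series; rewrite ger0_norm //; lra.
  rewrite (_ : (\sum_(0 <= k <oo) (K * 4^-1 ^+ k)%:E)%E = (limn (series (geometric K (4^-1 : R))))%:E) ?ltry //.
  rewrite -EFin_lim //; congr (limn _); apply/funext => n /=.
  by rewrite /series /= sumEFin.
have me : measurable_fun setT e by apply: ge0_emeasurable_sum => // k _; exact/mfE.
have Ie' : mu.-integrable setT e.
  apply/integrableP; split => //; apply: le_lt_trans Ie; rewrite le_eqVlt; apply/orP; left; apply/eqP.
  by apply: eq_integral => x _; rewrite gee0_abs // nneseries_ge0.
have cv : {ae mu, forall x, cvgn (fun k => Re (g k x)) /\ cvgn (fun k => Im (g k x))}.
  have := integrable_ae measurableT Ie'.
  apply: ae_S => x /(_ Logic.I) fx.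
  (* Each term of the series [e x] is at most its finite sum, hence the increments decrease like
     [2 ^ (- k)]. *)
  have bd k : normc (d k x) <= Num.sqrt (fine (e x)) * 2^-1 ^+ k.
    have h : ((4 ^+ k * normc (d k x) ^+ 2)%:E <= e x)%E.
      apply: (@le_trans _ _ (\sum_(0 <= j < k.+1) (4 ^+ j * normc (d j x) ^+ 2)%:E)%E); last first.
        by apply: nneseries_lim_ge => j _ _; exact: e0.
      by rewrite big_nat_recr //= leeDr // sume_ge0.
    rewrite -(fineK fx) lee_fin in h.
    have s0 : 0 <= fine (e x) by apply: le_trans h; rewrite -lee_fin.
    rewrite exprVn ler_pdivlMr ?exprn_gt0 // -ler_sqr ?nnegrE ?mulr_ge0 ?normc_ge0 ?exprn_ge0 ?sqrtr_ge0 //.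
    by rewrite sqr_sqrtr // exprMn exprAC mulrC (_ : 2 ^+ 2 = 4) // -natrX.
  have aux (p : C -> R) : (forall z w, p (z - w) = p z - p w) -> (forall z, `|p z| <= normc z) ->
      cvgn (fun k => p (g k x)).
    move=> pB pn.
    have cd : cvgn (series (fun k => p (d k x))).
      apply: normed_cvg; apply: (series_le_cvg (v_ := geometric (Num.sqrt (fine (e x))) 2^-1)) => //.
      - by move=> k /=; exact: normr_ge0.
      - by move=> k /=; rewrite mulr_ge0 ?sqrtr_ge0 // exprn_ge0 // invr_ge0.
      - by move=> k; exact: le_trans (pn _) (bd k).
      - by apply: is_cvg_geometric_series; rewrite ger0_norm //; lra.
    have -> : (fun k => p (g k x)) = (fun k => p (g 0%N x) + series (fun k => p (d k x)) k).
      apply/funext => k; rewrite /series /= (eq_bigr (fun i => p (g i.+1 x) - p (g i x))); last first.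
        by move=> i _; rewrite pB.
      by rewrite telescope_sumr // addrC subrK.
    by apply: is_cvgD => //; exact: is_cvg_cst.
  split; first by apply: aux; [exact: ReB|exact: Re_le_normc].
  by apply: aux; [exact: ImB|exact: Im_le_normc].
(* An upper limit is measurable everywhere and agrees with the limit where it exists, which gives a
   total measurable limit function. *)
pose L (p : C -> R) x := fine (limn_esup (fun k => (p (g k x))%:E)).
have mL (p : C -> R) : (forall k, mf (fun x => p (g k x))) -> mf (L p).
  move=> mp; apply: (@measurableT_comp _ _ _ _ _ _ (@fine R)) => //.
  by apply: measurable_fun_limn_esup => k; exact/mfE.
exists (fun x => L Re x +i* L Im x).
  by split; apply: mL => k; case: (hg k) => -[].
apply: ae_S cv => x [c1 c2]; apply/ccvgP; split; rewrite /= /L.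
- by have [_ ->] := cvg_limn_einf_sup (cvg_EFin2 c1).
- by have [_ ->] := cvg_limn_einf_sup (cvg_EFin2 c2).
Qed.


Definition is_fourier f F := cL2 f /\ L2cvg (fun n => FT (tr n f)) F.

Lemma is_fourier_ex f : cL2 f -> exists F, is_fourier f F.
Proof.
move=> hf; have [_ _ ct] := cvg_tr hf; have p0 := planch_gt0 R.
(* A subsequence fast enough for [riesz_fischer]. The clause [(k <= n)%N] makes its indices satisfy
   [k <= m k], so that it eventually contains any given truncation; the Fatou argument below uses
   this. *)
have pick k : exists n, (k <= n)%N /\ N2 (fun x => tr n f x - f x) <= 16^-1 ^+ k.
  have p : 0 < (16^-1 : R) ^+ k by rewrite exprn_gt0 // invr_gt0.
  move/cvgrPdist_le: ct => /(_ _ p) [N _ hN]; exists (maxn k N); split; first exact: leq_maxl.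
  have := hN (maxn k N) (leq_maxr _ _); rewrite sub0r normrN ger0_norm //; exact: N2_ge0.
have [m hm] := choice pick.
have hB n : cL2 (fun x => tr n f x - f x) by exact: (cL2B (cL2_tr n hf) hf).1.
have trB n n' : N2 (fun x => tr n f x - tr n' f x) <=
    2 * N2 (fun x => tr n f x - f x) + 2 * N2 (fun x => tr n' f x - f x).
  have [_] := cL2B (hB n) (hB n'); apply: le_trans; rewrite le_eqVlt; apply/orP; left; apply/eqP.
  by apply: eq_N2 => x; ring.
pose g k := FT (tr (m k) f).
have hg k : cL2 (g k) by have [] := tr_plancherel (m k) hf.
have [G mG cG] : exists2 G, cmf G & {ae mu, forall x, ccvg (fun k => g k x) (G x)}.
  (* The squared distance of consecutive truncations is at most
     [2 * 16^-1 ^+ k.+1 + 2 * 16^-1 ^+ k], hence at most [4 * 16^-1 ^+ k]; [trB_plancherel]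
     contributes [c0]. *)
  apply: (@riesz_fischer g (c0 * 4) hg) => k.
  rewrite trB_plancherel // -mulrA ler_pM2l //; apply: le_trans (trB _ _) _.
  have [_ h1] := hm k; have [_ h2] := hm k.+1.
  have h3 : (16^-1 : R) ^+ k.+1 <= 16^-1 ^+ k.
    by rewrite exprS ler_piMl ?exprn_ge0 ?invr_ge0 // invf_le1 ?ler1n.
  move: h1 h2 h3; move: ((16^-1 : R) ^+ k) ((16^-1 : R) ^+ k.+1) (N2 _) (N2 _) => p q u v; lra.
(* Fatou's lemma in [k] bounds the distance of [FT (tr n f)] to the almost everywhere limit [G], so
   the whole sequence converges to [G] in norm. *)
have fat n : cL2 (fun t => FT (tr n f) t - G t) /\
    N2 (fun t => FT (tr n f) t - G t) <= c0 * N2 (fun x => tr n f x - f x).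
  have hn : cL2 (FT (tr n f)) by have [] := tr_plancherel n hf.
  have mB : cmf (fun t => FT (tr n f) t - G t) by exact: (cmfB hn.1 mG).
  have le : (nint (fun t => normc (FT (tr n f) t - G t) ^+ 2)%R <= (c0 * N2 (fun x => tr n f x - f x))%R%:E)%E.
    apply: (@nint_fatou _ (fun k t => normc (FT (tr n f) t - g k t) ^+ 2)).
    - by move=> k; exact: I1_mf (cL2B hn (hg k)).1.2.
    - by move=> k t; exact: sqr_ge0.
    - exact: mf_sqr_normc.
    - apply: ae_S cG => t ct'; have /ccvgP[c1 c2] := ccvgB (ccvg_cst (FT (tr n f) t)) ct'.
      rewrite (_ : (fun k => _) = (fun k => Re (FT (tr n f) t - g k t) * Re (FT (tr n f) t - g k t) +
         Im (FT (tr n f) t - g k t) * Im (FT (tr n f) t - g k t))); last first.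
        by apply/funext => k; rewrite normc_sqr !expr2.
      by rewrite normc_sqr !expr2; apply: cvgD; apply: cvgM.
    - exists n => // k /= nk; rewrite -(N2E (cL2B hn (hg k)).1) lee_fin trB_plancherel // ler_pM2l //.
      rewrite N2BC [leRHS]N2BC.
      have [nm _] := hm k.
      have [] // := @cL2_le _ (fun x => tr (m k) f x - tr n f x) (fun x => f x - tr n f x).
      + by apply: cmfB; apply: cmf_tr; exact: hf.1.
      + by exact: (cL2B hf (cL2_tr n hf)).1.
      + move=> x; rewrite !trE.
        have lnm : ln n.+1%:R <= ln (m k).+1%:R :> R.
          by rewrite ler_ln ?posrE ?ltr0n // ler_nat ltnS (leq_trans nk).
        have [h1|h1] := leP `|x| (ln n.+1%:R); first by rewrite (le_trans h1) // !subrr Normc.normc0.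
        by rewrite !subr0; case: ifP => _ //; rewrite Normc.normc0 normc_ge0.
  have I2 : I1 (fun t => normc (FT (tr n f) t - G t) ^+ 2).
    apply: I1P0; [exact: mf_sqr_normc|by move=> t; exact: sqr_ge0|].
    by apply: (le_lt_trans le); rewrite ltry.
  by split; [split|rewrite -lee_fin N2E //; split].
have hn n : cL2 (FT (tr n f)) by have [] := tr_plancherel n hf.
exists G; split => //; split => //.
- have -> : G = (fun t => FT (tr 0%N f) t - (FT (tr 0%N f) t - G t)).
    by apply/funext => t; rewrite opprB addrC subrK.
  exact: (cL2B (hn 0%N) (fat 0%N).1).1.
- apply: (@cvg0_le _ _ (fun n => c0 * N2 (fun x => tr n f x - f x))).
    by move=> n; rewrite N2_ge0 (fat n).2.
  by rewrite -[X in _ --> X](mulr0 c0); apply: cvgM => //; exact: cvg_cst.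
Qed.

Lemma is_fourier_N2 f F : is_fourier f F -> N2 F = c0 * N2 f.
Proof.
move=> [hf hF]; apply: (cvg_unique _ (L2cvg_N2 hF)) => //.
rewrite (_ : (fun n => _) = (fun n => c0 * N2 (tr n f))).
  by apply: cvgM; [exact: cvg_cst|exact: (L2cvg_N2 (cvg_tr hf))].
by apply/funext => n; have [] := tr_plancherel n hf.
Qed.

Lemma is_fourier_unique f F G : is_fourier f F -> is_fourier f G -> {ae mu, forall x, F x = G x}.
Proof. by move=> [_ h1] [_ h2]; exact: L2cvg_unique h1 h2. Qed.

Lemma is_fourier_ae f F G : is_fourier f F -> cmf G -> {ae mu, forall x, F x = G x} -> is_fourier f G.
Proof.
move=> [hf [h1 h2 h3]] mG FG; split => //.
have [hG _] := ae_N2 mG h2 FG; split => //.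
rewrite (_ : (fun n => _) = (fun n => N2 (fun x => FT (tr n f) x - F x))) //.
apply/funext => n; apply/esym.
have [] // := @ae_N2 _ (fun x => FT (tr n f) x - F x) (fun x => FT (tr n f) x - G x) (cmfB (h1 n).1 mG)
  (cL2B (h1 n) h2).1.
by apply: ae_S FG => x ->.
Qed.

Lemma eq_fourier f g F : (forall x, f x = g x) -> is_fourier f F -> is_fourier g F.
Proof. by move=> /funext ->. Qed.

Lemma is_fourierD f g F G : is_fourier f F -> is_fourier g G ->
  is_fourier (fun x => f x + g x) (fun x => F x + G x).
Proof.
move=> [h1 h2] [h3 h4]; split; first exact: (cL2D h1 h3).1.
have -> : (fun n => FT (tr n (fun x => f x + g x))) = (fun n x => FT (tr n f) x + FT (tr n g) x).
  apply/funext => n; have [l1 _ _] := tr_plancherel n h1; have [l2 _ _] := tr_plancherel n h3.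
  by rewrite -FTD //; congr FT; apply/funext => x; rewrite /tr mulrDl.
exact: L2cvgD.
Qed.

Lemma is_fourierZ (c : C) f F : is_fourier f F -> is_fourier (fun x => c * f x) (fun x => c * F x).
Proof.
move=> [h1 h2]; split; first exact: (cL2Z c h1).1.
have -> : (fun n => FT (tr n (fun x => c * f x))) = (fun n x => c * FT (tr n f) x).
  apply/funext => n; have [l1 _ _] := tr_plancherel n h1.
  by rewrite -FTZ //; congr FT; apply/funext => x; rewrite /tr mulrA.
exact: L2cvgZ.
Qed.

Lemma is_fourierB f g F G : is_fourier f F -> is_fourier g G ->
  is_fourier (fun x => f x - g x) (fun x => F x - G x).
Proof.
move=> h1 /(is_fourierZ (-1)) /(is_fourierD h1).
have e (u v : R -> C) : (fun x => u x + -1 * v x) = (fun x => u x - v x).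
  by apply/funext => x; rewrite mulN1r.
by rewrite !e.
Qed.

(** Dominated convergence gives the pointwise limit [FT f] of the truncated transforms, while [G] is
    their limit in norm; Fatou's lemma shows that the two coincide almost everywhere. *)
Lemma is_fourier_L1 f : cL1 f -> cL2 f -> is_fourier f (FT f).
Proof.
move=> l1 l2; have [G hG] := is_fourier_ex l2; have [_ [h1 h2 h3]] := hG.
have mF := cmf_FT (cL1_cmf l1).
apply: (is_fourier_ae hG mF).
have pt t : ccvg (fun n => FT (tr n f) t) (FT f t).
  apply: (@cdct _ _ _ (fun x => normc (f x)) _ _ _ _ _).2.
  - by move=> n; apply: cmfM (cmf_lin t); exact: cmf_tr (cL1_cmf l1).
  - by apply: cmfM (cmf_lin t); exact: cL1_cmf.
  - exact: I1_normc.
  - apply: aeW => x; rewrite /ccvg; apply: cvg_near_cst; have := tr_near f x.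
    by apply: filterS => n ->; rewrite subrr Normc.normc0.
  - by move=> n x; rewrite normcM normc_cis mulr1; exact: normc_tr.
have mB : cmf (fun t => FT f t - G t) by exact: cmfB mF h2.1.
have z : nint (fun t => normc (FT f t - G t) ^+ 2) = 0%E.
  apply/eqP; rewrite eq_le nint_ge0 ?andbT; last by move=> t; exact: sqr_ge0.
  apply/lee_addgt0Pr => d d0; rewrite add0e.
  apply: (@nint_fatou _ (fun n t => normc (FT (tr n f) t - G t) ^+ 2)).
  - by move=> n; exact: I1_mf (cL2B (h1 n) h2).1.2.
  - by move=> n t; exact: sqr_ge0.
  - exact: mf_sqr_normc.
  - apply: aeW => t; have /ccvgP[c1 c2] := ccvgB (pt t) (ccvg_cst (G t)).
    rewrite (_ : (fun k => _) = (fun k => Re (FT (tr k f) t - G t) * Re (FT (tr k f) t - G t) +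
       Im (FT (tr k f) t - G t) * Im (FT (tr k f) t - G t))); last first.
      by apply/funext => k; rewrite normc_sqr !expr2.
    by rewrite normc_sqr !expr2; apply: cvgD; apply: cvgM.
  - move/cvgrPdist_le: h3 => /(_ _ d0); apply: filterS => n; rewrite sub0r normrN ger0_norm ?N2_ge0 // => h.
    by rewrite -(N2E (cL2B (h1 n) h2).1) lee_fin.
have := nint_eq0 (mf_sqr_normc mB) (fun x => sqr_ge0 _) z.
by apply: ae_S => t /= /(_ Logic.I) /eqP; rewrite sqrf_eq0 normc_eq0 subr_eq0 => /eqP.
Qed.

Lemma FT_mult f g : cL1 f -> cL1 g -> cint (fun t => FT f t * g t) = cint (fun x => f x * FT g x).
Proof.
move=> hf hg.
have [_ _ e _] := @cfubini_prod _ (fun t x => g t * (f x * cis (t * x))) (fun t => normc (g t)) (fun x => normc (f x))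
  (cmf2M (cmf2_fst (cL1_cmf hg)) (cmf2_FT (cL1_cmf hf))) (I1_normc hg) (I1_normc hf)
  (fun t x => ltac:(by rewrite !normcM normc_cis mulr1)).
transitivity (cint (fun t => cint (fun x => g t * (f x * cis (t * x))))).
  by apply: eq_cint => t; rewrite (cintZ _ (cL1_cis t hf)) mulrC.
rewrite e; apply: eq_cint => x; rewrite /FT -(cintZ _ (cL1_cis x hg)).
by apply: eq_cint => t; rewrite (mulrC x) mulrCA.
Qed.

Lemma is_fourier_mult f g F G : is_fourier f F -> is_fourier g G ->
  cint (fun x => F x * g x) = cint (fun x => f x * G x).
Proof.
move=> [h1 h2] [h3 h4].
have c1 := L2cvg_pairing h2 (cvg_tr h3); have c2 := L2cvg_pairing (cvg_tr h1) h4.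
apply: (ccvg_unique c1); move: c2; congr ccvg; apply/funext => n; apply/esym.
have [l1 _ _] := tr_plancherel n h1; have [l2 _ _] := tr_plancherel n h3.
exact: FT_mult.
Qed.

Lemma Re_polar f g : cL2 f -> cL2 g ->
  2 * Re (cint (fun x => f x * conjc (g x))) = N2 (fun x => f x + g x) - N2 f - N2 g.
Proof.
move=> hf hg; have hD := (cL2D hf hg).1.
have [i _] := cL2M hf (cL2J hg).1.
rewrite /cint Rei -rintZ // -(rintB hD.2 hf.2) -rintB; [|exact: I1B hD.2 hf.2|exact: hg.2].
by apply: eq_rint => x; rewrite !normc_sqr !reimE; ring.
Qed.

(** Polarisation: the norm identity for sums gives the real part, and replacing the second function
    by [i] times it gives the imaginary part. *)
Lemma is_fourier_parseval f g F G : is_fourier f F -> is_fourier g G ->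
  cint (fun x => F x * conjc (G x)) = c0%:C * cint (fun x => f x * conjc (g x)).
Proof.
move=> hF hG.
have re u v U V : is_fourier u U -> is_fourier v V ->
    Re (cint (fun x => U x * conjc (V x))) = c0 * Re (cint (fun x => u x * conjc (v x))).
  move=> hU hV; have n2 : 2 != 0 :> R by rewrite pnatr_eq0.
  apply: (mulfI n2); rewrite mulrCA.
  have [[u2 [_ U2 _]] [v2 [_ V2 _]]] := (hU, hV).
  rewrite (Re_polar U2 V2) (Re_polar u2 v2) (is_fourier_N2 (is_fourierD hU hV)).
  by rewrite (is_fourier_N2 hU) (is_fourier_N2 hV); ring.
have im u v : cL2 u -> cL2 v -> Im (cint (fun x => u x * conjc (v x))) =
    Re (cint (fun x => u x * conjc ((0 +i* 1) * v x))).
  move=> u2 v2.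
  have -> : cint (fun x => u x * conjc ((0 +i* 1) * v x)) =
      (0 -i* 1) * cint (fun x => u x * conjc (v x)).
    rewrite -cintZ; last exact: cL2M u2 (cL2J v2).1.
    by apply: eq_cint => x; rewrite conjcM mulrCA.
  by rewrite cReM /=; ring.
have [[f2 [_ F2 _]] [g2 [_ G2 _]]] := (hF, hG).
apply: ceq; first by rewrite ReMC; exact: re.
by rewrite ImMC (im _ _ F2 G2) (im _ _ f2 g2); apply: re => //; exact: is_fourierZ.
Qed.

(* [conj o F o conj] is, up to the constant [c0], the inverse transform: the
   defect has norm zero by the multiplication formula. *)
Lemma is_fourier_onto h : cL2 h -> exists f, is_fourier f h.
Proof.
move=> h2; have p0 := planch_gt0 R.
have [G hG] := is_fourier_ex (cL2J h2).1; have [_ [_ G2 _]] := hG.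
have [U hU] := is_fourier_ex (cL2J G2).1; have [_ [_ U2 _]] := hU.
have eG : N2 G = c0 * N2 h by rewrite (is_fourier_N2 hG) (cL2J h2).2.
have eU : N2 U = c0 ^+ 2 * N2 h by rewrite (is_fourier_N2 hU) (cL2J G2).2 eG; ring.
have cross : cint (fun x => U x * conjc (h x)) = (N2 G)%:C.
  rewrite (is_fourier_mult hU hG) -cint_N2; apply: eq_cint => x; exact: mulrC.
have hZ := (cL2Z (- c0%:C) h2).
(* With [N2 G = c0 N2 h], expanding the square gives [c0 ^+ 2 + c0 ^+ 2 - 2 c0 ^+ 2] times
   [N2 h]. *)
have z : N2 (fun x => U x - c0%:C * h x) = 0.
  have P := Re_polar U2 hZ.1.
  have e1 : cint (fun x => U x * conjc (- c0%:C * h x)) = - c0%:C * (N2 G)%:C.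
    rewrite -cross -cintZ; last exact: cL2M U2 (cL2J h2).1.
    by apply: eq_cint => x; rewrite conjcM conjcN conjcC; ring.
  have e2 : N2 (fun x => U x - c0%:C * h x) = N2 (fun x => U x + - c0%:C * h x).
    by apply: eq_N2 => x; rewrite mulNr.
  rewrite e2 -[LHS](subrK (N2 U)) -[X in X + _](subrK (N2 (fun x => - c0%:C * h x))) -P e1 hZ.2.
  by rewrite eU eG normcN normcC -rmorphN -rmorphM ReC real_normK ?num_real //; ring.
have ae0 := N2_eq0 (cL2B U2 (cL2Z c0%:C h2).1).1 z.
have c0C : c0%:C != 0 :> C by rewrite -normc_eq0 normcC normr_eq0 gt_eqF.
exists (fun x => c0%:C^-1 * conjc (G x)).
apply: (is_fourier_ae (is_fourierZ c0%:C^-1 hU) h2.1).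
by apply: ae_S ae0 => x /eqP; rewrite subr_eq0 => /eqP ->; rewrite mulKf.
Qed.

End Fourier.

(** * Power series, isolated zeros and analytic continuation along segments *)

Section Analytic.
Variable R : realType.
Local Notation C := (R[i]).
Local Notation Re := (@complex.Re R).
Local Notation Im := (@complex.Im R).
Local Notation normc := (@Normc.normc R).
Local Notation mu := (@lebesgue_measure R).
Implicit Types (z w s : C) (a b u v x : R).

(** Continuous induction: let [c] be the supremum of the [u] such that [P] holds on all of [[a, u]].
    The last hypothesis gives [P c], and the one before it would lead beyond [c] if [c < b]. *)
Lemma real_ind (P : R -> Prop) a b : a <= b -> P a ->
  (forall u, a <= u < b -> P u -> exists2 e, 0 < e & forall v, u < v < u + e -> P v) ->
  (forall u, a < u <= b -> (forall v, a <= v < u -> P v) -> P u) ->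
  forall u, a <= u <= b -> P u.
Proof.
move=> ab Pa hr hl.
pose S := [set u | a <= u <= b /\ forall v, a <= v <= u -> P v].
have Sa : S a.
  by split; [rewrite lexx|move=> v; rewrite -eq_le => /eqP <-].
have hS : has_sup S by split; [exists a|exists b => u [/andP[]]].
pose c := sup S.
have ac : a <= c by apply: ub_le_sup => //; case: hS.
have cb : c <= b by apply: ge_sup; [exists a|move=> u [/andP[]]].
have Sc v : a <= v < c -> P v.
  move=> /andP[av vc]; have vc' : 0 < c - v by rewrite subr_gt0.
  have [u [_ Su] vu] := sup_adherent vc' hS.
  by apply: Su; rewrite av /=; rewrite -/c subKr in vu; exact: ltW.
have Pc : P c.
  by have [<-//|ac'] := eqVneq a c; apply: hl => //; rewrite lt_neqAle ac' ac.
have cE : c = b.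
  apply/eqP; rewrite eq_le cb /= leNgt; apply/negP => cb'.
  have [e e0 he] := hr c (introT andP (conj ac cb')) Pc.
  pose d := Num.min (c + e / 2) b.
  have cd : c < d by rewrite /d lt_min cb' andbT ltrDl divr_gt0.
  suff : d <= c by rewrite leNgt cd.
  apply: ub_le_sup; first by case: hS.
  split; first by rewrite (le_trans ac (ltW cd)) /d ge_min lexx orbT.
  move=> v /andP[av vd]; have [vc|cv|->//] := ltgtP v c; first by apply: Sc; rewrite av.
  apply: he; rewrite cv /= (le_lt_trans vd) // /d gt_min ltrD2l ltr_pdivrMr //.
  by rewrite ltr_pMr // ltr1n.
move=> u /andP[au]; rewrite -cE le_eqVlt => /orP[/eqP ->//|uc].
by apply: Sc; rewrite au.
Qed.

Lemma ae_neq a : {ae mu, forall x, x != a}.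
Proof.
exists [set a]; split => //=; first exact: lebesgue_measure_set1.
by move=> t /= ht; apply: contrapT => t0; apply: ht; apply/eqP.
Qed.

Lemma normc_nat n : normc (n%:R : C) = n%:R.
Proof. by rewrite (_ : n%:R = (n%:R : R)%:C) ?normcC ?ger0_norm // rmorph_nat. Qed.

Lemma ftc_pow (K : R) n x : 0 <= x -> I1 (fun y => K * y ^+ n * \1_(`[0, x]) y) /\
  rint (fun y => K * y ^+ n * \1_(`[0, x]) y) = K / n.+1%:R * x ^+ n.+1.
Proof.
move=> x0.
have d (y : R) : is_derive y 1 (fun y => K * n.+1%:R^-1 * y ^+ n.+1) (K * y ^+ n).
  apply: (@is_derive_eq _ _ _ _ _ _ _ _ (is_deriveM1 (is_derive_cst (K * n.+1%:R^-1) y 1) (is_derive_pow n.+1 y))).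
  rewrite /=; have n0 : n.+1%:R != 0 :> R by rewrite pnatr_eq0.
  by field.
have [i1 ->] := ftc_itv x0 (fun y _ => d y) (fun y _ =>
  is_derive_continuous (is_deriveM1 (is_derive_cst K y 1) (is_derive_pow n y))).
by split; [exact: i1|rewrite expr0n /= mulr0 subr0].
Qed.

Definition exp_sum n w : C := \sum_(i < n) w ^+ i / i`!%:R.

(** The defect of order [n + 1] vanishes at 0 and has [w] times the defect of order [n] as
    derivative, so each order follows by integrating the previous estimate; every integration brings
    a factor 2 from [normc_cint]. *)
Lemma exp_sum_defect n w x : 0 <= x ->
  normc (cexp (x%:C * w) - exp_sum n (x%:C * w)) <=
  (2 * normc w) ^+ n / n`!%:R * x ^+ n * expR (normc w * x).
Proof.
elim: n x => [|n IH] x x0.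
  rewrite /exp_sum big_ord0 subr0 expr0 fact0 invr1 !mul1r normc_cexp ler_expR ReMC mulrC.
  by rewrite ler_wpM2r // (le_trans (ler_norm _)) // Re_le_normc.
pose D n (y : R) := cexp (y%:C * w) - exp_sum n (y%:C * w).
have dD m y : cder (D m.+1) y (w * D m y).
  have dE j : cder (fun y => exp_sum j.+1 (y%:C * w)) y (w * exp_sum j (y%:C * w)).
    elim: j => [|j IHj].
      have -> : (fun y : R => exp_sum 1 (y%:C * w)) = (fun=> 1).
        by apply/funext => t; rewrite /exp_sum big_ord1 expr0 fact0 divr1.
      by rewrite /exp_sum big_ord0 mulr0; exact: cder_cst.
    have -> : (fun y : R => exp_sum j.+2 (y%:C * w)) =
        (fun y => exp_sum j.+1 (y%:C * w) + (y ^+ j.+1)%:C * (w ^+ j.+1 / j.+1`!%:R)).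
      apply/funext => t; rewrite /exp_sum big_ord_recr /=; congr (_ + _).
      by rewrite exprMn rmorphXn mulrA.
    apply: cder_eq.
      exact: cderD IHj (cderM (cder_real (is_derive_pow j.+1 y)) (cder_cst _ _)).
    rewrite /exp_sum big_ord_recr /= mulrDr; congr (_ + _).
    rewrite mulr0 add0r factS natrM exprMn rmorphM /= rmorph_nat rmorphXn /= exprS.
    have n0 : j.+1%:R != 0 :> C by rewrite pnatr_eq0.
    have f0 : j`!%:R != 0 :> C by rewrite pnatr_eq0 -lt0n fact_gt0.
    move: (j.+1%:R : C) (j`!%:R : C) (y%:C ^+ j) n0 f0 => p q r n0 f0; field.
    by rewrite n0 f0.
  apply: cder_eq; first apply: cderD (cder_cexp w y) _.
    have := cderM (cder_cst (-1) y) (dE m).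
    have -> : (fun y : R => -1 * exp_sum m.+1 (y%:C * w)) = (fun y => - exp_sum m.+1 (y%:C * w)).
      by apply/funext => t; rewrite mulN1r.
    exact.
  by rewrite /D; ring.
have cD m y : cctn (D m.+1) y by exact: cder_cctn (dD m y).
have cD' y : cctn (fun y => w * D n y) y.
  case: n {IH} => [|n]; last by apply: cder_cctn; exact: cderM (cder_cst _ _) (dD n y).
  apply: cder_cctn; apply: cderM (cder_cst _ _) _.
  have -> : D 0%N = (fun y => cexp (y%:C * w)).
    by apply/funext => t; rewrite /D /exp_sum big_ord0 subr0.
  exact: cder_cexp.
have [L] := cftc_itv x0 (fun y _ => dD n y) (fun y _ => cD' y).
have -> : D n.+1 0 = 0.
  rewrite /D mul0r cexp0 /exp_sum big_ord_recl expr0 fact0 divr1 big1 ?addr0 ?subrr // => i _.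
  by rewrite /= exprS !mul0r.
rewrite subr0 -/(D n.+1 x) => <-.
pose K := normc w * ((2 * normc w) ^+ n / n`!%:R * expR (normc w * x)).
have K0 : 0 <= K by rewrite !mulr_ge0 ?normc_ge0 ?expR_ge0 ?exprn_ge0 ?mulr_ge0 ?normc_ge0 ?invr_ge0.
have [i1 e1] := ftc_pow K n x0.
apply: (le_trans (normc_cint L i1 _)).
  move=> y; rewrite mulrC normcMC indic_itvE in_itv /=.
  case: (boolP (0 <= y <= x)) => [/andP[y0 yx]|_]; last by rewrite normr0 mul0r mulr0.
  rewrite normr1 mul1r mulr1 normcM /K -(mulrA (normc w)) ler_wpM2l ?normc_ge0 //.
  apply: (le_trans (IH y y0)); rewrite -!mulrA ler_wpM2l ?exprn_ge0 ?mulr_ge0 ?normc_ge0 //.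
  rewrite ler_wpM2l ?invr_ge0 // mulrC ler_wpM2r ?exprn_ge0 // ler_expR ler_wpM2l ?normc_ge0 //.
rewrite e1 factS natrM (exprS (2 * normc w)) /K.
have n0 : n.+1%:R != 0 :> R by rewrite pnatr_eq0.
have f0 : n`!%:R != 0 :> R by rewrite pnatr_eq0 -lt0n fact_gt0.
move: (n.+1%:R : R) (n`!%:R : R) ((2 * normc w) ^+ n) (x ^+ n.+1) (expR _) n0 f0 => p q r t e n0 f0.
rewrite le_eqVlt; apply/orP; left; apply/eqP; field.
by rewrite n0 f0.
Qed.

Lemma exp_sum_le n x : 0 <= x -> \sum_(i < n) x ^+ i / i`!%:R <= expR x.
Proof.
move=> x0.
have := @nondecreasing_cvgn_le R (series (exp_coeff x)).
rewrite /expR => /(_ _ _ n); rewrite /series /= /exp_coeff /= big_mkord; apply.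
  by apply/nondecreasing_seqP => m; rewrite /= big_nat_recr //= lerDl divr_ge0 ?exprn_ge0.
exact: is_cvg_series_exp_coeff.
Qed.

Lemma exp_sum_bound n w : normc (exp_sum n w) <= expR (normc w).
Proof.
apply: le_trans (exp_sum_le n (normc_ge0 w)).
apply: (le_trans (normc_sum _ _ _)); apply: ler_sum => i _.
by rewrite normcM normcX normcV normc_nat.
Qed.

Lemma exp_sum_cvg w : ccvg (fun n => exp_sum n w) (cexp w).
Proof.
apply: (@ccvg_dist _ _ (fun n => expR (normc w) * ((2 * normc w) ^+ n / n`!%:R))) => [|n].
  rewrite -[X in _ --> X](mulr0 (expR (normc w))); apply: cvgM; first exact: cvg_cst.
  exact: (cvg_series_cvg_0 (is_cvg_series_exp_coeff (2 * normc w))).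
rewrite normcBC; have := @exp_sum_defect n w 1 ler01.
by rewrite mul1r expr1n !mulr1 mulrC.
Qed.

Lemma analyticB (h1 h2 : C -> C) s : analytic_at h1 s -> analytic_at h2 s ->
  analytic_at (fun z => h1 z - h2 z) s.
Proof.
move=> [a [r [r0 ha]]] [b [q [q0 hb]]].
exists (fun n => a n - b n), (Num.min r q); split; first by rewrite lt_min r0.
move=> z; rewrite lt_min => /andP[zr zq].
have := ccvgB (ha z zr) (hb z zq); congr ccvg; apply/funext => N.
by rewrite -sumrB; apply: eq_bigr => i _; rewrite mulrBl.
Qed.

Lemma ccvg_shift (u : nat -> C) z : ccvg (fun n => u n.+1) z -> ccvg u z.
Proof.
move=> /ccvgP[h1 h2]; apply/ccvgP; split.
- by rewrite -(cvg_shiftS (fun n => Re (u n))).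
- by rewrite -(cvg_shiftS (fun n => Im (u n))).
Qed.

Lemma eq_cvgn (u v : nat -> R) (l : R) : (forall n, u n = v n) -> u n @[n --> \oo] --> l ->
  v n @[n --> \oo] --> l.
Proof. by move=> /funext ->. Qed.

Lemma ccvg_shiftn (u : nat -> C) z k : ccvg u z -> ccvg (fun n => u (k + n)%N) z.
Proof.
move=> /ccvgP[h1 h2]; apply/ccvgP; split.
- apply: (@eq_cvgn (fun n => Re (u (n + k)%N))); first by move=> n; rewrite addnC.
  by rewrite (cvg_shiftn k (fun n => Re (u n))).
- apply: (@eq_cvgn (fun n => Im (u (n + k)%N))); first by move=> n; rewrite addnC.
  by rewrite (cvg_shiftn k (fun n => Im (u n))).
Qed.

(** As [z = s + (z - s)], the coefficients become [s a_n + a_(n-1)]. *)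
Lemma analyticMid (h : C -> C) s : analytic_at h s -> analytic_at (fun z => z * h z) s.
Proof.
move=> [a [r [r0 ha]]].
pose b n := s * a n + (if n is m.+1 then a m else 0).
exists b, r; split => // z zr; apply: ccvg_shift.
have c1 := ha z zr.
have c1s : ccvg (fun N => \sum_(n < N.+1) a n * (z - s) ^+ n) (h z).
  exact: (ccvg_shiftn 1 c1).
have := ccvgD (ccvgM (ccvg_cst s) c1s) (ccvgM (ccvg_cst (z - s)) c1).
rewrite -mulrDl (addrC s) subrK; congr ccvg; apply/funext => N.
rewrite !mulr_sumr /b.
under [RHS]eq_bigr do rewrite mulrDl.
rewrite big_split /=; congr (_ + _); first by apply: eq_bigr => i _; rewrite mulrA.
rewrite big_ord_recl mul0r add0r; apply: eq_bigr => i _.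
by rewrite /= /bump /= add1n exprS mulrCA.
Qed.

Lemma geo_sum q n : (1 - q) * \sum_(i < n) q ^+ i = 1 - q ^+ n :> C.
Proof.
elim: n => [|n IH]; first by rewrite big_ord0 mulr0 expr0 subrr.
by rewrite big_ord_recr /= mulrDr IH exprS; ring.
Qed.

Lemma ccvg_pow0 q : normc q < 1 -> @ccvg R (fun n => q ^+ n) 0.
Proof.
move=> q1; apply: (@ccvg_dist _ _ (fun n => normc q ^+ n)) => [|n]; last by rewrite subr0 normcX.
by apply: cvg_expr; rewrite ger0_norm // normc_ge0.
Qed.

(** Geometric series of ratio [- (z - s) / (s - 1)], convergent up to the pole. *)
Lemma analytic_inv1 s : s != 1 -> analytic_at (fun z => (z - 1)^-1) s.
Proof.
move=> s1; have d0 : s - 1 != 0 by rewrite subr_eq0.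
exists (fun n => (-1) ^+ n * (s - 1)^-1 ^+ n.+1), (normc (s - 1)).
split; first by rewrite normc_gt0.
move=> z zs; pose q := - ((z - s) / (s - 1)).
have q1 : normc q < 1 by rewrite normcN normcM normcV ltr_pdivrMr ?mul1r // normc_gt0.
have q10 : 1 - q != 0.
  by apply/eqP => /subr0_eq e; move: q1; rewrite -e Normc.normc1 ltxx.
have eq1 : 1 - q = (z - 1) / (s - 1) by rewrite /q; field.
have z1 : z - 1 != 0 by apply: contraNneq q10 => e; rewrite eq1 e mul0r.
have := ccvgM (ccvg_cst (z - 1)^-1) (ccvgB (ccvg_cst 1) (ccvg_pow0 q1)).
rewrite subr0 mulr1; congr ccvg; apply/funext => N.
rewrite -geo_sum eq1 mulrA mulrA mulVf // mul1r mulr_sumr; apply: eq_bigr => i _.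
by rewrite (_ : q = -1 * ((z - s) * (s - 1)^-1)) ?(exprMn, exprS); [ring|rewrite /q; ring].
Qed.

(* If the first nonvanishing coefficient is [a n], the values are
   [(z - s) ^+ n * (a n + O (z - s))]. *)
Lemma analytic_zeros (h : C -> C) s (zs : nat -> C) : analytic_at h s ->
  (forall j, h (zs j) = 0) -> (forall j, zs j != s) -> ccvg zs s ->
  exists2 r : R, 0 < r & forall z, normc (z - s) < r -> h z = 0.
Proof.
move=> [a [r [r0 ha]]] hz zn cz; exists r => //.
suff a0 n : a n = 0.
  move=> z /ha c; apply: (ccvg_unique c).
  rewrite (_ : (fun N => _) = fun=> 0); first exact: ccvg_cst.
  by apply/funext => N; rewrite big1 // => i _; rewrite a0 mul0r.
pose p := r / 2; have p0 : 0 < p by rewrite divr_gt0.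
(* The terms of the series tend to 0 at [s + p], inside the disc, hence are bounded; this replaces
   Cauchy's estimates. *)
have [B B0 hB] : exists2 B, 0 <= B & forall m, normc (a m) * p ^+ m <= B.
  have c := ha (s + p%:C); rewrite addrAC subrr add0r normcC gtr0_norm // in c.
  have {}c := c (ltac:(by rewrite ltr_pdivrMr // ltr_pMr // ltr1n)).
  have c' : ccvg (fun N => \sum_(n < N.+1) a n * p%:C ^+ n) (h (s + p%:C)).
    exact: (ccvg_shiftn 1 c).
  have t0 := ccvgB c' c; rewrite subrr in t0.
  have /cvg_seq_bounded [M [_ hM]] : cvgn (fun N => normc (a N) * p ^+ N).
    apply/cvg_ex; exists 0; apply: eq_cvgn t0 => N.
    rewrite subr0 big_ord_recr /= addrAC subrr add0r normcM normcX normcC.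
    by rewrite gtr0_norm.
  exists `|M + 1| => // m; have := hM (M + 1) (ltac:(by rewrite ltrDl)) m Logic.I.
  move=> /= h1; exact: le_trans (ler_norm _) (le_trans h1 (ler_norm _)).
elim/ltn_ind: n => n IH.
(* Below [p / 2] the terms after the [n]-th are dominated by a geometric series of ratio 1/2, whence
   the factor 2. *)
have small j : normc (zs j - s) < p / 2 -> normc (a n) <= 2 * B / p ^+ n.+1 * normc (zs j - s).
  set w := zs j - s => wp.
  have w0 : w != 0 by rewrite subr_eq0.
  have wn0 : 0 < normc w by rewrite normc_gt0.
  have c : ccvg (fun N => \sum_(m < N) a m * w ^+ m) 0.
    have wr : normc w < r.
      by apply: (lt_trans wp); rewrite /p; move: (r) r0 => q q0; lra.
    by have := ha _ wr; rewrite hz.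
  have c2 : ccvg (fun N => (w ^+ n)^-1 * \sum_(m < n.+1 + N) a m * w ^+ m) 0.
    rewrite -[X in ccvg _ X](mulr0 (w ^+ n)^-1); apply: ccvgM (ccvg_cst _) _.
    exact: (ccvg_shiftn n.+1 c).
  have bd N : normc (a n - (w ^+ n)^-1 * \sum_(m < n.+1 + N) a m * w ^+ m) <= 2 * B / p ^+ n.+1 * normc w.
    have -> : a n - (w ^+ n)^-1 * \sum_(m < n.+1 + N) a m * w ^+ m =
        - \sum_(m < N) a (n.+1 + m)%N * w ^+ m.+1.
      rewrite big_split_ord /= big_ord_recr /= big1 ?add0r => [|i _]; last by rewrite IH ?mul0r.
      rewrite mulrDr mulrCA mulVf ?expf_neq0 // mulr1 opprD addrA subrr add0r mulr_sumr.
      congr (- _); apply: eq_bigr => i _; rewrite exprD exprS [w ^+ i.+1]exprS.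
      have wn : w ^+ n != 0 by rewrite expf_neq0.
      by move: (w ^+ n) wn => v v0; field.
    rewrite normcN; apply: (le_trans (normc_sum _ _ _)).
    have q0 : 0 <= normc w / p by rewrite divr_ge0 ?normc_ge0 // ltW.
    apply: (@le_trans _ _ (\sum_(m < N) B / p ^+ n.+1 * normc w * (2^-1) ^+ m)).
      apply: ler_sum => i _; rewrite normcM normcX.
      have h1 := hB (n.+1 + i)%N.
      rewrite exprD mulrA -ler_pdivlMr ?exprn_gt0 // -ler_pdivlMr ?exprn_gt0 // in h1.
      apply: (le_trans (ler_wpM2r _ h1)); first by rewrite exprn_ge0 ?normc_ge0.
      have h2 : normc w ^+ i / p ^+ i <= 2^-1 ^+ i.
        rewrite -expr_div_n lerXn2r ?nnegrE ?invr_ge0 //.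
        by rewrite ler_pdivrMr //; apply: ltW; rewrite mulrC.
      rewrite [normc w ^+ i.+1]exprS (_ : B / p ^+ i / p ^+ n.+1 * (normc w * normc w ^+ i) =
        B / p ^+ n.+1 * normc w * (normc w ^+ i / p ^+ i)); last by ring.
      by apply: ler_wpM2l h2; rewrite !mulr_ge0 ?normc_ge0 // invr_ge0 exprn_ge0 // ltW.
    rewrite -mulr_sumr.
    have g : \sum_(m < N) (2^-1 : R) ^+ m <= 2.
      have -> : \sum_(m < N) (2^-1 : R) ^+ m = 2 - 2 * 2^-1 ^+ N.
        elim: N => [|N IHN]; first by rewrite big_ord0 expr0; lra.
        by rewrite big_ord_recr /= IHN exprS; field.
      by rewrite gerBl mulr_ge0 // exprn_ge0 // invr_ge0.
    apply: (le_trans (ler_wpM2l _ g)).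
      by rewrite !mulr_ge0 ?normc_ge0 // invr_ge0 exprn_ge0 // ltW.
    by rewrite le_eqVlt; apply/orP; left; apply/eqP; ring.
  have c3 := ccvgB (ccvg_cst (a n)) c2; rewrite subr0 in c3.
  have t1 : normc (a n) @[N --> \oo] --> normc (a n) by exact: cvg_cst.
  have t2 : 2 * B / p ^+ n.+1 * normc w + normc (a n - (w ^+ n)^-1 *
      (\sum_(m < n.+1 + N) a m * w ^+ m) - a n) @[N --> \oo] --> 2 * B / p ^+ n.+1 * normc w.
    by rewrite -[X in _ --> X]addr0; apply: cvgD; [exact: cvg_cst|exact: c3].
  apply: (ler_cvg_to t1 t2); apply: nearW => N.
  rewrite -{1}[a n](subrK (a n - (w ^+ n)^-1 * (\sum_(m < n.+1 + N) a m * w ^+ m))).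
  by apply: (le_trans (normcD _ _)); rewrite addrC lerD // normcBC.
apply/eqP; rewrite -normc_eq0 eq_le normc_ge0 andbT.
have K0 : 0 <= 2 * B / p ^+ n.+1 by rewrite !mulr_ge0 // invr_ge0 exprn_ge0 // ltW.
have t1 : normc (a n) @[N --> \oo] --> normc (a n) by exact: cvg_cst.
have t2 : 2 * B / p ^+ n.+1 * normc (zs j - s) @[j --> \oo] --> 0.
  by rewrite -[X in _ --> X](mulr0 (2 * B / p ^+ n.+1)); apply: cvgM; [exact: cvg_cst|exact: cz].
apply: (ler_cvg_to t1 t2).
have p20 : 0 < p / 2 by rewrite divr_gt0.
move/cvgrPdist_lt: cz => /(_ _ p20); apply: filterS => j.
by rewrite sub0r normrN ger0_norm ?normc_ge0 // => /small.
Qed.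

Definition seg (z0 z1 : C) u : C := z0 + u%:C * (z1 - z0).

Lemma seg_dist z0 z1 u v : normc (seg z0 z1 u - seg z0 z1 v) = `|u - v| * normc (z1 - z0).
Proof. by rewrite -normcMC; congr normc; rewrite /seg rmorphB /=; ring. Qed.

(** Continuous induction on [u]: vanishing near a point of the segment is an open condition, and it
    is closed because the points of parameter [u - u / (n + 1)] are zeros accumulating at [u], to
    which [analytic_zeros] applies. *)
Lemma identity_segment (h : C -> C) z0 z1 : z0 != z1 ->
  (forall u, 0 <= u <= 1 -> analytic_at h (seg z0 z1 u)) ->
  (exists2 r : R, 0 < r & forall z, normc (z - z0) < r -> h z = 0) ->
  exists2 r : R, 0 < r & forall z, normc (z - z1) < r -> h z = 0.
Proof.
move=> z01 ha h0; have d0 : 0 < normc (z1 - z0) by rewrite normc_gt0 subr_eq0 eq_sym.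
pose P u := exists2 r : R, 0 < r & forall z, normc (z - seg z0 z1 u) < r -> h z = 0.
have P0 : P 0 by rewrite /P /seg mul0r addr0.
suff : P 1 by rewrite /P /seg mul1r addrC subrK.
apply: (@real_ind P 0 1) => //; last by rewrite lexx ler01.
- move=> u _ [r r0 hr]; exists (r / 2 / normc (z1 - z0)); first by rewrite !divr_gt0.
  move=> v /andP[uv vu]; exists (r / 2); first by rewrite divr_gt0.
  move=> z hz; apply: hr; apply: (le_lt_trans (normc_tri (seg z0 z1 v) _ _)).
  have : normc (seg z0 z1 v - seg z0 z1 u) < r / 2.
    rewrite seg_dist -ltr_pdivlMr // gtr0_norm ?subr_gt0 //; move: vu.
    by move: (r / 2 / _) => q; lra.
  by move: hz; move: (normc _) (normc _) => p q; lra.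
- move=> u /andP[u0 u1] hv.
  pose v n := u - u * harmonic n.
  have hh n : 0 < (harmonic n : R) <= 1.
    by rewrite harmonic_gt0 /harmonic /= invf_le1 ?ler1n.
  have vu n : 0 <= v n < u.
    have /andP[h1 h2] := hh n; rewrite /v subr_ge0 gtrBl mulr_gt0 // andbT.
    by rewrite ler_piMr // ltW.
  apply: (@analytic_zeros h (seg z0 z1 u) (fun n => seg z0 z1 (v n))).
  + by apply: ha; rewrite ltW.
  + move=> n; have [r r0 hr] := hv _ (vu n); apply: hr.
    by rewrite subrr Normc.normc0.
  + move=> n; rewrite -subr_eq0 -normc_eq0 seg_dist mulf_neq0 ?gt_eqF //.
    by have /andP[_ h1] := vu n; rewrite normr_gt0 subr_eq0 lt_eqF.
  + apply: (@eq_cvgn (fun n => u * normc (z1 - z0) * harmonic n)) => [n|].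
      rewrite seg_dist /v addrAC subrr add0r normrN ger0_norm; first by ring.
      by have /andP[h1 _] := hh n; rewrite mulr_ge0 // ltW.
    rewrite -[X in _ --> X](mulr0 (u * normc (z1 - z0))); apply: cvgM; first exact: cvg_cst.
    exact: cvg_harmonic.
Qed.

End Analytic.

(** * The zeta function for [0 < Re s], and its values on the critical line *)

Section Zeta.
Variable R : realType.
Local Notation C := (R[i]).
Local Notation Re := (@complex.Re R).
Local Notation Im := (@complex.Im R).
Local Notation normc := (@Normc.normc R).
Local Notation mu := (@lebesgue_measure R).
Implicit Types (z w s : C) (a b u v x y t : R).

(** The integer part counted by indicators: as [N] grows this gives its measurability, and in
    [rint_zfrac] it is integrated term by term. *)
Lemma truncn_sum N x :
  \sum_(k < N) \1_(`[k.+1%:R, +oo[) x = (minn N (Num.truncn x))%:R :> R.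
Proof.
elim: N => [|N IH]; first by rewrite big_ord0 min0n.
rewrite big_ord_recr /= IH indic_itvE in_itv /= andbT -truncn_gt_nat -natrD.
congr (_%:R); case: ltnP => h1.
  by rewrite (minn_idPl h1) addn1.
by rewrite (minn_idPr (leqW h1)) addn0.
Qed.

Lemma mf_truncn : mf (fun x : R => (Num.truncn x)%:R).
Proof.
apply: (@mf_cvg _ (fun N x => \sum_(k < N) \1_(`[k.+1%:R, +oo[) x)) => [N|x].
  by apply: mf_sum => k; exact: mf_indic.
apply: cvg_near_cst; exists (Num.truncn x) => // N /= hN.
by rewrite truncn_sum (minn_idPr hN).
Qed.

Definition zfrac y : R := expR y - (Num.truncn (expR y))%:R.

Lemma zfrac_ge0 y : 0 <= zfrac y <= 1.
Proof.
have /andP[h1 h2] := truncn_itv (expR_ge0 y).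
by rewrite /zfrac subr_ge0 h1 /= lerBlDl natr1 ltW.
Qed.

Lemma mf_zfrac : mf zfrac.
Proof.
apply: mfB; first exact: mf_expR (@mf_id R).
by apply: mf_comp mf_truncn _; exact: mf_expR (@mf_id R).
Qed.

Lemma normc_zfrac y : normc (zfrac y)%:C <= 1.
Proof. by rewrite normcC; have /andP[h1 h2] := zfrac_ge0 y; rewrite ger0_norm. Qed.

Definition Mz s : C := cint (fun y => (zfrac y)%:C * (pexp 0 s y * (ray y)%:C)).

Lemma cmf_Mz n s : cmf (fun y => (zfrac y)%:C * (pexp n s y * (ray y)%:C)).
Proof.
apply: cmfM; first exact: cmf_real mf_zfrac.
by apply: cmfM (cmf_pexp n s) _; apply: cmf_real; exact: mf_ray.
Qed.

Lemma cL1_Mz n s : 0 < Re s -> cL1 (fun y => (zfrac y)%:C * (pexp n s y * (ray y)%:C)).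
Proof.
move=> s0; have := cL1Mb (B := 1) (cL1_pexp n s0) (cmf_real mf_zfrac) (fun y => normc_zfrac y).
by congr cL1; apply/funext => y; rewrite mulrC.
Qed.

(** The factor [exp (- (z - s) y)] is expanded under the integral. Its partial sums are at most
    [exp (|z - s| y)], which [exp (- Re s y)] outweighs throughout the disc of radius [Re s]. *)
Lemma analytic_Mz s : 0 < Re s -> analytic_at Mz s.
Proof.
move=> s0.
pose a n := (-1) ^+ n / n`!%:R * cint (fun y => (zfrac y)%:C * (pexp n s y * (ray y)%:C)).
exists a, (Re s); split => // z zs.
pose f N y := (zfrac y)%:C * (pexp 0 s y * exp_sum N (y%:C * - (z - s)) * (ray y)%:C).
have fE N : \sum_(n < N) a n * (z - s) ^+ n = cint (f N).
  have L n : cL1 (fun y => (-1) ^+ n / n`!%:R * (z - s) ^+ n * ((zfrac y)%:C * (pexp n s y * (ray y)%:C))).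
    by apply: cL1Z; exact: cL1_Mz.
  rewrite (eq_cint (g := fun y => \sum_(n < N) ((-1) ^+ n / n`!%:R * (z - s) ^+ n *
    ((zfrac y)%:C * (pexp n s y * (ray y)%:C))))); last first.
    move=> y; rewrite /f /exp_sum mulr_sumr mulr_suml mulr_sumr; apply: eq_bigr => n _.
    rewrite /pexp expr0 mul1r -(mulN1r (z - s)) !exprMn rmorphXn /=; ring.
  rewrite (@cint_sum _ 'I_N (index_enum 'I_N) (fun n y => (-1) ^+ n / n`!%:R * (z - s) ^+ n *
    ((zfrac y)%:C * (pexp n s y * (ray y)%:C)))) //.
  apply: eq_bigr => n _; rewrite (cintZ _ (cL1_Mz n s0)) /a.
  by move: (cint _) (_ ^+ n) (_ / _) => p q t; ring.
have d0 : 0 < Re s - normc (z - s) by rewrite subr_gt0.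
have ray01 y : 0 <= ray y <= 1 by exact: indic_le1.
have [_] : cL1 (fun y => (zfrac y)%:C * (pexp 0 z y * (ray y)%:C)) /\
    ccvg (fun N => cint (f N)) (Mz z).
  apply: (@cdct _ f _ (fun y => expR (- (Re s - normc (z - s)) * y) * ray y)).
  - move=> N; apply: cmfM; first exact: cmf_real mf_zfrac.
    apply: cmfM; last exact: cmf_real (@mf_ray R).
    apply: cmfM (cmf_pexp 0 s) _; apply: cmf_sum => i.
    apply: cmfM (cmf_cst _); elim: (nat_of_ord i) => [|j IH].
      by under eq_fun do rewrite expr0; exact: cmf_cst.
    under eq_fun do rewrite exprS; apply: cmfM IH; exact: cmfM (@cmf_id R) (cmf_cst _).
  - exact: cmf_Mz.
  - exact: I1_expR.
  - apply: aeW => y; rewrite (_ : (zfrac y)%:C * (pexp 0 z y * (ray y)%:C) =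
      (zfrac y)%:C * (pexp 0 s y * cexp (y%:C * - (z - s)) * (ray y)%:C)).
      apply: ccvgM (ccvg_cst _) _; apply: ccvgM (ccvg_cst _).
      by apply: ccvgM (ccvg_cst _) _; exact: exp_sum_cvg.
    rewrite /pexp !expr0 !mul1r -cexpD; congr (_ * (cexp _ * _)); ring.
  - move=> N y; rewrite normcM -[leRHS]mul1r; apply: ler_pM; rewrite ?normc_ge0 ?normc_zfrac //.
    rewrite mulrC normcMC rayE; case: (leP 0 y) => y0; last by rewrite normr0 mul0r mulr0.
    rewrite normr1 mul1r mulr1 normcM normc_pexp // expr0 mul1r.
    apply: (le_trans (ler_wpM2l (expR_ge0 _) (exp_sum_bound _ _))).
    rewrite -expRD ler_expR normcMC normcN ger0_norm //; lra.
by congr ccvg; apply/funext => N; rewrite fE.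
Qed.

(* [zeta(s) = s / (s - 1) - s \int_1^oo {t} t^(-s-1) dt] in the variable [y = ln t]. *)
Definition hzeta s : C := s / (s - 1) - s * Mz s.

Lemma analytic_hzeta s : 0 < Re s -> s != 1 -> analytic_at hzeta s.
Proof.
move=> s0 s1; apply: analyticB; first exact: analyticMid (analytic_inv1 s1).
exact: analyticMid (analytic_Mz s0).
Qed.

Local Notation L := (fun n : nat => ln (n.+1%:R : R)).

Let expL n : expR (ln (n.+1%:R : R)) = n.+1%:R.
Proof. by rewrite lnK // posrE ltr0n. Qed.

Let L_ge0 n : 0 <= ln (n.+1%:R : R).
Proof. by rewrite ln_ge0 // ler1n. Qed.

Let L_le n : ln (n.+1%:R : R) <= ln n.+2%:R.
Proof. by rewrite ler_ln ?posrE ?ltr0n // ler_nat. Qed.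

Let window N y : R := \1_(`[0, ln N.+1%:R]) y.

Let cL1_window s N : 0 < Re s ->
  cL1 (fun y => (zfrac y)%:C * (pexp 0 s y * (window N y)%:C)).
Proof.
move=> s0; have := cL1Mb (B := 1) (cL1_Mz 0 s0) (cmf_real (mf_indic (measurable_itv `[0, ln (N.+1%:R : R)]))).
have h y : normc (\1_(`[0, ln (N.+1%:R : R)]) y)%:C <= 1.
  by rewrite normcC; have /andP[h1 h2] := indic_le1 (`[0, ln (N.+1%:R : R)]) y; rewrite ger0_norm.
move/(_ h); congr cL1; apply/funext => y; rewrite -(mulrA (zfrac y)%:C) -(mulrA (pexp 0 s y)).
have -> : window N y = ray y * \1_(`[0, ln (N.+1%:R : R)]) y.
  rewrite rayE /window indic_itvE in_itv /=; case: (0 <= y); first by rewrite mul1r.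
  by rewrite mul0r.
by rewrite rmorphM.
Qed.

Lemma ccvg_tail (u : nat -> C) z : (exists N, forall n, (N <= n)%N -> u n = z) -> ccvg u z.
Proof.
move=> [N h]; rewrite /ccvg; apply: cvg_near_cst; exists N => // n hn.
by rewrite h // subrr Normc.normc0.
Qed.

(** Induction over the segments [[ln (N + 1), ln (N + 2)]], on which the integer part of [exp y] is
    [N + 1], the right end point excepted, and the integrand has the explicit primitive [F]. *)
Lemma abel_step s N : 0 < Re s -> s != 1 ->
  s * cint (fun y => (zfrac y)%:C * (pexp 0 s y * (window N y)%:C)) =
  cpow N.+1%:R (1 - s) / (1 - s) - s / (1 - s) - \sum_(n < N.+1) cpow n.+1%:R (- s).
Proof.
move=> s0 s1.
have sn0 : s != 0 by apply: contraTneq s0 => ->; rewrite ltxx.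
have s1' : 1 - s != 0 by rewrite subr_eq0 eq_sym.
elim: N => [|N IH].
  rewrite big_ord1 !cpow1.
  have -> : cint (fun y => (zfrac y)%:C * (pexp 0 s y * (window 0 y)%:C)) = cint (fun=> (0 : R)%:C).
    apply: ae_cint; [exact: cL1_cmf (cL1_window 0 s0)|exact: cmf_cst|].
    apply: ae_S (@ae_neq R 0) => y y0; rewrite /window ln1 indic_itvE in_itv /= -eq_le eq_sym.
    by rewrite (negbTE y0) !mulr0.
  by rewrite cint_real rint0 mulr0; field.
have ab := L_le N.
pose F y := (1 - s)^-1 * cexp (y%:C * (1 - s)) + N.+1%:R / s * cexp (y%:C * - s).
pose f y := (cexp (y%:C * (1 - s)) - N.+1%:R * cexp (y%:C * - s)).
have dF y : cder F y (f y).
  apply: cder_eq.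
    exact: cderD (cderM (cder_cst _ _) (cder_cexp (1 - s) y)) (cderM (cder_cst _ _) (cder_cexp (- s) y)).
  by rewrite /f; field; rewrite sn0.
have cf y : cctn f y.
  have -> : f = (fun y => cexp (y%:C * (1 - s)) + - N.+1%:R * cexp (y%:C * - s)).
    by apply/funext => t; rewrite mulNr.
  by apply: cder_cctn; exact: cderD (cder_cexp (1 - s) y) (cderM (cder_cst _ _) (cder_cexp (- s) y)).
have [i1 e1] := cftc_itv ab (fun y _ => dF y) (fun y _ => cf y).
have split : cint (fun y => (zfrac y)%:C * (pexp 0 s y * (window N.+1 y)%:C)) =
    cint (fun y => (zfrac y)%:C * (pexp 0 s y * (window N y)%:C)) + (F (L N.+1) - F (L N)).
  rewrite -e1 -(cintD (cL1_window N s0) i1); apply: ae_cint.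
  - exact: cL1_cmf (cL1_window N.+1 s0).
  - by apply: cmfD; [exact: cL1_cmf (cL1_window N s0)|exact: cL1_cmf i1].
  apply: ae_S (ae_I (@ae_neq R (L N)) (@ae_neq R (L N.+1))) => y [y1 y2].
  rewrite /window !indic_itvE !in_itv /=.
  have a0 := L_ge0 N.
  have [h1|h1|h1] := ltgtP y (L N); last by rewrite h1 eqxx in y1.
  - by rewrite (le_trans (ltW h1) ab) mulr0 addr0.
  - rewrite (le_trans a0 (ltW h1)) /= !mulr0 add0r.
    have [h2|h2|h2] := ltgtP y (L N.+1); last by rewrite h2 eqxx in y2.
      rewrite !mulr1 /zfrac (@truncn_def _ _ N.+1); last first.
        by rewrite -(expL N) -(expL N.+1) ler_expR ltr_expR (ltW h1).
      rewrite /pexp expr0 mul1r /f rmorphB /= rmorph_nat mulrBl -cexpC -cexpD.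
      by congr (cexp _ - _); ring.
    by rewrite !mulr0.
rewrite split mulrDr IH.
have c w n : cpow n.+1%:R w = cexp ((L n)%:C * w) by [].
have shift n : n.+1%:R * cexp ((L n)%:C * - s) = cexp ((L n)%:C * (1 - s)).
  by rewrite mulrBr mulr1 cexpD cexpC expL rmorph_nat mulrN.
have shift2 n : cpow n.+1%:R (1 - s) = n.+1%:R * cpow n.+1%:R (- s) by rewrite !c shift.
have e2 : F (L N) = (1 - s)^-1 * cpow N.+1%:R (1 - s) + N.+1%:R / s * cpow N.+1%:R (- s) by [].
have e3 : F (L N.+1) = (1 - s)^-1 * cpow N.+2%:R (1 - s) + N.+1%:R / s * cpow N.+2%:R (- s) by [].
rewrite [\sum_(n < N.+2) _]big_ord_recr [\sum_(n < N.+1) _]big_ord_recr e2 e3 !shift2.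
have -> : N.+2%:R = N.+1%:R + 1 :> C by rewrite -natr1.
rewrite /=; move: (cpow N.+1%:R (- s)) (cpow N.+2%:R (- s)) (N.+1%:R : C) (\sum_(i < _) _ : C) => p q n S.
by field; rewrite sn0 s1'.
Qed.

(* Partial summation; the subtracted power is the divergent part. *)
Lemma abel_cvg s : 0 < Re s -> s != 1 ->
  ccvg (fun N => \sum_(n < N.+1) cpow n.+1%:R (- s) - cpow N.+1%:R (1 - s) / (1 - s)) (hzeta s).
Proof.
move=> s0 s1.
have s1' : 1 - s != 0 by rewrite subr_eq0 eq_sym.
have s1'' : s - 1 != 0 by rewrite subr_eq0.
have c : ccvg (fun N => cint (fun y => (zfrac y)%:C * (pexp 0 s y * (window N y)%:C))) (Mz s).
  apply: (@cdct _ _ _ (fun y => normc ((zfrac y)%:C * (pexp 0 s y * (ray y)%:C))) _ _ _ _ _).2.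
  - by move=> N; exact: cL1_cmf (cL1_window N s0).
  - exact: cmf_Mz.
  - exact: I1_normc (cL1_Mz 0 s0).
  - apply: aeW => y; apply: ccvg_tail; exists (Num.bound (expR `|y|)) => n hn.
    have yn : y <= ln n.+1%:R.
      rewrite -ler_expR expL; apply: (@le_trans _ _ (expR `|y|)); first by rewrite ler_expR ler_norm.
      by rewrite (le_trans (ltW (archi_boundP (expR_ge0 _)))) // ler_nat leqW.
    have -> : window n y = ray y by rewrite /window rayE indic_itvE in_itv /= yn andbT.
    by [].
  - move=> N y; rewrite 4!normcM; apply: (ler_wpM2l (normc_ge0 _)).
    apply: (ler_wpM2l (normc_ge0 _)); rewrite !normcC rayE /window indic_itvE in_itv.
    rewrite /= !normr_nat ler_nat; case: (0 <= y) => //; exact: leq_b1.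
have := ccvgB (ccvg_cst (s / (s - 1))) (ccvgM (ccvg_cst s) c).
congr ccvg; apply/funext => N; rewrite abel_step //.
move: (\sum_(i < _) _) (cpow _ _) => S p; field.
by rewrite s1' s1''.
Qed.

Lemma pow_cvg0 a : 0 < a -> expR (- a * ln n.+1%:R) @[n --> \oo] --> (0 : R).
Proof.
move=> a0; apply/cvgrPdist_lt => e e0.
exists (Num.bound (expR (`|ln e| / a))) => // n /= hn.
rewrite sub0r normrN ger0_norm ?expR_ge0 // -[ltRHS](lnK e0) ltr_expR mulNr.
have h : `|ln e| / a < ln n.+1%:R.
  rewrite -ltr_expR expL (lt_le_trans (archi_boundP (expR_ge0 _))) // ler_nat leqW //.
rewrite ltr_pdivrMr // in h; have := ler_norm (- ln e); rewrite normrN.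
by move: h; rewrite mulrC; lra.
Qed.

(** For [1 < Re s] the power that [abel_cvg] subtracts tends to 0, so the plain partial sums
    converge to [hzeta s]. *)
Lemma is_zeta_hzeta : is_zeta hzeta.
Proof.
split=> [s s0 s1|s s1]; first exact: analytic_hzeta.
have s0 : 0 < Re s by apply: lt_trans s1.
have sn1 : s != 1 by apply: contraTneq s1 => ->; rewrite ltxx.
apply: ccvg_shift.
have c0 : ccvg (fun N => cpow N.+1%:R (1 - s) / (1 - s)) 0.
  rewrite -(mul0r (1 - s)^-1); apply: ccvgM (ccvg_cst _).
  have a0 : 0 < Re s - 1 by rewrite subr_gt0.
  apply: (ccvg_dist (pow_cvg0 a0)) => n; rewrite subr0 normc_cpow ler_expR !reimE.
  by rewrite le_eqVlt; apply/orP; left; apply/eqP; ring.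
have := ccvgD (abel_cvg s0 sn1) c0; rewrite addr0; congr ccvg.
by apply/funext => N; rewrite subrK.
Qed.

Lemma is_zeta_zeta : is_zeta (@zeta R).
Proof. by apply: xgetPex; exists hzeta; exact: is_zeta_hzeta. Qed.

(* A slanted segment from the half-plane of convergence that avoids the pole. *)
Lemma zeta_path s : 0 < Re s -> s != 1 -> exists2 z0, Re z0 = 2 & z0 != s /\
  forall u, 0 <= u <= 1 -> 0 < Re (seg z0 s u) /\ seg z0 s u != 1.
Proof.
move=> s0 s1; pose d : R := if 0 <= Im s then 1 else -1.
have d2 : d = 1 \/ d = -1 by rewrite /d; case: ifP; [left|right].
exists (2 +i* (Im s + d)) => //; split.
  apply/eqP => e; have : Im (2 +i* (Im s + d)) = Im s by rewrite e.
  by move=> /= /eqP; rewrite -subr_eq0 addrAC subrr add0r; case: d2 => ->; rewrite ?oppr_eq0 oner_eq0.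
move=> u /andP[u0 u1].
have eR : Re (seg (2 +i* (Im s + d)) s u) = 2 + u * (Re s - 2).
  by rewrite /seg ReD ReMC !reimE.
have eI : Im (seg (2 +i* (Im s + d)) s u) = Im s + d * (1 - u).
  by rewrite /seg ImD ImMC !reimE; ring.
split.
  rewrite eR; have := mulr_ge0 u0 (ltW s0).
  have [->|un1] := eqVneq u 1; first by rewrite mul1r => _; lra.
  by have : u < 1; [rewrite lt_neqAle un1|rewrite mulrBr; lra].
apply/eqP => e; have eI0 : Im s + d * (1 - u) = 0 by rewrite -eI e.
have u1' : u = 1.
  apply/eqP; rewrite eq_le u1 /=; move: eI0; rewrite /d; case: (leP 0 (Im s)) => h; lra.
move: e; rewrite u1' /seg mul1r addrC subrK => e; by rewrite e eqxx in s1.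
Qed.

Lemma analytic_seg_of (h : C -> C) : (forall s, 0 < Re s -> s != 1 -> analytic_at h s) ->
  forall z0 s, (forall u, 0 <= u <= 1 -> 0 < Re (seg z0 s u) /\ seg z0 s u != 1) ->
  forall u, 0 <= u <= 1 -> analytic_at h (seg z0 s u).
Proof. by move=> ha z0 s hs u /hs[h1 h2]; exact: ha. Qed.

(** Both functions are sums of the same Dirichlet series in the disc of radius 1 about a point of
    real part 2; [identity_segment], applied to their difference, carries the agreement to [s]. *)
Lemma zetaE s : 0 < Re s -> s != 1 -> zeta s = hzeta s.
Proof.
move=> s0 s1; have [z0 z2 [zs hp]] := zeta_path s0 s1.
have [hz1 hz2] := is_zeta_zeta; have [hh1 hh2] := is_zeta_hzeta.
have [||r r0 hr] := @identity_segment R (fun z => zeta z - hzeta z) z0 s zs.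
- apply: analytic_seg_of hp => z z0' z1.
  by apply: analyticB; [exact: hz1|exact: hh1].
- exists 1 => // z hz; apply/eqP; rewrite subr_eq0; apply/eqP.
  have z1 : 1 < Re z.
    have := le_lt_trans (Re_le_normc (z - z0)) hz; rewrite ReB z2 ltr_norml => /andP[h _]; lra.
  exact: ccvg_unique (hz2 z z1) (hh2 z z1).
by apply/eqP; rewrite -subr_eq0 hr // subrr Normc.normc0.
Qed.

(** The term 1 outweighs the rest of the series, whose absolute values [n ^- 2] add up to at most
    3/4. *)
Lemma zeta_neq0_2 s : Re s = 2 -> zeta s != 0.
Proof.
move=> s2; apply/eqP => z0.
have s1 : 1 < Re s by rewrite s2; lra.
have := is_zeta_zeta.2 s s1; rewrite z0 => c.
have t n : normc (cpow (n.+1%:R : R) (- s)) = (n.+1%:R ^+ 2)^-1.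
  rewrite normc_cpow ReN s2 mulrN expRN; congr (_^-1).
  by rewrite mulrC expRM_natl expL.
(* The first term is 1/4, and each later [n ^- 2] is at most [1 / (n - 1) - 1 / n], telescoping from
   1/2; the case [N = 0] is the empty sum. *)
have tail N : \sum_(n < N) normc (cpow (n.+2%:R : R) (- s)) <= 3 / 4 - (if N is 0 then 0 else (N.+1%:R)^-1).
  elim: N => [|N IH]; first by rewrite big_ord0; lra.
  have -> : \sum_(n < N.+1) normc (cpow (n.+2%:R : R) (- s)) =
      \sum_(n < N) normc (cpow (n.+2%:R : R) (- s)) + normc (cpow (N.+2%:R : R) (- s)).
      exact: big_ord_recr.
    rewrite (t N.+1); case: N IH => [|N] IH; first by rewrite big_ord0 add0r; lra.
  have h : (N.+3%:R ^+ 2)^-1 <= (N.+2%:R)^-1 - (N.+3%:R)^-1 :> R.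
    have p2 : 0 < N.+2%:R :> R by rewrite ltr0n.
    rewrite -(natr1 N.+2); move: (N.+2%:R : R) p2 => p p2.
    have p1 : 0 < p + 1 by lra.
    rewrite -subr_ge0 (_ : _ - _ = (p * (p + 1) ^+ 2)^-1); last by field; rewrite !lt0r_neq0.
    by rewrite invr_ge0 mulr_ge0 ?exprn_ge0 // ltW.
  by move: h IH; move: (_^-1) (\sum_(i < _) _) (N.+2%:R^-1) (N.+3%:R^-1) => p q r v; lra.
move/cvgrPdist_lt: c => /(_ (1/4)) [|N _ hN]; first by lra.
have := hN N.+1 (leqnSn N); rewrite /= sub0r normrN ger0_norm ?normc_ge0 // subr0 big_ord_recl /=.
rewrite cpow1 => h.
have h1 : 1 <= normc (1 + \sum_(i < N) cpow (lift ord0 i).+1%:R (- s)) +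
    \sum_(n < N) normc (cpow (n.+2%:R : R) (- s)).
  rewrite -[leLHS](@Normc.normc1 R) -{1}(addrK (\sum_(i < N) cpow (lift ord0 i).+1%:R (- s)) 1).
  by apply: (le_trans (normcB _ _)); rewrite lerD2l; exact: normc_sum.
have h2 : \sum_(n < N) normc (cpow (n.+2%:R : R) (- s)) <= 3 / 4.
  apply: (le_trans (tail N)); rewrite gerBl; case: (N) => // n; by rewrite invr_ge0.
by move: h h1 h2; move: (normc _) (\sum_(n < N) _) => p q; lra.
Qed.

Lemma crit_neq1 t : crit t != 1.
Proof.
apply/eqP => e; have : Re (crit t) = 1 by rewrite e.
by case: e => h _ _; have := @ltr1n R 2; rewrite -invf_lt1 // h ltxx.
Qed.

Lemma Re_crit_gt0 t : 0 < Re (crit t).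
Proof. by rewrite /crit Rei invr_gt0. Qed.

Lemma crit_dist t u : normc (crit t - crit u) = `|t - u|.
Proof.
apply: normc_eq => //; rewrite !reimE /crit /= subrr expr0n add0r.
by rewrite -[LHS]real_normK ?num_real.
Qed.

(** Zeros accumulating at [crit t0] would make zeta vanish near that point and, along the reversed
    segment of [zeta_path], near a point of real part 2, against [zeta_neq0_2]. *)
Lemma zeta_zeros_isolated t0 : exists2 e : R, 0 < e &
  forall t, `|t - t0| < e -> t != t0 -> zeta (crit t) != 0.
Proof.
apply: contrapT => hn.
have H n : exists t, `|t - t0| < harmonic n /\ t != t0 /\ zeta (crit t) = 0.
  apply: contrapT => hn2; apply: hn; exists (harmonic n); first exact: harmonic_gt0.
  move=> t h1 h2; apply/eqP => h3; apply: hn2; by exists t.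
have [ts hts] := choice H.
have s0 := Re_crit_gt0 t0; have s1 := crit_neq1 t0.
have [||||r r0 hr] := @analytic_zeros R (@zeta R) (crit t0) (fun j => crit (ts j)).
- exact: is_zeta_zeta.1.
- by move=> j; have [_ []] := hts j.
- move=> j; have [_ [h _]] := hts j.
  by rewrite -subr_eq0 -normc_eq0 crit_dist normr_eq0 subr_eq0.
- apply: (ccvg_dist (@cvg_harmonic R)) => n; rewrite crit_dist; exact: ltW (hts n).1.
have [z0 z2 [zs hp]] := zeta_path s0 s1.
have sr u : seg (crit t0) z0 u = seg z0 (crit t0) (1 - u).
  by rewrite /seg rmorphB /=; ring.
have [|||q q0 hq] := @identity_segment R (@zeta R) (crit t0) z0.
- by rewrite eq_sym.
- apply: analytic_seg_of => [|u /andP[u0 u1]]; first exact: is_zeta_zeta.1.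
  by rewrite sr; apply: hp; apply/andP; split; lra.
- by exists r.
have := zeta_neq0_2 z2; rewrite hq ?eqxx //.
by rewrite subrr Normc.normc0.
Qed.

(** Continuous induction on the right end of [[a, u]]: since zeros are isolated, passing through any
    point adds at most that point to the zero set. *)
Lemma zeta_neq0_ae : {ae mu, forall t, zeta (crit t) != 0}.
Proof.
pose E : set R := [set t | zeta (crit t) = 0].
have sub (A B : set R) : mu.-negligible B -> A `<=` B -> mu.-negligible A.
  by move=> nB AB; exact: negligibleS nB.
have n1 (c : R) : mu.-negligible [set c].
  by exists [set c]; split => //; exact: lebesgue_measure_set1.
have fin (a b : R) : a <= b -> mu.-negligible (E `&` `[a, b]).
  move=> ab.
  apply: (@real_ind R (fun u => mu.-negligible (E `&` `[a, u])) a b ab); last by rewrite ab lexx.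
  - apply: (sub _ [set a]) => // t [_] /=; rewrite in_itv /= -eq_le eq_sym => /eqP h; exact: h.
  - move=> u _ Pu; have [e e0 he] := zeta_zeros_isolated u.
    exists e => // v /andP[uv vu]; apply: (sub _ _ Pu) => t [Et] /=.
    rewrite in_itv /= => /andP[at_ tv]; split => //=; rewrite in_itv /= at_ /= leNgt.
    apply/negP => ut; have := he t; rewrite Et eqxx gtr0_norm ?subr_gt0 // => h.
    by have := h _ _; rewrite ltrBlDl (le_lt_trans tv) // gt_eqF // => /(_ isT isT).
  - move=> u /andP[au ub] Pv; have [e e0 he] := zeta_zeros_isolated u.
    pose v := Num.max a (u - e / 2).
    have hv : a <= v < u by rewrite /v le_max lexx /= gt_max au ltrBlDr ltrDl divr_gt0.
    apply: (sub _ ((E `&` `[a, v]) `|` [set u])); first exact: negligibleU (Pv v hv) (n1 u).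
    move=> t [Et] /=; rewrite in_itv /= => /andP[at_ tu].
    have [tv|vt] := leP t v; first by left; split => //=; rewrite in_itv /= at_.
    have [->|tu'] := eqVneq t u; [by right|exfalso].
    have h := he t; rewrite Et eqxx ler0_norm ?subr_le0 // opprB in h.
    have : u - t < e.
      move: vt; rewrite /v gt_max => /andP[_ h1].
      by have : e / 2 < e; [rewrite ltr_pdivrMr // ltr_pMr // ltr1n|lra].
    by move=> /h /(_ tu').
have : mu.-negligible (\bigcup_n (E `&` `[- n%:R, n%:R])).
  by apply: negligible_bigcup => n; apply: fin; rewrite -subr_ge0 opprK addr_ge0.
move=> h; apply: (sub _ _ h) => t /= ht.
have Et : E t by apply: contrapT => h'; apply: ht; apply/eqP.
exists (Num.bound `|t|) => //; split => //=; rewrite in_itv /= -ler_norml.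
by apply: ltW; exact: archi_boundP.
Qed.

Lemma conjcV z : conjc z^-1 = (conjc z)^-1.
Proof.
have [->|z0] := eqVneq z 0; first by rewrite invr0 (conjcC 0) invr0.
have cz : conjc z != 0 by rewrite -normc_eq0 normcJ normc_eq0.
by apply: (mulIf cz); rewrite mulVf // -conjcM mulVf //; exact: (conjcC 1).
Qed.

Lemma pexpJ k z x : conjc (pexp k z x) = pexp k (conjc z) x.
Proof. by rewrite /pexp conjcM conjcC -cexpJ conjcM conjcN conjcC. Qed.

(** Schwarz reflection, from the reality of [zfrac]. *)
Lemma hzetaJ s : 0 < Re s -> hzeta (conjc s) = conjc (hzeta s).
Proof.
move=> s0.
have e : Mz (conjc s) = conjc (Mz s).
  rewrite /Mz -(cintJ (cL1_Mz 0 s0)); apply: eq_cint => y.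
  by rewrite (conjcM (zfrac y)%:C) (conjcM (pexp 0 s y)) !conjcC pexpJ.
have i1 : conjc ((s - 1)^-1) = (conjc s - 1)^-1.
  by rewrite conjcV conjcD conjcN (_ : conjc 1 = 1) //; exact: conjcC.
by rewrite /hzeta e conjcD conjcN !conjcM i1.
Qed.

Lemma zeta_crit t : zeta (crit t) = hzeta (crit t).
Proof. exact: zetaE (Re_crit_gt0 t) (crit_neq1 t). Qed.

Lemma critN t : 1 - crit t = crit (- t).
Proof. by rewrite -conjc_crit. Qed.

Lemma zeta_critJ t : zeta (1 - crit t) = conjc (zeta (crit t)).
Proof. by rewrite critN !zeta_crit -hzetaJ ?Re_crit_gt0. Qed.

Lemma cmf_crit : cmf (@crit R).
Proof. by split; [exact: mf_cst|exact: (@mf_id R)]. Qed.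

Lemma cmf_inv (f : R -> C) : cmf f -> cmf (fun x => (f x)^-1).
Proof.
move=> mff.
have -> : (fun x => (f x)^-1) = (fun x => conjc (f x) * ((normc (f x) ^+ 2)^-1)%:C).
  apply/funext => x; have [->|z0] := eqVneq (f x) 0.
    by rewrite invr0 (conjcC 0) mul0r.
  have n0 : (normc (f x) ^+ 2)%:C != 0 :> C.
    by rewrite -normc_eq0 normcC normr_eq0 expf_neq0 // normc_eq0.
  apply: (mulfI z0); rewrite divff // mulrA mulc_conj fmorphV mulfV //.
apply: cmfM (cmfJ mff) _; apply: cmf_real.
exact: (mf_comp (@mf_inv_sqr R) (mf_normc mff)).
Qed.

(** Measurability is read off from [hzeta], whose integral depends on [t] through a jointly
    measurable kernel. *)
Lemma cmf_zeta : cmf (fun t => zeta (crit t)).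
Proof.
have -> : (fun t => zeta (crit t)) = (fun t => hzeta (crit t)) by apply/funext => t; exact: zeta_crit.
apply: cmfB; first by apply: cmfM cmf_crit _; apply: cmf_inv; apply: cmfB cmf_crit _; exact: cmf_cst.
apply: cmfM cmf_crit _; apply: cmf_cint.
have -> : (fun t y => (zfrac y)%:C * (pexp 0 (crit t) y * (ray y)%:C)) =
    (fun t y => (zfrac y)%:C * ((expR (- 2^-1 * y) * ray y)%:C * cis (- y * t))).
  apply/funext => t; apply/funext => y; rewrite /pexp expr0 mul1r cexpE ReMC ImMC !reimE.
  rewrite (mulrC y) (mulrN y) -(mulNr y) rmorphM /=.
  by move: (cis _) => c; ring.
apply: cmf2M; first exact: cmf2_snd (cmf_real mf_zfrac).
apply: cmf2M.
  by apply: cmf2_snd; apply: cmf_real; apply: mfM (@mf_ray R); apply: mf_expR; exact: mfM (mf_cst _) (@mf_id R).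
apply: cmf2_cis; apply: mf2M; last exact: mf2_fst (@mf_id R).
by apply: mf2_snd; apply: mfN; exact: (@mf_id R).
Qed.

Lemma crit_neq0 t : crit t != 0.
Proof. by apply: contraTneq (Re_crit_gt0 t) => ->; rewrite ltxx. Qed.

Lemma cmf_Vsymbol : cmf (fun t => Vsymbol (crit t)).
Proof.
have m1 : cmf (fun t => crit t / (1 - crit t)).
  by apply: cmfM cmf_crit _; apply: cmf_inv; apply: cmfB cmf_crit; exact: cmf_cst.
have m2 : cmf (fun t => zeta (1 - crit t) / zeta (crit t)).
  apply: cmfM; last exact: cmf_inv cmf_zeta.
  have -> : (fun t => zeta (1 - crit t)) = (fun t => conjc (zeta (crit t))).
    by apply/funext => t; exact: zeta_critJ.
  exact: cmfJ cmf_zeta.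
rewrite /Vsymbol; apply: cmfM m2.
have -> : (fun t => (crit t / (1 - crit t)) ^+ 3) =
    (fun t => crit t / (1 - crit t) * (crit t / (1 - crit t) * (crit t / (1 - crit t)))).
  by apply/funext => t; rewrite 2!exprS expr1.
exact: cmfM m1 (cmfM m1 m1).
Qed.

(** On the line [1 - s] is the conjugate of [s], so both quotients in [Vsymbol] have conjugate
    numerator and denominator. *)
Lemma normc_Vsymbol t : zeta (crit t) != 0 -> normc (Vsymbol (crit t)) = 1.
Proof.
move=> z0; have h (w : C) : w != 0 -> normc (conjc w / w) = 1.
  by move=> w0; rewrite normcM normcV normcJ divff // normc_eq0.
rewrite /Vsymbol normcM zeta_critJ h // mulr1 normcX -conjc_crit.
rewrite -{1}(conjcK (crit t)) h ?expr1n //.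
by rewrite -normc_eq0 normcJ normc_eq0 crit_neq0.
Qed.

End Zeta.

(** * Convolution, exponentially decaying functions and the averaging operator *)

Section Convolution.
Variable R : realType.
Local Notation C := (R[i]).
Local Notation Re := (@complex.Re R).
Local Notation Im := (@complex.Im R).
Local Notation normc := (@Normc.normc R).
Local Notation mu := (@lebesgue_measure R).
Implicit Types (f g : R -> C) (a u v x t : R).

Definition conv f g x : C := cint (fun u => g u * f (x - u)).

Let mf2_sub : mf2 (fun x u : R => x - u).
Proof. by apply: mf2B; [exact: mf2_fst (@mf_id R)|exact: mf2_snd (@mf_id R)]. Qed.

Lemma cmf2_conv f g : cmf f -> cmf g -> cmf2 (fun x u => g u * f (x - u)).
Proof. by move=> hf hg; apply: cmf2M; [exact: cmf2_snd|exact: cmf2_comp hf mf2_sub]. Qed.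

Lemma cL1_conv_ker (M : R) f g x : cmf f -> (forall x, normc (f x) <= M) -> cL1 g ->
  cL1 (fun u => g u * f (x - u)).
Proof.
move=> mff fM hg; apply: (cL1Mb hg _ (fun u => fM (x - u))).
by apply: cmf_comp mff _; apply: mfB; [exact: mf_cst|exact: (@mf_id R)].
Qed.

(** Fubini's theorem. Boundedness of [f] makes the convolution integral converge at every [x], so
    that no exceptional set has to be carried. *)
Lemma FT_conv (M : R) f g : cL1 f -> (forall x, normc (f x) <= M) -> cL1 g ->
  cL1 (conv f g) /\ forall t, FT (conv f g) t = FT f t * FT g t.
Proof.
move=> hf fM hg; have mff := cL1_cmf hf; have mg := cL1_cmf hg.
have key t : cL1 (fun x => conv f g x * cis (t * x)) /\ FT (conv f g) t = FT f t * FT g t.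
  pose F u x := g u * f (x - u) * cis (t * x).
  have mF : cmf2 F.
    apply: cmf2_swap; apply: cmf2M; first exact: cmf2_conv.
    by apply: cmf2_fst; exact: cmf_lin.
  pose B := rint (fun x => normc (f x)).
  have [||h1 h2 h3 _] := @cfubini _ F (fun u => B * normc (g u)) mF; first exact: I1Z (I1_normc hg).
    move=> u; have -> : (fun x => normc (F u x)) = (fun x => normc (g u) * normc (f (x - u))).
      by apply/funext => x; rewrite /F !normcM normc_cis mulr1.
    rewrite nintZ ?normc_ge0 //; last 2 first.
    - apply: mf_normc; apply: (cmf_comp mff); apply: mfB; [exact: (@mf_id R)|exact: mf_cst].
    - by move=> x; exact: normc_ge0.
    rewrite (nint_shift (- u) (mf_normc mff) (fun x => normc_ge0 _)) -(rintE (I1_normc hf)).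
    by rewrite mulrC EFinM.
  have e x : cint (F ^~ x) = conv f g x * cis (t * x).
    rewrite /conv mulrC -(cintZ _ (cL1_conv_ker x mff fM hg)); apply: eq_cint => u.
    by rewrite /F mulrC.
  split; first by move: h2; congr cL1; apply/funext => x; exact: e.
  rewrite /FT -/(FT f t) -(eq_cint e) -h3 -(cintZ _ (cL1_cis t hg)); apply: eq_cint => u.
  rewrite mulrC -mulrA -(FT_shift u t hf) /FT -(cintZ _ (cL1_cis t (cL1_shift (- u) hf))).
  by apply: eq_cint => x; rewrite /F -mulrA.
split; last by move=> t; case: (key t).
have := (key 0).1; congr cL1; apply/funext => x.
by rewrite mul0r /cis cos0 sin0 (_ : (1 +i* 0) = 1 :> C) // mulr1.
Qed.

Lemma I1_expR_abs a : 0 < a -> I1 (fun x => expR (- a * `|x|)).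
Proof.
move=> a0; have h := I1_expR a0; have h2 := I1_sub 0 h.
have m : mf (fun x => expR (- a * `|x|)).
  by apply: mf_expR; apply: mfM (mf_cst _) _; exact: mf_norm (@mf_id R).
apply: (le_I1 m (I1D h h2)) => x; rewrite ger0_norm ?expR_ge0 // !rayE sub0r oppr_ge0.
case: (leP 0 x) => x0.
  by rewrite ger0_norm // mulr1 lerDl mulr_ge0 ?expR_ge0.
by rewrite ltr0_norm // (ltW x0) mulr1 lerDr mulr_ge0 ?expR_ge0.
Qed.

(** The rate 1/4 lies below the rate 1/2 of the kernel of [avgexp], which keeps the class stable
    under averaging; at the rate 1/2 each average would cost a factor [1 + |x|]. *)
Definition decay f := cmf f /\ exists B : R, forall x, normc (f x) <= B * expR (- 4^-1 * `|x|).

Let q0 : 0 < 4^-1 :> R. Proof. by rewrite invr_gt0. Qed.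

Let exp_le1 x : expR (- 4^-1 * `|x|) <= 1.
Proof. by rewrite -expR0 ler_expR mulNr oppr_le0 mulr_ge0 // ltW. Qed.

Lemma decay_bounded f : decay f -> exists2 B : R, 0 <= B & forall x, normc (f x) <= B.
Proof.
move=> [mff [B hB]].
have B0 : 0 <= B by have := le_trans (normc_ge0 _) (hB 0); rewrite normr0 mulr0 expR0 mulr1.
by exists B => // x; apply: (le_trans (hB x)); rewrite ler_piMr.
Qed.

Lemma decay_cL1 f : decay f -> cL1 f.
Proof. by move=> [mff [B hB]]; exact: le_cL1 mff (I1Z B (I1_expR_abs q0)) hB. Qed.

Lemma decay_cL2 f : decay f -> cL2 f.
Proof.
move=> df; have [B B0 hB] := decay_bounded df; have i := I1_normc (decay_cL1 df).
apply: (le_cL2 df.1 (I1Z B i)) => x.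
by rewrite expr2 ler_wpM2r ?normc_ge0.
Qed.

Lemma decayB f g : decay f -> decay g -> decay (fun x => f x - g x).
Proof.
move=> [mff [B hB]] [mg [D hD]]; split; first exact: cmfB.
by exists (B + D) => x; rewrite mulrDl (le_trans (normcB _ _)) // lerD.
Qed.

(** Hardy's averaging operator [F -> (1 / t) \int_0^t F] in the variable [x = ln t], with the weight
    [exp (x / 2)] of [expT]. On the transform side it divides by [1 - s]. *)
Definition avgexp f := conv f (fun u => (expR (- 2^-1 * u) * ray u)%:C).

Lemma cL1_expray : @cL1 R (fun u => (expR (- 2^-1 * u) * ray u)%:C).
Proof. by apply: cL1_real; apply: I1_expR; rewrite invr_gt0. Qed.

Lemma FT_expray t : FT (fun u => (expR (- 2^-1 * u) * ray u)%:C) t = (1 - crit t)^-1.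
Proof.
have z0 : 0 < Re (1 - crit t) by rewrite critN Re_crit_gt0.
rewrite -[RHS]mul1r; have := cint_pexp 0 z0; rewrite fact0 expr1 => <-.
apply: eq_cint => u; rewrite /pexp expr0 mul1r cexpE ReMC ImMC critN !reimE.
rewrite opprK (mulrC u t) (mulrC u) rmorphM mulrAC.
exact: erefl.
Qed.

Lemma decay_avgexp f : decay f ->
  decay (avgexp f) /\ forall t, FT (avgexp f) t = FT f t / (1 - crit t).
Proof.
move=> df; have [M M0 hM] := decay_bounded df; have [mff [B hB]] := df.
have l1 := decay_cL1 df.
have [h1 h2] := FT_conv l1 hM cL1_expray; split; last by move=> t; rewrite h2 FT_expray.
split; first exact: cL1_cmf h1.
have I4 : I1 (fun u => B * expR (- 4^-1 * u) * ray u).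
  by have := I1Z B (I1_expR q0); congr I1; apply/funext => u; rewrite mulrA.
have B0 : 0 <= B by have := le_trans (normc_ge0 _) (hB 0); rewrite normr0 mulr0 expR0 mulr1.
exists (2 * rint (fun u => B * expR (- 4^-1 * u) * ray u)) => x.
rewrite -(mulrA 2) (mulrC _ (expR _)) -(rintZ _ I4).
apply: normc_cint; [exact: cL1_conv_ker hM cL1_expray|exact: I1Z I4|].
move=> u; rewrite normcM normcC rayE; case: (leP 0 u) => u0; last first.
  by rewrite !mulr0 normr0 mul0r.
rewrite !mulr1 ger0_norm ?expR_ge0 //.
apply: (le_trans (ler_wpM2l (expR_ge0 _) (hB _))).
rewrite mulrCA (mulrCA (expR _) B) ler_wpM2l // -!expRD ler_expR.
(* Half of the rate in [exp (- u / 2)] moves the decay from [x - u] to [x]; the other half is left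
   to be integrated. *)
have : `|x| <= `|x - u| + u by rewrite -{2}(ger0_norm u0) -{1}(subrK u x) ler_normD.
move: (`|x|) (`|x - u|) => p q; lra.
Qed.

Lemma is_derive_rint_itv (f : R -> R) (u x : R) : x < u ->
  I1 (fun y => f y * \1_(`]-oo, u]) y) -> {for x, continuous f} ->
  is_derive x 1 (fun v => rint (fun y => f y * \1_(`]-oo, v]) y)) (f x).
Proof.
move=> xu /(I1_in _ (measurable_itv _)) i c.
have [d e] := continuous_FTC1 xu i (ltNyr _) c.
have fE : (fun v => rint (fun y => f y * \1_(`]-oo, v]) y)) =
    (fun v => (\int[mu]_(t in [set` Interval -oo%O (BRight v)]) (f t))%R).
  by apply/funext => v; rewrite rint_in.
by rewrite fE; split; [exact: d|rewrite -derive1E e].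
Qed.

End Convolution.

(** * Partial sums of the sawtooth series, and the sine integral *)

Section Sawtooth.
Variable R : realType.
Implicit Types (f F : R -> R) (a b c u v x y : R) (n N : nat).

Lemma mean_value f F a b : a <= b -> (forall x, a <= x <= b -> is_derive x 1 F (f x)) ->
  exists2 c, a <= c <= b & F b - F a = f c * (b - a).
Proof.
move=> ab dF.
have [||c cab e] := @MVT_segment R F f a b ab.
- move=> x; rewrite in_itv /= => /andP[h1 h2]; apply: dF.
  by rewrite (ltW h1) (ltW h2).
- apply: derivable_within_continuous => x; rewrite in_itv /= => h.
  by have [d _] := dF x h.
by exists c => //; move: cab; rewrite in_itv.
Qed.

(** The derivative is controlled on []0, b]] only, so the value 0 at the origin is expressed by the
    bound [K x]. Its constant disappears: the mean value theorem is used from a point [a] so small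
    that [K a <= e]. *)
Lemma lipschitz0 f F b (B K : R) : 0 < b -> 0 <= K -> (forall x, 0 < x <= b -> is_derive x 1 F (f x)) ->
  (forall x, 0 < x <= b -> `|f x| <= B) -> (forall x, 0 < x <= b -> `|F x| <= K * x) ->
  `|F b| <= B * b.
Proof.
move=> b0 K0 dF fB FK; apply/ler_addgt0Pr => e e0.
have K1 : 0 < K + 1 by rewrite ltr_wpDl.
pose a := Num.min b (e / (K + 1)).
have a0 : 0 < a by rewrite lt_min b0 divr_gt0.
have ab : a <= b by rewrite ge_min lexx.
have B0 : 0 <= B by rewrite (le_trans (normr_ge0 (f b))) // fB // b0 lexx.
have [|c /andP[ac cb] e1] := @mean_value f F a b ab.
  by move=> x /andP[ax xb]; apply: dF; rewrite (lt_le_trans a0 ax).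
have h1 : `|F b - F a| <= B * b.
  rewrite e1 normrM; apply: ler_pM => //; first by apply: fB; rewrite (lt_le_trans a0 ac).
  by rewrite ger0_norm ?subr_ge0 // gerBl ltW.
have h2 : `|F a| <= e.
  apply: (le_trans (FK a _)); first by rewrite a0.
  apply: (@le_trans _ _ (K * (e / (K + 1)))); first by rewrite ler_wpM2l // ge_min lexx orbT.
  rewrite mulrCA -[leRHS]mulr1 ler_pM2l //.
  by rewrite ler_pdivrMr // mul1r lerDl.
by rewrite -(subrK (F a) (F b)) (le_trans (ler_normD _ _)) // lerD.
Qed.

Lemma monotone_itv f F a b : a <= b -> (forall x, a <= x <= b -> is_derive x 1 F (f x)) ->
  (forall x, a <= x <= b -> 0 <= f x) -> F a <= F b.
Proof.
move=> ab dF f0; have [c cab e] := mean_value ab dF.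
by rewrite -subr_ge0 e mulr_ge0 ?f0 // subr_ge0.
Qed.

Lemma is_derive_sinM c x : is_derive x 1 (fun v => sin (c * v)) (c * cos (c * x)).
Proof.
apply: (@is_derive_eq _ _ _ _ _ _ _ _ (is_derive1_comp (is_derive_sin (c * x)) (is_derive_lin c x))).
by rewrite mulrC.
Qed.

Lemma is_derive_cosM c x : is_derive x 1 (fun v => cos (c * v)) (- (c * sin (c * x))).
Proof.
apply: (@is_derive_eq _ _ _ _ _ _ _ _ (is_derive1_comp (is_derive_cos (c * x)) (is_derive_lin c x))).
by rewrite mulrC mulrN.
Qed.

(** The difference has derivative [cos y - 1 + y ^+ 2 / 2], nonnegative by
    [1 - cos y = 2 sin (y / 2) ^+ 2]. *)
Lemma sin_lower x : 0 <= x <= 2 -> x - x ^+ 3 / 6 <= sin x.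
Proof.
move=> /andP[x0 _]; rewrite -subr_ge0.
have d y : is_derive y 1 (fun y => sin (1 * y) - (1 * y - 6^-1 * y ^+ 3)) (cos y - 1 + y ^+ 2 / 2).
  apply: is_derive_eq.
  by rewrite !mul1r /GRing.scale /=; move: (cos y) => z; field.
have h := @monotone_itv _ _ 0 x x0 (fun y _ => d y).
have : 0 <= sin (1 * x) - (1 * x - 6^-1 * x ^+ 3).
  apply: le_trans (h _); first by rewrite !mulr0 sin0 expr0n mulr0 !subr0.
  move=> y _; have := cos_half y; have := sin_le_norm (y / 2); rewrite -ler_sqr ?nnegrE // !real_normK ?num_real //.
  by rewrite expr_div_n; move: (sin _ ^+ 2) (cos y) (y ^+ 2) => p q r; lra.
by rewrite !mul1r (mulrC 6^-1).
Qed.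

Lemma sin_third x : 0 <= x <= 2 -> x / 3 <= sin x.
Proof.
move=> h; apply: le_trans (sin_lower h); case/andP: h => x0 x2.
have : 0 <= x * (4 - x ^+ 2).
  rewrite mulr_ge0 // subr_ge0 (_ : 4 = 2 ^+ 2); last by ring.
  by rewrite lerXn2r ?nnegrE.
rewrite mulrBr -exprS; move: (x ^+ 3) => p; lra.
Qed.

Local Notation pi := (@pi R).

Let p2 : 2 <= pi. Proof. exact: pi_ge2. Qed.
Let p4 : pi <= 4. Proof. by have := @pihalf_lt2 R; lra. Qed.
Let p0 : 0 < pi. Proof. exact: pi_gt0. Qed.
Let pn0 : pi != 0. Proof. by rewrite gt_eqF. Qed.

Let arg v : 0 < v <= 2^-1 -> 0 < pi * v <= 2.
Proof.
move=> /andP[v0 v2]; rewrite mulr_gt0 //= (@le_trans _ _ (4 * 2^-1)) //; last by lra.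
by rewrite ler_pM // ltW.
Qed.

(** The cotangent without its pole at 0: what remains when the kernel of the sawtooth sums is
    compared with that of the sine integral. *)
Definition cotd v : R := cos (pi * v) / sin (pi * v) - (pi * v)^-1.
Definition cotd' v : R := pi * ((pi * v) ^- 2 - sin (pi * v) ^- 2).

Let sin_pos v : 0 < v <= 2^-1 -> 0 < sin (pi * v).
Proof.
move=> /arg /andP[x0 x2]; apply: lt_le_trans (sin_third _); first by rewrite divr_gt0.
by rewrite ltW.
Qed.

Lemma is_derive_cotd v : 0 < v <= 2^-1 -> is_derive v 1 cotd (cotd' v).
Proof.
move=> hv; have /andP[x0 x2] := arg hv; have s0 := sin_pos hv.
apply: is_derive_eq.
  apply: is_deriveB; last by apply: is_deriveV (is_derive_lin pi v); rewrite gt_eqF.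
  apply: is_deriveM1 (is_derive_cosM pi v) _; apply: is_deriveV (is_derive_sinM pi v).
  by rewrite gt_eqF.
have e := cos2Dsin2 (pi * v); rewrite /cotd' /GRing.scale /=.
have sn0 : sin (pi * v) != 0 by rewrite gt_eqF.
have xn0 : pi * v != 0 by rewrite gt_eqF.
have e2 : (sin (pi * v) ^+ 2)^-1 = 1 + cos (pi * v) ^+ 2 / sin (pi * v) ^+ 2.
  by rewrite -[LHS]mul1r -[in LHS]e mulrDl divff ?expf_neq0 // addrC.
rewrite [in RHS]e2.
move: (pi * v) (sin (pi * v)) (cos (pi * v)) sn0 xn0 => x s c sn0 xn0.
by field; rewrite sn0 xn0.
Qed.

(** The estimates are made in [x = pi v], which lies in []0, 2]]; there [x / 3 <= sin x] bounds the
    denominators, and the Taylor bounds of [sin] and [cos] control the numerators. The 12 is the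
    bound 4 of [pi] times the bound 3 of [sin x ^- 2 - x ^- 2]. *)
Lemma cotd_bound v : 0 < v <= 2^-1 -> `|cotd v| <= 2 * (pi * v) /\ `|cotd' v| <= 12.
Proof.
move=> hv; have /andP[x0 x2] := arg hv; have s0 := sin_pos hv.
have sl := @sin_third (pi * v) (ltac:(by rewrite (ltW x0))).
have sl2 := @sin_lower (pi * v) (ltac:(by rewrite (ltW x0))).
have su : sin (pi * v) <= pi * v.
  by have := sin_le_norm (pi * v); rewrite !gtr0_norm.
have c1 : cos (pi * v) <= 1 by exact: cos_le1.
have cl : 1 - cos (pi * v) <= (pi * v) ^+ 2 / 2.
  have := cos_half (pi * v); have := sin_le_norm (pi * v / 2).
  rewrite -ler_sqr ?nnegrE // !real_normK ?num_real // expr_div_n.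
  by move: (sin _ ^+ 2) (cos _) ((pi * v) ^+ 2) => p q r; lra.
rewrite /cotd /cotd'.
move: (pi * v) (sin (pi * v)) (cos (pi * v)) x0 x2 s0 sl sl2 su c1 cl => x s c x0 x2 s0 sl sl2 su c1 cl.
have sn0 : s != 0 by rewrite gt_eqF.
have xn0 : x != 0 by rewrite gt_eqF.
have xs0 : 0 < x * s by rewrite mulr_gt0.
have x2p : 0 <= x ^+ 2 by rewrite sqr_ge0.
have x3p : 0 <= x ^+ 3 by rewrite exprn_ge0 // ltW.
have e3 : x * x ^+ 2 = x ^+ 3 by rewrite exprS.
have xxs : x * (x / 3) <= x * s by rewrite ler_pM2l.
split.
  rewrite (_ : c / s - x^-1 = (x * c - s) / (x * s)); last by field; rewrite sn0 xn0.
  rewrite normrM (gtr0_norm (x := (x * s)^-1)) ?invr_gt0 // ler_pdivrMr //.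
  have h1 : x * (1 - c) <= x ^+ 3 / 2 by rewrite -e3 -mulrA ler_pM2l.
  have h2 : 0 <= x * (1 - c) by rewrite mulr_ge0 ?subr_ge0 // ltW.
  have h3 : 2 * x * (x * (x / 3)) <= 2 * x * (x * s) by rewrite ler_pM2l // mulr_gt0.
  have h4 : 2 * x * (x * (x / 3)) = 2 / 3 * x ^+ 3 by rewrite -e3; field.
  rewrite h4 in h3; rewrite mulrBr mulr1 in h1 h2.
  by rewrite ler_norml; apply/andP; split; move: (x * c) (x * s) h1 h2 h3 => p q h1 h2 h3; lra.
rewrite (_ : x ^- 2 - s ^- 2 = - ((x ^+ 2 - s ^+ 2) / (x ^+ 2 * s ^+ 2))); last first.
  by field; rewrite sn0 xn0.
have d0 : 0 <= x ^+ 2 - s ^+ 2 by rewrite subr_ge0 lerXn2r ?nnegrE // ltW.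
have q0 : 0 < x ^+ 2 * s ^+ 2 by rewrite mulr_gt0 ?exprn_gt0.
rewrite normrM normrN (gtr0_norm p0) ger0_norm; last by rewrite divr_ge0 // ltW.
rewrite (_ : 12 = 4 * 3); last by ring.
apply: ler_pM => //; [exact: ltW|by rewrite divr_ge0 // ltW|].
rewrite ler_pdivrMr // subr_sqr.
have h1 : (x - s) * (x + s) <= x ^+ 3 / 6 * (2 * x).
  apply: ler_pM; [by rewrite subr_ge0|by rewrite addr_ge0 // ltW|lra|lra].
apply: (le_trans h1).
have h2 : (x * (x / 3)) ^+ 2 <= (x * s) ^+ 2.
  have a0 : 0 <= x * (x / 3) by rewrite !mulr_ge0 ?invr_ge0 // ltW.
  by rewrite lerXn2r ?nnegrE // ltW.
have h3 : x ^+ 3 / 6 * (2 * x) = 3 * (x * (x / 3)) ^+ 2 by field.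
by rewrite h3 -exprMn ler_pM2l.
Qed.

(** The terms of the Fourier series of [1/2 - v] on []0, 1[]. *)
Definition har n v : R := sin (2 * pi * n%:R * v) / (pi * n%:R).

Lemma is_derive_har n v : (0 < n)%N -> is_derive v 1 (har n) (2 * cos (2 * pi * n%:R * v)).
Proof.
move=> n0; have nn : n%:R != 0 :> R by rewrite pnatr_eq0 -lt0n.
apply: (@is_derive_eq _ _ _ _ _ _ _ _
  (is_deriveM1 (is_derive_sinM (2 * pi * n%:R) v) (is_derive_cst (pi * n%:R)^-1 v 1))).
rewrite /=; move: (pi) pn0 (cos _) (sin _) => q qn0 c s; field.
by rewrite nn qn0.
Qed.

Lemma har_le n v : (0 < n)%N -> 0 <= v -> `|har n v| <= 2 * v /\ `|har n v| <= n%:R^-1.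
Proof.
move=> n0 v0; have nn : 0 < n%:R :> R by rewrite ltr0n.
have d0 : 0 < pi * n%:R by rewrite mulr_gt0.
rewrite /har normrM (gtr0_norm (x := _^-1)) ?invr_gt0 //; split.
  rewrite ler_pdivrMr //; apply: (le_trans (sin_le_norm _)).
  rewrite ger0_norm; last by rewrite !mulr_ge0 // ltW.
  by rewrite le_eqVlt; apply/orP; left; apply/eqP; ring.
rewrite ler_pdivrMr // mulrCA mulVf ?gt_eqF // mulr1.
by apply: le_trans (_ : 1 <= _); [rewrite ler_norml sin_geN1 sin_le1|move: p2; lra].
Qed.

(* With its last term halved, the partial sum of the sawtooth series has the kernel
   [sin (2 pi (N+1) v) cot (pi v) - 1] as derivative. *)
Definition saw N v : R := \sum_(i < N.+1) har i.+1 v - har N.+1 v / 2.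
Definition saw' N v : R :=
  \sum_(i < N.+1) 2 * cos (2 * pi * i.+1%:R * v) - cos (2 * pi * N.+1%:R * v).

Lemma is_derive_saw N v : is_derive v 1 (saw N) (saw' N v).
Proof.
have h M : is_derive v 1 (fun v => \sum_(i < M) har i.+1 v) (\sum_(i < M) 2 * cos (2 * pi * i.+1%:R * v)).
  elim: M => [|M IH].
    rewrite big_ord0 (_ : (fun v => _) = cst 0); first exact: is_derive_cst.
    by apply/funext => x; rewrite big_ord0.
  rewrite big_ord_recr (_ : (fun v => _) = (fun v => \sum_(i < M) har i.+1 v + har M.+1 v)).
    exact: is_deriveD IH (is_derive_har v (ltn0Sn M)).
  by apply/funext => x; rewrite big_ord_recr.
have d : is_derive v 1 (fun v => har N.+1 v / 2) (cos (2 * pi * N.+1%:R * v)).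
  have e := is_deriveM1 (is_derive_har v (ltn0Sn N)) (is_derive_cst (2^-1 : R) v 1).
  apply: (@is_derive_eq _ _ _ _ _ _ _ _ e).
  by move: (cos _) (har _ _) => c a /=; field.
exact: is_deriveB (h N.+1) d.
Qed.

(** Multiplication by [sin (pi v)] telescopes the cosines. Halving the last one leaves the single
    product with [cos (pi v)], hence a pure cotangent kernel. *)
Lemma saw'E N v : (saw' N v + 1) * sin (pi * v) = sin (2 * pi * N.+1%:R * v) * cos (pi * v).
Proof.
rewrite /saw'; elim: N => [|N IH].
  rewrite big_ord1 mulr1 (_ : 2 * pi * v = pi * v + pi * v); last by ring.
  rewrite sinD cosD; have e := cos2Dsin2 (pi * v); rewrite -[in X in _ + X]e.
  by move: (sin _) (cos _) => s c; ring.
rewrite big_ord_recr /=.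
have step : (cos (2 * pi * N.+1%:R * v) + cos (2 * pi * N.+2%:R * v)) * sin (pi * v) =
    sin (2 * pi * N.+2%:R * v) * cos (pi * v) - sin (2 * pi * N.+1%:R * v) * cos (pi * v).
  have -> : 2 * pi * N.+2%:R * v = 2 * pi * N.+1%:R * v + (pi * v + pi * v).
    by rewrite -(natr1 N.+1); ring.
  rewrite [cos (_ + _)]cosD [sin (2 * pi * _ * v + _)]sinD cosD sinD.
  have e := cos2Dsin2 (pi * v).
  move: (sin (pi * v)) (cos (pi * v)) (sin (2 * pi * N.+1%:R * v)) (cos (2 * pi * N.+1%:R * v)) e => s c a b e.
  have e1 : s ^+ 2 = 1 - c ^+ 2 by rewrite -e addrC addKr.
  have -> : (b + (b * (c * c - s * s) - a * (s * c + c * s))) * s =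
    b * s + b * c ^+ 2 * s - s ^+ 2 * (b * s + 2 * a * c) by ring.
  have -> : (a * (c * c - s * s) + b * (s * c + c * s)) * c - a * c =
    a * c ^+ 3 - s ^+ 2 * a * c + 2 * b * s * c ^+ 2 - a * c by ring.
  by rewrite e1; ring.
move: IH step; move: (\sum_(i < _) _) (cos (2 * pi * N.+1%:R * v)) (cos (2 * pi * N.+2%:R * v)) => S a b IH st.
rewrite (_ : S + 2 * b - b + 1 = (S - a + 1) + (a + b)); last by ring.
by rewrite mulrDl IH st addrC subrK.
Qed.

Let osc y : R := sin (2 * pi * expR y) / pi.

Let osc_le y : `|osc y| <= 2 * expR y.
Proof.
rewrite /osc normrM (gtr0_norm (x := _^-1)) ?invr_gt0 // ler_pdivrMr //.
apply: (le_trans (sin_le_norm _)); rewrite ger0_norm; last by rewrite !mulr_ge0 ?expR_ge0 // ltW.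
by rewrite le_eqVlt; apply/orP; left; apply/eqP; ring.
Qed.

Let mf_osc : mf osc.
Proof. by apply: mfM (mf_cst _); apply: mf_sin; apply: mfM (mf_cst _) _; exact: mf_expR (@mf_id R). Qed.

Let osc_dom u y : `|osc y * \1_(`]-oo, u]) y| <= 2 * expR u * (expR (- 1 * (u - y)) * ray (u - y)).
Proof.
rewrite indic_itvE in_itv /= rayE subr_ge0; case: (y <= u); last by rewrite !mulr0 normr0.
rewrite !mulr1 -mulrA -expRD (_ : u + - 1 * (u - y) = y); last by ring.
exact: osc_le.
Qed.

Let I1_dom u : I1 (fun y => expR (- 1 * (u - y)) * ray (u - y)).
Proof. exact: (@I1_sub R u (fun y => expR (- 1 * y) * ray y) (I1_expR ltr01)). Qed.

Lemma I1_osc u : I1 (fun y => sin (2 * pi * expR y) / pi * \1_(`]-oo, u]) y).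
Proof.
apply: (@le_I1 R (fun y => osc y * \1_(`]-oo, u]) y) _ _ (I1Z _ (I1_dom u)) (@osc_dom u)).
by apply: mfM mf_osc _; exact: mf_indic.
Qed.

(* [sinint v] is the sine integral of [sin (2 pi u) / (pi u)] over [0, v],
   written in the variable [y = ln u]. *)
Definition sinint v : R := rint (fun y => sin (2 * pi * expR y) / pi * \1_(`]-oo, ln v]) y).

Lemma sinint_le : exists2 K : R, 0 <= K & forall v, 0 < v -> `|sinint v| <= K * v.
Proof.
pose K := rint (fun y : R => expR (- 1 * y) * ray y).
have K0 : 0 <= K by apply: rint_ge0 => y; rewrite mulr_ge0 ?expR_ge0 // rayE.
exists (2 * K); first by rewrite mulr_ge0.
move=> v v0; apply: (le_trans (rint_norm (I1_osc _))).
apply: (@le_trans _ _ (rint (fun y => 2 * expR (ln v) * (expR (- 1 * (ln v - y)) * ray (ln v - y))))).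
  by apply: le_rint; [exact: I1_norm (I1_osc _)|exact: I1Z (I1_dom _)|move=> y; exact: osc_dom].
rewrite (rintZ _ (I1_dom _)) lnK ?posrE //.
rewrite (@rint_sub R (ln v) (fun y => expR (- 1 * y) * ray y) (I1_expR ltr01)) -/K.
by rewrite le_eqVlt; apply/orP; left; apply/eqP; ring.
Qed.

Lemma is_derive_sinint v : 0 < v -> is_derive v 1 sinint (sin (2 * pi * v) / (pi * v)).
Proof.
move=> v0; have vn0 : v != 0 by rewrite gt_eqF.
have h : is_derive (ln v) 1 (fun x => rint (fun y => osc y * \1_(`]-oo, x]) y)) (osc (ln v)).
  apply: (@is_derive_rint_itv R osc (ln v + 1)); [by rewrite ltrDl|exact: I1_osc|].
  have d : is_derive (ln v) 1 osc ((2 * pi * expR (ln v)) * cos (2 * pi * expR (ln v)) / pi).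
    have d1 : is_derive (ln v) 1 (fun y => 2 * pi * expR y) (2 * pi * expR (ln v)).
      apply: (@is_derive_eq _ _ _ _ _ _ _ _ (is_deriveM1 (is_derive_cst (2 * pi) (ln v) 1) (is_derive_expR (ln v)))).
      by rewrite mul0r addr0.
    have d2 : is_derive (ln v) 1 (fun y => sin (2 * pi * expR y))
      (cos (2 * pi * expR (ln v)) * (2 * pi * expR (ln v))) by exact: is_derive1_comp.
    apply: (@is_derive_eq _ _ _ _ _ _ _ _ (is_deriveM1 d2 (is_derive_cst pi^-1 (ln v) 1))).
    by rewrite mulr0 add0r (mulrC (cos _)).
  exact: is_derive_continuous d.
apply: (@is_derive_eq _ _ _ _ _ _ _ _ (is_derive1_comp h (is_derive1_ln v0))).
by rewrite /osc lnK ?posrE // invfM mulrA.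
Qed.

End Sawtooth.

(** * Uniform bounds and limits for the sawtooth sums *)

Section SawtoothLimit.
Variable R : realType.
Implicit Types (f F : R -> R) (a b c u v x y : R) (n N : nat).
Local Notation pi := (@pi R).

Let p2 : 2 <= pi. Proof. exact: pi_ge2. Qed.
Let p4 : pi <= 4. Proof. by have := @pihalf_lt2 R; lra. Qed.
Let p0 : 0 < pi. Proof. exact: pi_gt0. Qed.
Let pn0 : pi != 0. Proof. by rewrite gt_eqF. Qed.
Let arg4 v : 0 < v <= 2^-1 -> 2 * (pi * v) <= 4.
Proof.
move=> /andP[v0 v2]; have : pi * v <= 4 * 2^-1 by rewrite ler_pM // ltW.
by move: (pi * v) => x; lra.
Qed.

(** Near 0 the kernel of [saw N] behaves like that of the sine integral, and on []0, 1/2]] the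
    difference has a derivative bounded uniformly in [N]. Off the integers the limit is
    [(1/2 - {v}) - 1/2 = - {v}]. *)
Definition sawB N v : R := saw N v - sinint (N.+1%:R * v).

Lemma is_derive_sawB N v : 0 < v <= 2^-1 ->
  is_derive v 1 (sawB N) (- 1 + sin (2 * pi * N.+1%:R * v) * cotd v).
Proof.
move=> /andP[v0 v2]; have M0 : 0 < N.+1%:R :> R by rewrite ltr0n.
have Mv0 : 0 < N.+1%:R * v by rewrite mulr_gt0.
have d1 : is_derive v 1 (fun v => sinint (N.+1%:R * v))
    (sin (2 * pi * (N.+1%:R * v)) / (pi * (N.+1%:R * v)) * N.+1%:R).
  exact: is_derive1_comp (is_derive_sinint Mv0) (is_derive_lin N.+1%:R v).
apply: (@is_derive_eq _ _ _ _ _ _ _ _ (is_deriveB (is_derive_saw N v) d1)).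
have s0 : sin (pi * v) != 0.
  rewrite gt_eqF // sin_gt0_pi // mulr_gt0 //= -[ltRHS]mulr1 ltr_pM2l //.
  by move: v2 v0; lra.
have -> : saw' N v = sin (2 * pi * N.+1%:R * v) * cos (pi * v) / sin (pi * v) - 1.
  by rewrite -saw'E mulfK // addrK.
rewrite /cotd (mulrA (2 * pi)).
move: (sin (2 * pi * N.+1%:R * v)) (sin (pi * v)) (cos (pi * v)) s0 => t s c s0.
move: (N.+1%:R : R) M0 => M M0.
move: (pi) pn0 => q qn0; field.
by rewrite s0 qn0 !gt_eqF.
Qed.

Let sin01 x : `|sin x| <= 1. Proof. by rewrite ler_norml sin_geN1 sin_le1. Qed.
Let cos01 x : `|cos x| <= 1. Proof. by rewrite ler_norml cos_geN1 cos_le1. Qed.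

(** The constant depends on [N]; the lemma only supplies the behaviour at 0 that [lipschitz0] asks
    for. *)
Lemma sawB_init N : exists2 K, 0 <= K & forall v, 0 < v -> `|sawB N v| <= K * v.
Proof.
have [K K0 hK] := sinint_le R.
exists (N.+1%:R * 2 + 1 + K * N.+1%:R); first by rewrite !addr_ge0 ?mulr_ge0.
move=> v v0; rewrite mulrDl; apply: (le_trans (ler_normB _ _)); apply: lerD; last first.
  by rewrite -mulrA hK // mulr_gt0 // ltr0n.
rewrite mulrDl; apply: (le_trans (ler_normB _ _)); apply: lerD.
  apply: (le_trans (ler_norm_sum _ _ _)).
  apply: (@le_trans _ _ (\sum_(i < N.+1) 2 * v)).
    by apply: ler_sum => i _; case: (@har_le R i.+1 v) => //; exact: ltW.
  by rewrite sumr_const card_ord -[X in X <= _]mulr_natl mulrA.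
rewrite normrM (gtr0_norm (x := 2^-1)) ?invr_gt0 // ler_pdivrMr //.
case: (@har_le R N.+1 v) => //; first exact: ltW.
by move=> h _; rewrite mul1r mulrC.
Qed.

(** The derivative is at most [1 + |cotd v|] in absolute value, and [|cotd v| <= 2 pi v <= 4] on
    this range. *)
Lemma sawB_le N v : 0 < v <= 2^-1 -> `|sawB N v| <= 5 * v.
Proof.
move=> hv; have /andP[v0 v2] := hv; have [K K0 hK] := sawB_init N.
apply: (@lipschitz0 R (fun v => - 1 + sin (2 * pi * N.+1%:R * v) * cotd v) _ v 5 K v0 K0).
- by move=> x /andP[x0 xv]; apply: is_derive_sawB; rewrite x0 (le_trans xv).
- move=> x /andP[x0 xv]; have hx : 0 < x <= 2^-1 by rewrite x0 (le_trans xv).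
  apply: (le_trans (ler_normD _ _)); rewrite normrN1 (_ : 5 = 1 + 4); last by ring.
  rewrite lerD2l normrM -[leRHS]mul1r; apply: ler_pM => //.
  exact: le_trans (cotd_bound hx).1 (arg4 hx).
- by move=> x /andP[x0 _]; exact: hK.
Qed.

(* Adding [cos (2 pi (N+1) v) cotd v / (2 pi (N+1))] integrates the
   oscillating part of the derivative by parts. *)
Lemma sawB_cvg N v : 0 < v <= 2^-1 -> `|sawB N v + v| <= 3 / N.+1%:R.
Proof.
move=> hv; have /andP[v0 v2] := hv; have [K K0 hK] := sawB_init N.
have M0 : 0 < N.+1%:R :> R by rewrite ltr0n.
pose M := 2 * pi * N.+1%:R; have hM : 0 < M by rewrite !mulr_gt0.
have Mi : M^-1 <= 4^-1 / N.+1%:R.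
  rewrite /M -invfM lef_pV2 ?posrE ?mulr_gt0 // ler_pM2r // (_ : 4 = 2 * 2); last by ring.
  by rewrite ler_pM2l.
pose F v := sawB N v + v + M^-1 * (cos (M * v) * cotd v).
have hd x : 0 < x <= 2^-1 -> is_derive x 1 F (M^-1 * (cos (M * x) * cotd' x)).
  move=> hx; have d3 := is_deriveM1 (is_derive_cosM M x) (is_derive_cotd hx).
  have d4 := is_deriveM1 (is_derive_cst M^-1 x 1) d3.
  have d5 := is_deriveD (is_deriveD (is_derive_sawB N hx) (is_derive_id x 1)) d4.
  apply: (@is_derive_eq _ _ _ _ _ _ _ _ d5); rewrite /= -/M.
  move: (sin _) (cos _) (cotd _) (cotd' _) => s c t u.
  have hn : M != 0 by rewrite gt_eqF.
  by field.
have cb x : `|M^-1 * cos x| <= M^-1.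
  by rewrite normrM gtr0_norm ?invr_gt0 // -[leRHS]mulr1 ler_pM2l ?invr_gt0.
have hF : `|F v| <= M^-1 * 12 * v.
  apply: (@lipschitz0 R (fun v => M^-1 * (cos (M * v) * cotd' v)) _ v _ (K + 1 + M^-1 * 8) v0).
  - by rewrite !addr_ge0 // mulr_ge0 // invr_ge0 ltW.
  - by move=> x /andP[x0 xv]; apply: hd; rewrite x0 (le_trans xv).
  - move=> x /andP[x0 xv]; have hx : 0 < x <= 2^-1 by rewrite x0 (le_trans xv).
    by rewrite mulrA normrM; apply: ler_pM => //; exact: (cotd_bound hx).2.
  - move=> x /andP[x0 xv]; have hx : 0 < x <= 2^-1 by rewrite x0 (le_trans xv).
    rewrite !mulrDl mul1r; apply: (le_trans (ler_normD _ _)); apply: lerD.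
      by apply: (le_trans (ler_normD _ _)); rewrite (gtr0_norm x0) lerD2r hK.
    rewrite (mulrA M^-1) normrM -(mulrA M^-1 8); apply: ler_pM => //.
    apply: (le_trans (cotd_bound hx).1); rewrite mulrA ler_pM2r //.
    by move: p4; lra.
have hc : `|M^-1 * (cos (M * v) * cotd v)| <= M^-1 * 4.
  by rewrite mulrA normrM; apply: ler_pM => //; exact: le_trans (cotd_bound hv).1 (arg4 hv).
have h1 : `|sawB N v + v| <= `|F v| + `|M^-1 * (cos (M * v) * cotd v)|.
  by rewrite -{1}(addrK (M^-1 * (cos (M * v) * cotd v)) (sawB N v + v)) ler_normB.
(* With [M^-1 <= 1 / (4 (N + 1))] and [v <= 1/2] the sum is at most [(12 / 2 + 4) / 4 = 5/2] over
   [N + 1]. *)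
apply: (le_trans h1); apply: (le_trans (lerD hF hc)); rewrite -mulrA -mulrDr.
apply: (@le_trans _ _ (4^-1 / N.+1%:R * (12 * v + 4))).
  by rewrite ler_wpM2r // addr_ge0 // mulr_ge0 // ltW.
rewrite mulrAC ler_pM2r ?invr_gt0 //; move: v2; lra.
Qed.

(** Integration by parts: [H] adds [cos (2 pi v) / (2 pi ^+ 2 v)] to the sine integral, and its
    derivative is bounded by [v ^- 2]. Hence both [H - 1 / v] and [- H - 1 / v] are
    nondecreasing. *)
Lemma sinint_osc a b : 0 < a <= b -> `|sinint b - sinint a| <= 2 / a.
Proof.
move=> /andP[a0 ab]; have b0 : 0 < b by exact: lt_le_trans ab.
pose c0 := 2 * pi ^+ 2; have c8 : 8 <= c0.
  rewrite /c0 (_ : 8 = 2 * 2 ^+ 2); last by ring.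
  by rewrite ler_pM2l // lerXn2r ?nnegrE // ltW.
have c00 : 0 < c0 by apply: lt_le_trans c8.
have c0n : c0 != 0 by rewrite gt_eqF.
pose H v := sinint v + c0^-1 * (cos (2 * pi * v) * v^-1).
pose H' v := - (c0^-1 * (cos (2 * pi * v) * v ^- 2)).
have hd v : 0 < v -> is_derive v 1 H (H' v).
  move=> v0; have vn : v != 0 by rewrite gt_eqF.
  have d1 := is_deriveM1 (is_derive_cosM (2 * pi) v) (is_deriveV vn (is_derive_id v 1)).
  have d2 := is_deriveM1 (is_derive_cst c0^-1 v 1) d1.
  apply: (@is_derive_eq _ _ _ _ _ _ _ _ (is_deriveD (is_derive_sinint v0) d2)).
  rewrite /H' /GRing.scale /= /c0.
  move: (sin _) (cos _) => s c; move: (pi) pn0 => q qn0; field.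
  by rewrite vn qn0.
have dV v : 0 < v -> is_derive v 1 (fun v => v^-1) (- v ^- 2).
  move=> v0; have vn : v != 0 by rewrite gt_eqF.
  apply: (@is_derive_eq _ _ _ _ _ _ _ _ (is_deriveV vn (is_derive_id v 1))).
  by rewrite /GRing.scale /= mulr1.
have H'b v : 0 < v -> `|H' v| <= v ^- 2.
  move=> v0; rewrite normrN mulrA normrM (gtr0_norm (x := v ^- 2)) ?invr_gt0 ?exprn_gt0 //.
  have h1 : `|c0^-1 * cos (2 * pi * v)| <= 1.
    rewrite normrM gtr0_norm ?invr_gt0 // mulrC ler_pdivrMr // mul1r (le_trans (cos01 _)) //.
    by apply: le_trans c8; lra.
  by rewrite ler_piMl ?invr_ge0 ?exprn_ge0 // ltW.
have pos x : a <= x <= b -> 0 < x by move=> /andP[ax _]; exact: lt_le_trans ax.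
have m1 : H a - a^-1 <= H b - b^-1.
  apply: (@monotone_itv R (fun v => H' v - - v ^- 2) (fun v => H v - v^-1) a b ab) => x /pos x0.
    exact: is_deriveB (hd x x0) (dV x x0).
  by have := H'b x x0; rewrite ler_norml; move: (H' x) (x ^- 2) => p q /andP[]; lra.
have m2 : - H a - a^-1 <= - H b - b^-1.
  apply: (@monotone_itv R (fun v => - H' v - - v ^- 2) (fun v => - H v - v^-1) a b ab) => x /pos x0.
    exact: is_deriveB (is_deriveN (hd x x0)) (dV x x0).
  by have := H'b x x0; rewrite ler_norml; move: (H' x) (x ^- 2) => p q /andP[]; lra.
have tail x : 0 < x -> `|c0^-1 * (cos (2 * pi * x) * x^-1)| <= 8^-1 * x^-1.
  move=> x0; rewrite mulrA normrM (gtr0_norm (x := x^-1)) ?invr_gt0 // ler_pM2r ?invr_gt0 //.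
  rewrite normrM gtr0_norm ?invr_gt0 //.
  apply: (@le_trans _ _ (c0^-1 * 1)); first by rewrite ler_pM2l ?invr_gt0.
  by rewrite mulr1 lef_pV2 ?posrE.
have ta := tail a a0; have tb := tail b b0.
have bi : b^-1 <= a^-1 by rewrite lef_pV2 ?posrE.
have bi0 : 0 <= b^-1 by rewrite invr_ge0 ltW.
move: ta tb m1 m2; rewrite /H !ler_norml.
move: (a^-1) (b^-1) bi bi0 (c0^-1 * (cos (2 * pi * a) * _)) (c0^-1 * (cos (2 * pi * b) * _)) (sinint a) (sinint b) => x y bi bi0 p q s t.
by move=> /andP[h1 h2] /andP[h3 h4] h5 h6; apply/andP; split; lra.
Qed.

Let sin_nat n x : sin (x + 2 * pi * n%:R) = sin x.
Proof.
rewrite (_ : 2 * pi * n%:R = pi *+ 2 *+ n); last by rewrite -mulr_natr -(mulr_natr pi); ring.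
exact: (periodicn (@sinD2pi R)).
Qed.

Lemma harD n k v : har n (v + k%:R) = har n v.
Proof.
rewrite /har; congr (_ / _).
rewrite (_ : 2 * pi * n%:R * (v + k%:R) = 2 * pi * n%:R * v + 2 * pi * (n * k)%:R) ?sin_nat //.
by rewrite natrM; ring.
Qed.

Lemma har_sym n v : har n (1 - v) = - har n v.
Proof.
rewrite /har -mulNr; congr (_ / _); rewrite -sinN -[in RHS](sin_nat n).
by congr sin; ring.
Qed.

Lemma sawD N k v : saw N (v + k%:R) = saw N v.
Proof. by rewrite /saw harD; congr (_ - _); apply: eq_bigr => i _; rewrite harD. Qed.

Lemma saw_sym N v : saw N (1 - v) = - saw N v.
Proof.
rewrite /saw har_sym mulNr opprB opprK addrC -sumrN; congr (_ + _).
by apply: eq_bigr => i _; rewrite har_sym.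
Qed.

Lemma saw_half N : saw N (2^-1 : R) = 0.
Proof.
have := saw_sym N (2^-1 : R); rewrite (_ : 1 - 2^-1 = 2^-1 :> R); last by field.
by move: (saw _ _) => x; lra.
Qed.

Lemma le_of_nat x y c : (exists k, forall n, (k <= n)%N -> x <= y + c / n.+1%:R) -> 0 <= c -> x <= y.
Proof.
move=> [k hk] c0; apply/ler_addgt0Pr => e e0.
pose n := maxn k (Num.bound (c / e)).
apply: (le_trans (hk n (leq_maxl _ _))); rewrite lerD2l ler_pdivrMr ?ltr0n //.
rewrite mulrC -ler_pdivrMr //; apply: ltW.
apply: (lt_le_trans (archi_boundP _)); first by rewrite divr_ge0 // ltW.
by rewrite ler_nat leqW // leq_maxr.
Qed.

(** The value 1/2 comes from the sawtooth itself: by symmetry [saw N] vanishes at 1/2, so [sawB_cvg]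
    puts [sinint ((N + 1) / 2)] within [3 / (N + 1)] of 1/2, and [sinint_osc] bounds the oscillation
    beyond [y]. *)
Lemma sinint_cvg y : 0 < y -> `|sinint y - 2^-1| <= 2 / y.
Proof.
move=> y0; apply: (@le_of_nat _ _ 3) => //.
exists (Num.bound (2 * y)) => n hn.
have hy : 0 < y <= n.+1%:R * 2^-1.
  rewrite y0 /= ler_pdivlMr // mulrC; apply: ltW.
  apply: (lt_le_trans (archi_boundP _)); first by rewrite mulr_ge0 // ltW.
  by rewrite ler_nat leqW.
have := @sawB_cvg n 2^-1 (ltac:(by rewrite invr_gt0 lexx ltr0n)).
rewrite /sawB saw_half sub0r => h1; have h2 := sinint_osc hy.
rewrite -(subrK (sinint (n.+1%:R * 2^-1)) (sinint y)) -addrA.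
apply: (le_trans (ler_normD _ _)); apply: lerD; first by rewrite distrC.
by rewrite -normrN opprB addrC.
Qed.

Lemma sinint_bounded : exists2 B : R, 0 <= B & forall v, 0 < v -> `|sinint v| <= B.
Proof.
have [K K0 hK] := sinint_le R; exists (K + 3); first by rewrite addr_ge0.
move=> v v0; case: (leP v 1) => v1.
  by apply: (le_trans (hK v v0)); rewrite -[leLHS]addr0 lerD // ler_piMr.
have h := sinint_cvg v0.
have v2 : 2 / v <= 2 by rewrite ler_pdivrMr // ler_pMr // ltW.
rewrite -(subrK 2^-1 (sinint v)); apply: (le_trans (ler_normD _ _)).
rewrite (gtr0_norm (x := 2^-1)) ?invr_gt0 //.
by move: h v2; move: (`|_|) (2 / v) => p q; lra.
Qed.

(** On []0, 1/2]] the error is [sawB N v + v] plus the error of the sine integral at [(N + 1) v],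
    which is where [2 / v] comes from; the symmetry [v -> 1 - v] covers the rest. *)
Lemma saw_cvg01 N v : 0 < v < 1 ->
  `|saw N v - (2^-1 - v)| <= (3 + 2 / Num.min v (1 - v)) / N.+1%:R.
Proof.
have M0 : 0 < N.+1%:R :> R by rewrite ltr0n.
have half x : 0 < x <= 2^-1 -> `|saw N x - (2^-1 - x)| <= (3 + 2 / x) / N.+1%:R.
  move=> hx; have /andP[x0 x2] := hx; have h1 := sawB_cvg N hx.
  have h2 := @sinint_cvg (N.+1%:R * x) (ltac:(by rewrite mulr_gt0)).
  rewrite (_ : saw N x - (2^-1 - x) = (sawB N x + x) + (sinint (N.+1%:R * x) - 2^-1)); last first.
    by rewrite /sawB; ring.
  apply: (le_trans (ler_normD _ _)); rewrite mulrDl; apply: (le_trans (lerD h1 h2)).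
  by rewrite lerD2l invfM mulrA mulrAC.
move=> /andP[v0 v1]; case: (leP v 2^-1) => v2.
  by have -> : Num.min v (1 - v) = v; [apply/min_idPl; lra|apply: half; rewrite v0].
have -> : Num.min v (1 - v) = 1 - v by apply/min_idPr; lra.
have -> : saw N v - (2^-1 - v) = - (saw N (1 - v) - (2^-1 - (1 - v))) by rewrite saw_sym; field.
by rewrite normrN; apply: half; rewrite subr_gt0 v1 /=; lra.
Qed.

(** On [[0, 1/2]] the difference [sawB] is at most 5/2 and the sine integral is bounded; symmetry
    and periodicity do the rest. *)
Lemma saw_bounded : exists2 B : R, 0 <= B & forall N v, 0 < v -> `|saw N v| <= B.
Proof.
have [K K0 hK] := sinint_bounded; exists (3 + K); first by rewrite addr_ge0.
have half N x : 0 <= x <= 2^-1 -> `|saw N x| <= 3 + K.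
  move=> /andP[x0 x2]; have [->|xn] := eqVneq x 0.
    rewrite /saw /har mulr0 sin0 mul0r mul0r big1 ?subrr ?normr0 ?addr_ge0 // => i _.
    by rewrite mulr0 sin0 mul0r.
  have xp : 0 < x by rewrite lt_neqAle eq_sym xn.
  rewrite -(subrK (sinint (N.+1%:R * x)) (saw N x)); apply: (le_trans (ler_normD _ _)).
  apply: lerD; last by rewrite hK // mulr_gt0 // ltr0n.
  by apply: (le_trans (@sawB_le N x _)); [rewrite xp|move: x2; lra].
move=> N v v0; have /andP[t1 t2] := truncn_itv (ltW v0).
rewrite -(subrK (Num.truncn v)%:R v) sawD.
set x := v - _; have x0 : 0 <= x by rewrite subr_ge0.
have x1 : x < 1 by rewrite ltrBlDr addrC natr1.
case: (leP x 2^-1) => x2; first by apply: half; rewrite x0.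
rewrite -(opprK (saw N x)) -saw_sym normrN; apply: half.
by apply/andP; split; lra.
Qed.

(** Bounded at infinity and linear at 0: after weighting by [exp (- x / 2)] at [v = exp x], this
    gives decay in both directions, uniformly in [N]. *)
Lemma sawB_bounded : exists2 B : R, 0 <= B & forall N v, 0 < v -> `|sawB N v| <= B /\ `|sawB N v| <= B * v.
Proof.
have [K K0 hK] := sinint_bounded; have [L L0 hL] := saw_bounded.
exists (2 * (L + K) + 5); first by rewrite addr_ge0 // mulr_ge0 // addr_ge0.
move=> N v v0; have LK : 0 <= L + K by rewrite addr_ge0.
have h : `|sawB N v| <= L + K.
  apply: (le_trans (ler_normB _ _)); rewrite lerD ?hL //.
  by rewrite hK // mulr_gt0 // ltr0n.
split; first by apply: (le_trans h); lra.
case: (leP v 2^-1) => v2.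
  apply: (le_trans (@sawB_le N v _)); first by rewrite v0.
  by rewrite ler_pM2r // lerDr mulr_ge0.
apply: (le_trans h); apply: (@le_trans _ _ ((2 * (L + K) + 5) * 2^-1)); first by lra.
by rewrite ler_wpM2l ?ltW //; lra.
Qed.

(** At integers the sawtooth sums stay at 0 and the limit would be -1/2 instead of 0;
    [zfrac_neq0_ae] shows that this exception is negligible. *)
Lemma sawB_pointwise v : 0 < v -> v - (Num.truncn v)%:R != 0 ->
  sawB N v @[N --> \oo] --> - (v - (Num.truncn v)%:R).
Proof.
move=> v0 vn; have /andP[t1 t2] := truncn_itv (ltW v0).
set x := v - _; have x0 : 0 < x by rewrite lt_neqAle eq_sym vn subr_ge0.
have x1 : x < 1 by rewrite ltrBlDr addrC natr1.
have h N : `|sawB N v - - x| <= (3 + 2 / Num.min x (1 - x) + 2 / v) / N.+1%:R.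
  have h1 := @saw_cvg01 N x (ltac:(by rewrite x0)).
  have h2 := @sinint_cvg (N.+1%:R * v) (ltac:(by rewrite mulr_gt0 // ltr0n)).
  have -> : sawB N v - - x = (saw N x - (2^-1 - x)) - (sinint (N.+1%:R * v) - 2^-1).
    have e : saw N v = saw N x by rewrite -(sawD N (Num.truncn v) x) subrK.
    by rewrite /sawB e; ring.
  apply: (le_trans (ler_normB _ _)); rewrite mulrDl; apply: lerD => //.
  by apply: (le_trans h2); rewrite invfM mulrA mulrAC.
have c : (3 + 2 / Num.min x (1 - x) + 2 / v) / N.+1%:R @[N --> \oo] --> (0 : R).
  rewrite -[X in _ --> X](mulr0 (3 + 2 / Num.min x (1 - x) + 2 / v)).
  by apply: cvgM; [exact: cvg_cst|exact: cvg_harmonic].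
have : `|sawB N v - - x| @[N --> \oo] --> (0 : R).
  apply: (cvg0_le _ c) => n; by rewrite normr_ge0 h.
move=> /norm_cvg0P h3.
have h4 : sawB N v - - x + - x @[N --> \oo] --> 0 + - x by apply: cvgD h3 _; exact: cvg_cst.
by rewrite add0r in h4; apply: eq_cvgn h4 => n; rewrite subrK.
Qed.

End SawtoothLimit.

(** * The functional equation on the critical line, and the kernel [phi] *)

Section FunctionalEquation.
Variable R : realType.
Local Notation C := (R[i]).
Local Notation Re := (@complex.Re R).
Local Notation Im := (@complex.Im R).
Local Notation normc := (@Normc.normc R).
Local Notation mu := (@lebesgue_measure R).
Local Notation pi := (@pi R).
Implicit Types (s z w : C) (t u v x y : R) (N : nat).

Let p2 : 2 <= pi. Proof. exact: pi_ge2. Qed.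
Let p0 : 0 < pi. Proof. exact: pi_gt0. Qed.

Let halfE x : expR (- 2^-1 * x) * expR (- 2^-1 * x) = expR (- x).
Proof. by rewrite -expRD; congr expR; field. Qed.

(** The function [sin (2 pi t) / (pi t)] under [expT]. By [zeta_fe] its transform is
    [zeta (1 - s) / ((1 - s) zeta s)] off the zeros, so it carries the gamma factor of the
    functional equation. *)
Definition sinck x : R := expR (- 2^-1 * x) * (sin (2 * pi * expR x) / pi).

Lemma mf_sinck : mf sinck.
Proof.
apply: mfM; first by apply: mf_expR; apply: mfM (mf_cst _) (@mf_id R).
by apply: mfM (mf_cst _); apply: mf_sin; apply: mfM (mf_cst _) _; exact: mf_expR (@mf_id R).
Qed.

Lemma decay_sinck : decay (fun x => (sinck x)%:C).
Proof.
split; first exact: cmf_real mf_sinck.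
exists 2 => x; rewrite normcC normrM ger0_norm ?expR_ge0 //.
have s1 : `|sin (2 * pi * expR x) / pi| <= 2.
  rewrite normrM (gtr0_norm (x := _^-1)) ?invr_gt0 // ler_pdivrMr //.
  apply: (@le_trans _ _ 1); first by rewrite ler_norml sin_geN1 sin_le1.
  by move: p2; lra.
have s2 : `|sin (2 * pi * expR x) / pi| <= 2 * expR x.
  rewrite normrM (gtr0_norm (x := _^-1)) ?invr_gt0 // ler_pdivrMr //.
  apply: (le_trans (sin_le_norm _)); rewrite ger0_norm; last by rewrite !mulr_ge0 ?expR_ge0 // ltW.
  by rewrite le_eqVlt; apply/orP; left; apply/eqP; ring.
case: (leP 0 x) => x0.
  rewrite mulrC; apply: ler_pM => //.
  by rewrite ler_expR (ger0_norm x0); lra.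
apply: (le_trans (ler_wpM2l (expR_ge0 _) s2)); rewrite mulrCA ler_pM2l // -expRD ler_expR ltr0_norm //.
by lra.
Qed.

Lemma avgexp_real (h : R -> R) x : I1 (fun y => h y * \1_(`]-oo, x]) y) ->
  avgexp (fun x => (expR (- 2^-1 * x) * h x)%:C) x =
  (expR (- 2^-1 * x) * rint (fun y => h y * \1_(`]-oo, x]) y))%:C.
Proof.
move=> i1; pose g y := expR (- 2^-1 * x) * (h y * \1_(`]-oo, x]) y).
rewrite /avgexp /conv (eq_cint (g := fun u => (g (x - u))%:C)); last first.
  move=> u; rewrite -rmorphM; congr (_%:C).
  rewrite /g indic_itvE in_itv /= rayE gerBl.
  have -> : expR (- 2^-1 * x) = expR (- 2^-1 * u) * expR (- 2^-1 * (x - u)).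
    by rewrite -expRD; congr expR; ring.
  by case: (0 <= u) => /=; ring.
by rewrite cint_real (rint_sub x (I1Z _ i1)) (rintZ _ i1).
Qed.

Lemma avgexp_sinck x :
  avgexp (fun x => (sinck x)%:C) x = (expR (- 2^-1 * x) * sinint (expR x))%:C.
Proof. by rewrite /sinck (avgexp_real (I1_osc x)) /sinint expRK. Qed.

Definition sawk N x : C := (expR (- 2^-1 * x) * sawB N (expR x))%:C.

Let nroot n : expR (- 2^-1 * ln n.+1%:R) * expR (- 2^-1 * ln n.+1%:R) = (n.+1%:R : R)^-1.
Proof. by rewrite halfE expRN lnK // posrE ltr0n. Qed.

(** In the variable [x = ln v] dilation by [n] is translation by [- ln n], so every harmonic is a
    translate of [sinck], and the sine integral is a translate of its average. *)
Lemma sawkE N x : sawk N x =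
  \sum_(i < N.+1) (expR (- 2^-1 * ln i.+1%:R))%:C * (sinck (x - - ln i.+1%:R))%:C
  - (expR (- 2^-1 * ln N.+1%:R) / 2)%:C * (sinck (x - - ln N.+1%:R))%:C
  - (expR (2^-1 * ln N.+1%:R))%:C * avgexp (fun x => (sinck x)%:C) (x - - ln N.+1%:R).
Proof.
have e n : expR (x - - ln n.+1%:R) = n.+1%:R * expR x.
  by rewrite opprK expRD lnK ?posrE ?ltr0n // mulrC.
have h n : expR (- 2^-1 * x) * har n.+1 (expR x) =
    expR (- 2^-1 * ln n.+1%:R) * sinck (x - - ln n.+1%:R).
  have a : expR (- 2^-1 * (x - - ln n.+1%:R)) = expR (- 2^-1 * x) * expR (- 2^-1 * ln n.+1%:R).
    by rewrite opprK mulrDr expRD.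
  rewrite /har /sinck e a (mulrA (2 * pi) n.+1%:R) invfM -(nroot n).
  move: (sin _) (expR (- 2^-1 * x)) (expR (- 2^-1 * ln n.+1%:R)) => s p q; ring.
rewrite avgexp_sinck /sawk e.
have -> : expR (- 2^-1 * (x - - ln N.+1%:R)) = expR (- 2^-1 * x) * (expR (2^-1 * ln N.+1%:R))^-1.
  by rewrite -expRN -expRD; congr expR; ring.
have E0 : expR (2^-1 * ln (N.+1%:R : R)) != 0 by rewrite gt_eqF ?expR_gt0.
rewrite -!rmorphM /= /sawB /saw; under eq_bigr do rewrite -rmorphM /=.
rewrite -rmorph_sum -!rmorphB /=; congr (_%:C).
under [in RHS]eq_bigr do rewrite -h.
have h2 : expR (- 2^-1 * ln N.+1%:R) / 2 * sinck (x - - ln N.+1%:R) =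
    expR (- 2^-1 * x) * har N.+1 (expR x) / 2.
  by rewrite h; move: (sinck _) (expR _) => p q; ring.
rewrite -mulr_sumr h2.
move: (\sum_(i < _) _) (har _ _) (sinint _) (expR (- 2^-1 * x)) => S a b c; field.
exact: E0.
Qed.

(** A translate by [- ln n], with its weight, contributes the factor [n ^ (- s)]. The average
    contributes [(N + 1) ^ (1 - s) / (1 - s)], exactly the divergent part that [abel_cvg]
    removes. *)
Lemma FT_sawk N t : FT (sawk N) t = FT (fun x => (sinck x)%:C) t *
  (\sum_(i < N.+1) cpow i.+1%:R (- crit t) - cpow N.+1%:R (- crit t) / 2
   - cpow N.+1%:R (1 - crit t) / (1 - crit t)).
Proof.
have l1 := decay_cL1 decay_sinck; have [da fa] := decay_avgexp decay_sinck.
have la := decay_cL1 da.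
have lS n : cL1 (fun x => (expR (- 2^-1 * ln n.+1%:R))%:C * (sinck (x - - ln n.+1%:R))%:C).
  exact: cL1Z (cL1_shift _ l1).
have cp n : (expR (- 2^-1 * ln n.+1%:R))%:C * cis (t * - ln n.+1%:R) = cpow n.+1%:R (- crit t).
  rewrite /cpow cexpE ReMC ImMC !reimE; congr ((expR _)%:C * cis _); first exact: mulrC.
  by rewrite !mulrN mulrC.
have cp' n : (expR (2^-1 * ln n.+1%:R))%:C * cis (t * - ln n.+1%:R) = cpow n.+1%:R (1 - crit t).
  rewrite critN /cpow cexpE ReMC ImMC !reimE; congr ((expR _)%:C * cis _); first exact: mulrC.
  by rewrite !mulrN mulrC.
have FS n (c : C) : FT (fun x => c * (sinck (x - - ln n.+1%:R))%:C) t =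
    c * cis (t * - ln n.+1%:R) * FT (fun x => (sinck x)%:C) t.
  by rewrite FTZ ?(FT_shift (- ln n.+1%:R) t l1) ?mulrA //; exact: cL1_shift l1.
have Fsum M : FT (fun x => \sum_(i < M) (expR (- 2^-1 * ln i.+1%:R))%:C * (sinck (x - - ln i.+1%:R))%:C) t
    = FT (fun x => (sinck x)%:C) t * \sum_(i < M) cpow i.+1%:R (- crit t).
  rewrite /FT mulr_sumr -/(FT (fun x => (sinck x)%:C) t).
  rewrite (eq_cint (g := fun x => \sum_(i < M) ((expR (- 2^-1 * ln i.+1%:R))%:C *
    (sinck (x - - ln i.+1%:R))%:C * cis (t * x)))); last by move=> x; rewrite mulr_suml.
  rewrite (@cint_sum _ 'I_M (index_enum 'I_M) (fun i x => (expR (- 2^-1 * ln i.+1%:R))%:C *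
    (sinck (x - - ln i.+1%:R))%:C * cis (t * x))); last by move=> i; exact: cL1_cis (lS i).
  by apply: eq_bigr => i _; rewrite -/(FT _ t) FS cp mulrC.
have -> : sawk N = (fun x =>
  \sum_(i < N.+1) (expR (- 2^-1 * ln i.+1%:R))%:C * (sinck (x - - ln i.+1%:R))%:C
  - (expR (- 2^-1 * ln N.+1%:R) / 2)%:C * (sinck (x - - ln N.+1%:R))%:C
  - (expR (2^-1 * ln N.+1%:R))%:C * avgexp (fun x => (sinck x)%:C) (x - - ln N.+1%:R)).
  by apply/funext => x; exact: sawkE.
have lsum := @cL1_sum R 'I_N.+1 (index_enum 'I_N.+1) _ (fun i => lS i).
have lh : cL1 (fun x => (expR (- 2^-1 * ln N.+1%:R) / 2)%:C * (sinck (x - - ln N.+1%:R))%:C).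
  exact: cL1Z (cL1_shift _ l1).
have lla : cL1 (fun x => (expR (2^-1 * ln N.+1%:R))%:C *
    avgexp (fun x => (sinck x)%:C) (x - - ln N.+1%:R)) by exact: cL1Z (cL1_shift _ la).
have Fa : FT (fun x => (expR (2^-1 * ln N.+1%:R))%:C *
    avgexp (fun x => (sinck x)%:C) (x - - ln N.+1%:R)) t =
    cpow N.+1%:R (1 - crit t) * (FT (fun x => (sinck x)%:C) t / (1 - crit t)).
  by rewrite (FTZ _ (cL1_shift _ la)) (FT_shift _ _ la) fa mulrA cp'.
have ch : (expR (- 2^-1 * ln N.+1%:R) / 2)%:C * cis (t * - ln N.+1%:R) = cpow N.+1%:R (- crit t) / 2.
  by rewrite -cp rmorphM fmorphV rmorph_nat mulrAC.
rewrite (FTB (cL1B lsum lh) lla) (FTB lsum lh) Fsum FS ch Fa.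
move: (FT _ t) (cpow _ (1 - crit t)) (cpow N.+1%:R (- crit t)) (\sum_(i < _) _) => F c p S.
by move: ((1 - crit t)^-1) => q; ring.
Qed.

Lemma zfrac_neq0_ae : {ae mu, forall x, zfrac x != 0}.
Proof.
have h : {ae mu, forall x, forall n, x != ln (n%:R : R)} by apply/ae_foralln => n; exact: ae_neq.
apply: ae_S h => x hx; rewrite /zfrac subr_eq0; apply/eqP => e.
by have := hx (Num.truncn (expR x)); rewrite -e expRK eqxx.
Qed.

Lemma normc_sawk : exists B : R, forall N x, normc (sawk N x) <= B * expR (- 2^-1 * `|x|).
Proof.
have [B B0 hB] := sawB_bounded R; exists B => N x; rewrite normcC normrM ger0_norm ?expR_ge0 //.
have [h1 h2] := hB N _ (expR_gt0 x); rewrite mulrC; case: (leP 0 x) => x0.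
  by rewrite (ger0_norm x0) ler_wpM2r ?expR_ge0.
apply: (le_trans (ler_wpM2r (expR_ge0 _) h2)); rewrite -mulrA -expRD ler_wpM2l // ler_expR ltr0_norm //.
by lra.
Qed.

Lemma mf_sawB N : mf (fun x => sawB N (expR x)).
Proof.
have l1 := decay_cL1 decay_sinck; have [da _] := decay_avgexp decay_sinck.
have mk : cmf (sawk N).
  have -> : sawk N = (fun x =>
    \sum_(i < N.+1) (expR (- 2^-1 * ln i.+1%:R))%:C * (sinck (x - - ln i.+1%:R))%:C
    - (expR (- 2^-1 * ln N.+1%:R) / 2)%:C * (sinck (x - - ln N.+1%:R))%:C
    - (expR (2^-1 * ln N.+1%:R))%:C * avgexp (fun x => (sinck x)%:C) (x - - ln N.+1%:R)).
    by apply/funext => x; exact: sawkE.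
  have lS n : cmf (fun x => (sinck (x - - ln n.+1%:R))%:C) by exact: cL1_cmf (cL1_shift _ l1).
  apply: cmfB; last exact: cmfM (cmf_cst _) (cL1_cmf (cL1_shift _ (decay_cL1 da))).
  apply: cmfB; last exact: cmfM (cmf_cst _) (lS N).
  by apply: cmf_sum => i; exact: cmfM (cmf_cst _) (lS i).
have -> : (fun x => sawB N (expR x)) = (fun x => expR (2^-1 * x) * Re (sawk N x)).
  apply/funext => x; rewrite /sawk ReC mulrA -expRD (_ : 2^-1 * x + - 2^-1 * x = 0) ?expR0 ?mul1r //.
  by rewrite mulNr subrr.
by apply: mfM mk.1; apply: mf_expR; exact: mfM (mf_cst _) (@mf_id R).
Qed.

Lemma sawk_FT_cvg t : ccvg (fun N => FT (sawk N) t)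
  (FT (fun x => (- zfrac x * expR (- 2^-1 * x))%:C) t).
Proof.
have [B hB] := normc_sawk; have h2 : 0 < 2^-1 :> R by rewrite invr_gt0.
have mk N : cmf (sawk N).
  apply: cmf_real; apply: mfM (mf_sawB N).
  by apply: mf_expR; exact: mfM (mf_cst _) (@mf_id R).
apply: (@cdct R (fun N x => sawk N x * cis (t * x)) _ _ _ _ (I1Z B (I1_expR_abs h2)) _ _).2.
- by move=> N; exact: cmfM (mk N) (cmf_lin t).
- apply: cmfM (cmf_lin t); apply: cmf_real; apply: mfM; first exact: mfN (@mf_zfrac R).
  by apply: mf_expR; exact: mfM (mf_cst _) (@mf_id R).
- apply: ae_S zfrac_neq0_ae => x xn; apply: ccvgM (ccvg_cst _).
  have h := sawB_pointwise (expR_gt0 x) xn.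
  apply/ccvgP; split; rewrite /sawk; last by rewrite ImC; exact: cvg_cst.
  have hh : sawB N (expR x) * expR (- 2^-1 * x) @[N --> \oo] --> - zfrac x * expR (- 2^-1 * x).
    by apply: cvgM h _; exact: cvg_cst.
  by rewrite ReC; apply: eq_cvgn hh => n; rewrite ReC mulrC.
- by move=> N x; rewrite normcM normc_cis mulr1.
Qed.

(** For [x < 0] the fractional part of [exp x] is [exp x] itself and contributes [1 / s]; the
    half-line [x > 0] contributes [Mz (1 - s)]. Up to sign and the factor [1 - s], the sum is the
    formula for [hzeta] at [1 - s]. *)
Lemma FT_zfrac t : FT (fun x => (- zfrac x * expR (- 2^-1 * x))%:C) t =
  zeta (1 - crit t) / (1 - crit t).
Proof.
have s0 := Re_crit_gt0 t; have s0' : 0 < Re (1 - crit t) by rewrite critN Re_crit_gt0.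
have sn0 := crit_neq0 t; have s1 : 1 - crit t != 0 by rewrite critN crit_neq0.
have cL1a := cL1_Mz 0 s0'.
have cL1b := cL1_sub 0 (cL1_pexp 0 s0).
rewrite critN zeta_crit -critN /hzeta.
have -> : (1 - crit t) / (1 - crit t - 1) - (1 - crit t) * Mz (1 - crit t) =
    (1 - crit t) * - ((crit t)^-1 + Mz (1 - crit t)).
  have -> : 1 - crit t - 1 = - crit t by rewrite addrAC subrr add0r.
  by rewrite invrN; ring.
rewrite mulrC mulKf //.
have := cint_pexp 0 s0; rewrite fact0 expr1 mul1r => <-.
rewrite -(cint_sub 0 (cL1_pexp 0 s0)) /Mz -(cintD cL1b cL1a) -(cintN (cL1D cL1b cL1a)).
rewrite /FT; apply: ae_cint.
- apply: cmfM (cmf_lin t); apply: cmf_real; apply: mfM; first exact: mfN (@mf_zfrac R).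
  by apply: mf_expR; exact: mfM (mf_cst _) (@mf_id R).
- exact: cL1_cmf (cL1N (cL1D cL1b cL1a)).
apply: ae_S (@ae_neq R 0) => x xn.
rewrite !rayE sub0r oppr_ge0 rmorphM rmorphN mulNr mulNr; congr (- _).
have ep : pexp 0 (1 - crit t) x = (expR (- 2^-1 * x))%:C * cis (t * x).
  rewrite /pexp expr0 mul1r cexpE ReMC ImMC critN !reimE opprK.
  by rewrite (mulrC x t) (mulrC x).
case: (ltgtP x 0) => x0; last by rewrite x0 eqxx in xn.
  rewrite mulr0 mulr0 addr0 mulr1.
  have -> : zfrac x = expR x.
    have : expR x < 1 by rewrite expR_lt1.
    by move=> h; rewrite /zfrac (@truncn_def _ _ 0) ?subr0 // expR_ge0.
  rewrite /pexp expr0 mul1r cexpE ReMC ImMC !reimE -mulrA.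
  rewrite (mulrA (real_complex _ _)) -rmorphM -expRD /=.
  have -> : x + - 2^-1 * x = - x * - 2^-1 by field.
  by rewrite (_ : - x * - t = t * x) // mulrNN mulrC.
by rewrite mulr0 add0r mulr1 ep mulrA.
Qed.

(** Two evaluations of the limit of [FT (sawk N) t]: by dominated convergence, and by [abel_cvg],
    the halved last term tending to 0. *)
Lemma zeta_fe t : FT (fun x => (sinck x)%:C) t * zeta (crit t) = zeta (1 - crit t) / (1 - crit t).
Proof.
rewrite -FT_zfrac; apply: ccvg_unique (sawk_FT_cvg t).
have c0 : ccvg (fun N => cpow N.+1%:R (- crit t) / 2) 0.
  rewrite -(mul0r (2^-1 : C)); apply: ccvgM (ccvg_cst _).
  have h2 : 0 < 2^-1 :> R by rewrite invr_gt0.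
  apply: (ccvg_dist (pow_cvg0 h2)) => n; rewrite subr0 normc_cpow ler_expR ReN mulrC.
  exact: lexx.
have c1 := abel_cvg (Re_crit_gt0 t) (crit_neq1 t).
have := ccvgM (ccvg_cst (FT (fun x => (sinck x)%:C) t)) (ccvgB c1 c0).
rewrite subr0 -zeta_crit; congr ccvg; apply/funext => N; rewrite FT_sawk; congr (_ * _).
by rewrite addrAC.
Qed.

(* Each factor [1 - avgexp] multiplies the transform by [- s / (1 - s)]. *)
Definition phi1 x : C := (sinck x)%:C - avgexp (fun x => (sinck x)%:C) x.
Definition phi x : C := phi1 x - avgexp phi1 x.

Lemma decay_phi : decay phi.
Proof.
have d1 : decay phi1 by apply: decayB decay_sinck _; case: (decay_avgexp decay_sinck).
exact: decayB d1 (decay_avgexp d1).1.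
Qed.

Lemma FT_phi t : zeta (crit t) != 0 -> FT phi t = Vsymbol (crit t) / crit t.
Proof.
move=> z0; have [d2 e2] := decay_avgexp decay_sinck.
have d1 : decay phi1 by apply: decayB decay_sinck _.
have [d3 e3] := decay_avgexp d1.
have sn0 := crit_neq0 t; have s1 : 1 - crit t != 0 by rewrite critN crit_neq0.
have h := zeta_fe t.
have -> : Vsymbol (crit t) / crit t = (crit t / (1 - crit t)) ^+ 2 * (zeta (1 - crit t) / (1 - crit t) / zeta (crit t)).
  by rewrite /Vsymbol; field; rewrite s1 sn0 z0.
rewrite -h mulfK // (FTB (decay_cL1 d1) (decay_cL1 d3)) e3.
rewrite (FTB (decay_cL1 decay_sinck) (decay_cL1 d2)) e2.
by move: (FT _ _) => F; field.
Qed.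

End FunctionalEquation.

(** * The function [A] in logarithmic variable *)

Section TransformOfA.
Variable R : realType.
Local Notation C := (R[i]).
Local Notation Re := (@complex.Re R).
Local Notation Im := (@complex.Im R).
Local Notation normc := (@Normc.normc R).
Local Notation mu := (@lebesgue_measure R).
Implicit Types (s z w : C) (t u v x y : R) (N : nat).

Lemma zfrac_lt0 x : x < 0 -> zfrac x = expR x.
Proof.
by move=> x0; rewrite /zfrac (@truncn_def _ _ 0) ?subr0 // expR_ge0 expR_lt1.
Qed.

Definition fracT x : C := (expR (- 2^-1 * x) * - zfrac x)%:C.

Lemma decay_fracT : decay fracT.
Proof.
split.
  apply: cmf_real; apply: mfM; last exact: mfN (@mf_zfrac R).
  by apply: mf_expR; exact: mfM (mf_cst _) (@mf_id R).
exists 1 => x; have /andP[z0 z1] := zfrac_ge0 x.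
rewrite mul1r normcC normrM normrN (ger0_norm z0) ger0_norm ?expR_ge0 //.
case: (leP 0 x) => x0.
  rewrite -[leRHS]mulr1; apply: ler_pM => //.
  by rewrite ler_expR (ger0_norm x0); lra.
by rewrite zfrac_lt0 // -expRD ler_expR ltr0_norm //; lra.
Qed.

(** Up to [x] the integer part of [exp y] is the sum of the indicators of the segments [[ln k, x]]
    for [1 <= k <= n]; their lengths add up to [n x - ln n!]. *)
Lemma rint_zfrac x : let n := Num.truncn (expR x) in
  I1 (fun y => - zfrac y * \1_(`]-oo, x]) y) /\
  rint (fun y => - zfrac y * \1_(`]-oo, x]) y) = n%:R * x - ln n`!%:R - expR x.
Proof.
move=> n.
have e1 : (fun y => expR (- 1 * (x - y)) * ray (x - y)) = (fun y => expR (- x) * (expR y * \1_(`]-oo, x]) y)).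
  apply/funext => y; rewrite rayE subr_ge0 indic_itvE in_itv /= mulrA -expRD; congr (expR _ * _).
  by ring.
have i1 : I1 (fun y => expR y * \1_(`]-oo, x]) y).
  have := @I1_sub R x (fun y => expR (- 1 * y) * ray y) (I1_expR ltr01).
  rewrite e1 => /(I1Z (expR x)); congr I1; apply/funext => y.
  by rewrite mulrA -expRD subrr expR0 mul1r.
have r1 : rint (fun y => expR y * \1_(`]-oo, x]) y) = expR x.
  have := @rint_sub R x (fun y => expR (- 1 * y) * ray y) (I1_expR ltr01).
  have -> : rint (fun y : R => expR (- 1 * y) * ray y) = 1.
    have := cint_pexp 0 (ltr01 : 0 < Re (1 : C)); rewrite fact0 expr1 divr1.
    rewrite (eq_cint (g := fun y => (expR (- 1 * y) * ray y)%:C)).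
      by rewrite cint_real => /(congr1 Re); rewrite ReC.
    move=> y; rewrite /pexp expr0 mul1r mulrN1 rmorphM; congr (_ * _).
    by rewrite -rmorphN -[RHS]cexpC mulN1r.
  rewrite e1 (rintZ _ i1) => h.
  by rewrite -[LHS]mul1r -expR0 -(subrr x) expRD -mulrA h mulr1.
have j1 (k : 'I_n) : I1 (\1_(`[ln k.+1%:R, x]) : R -> R) /\
    rint (\1_(`[ln k.+1%:R, x]) : R -> R) = x - ln k.+1%:R.
  have kx : ln (k.+1%:R : R) <= x.
    rewrite -(expRK x) ler_ln ?posrE ?ltr0n ?expR_gt0 //.
    apply: (@le_trans _ _ n%:R); first by rewrite ler_nat.
    by have /andP[] := truncn_itv (expR_ge0 x).
  have [i2 e2] := ftc_itv kx (fun y _ => is_derive_id y 1) (fun y _ => @cst_continuous _ _ (1 : R) y).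
  split; first by move: i2; congr I1; apply/funext => y; rewrite mul1r.
  by rewrite -e2; apply: eq_rint => y; rewrite mul1r.
have e y : - zfrac y * \1_(`]-oo, x]) y =
    \sum_(k < n) \1_(`[ln k.+1%:R, x]) y - expR y * \1_(`]-oo, x]) y.
  rewrite indic_itvE in_itv /=; case: (leP y x) => yx; last first.
    rewrite !mulr0 subr0 big1 // => k _; rewrite indic_itvE in_itv /= andbC.
    by rewrite leNgt yx.
  rewrite !mulr1 /zfrac opprB; congr (_ - _).
  have yn : (Num.truncn (expR y) <= n)%N by rewrite le_truncn // ler_expR.
  rewrite -[in LHS](minn_idPr yn) -truncn_sum; apply: eq_bigr => k _.
  rewrite !indic_itvE !in_itv /= yx !andbT; congr (_%:R).
  by rewrite -[in RHS]ler_expR lnK // posrE ltr0n.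
have hs := @I1_sum R 'I_n (index_enum 'I_n) (fun k => \1_(`[ln k.+1%:R, x])) (fun k => (j1 k).1).
split.
  by move: (I1B hs i1); congr I1; apply/funext => y; rewrite e.
rewrite (eq_rint e) (rintB hs i1) r1 rint_sum; last by move=> k; case: (j1 k).
congr (_ - _); rewrite (eq_bigr (fun k : 'I_n => x - ln k.+1%:R)); last by move=> k _; case: (j1 k).
rewrite sumrB sumr_const card_ord -[X in X - _]mulr_natl; congr (_ - _).
elim: (n) => [|m IH]; first by rewrite big_ord0 fact0 ln1.
by rewrite big_ord_recr /= IH factS natrM lnM ?posrE ?ltr0n ?fact_gt0 // addrC.
Qed.

(* [A(t) = - {1/t} + \int_0^(1/t) {v} dv/v], read in the variable [x = - ln t]. *)
Definition hA x : C := fracT x - avgexp fracT x.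

Lemma hAE x : hA x = let n := Num.truncn (expR x) in
  (expR (- 2^-1 * x) * (n%:R * - x + ln n`!%:R + n%:R))%:C.
Proof.
have [i e] := rint_zfrac x.
rewrite /hA /fracT (avgexp_real i) -rmorphB e /=; congr (_%:C); rewrite /zfrac; ring.
Qed.

Lemma decay_hA : decay hA.
Proof. exact: decayB decay_fracT (decay_avgexp decay_fracT).1. Qed.

Lemma FT_hA t : FT hA t = Z (1 - crit t).
Proof.
have [d e] := decay_avgexp decay_fracT; rewrite (FTB (decay_cL1 decay_fracT) (decay_cL1 d)) e.
have -> : FT fracT t = zeta (1 - crit t) / (1 - crit t).
  by rewrite -FT_zfrac; congr FT; apply/funext => x; rewrite /fracT mulrC.
have s1 : 1 - crit t != 0 by rewrite critN crit_neq0.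
by rewrite /Z; field.
Qed.

End TransformOfA.

(** * Continuation of [V psi] to the critical line *)

Section Continuation.
Variable R : realType.
Local Notation C := (R[i]).
Local Notation Re := (@complex.Re R).
Local Notation Im := (@complex.Im R).
Local Notation normc := (@Normc.normc R).
Local Notation mu := (@lebesgue_measure R).
Implicit Types (s z w : C) (t u v x y : R) (k N : nat).
Local Notation hf := ((2^-1 : R)%:C : C).

Lemma cL2_conv (M : R) (f g : R -> C) : cL1 f -> (forall x, normc (f x) <= M) -> cL1 g ->
  cL2 (conv f g).
Proof.
move=> hf fM hg; have [l1 _] := FT_conv hf fM hg; have mff := cL1_cmf hf.
have ig := I1_normc hg.
have b x : normc (conv f g x) <= 2 * (M * rint (fun u => normc (g u))).
  rewrite -(rintZ _ ig); apply: normc_cint; [exact: cL1_conv_ker fM hg|exact: I1Z|].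
  by move=> u; rewrite normcM mulrC ler_wpM2r ?normc_ge0.
apply: (le_cL2 (cL1_cmf l1) (I1Z (2 * (M * rint (fun u => normc (g u)))) (I1_normc l1))) => x.
by rewrite expr2 ler_wpM2r ?normc_ge0.
Qed.

(** The function [psi w k] in the variable [x = ln t], as [expT_psi] shows: a reflected [pexp], on
    [x <= 0] because [psi] lives on []0, 1]]. *)
Definition psT w k x : C := pexp k (hf - w) (- x) * (ray (- x))%:C.

Let Re_hf w : Re w < 2^-1 -> 0 < Re (hf - w).
Proof. by move=> h; rewrite ReB ReC subr_gt0. Qed.

Lemma cL1_psT w k : Re w < 2^-1 -> cL1 (psT w k).
Proof.
move=> /Re_hf h; have := cL1_sub 0 (cL1_pexp k h); congr cL1; apply/funext => x.
by rewrite sub0r.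
Qed.

Lemma critE t : crit t = hf + (0 +i* t).
Proof. by apply: ceq; rewrite !reimE ?addr0 ?add0r. Qed.

Lemma FT_psT w k t : Re w < 2^-1 -> FT (psT w k) t = k`!%:R / (crit t - w) ^+ k.+1.
Proof.
move=> hw; have h0 : 0 < Re (crit t - w) by rewrite ReB subr_gt0.
rewrite -(cint_pexp k h0) -(cint_sub 0 (cL1_pexp k h0)); apply: eq_cint => x.
rewrite sub0r /psT mulrAC; congr (_ * _); rewrite /pexp -mulrA; congr (_ * _).
have -> : cis (t * x) = cexp ((- x)%:C * - (0 +i* t)).
  by rewrite cexpE ReMC ImMC !reimE oppr0 mulr0 expR0 mul1r mulrNN mulrC.
by rewrite -cexpD critE; congr cexp; ring.
Qed.

(** For [Re w < 1/2] the convolution of [phi] with [psT w k]. At [Re w = 1/2] the function [psT] is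
    no longer integrable, but the decay of [phi (x + v)] in [v] keeps this integral convergent. *)
Definition Eint w k x : C := cint (fun v => pexp k (hf - w) v * (ray v)%:C * phi (x + v)).

Lemma conv_psT w k x : Re w < 2^-1 -> conv (@phi R) (psT w k) x = Eint w k x.
Proof.
move=> hw; have [M M0 hM] := decay_bounded (@decay_phi R).
have l := cL1_conv_ker x (@decay_phi R).1 hM (cL1_psT k hw).
rewrite /conv -(cint_sub 0 l); apply: eq_cint => v.
by rewrite sub0r opprK /psT opprK.
Qed.

Lemma is_fourier_Eint w k : Re w < 2^-1 ->
  is_fourier (Eint w k) (fun t => FT (@phi R) t * (k`!%:R / (crit t - w) ^+ k.+1)).
Proof.
move=> hw; have [M M0 hM] := decay_bounded (@decay_phi R); have l1 := decay_cL1 (@decay_phi R).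
have lp := cL1_psT k hw; have [c1 c2] := FT_conv l1 hM lp.
have := is_fourier_L1 c1 (cL2_conv l1 hM lp).
have -> : FT (conv (@phi R) (psT w k)) = (fun t => FT (@phi R) t * (k`!%:R / (crit t - w) ^+ k.+1)).
  by apply/funext => t; rewrite c2 FT_psT.
by apply: eq_fourier => x; exact: conv_psT.
Qed.

(* [V (psi w k)] in the variable [x = ln t], in a form that still makes sense for
   [Re w = 1/2]: write [s = (s - w) + w] in [(V(s) / s) * s * k! / (s - w) ^+ k.+1]. *)
Definition Gk w k x : C :=
  if k is j.+1 then k%:R * Eint w j x + w * Eint w k x else phi x + w * Eint w 0 x.

Lemma is_fourier_Gk w k : Re w < 2^-1 ->
  is_fourier (Gk w k) (fun t => Vsymbol (crit t) * FT (psT w k) t).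
Proof.
move=> hw; have f1 j := is_fourier_Eint j hw.
have f0 := is_fourier_L1 (decay_cL1 (@decay_phi R)) (decay_cL2 (@decay_phi R)).
have mV : cmf (fun t => Vsymbol (crit t) * FT (psT w k) t).
  exact: cmfM (@cmf_Vsymbol R) (cmf_FT (cL1_cmf (cL1_psT k hw))).
have sw t : crit t - w != 0.
  by apply: contraTneq hw => /eqP; rewrite subr_eq0 => /eqP <-; rewrite ltxx.
case: k mV => [|k] mV.
- apply: (is_fourier_ae (is_fourierD f0 (is_fourierZ w (f1 0%N))) mV).
  apply: ae_S (@zeta_neq0_ae R) => t z0.
  have s0 := crit_neq0 t; have := sw t.
  rewrite FT_psT // fact0 expr1 FT_phi //; move: (crit t) s0 (Vsymbol (crit t)) => s s0 V sw0.
  by field; rewrite s0 sw0.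
- apply: (is_fourier_ae (is_fourierD (is_fourierZ k.+1%:R (f1 k)) (is_fourierZ w (f1 k.+1))) mV).
  apply: ae_S (@zeta_neq0_ae R) => t z0.
  have s0 := crit_neq0 t; have := sw t.
  rewrite FT_psT // FT_phi // factS natrM !exprS; move: (crit t) s0 (Vsymbol (crit t)) => s s0 V sw0.
  have swk : (s - w) ^+ k != 0 by rewrite expf_neq0.
  move: ((s - w) ^+ k) swk (k.+1%:R : C) (k`!%:R : C) => q q0 a b.
  by field; rewrite s0 sw0 q0.
Qed.

Let q0 : 0 < 4^-1 :> R. Proof. by rewrite invr_gt0. Qed.

(** The bound is weakened to [exp (- x / 4)] because this form is multiplicative in [x + v]: the
    dependence on [x] leaves the integral. It grows as [x] tends to minus infinity, a region removed
    by [Q]. *)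
Let Phib : {B : R | 0 <= B /\ forall x, normc (phi x) <= B * expR (- 4^-1 * x)}.
Proof.
apply: cid; have [_ [B hB]] := @decay_phi R.
have B0 : 0 <= B by have := le_trans (normc_ge0 _) (hB 0); rewrite normr0 mulr0 expR0 mulr1.
exists B; split => // x; apply: (le_trans (hB x)); rewrite ler_wpM2l // ler_expR.
by rewrite !mulNr lerN2 ler_wpM2l ?ler_norm // ltW.
Qed.
Let B := sval Phib.
Let B0 : 0 <= B. Proof. by case: (svalP Phib). Qed.
Let hB x : normc (phi x) <= B * expR (- 4^-1 * x). Proof. by case: (svalP Phib) => _. Qed.

Let dom k x v : R := B * expR (- 4^-1 * x) * (v ^+ k * expR (- 4^-1 * v) * ray v).

Let I1_dom k x : I1 (dom k x).
Proof. exact: I1Z (I1_pexp k q0). Qed.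

Let pexp_le k z v : 0 <= Re z -> normc (pexp k z v * (ray v)%:C) <= v ^+ k * ray v.
Proof.
move=> z0; rewrite mulrC normcMC rayE; case: (leP 0 v) => v0; last by rewrite normr0 mul0r mulr0.
rewrite normr1 mul1r mulr1 normc_pexp // ler_piMr ?exprn_ge0 // -expR0 ler_expR mulNr oppr_le0.
exact: mulr_ge0.
Qed.

Let ker_le k z x v (f : C) : normc f <= v ^+ k * ray v -> normc (f * phi (x + v)) <= dom k x v.
Proof.
move=> hf; have r0 : 0 <= v ^+ k * ray v by apply: le_trans (normc_ge0 _) hf.
rewrite normcM; apply: (le_trans (ler_pM (normc_ge0 _) (normc_ge0 _) hf (hB _))).
rewrite /dom mulrDr expRD le_eqVlt; apply/orP; left; apply/eqP.
by move: (expR _) (expR _) => p q; ring.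
Qed.

Let mker k w x : cmf (fun v => pexp k (hf - w) v * (ray v)%:C * phi (x + v)).
Proof.
apply: cmfM; first by apply: cmfM (cmf_pexp k _) (cmf_real (@mf_ray R)).
by apply: (cmf_comp (@decay_phi R).1); apply: mfD; [exact: mf_cst|exact: (@mf_id R)].
Qed.

Let Re_ge w : Re w <= 2^-1 -> 0 <= Re (hf - w).
Proof. by move=> h; rewrite ReB ReC subr_ge0. Qed.

Let cL1_ker k w x : Re w <= 2^-1 -> cL1 (fun v => pexp k (hf - w) v * (ray v)%:C * phi (x + v)).
Proof.
move=> hw; apply: (le_cL1 (mker k w x) (I1_dom k x)) => v.
exact: (ker_le 0 _ (pexp_le k v (Re_ge hw))).
Qed.

Lemma cmf_Eint w k : cmf (Eint w k).
Proof.
apply: cmf_cint; apply: cmf2M.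
  by apply: cmf2_snd; apply: cmfM (cmf_pexp k _) (cmf_real (@mf_ray R)).
apply: (cmf2_comp (@decay_phi R).1).
by apply: mf2D; [exact: mf2_fst (@mf_id R)|exact: mf2_snd (@mf_id R)].
Qed.

Let moment k : R := rint (fun v => v ^+ k * expR (- 4^-1 * v) * ray v).

Let cint_le k x (f : R -> C) : cL1 (fun v => f v * phi (x + v)) ->
  (forall v, normc (f v) <= v ^+ k * ray v) ->
  normc (cint (fun v => f v * phi (x + v))) <= 2 * (B * moment k) * expR (- 4^-1 * x).
Proof.
move=> l h; apply: (le_trans (normc_cint l (I1_dom k x) (fun v => ker_le 0 _ (h v)))).
rewrite /dom (rintZ _ (I1_pexp k q0)) -/(moment k) le_eqVlt; apply/orP; left; apply/eqP.
by ring.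
Qed.

Lemma Eint_le k : exists2 M : R, 0 <= M & forall w x, Re w <= 2^-1 ->
  normc (Eint w k x) <= M * expR (- 4^-1 * x).
Proof.
have m0 : 0 <= moment k.
  apply: rint_ge0 => v; rewrite rayE; case: (leP 0 v) => v0; last by rewrite mulr0.
  by rewrite mulr1 mulr_ge0 ?exprn_ge0 ?expR_ge0.
exists (2 * (B * moment k)); first by rewrite !mulr_ge0.
move=> w x hw; exact: cint_le (cL1_ker k x hw) (fun v => pexp_le k v (Re_ge hw)).
Qed.

Lemma cexp_lip z w : Re z <= 0 -> Re w <= 0 -> normc (cexp z - cexp w) <= 2 * normc (z - w).
Proof.
wlog h : z w / Re z <= Re w.
  move=> H z0 w0; have [h|h] := leP (Re z) (Re w); first exact: H.
  by rewrite normcBC (normcBC z); apply: H => //; exact: ltW.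
move=> _ w0; pose d := z - w; have d0 : Re d <= 0 by rewrite /d ReB subr_le0.
have -> : cexp z - cexp w = cexp w * (cexp d - 1).
  by rewrite mulrBr mulr1 -cexpD /d (addrC w) subrK.
rewrite normcM -[leRHS]mul1r; apply: ler_pM; rewrite ?normc_ge0 //.
  by rewrite normc_cexp -expR0 ler_expR.
have [l e] := cftc_itv ler01 (fun y _ => cder_cexp d y)
  (fun y _ => cder_cctn (cderM (cder_cst d y) (cder_cexp d y))).
rewrite mul1r mul0r cexp0 in e; rewrite -e.
have [i1 e1] := ftc_pow (normc d) 0 ler01.
rewrite divr1 expr1n mulr1 in e1; rewrite -[in leRHS]e1.
have e2 : (fun y => normc d * y ^+ 0 * \1_(`[0, 1]) y) = (fun y => normc d * \1_(`[0, 1]) y).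
  by apply/funext => y; rewrite expr0 mulr1.
rewrite e2 in i1; apply: (normc_cint l i1) => y; rewrite mulrC normcMC mulrC.
have /andP[i0 _] := indic_le1 (`[0, 1]%classic : set R) y.
rewrite ger0_norm //; move: i0; rewrite indic_itvE in_itv /=; case: (boolP (0 <= y <= 1)) => [/andP[y0 _] _|_ _].
  by rewrite !mulr1 normcM -[leRHS]mulr1 ler_wpM2l ?normc_ge0 // normc_cexp -expR0 ler_expR ReMC mulr_ge0_le0.
by rewrite !mulr0.
Qed.

Lemma Eint_lip k : exists2 M : R, 0 <= M & forall w w' x, Re w <= 2^-1 -> Re w' <= 2^-1 ->
  normc (Eint w k x - Eint w' k x) <= M * normc (w - w') * expR (- 4^-1 * x).
Proof.
have m0 : 0 <= moment k.+1.
  apply: rint_ge0 => v; rewrite rayE; case: (leP 0 v) => v0; last by rewrite mulr0.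
  by rewrite mulr1 mulr_ge0 ?exprn_ge0 ?expR_ge0.
exists (4 * (B * moment k.+1)); first by rewrite !mulr_ge0.
move=> w w' x hw hw'; have [->|wn] := eqVneq w w'.
  by rewrite !subrr Normc.normc0 mulr0 mul0r.
have d0 : 0 < normc (w - w') by rewrite normc_gt0 subr_eq0.
(* Dividing by [2 |w - w'|] brings the difference of kernels under the bound of [cint_le] with
   [k + 1]: by [cexp_lip] the change of exponent costs one factor [v]. *)
pose c : C := ((2 * normc (w - w'))^-1)%:C.
have c0 : 2 * normc (w - w') != 0 by rewrite gt_eqF // mulr_gt0.
pose f v := c * (pexp k (hf - w) v * (ray v)%:C - pexp k (hf - w') v * (ray v)%:C).
have hf v : normc (f v) <= v ^+ k.+1 * ray v.
  rewrite /f -mulrBl mulrA mulrC normcMC rayE; case: (leP 0 v) => v0; last by rewrite normr0 mul0r mulr0.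
  rewrite normr1 mul1r mulr1 normcMC ger0_norm ?invr_ge0 ?mulr_ge0 ?normc_ge0 //.
  rewrite mulrC ler_pdivrMr ?mulr_gt0 // /pexp -mulrBr normcMC ger0_norm ?exprn_ge0 //.
  rewrite exprSr -mulrA ler_wpM2l ?exprn_ge0 //.
  have r z : Re z <= 2^-1 -> Re (v%:C * - (hf - z)) <= 0.
    by move=> hz; rewrite ReMC ReN mulrN oppr_le0 mulr_ge0 // Re_ge.
  apply: (le_trans (cexp_lip (r _ hw) (r _ hw'))).
  rewrite -mulrBr (_ : - (hf - w) - - (hf - w') = w - w'); last by ring.
  by rewrite normcMC ger0_norm // mulrCA.
have lf : cL1 (fun v => f v * phi (x + v)).
  have := cL1Z c (cL1B (cL1_ker k x hw) (cL1_ker k x hw')); congr cL1; apply/funext => v.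
  by rewrite /f -mulrBl mulrA.
have e : Eint w k x - Eint w' k x = (2 * normc (w - w'))%:C * cint (fun v => f v * phi (x + v)).
  rewrite /Eint -(cintB (cL1_ker k x hw) (cL1_ker k x hw')) -(cintZ _ lf); apply: eq_cint => v.
  rewrite /f mulrA mulrA -rmorphM mulfV // rmorph1 mul1r mulrBl //.
rewrite e normcMC ger0_norm; last by rewrite mulr_ge0 ?normc_ge0.
apply: (le_trans (ler_wpM2l _ (cint_le lf hf))); first by rewrite mulr_ge0 ?normc_ge0.
by rewrite le_eqVlt; apply/orP; left; apply/eqP; move: (expR _) => p; ring.
Qed.

Lemma cmf_Gk w k : cmf (Gk w k).
Proof.
case: k => [|k]; apply: cmfD; try exact: cmfM (cmf_cst _) (cmf_Eint _ _).
exact: (@decay_phi R).1.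
Qed.

Lemma normc_lin (u1 v1 u2 v2 : C) (a b c d e : R) : normc u1 <= a -> normc v1 <= b * e ->
  normc u2 <= c -> normc v2 <= d * e -> normc (u1 * v1 + u2 * v2) <= (a * b + c * d) * e.
Proof.
move=> h1 h2 h3 h4; apply: (le_trans (normcD _ _)); rewrite !normcM mulrDl -!mulrA.
by apply: lerD; apply: ler_pM; rewrite ?normc_ge0.
Qed.

Lemma Gk_le s k : Re s <= 2^-1 -> exists M : R, forall x, normc (Gk s k x) <= M * expR (- 4^-1 * x).
Proof.
move=> hs; have [M1 _ h1] := Eint_le k.
case: k h1 => [|k] h1; rewrite /Gk.
  exists (1 * B + normc s * M1) => x; rewrite -[phi x]mul1r.
  by apply: normc_lin; [rewrite Normc.normc1|exact: hB| |exact: h1].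
have [M2 _ h2] := Eint_le k; exists (k.+1%:R * M2 + normc s * M1) => x.
by apply: normc_lin; [rewrite normc_nat|exact: h2| |exact: h1].
Qed.

Lemma Gk_lip s k : Re s <= 2^-1 -> exists M : R, forall w x, Re w <= 2^-1 -> normc (w - s) <= 1 ->
  normc (Gk w k x - Gk s k x) <= M * normc (w - s) * expR (- 4^-1 * x).
Proof.
move=> hs; have [M1 _ h1] := Eint_le k; have [L1 L10 l1] := Eint_lip k.
have key w x : Re w <= 2^-1 -> normc (w - s) <= 1 ->
    normc (w * Eint w k x - s * Eint s k x) <= (1 * M1 + (normc s + 1) * L1) * (normc (w - s) * expR (- 4^-1 * x)).
  move=> hw ws.
  (* The first summand is controlled by the bound of [Eint], the second by its Lipschitz bound; the
     restriction to distance 1 keeps the factor [w] bounded. *)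
  have -> : w * Eint w k x - s * Eint s k x = (w - s) * Eint s k x + w * (Eint w k x - Eint s k x) by ring.
  have nw : normc w <= normc s + 1.
    by rewrite -(subrK s w) addrC (le_trans (normcD _ _)) // lerD2l.
  rewrite -[(w - s) * _]mul1r; apply: normc_lin => //; first by rewrite Normc.normc1.
    by rewrite mulrCA normcM ler_wpM2l ?normc_ge0 // h1.
  by rewrite mulrA; exact: l1.
case: k h1 L10 l1 key => [|k] h1 L10 l1 key; rewrite /Gk.
  exists (1 * M1 + (normc s + 1) * L1) => w x hw ws.
  by rewrite opprD addrACA subrr add0r -mulrA; exact: key.
have [L2 L20 l2] := Eint_lip k.
exists (k.+1%:R * L2 + 1 * (1 * M1 + (normc s + 1) * L1)) => w x hw ws.
rewrite opprD addrACA -mulrBr -(mulrA (_ + _)) -[w * _ - _]mul1r.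
apply: normc_lin; [by rewrite normc_nat| |by rewrite Normc.normc1|exact: key].
by rewrite mulrA; exact: l2.
Qed.

Definition cut (l x : R) : C := (\1_(`[l, +oo[) x)%:C.

Lemma cmf_cut l : cmf (cut l).
Proof. by apply: cmf_real; exact: mf_indic. Qed.

(** The square of [exp (- x / 4)] is integrable to the right of [l]; [J] is its integral there. *)
Let raysq l : {J : R | 0 <= J /\ forall (f : R -> C) (M : R), cmf f ->
  (forall x, normc (f x) <= M * expR (- 4^-1 * x)) ->
  cL2 (fun x => cut l x * f x) /\ N2 (fun x => cut l x * f x) <= M ^+ 2 * J}.
Proof.
apply: cid.
have h2 : 0 < 2^-1 :> R by rewrite invr_gt0.
pose g x := expR (- 2^-1 * l) * (expR (- 2^-1 * (x - l)) * ray (x - l)).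
have Ig : I1 g by apply: I1Z; exact: (@I1_shift R (- l) (fun x => expR (- 2^-1 * x) * ray x) (I1_expR h2)).
have g0 x : 0 <= g x by rewrite /g !mulr_ge0 ?expR_ge0 // rayE.
exists (rint g); split; first exact: rint_ge0.
move=> f M mff hM.
have le x : normc (cut l x * f x) ^+ 2 <= M ^+ 2 * g x.
  rewrite /cut normcMC indic_itvE in_itv /= andbT /g rayE subr_ge0; case: (l <= x); last first.
    by rewrite normr0 mul0r expr0n /= !mulr0.
  rewrite normr1 mul1r mulr1 -expRD (_ : - 2^-1 * l + - 2^-1 * (x - l) = - 4^-1 * x + - 4^-1 * x); last by field.
  rewrite expRD -expr2 -exprMn lerXn2r ?nnegrE ?normc_ge0 //.
  exact: le_trans (normc_ge0 _) (hM x).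
have m : cmf (fun x => cut l x * f x) by exact: cmfM (cmf_cut l) mff.
have c2 := le_cL2 m (I1Z (M ^+ 2) Ig) le; split => //.
by rewrite -(rintZ _ Ig); apply: le_rint; [exact: c2.2|exact: I1Z|].
Qed.

Lemma cL2_cutG l s k : Re s <= 2^-1 -> cL2 (fun x => cut l x * Gk s k x).
Proof.
move=> /(Gk_le k)[M hM]; exact: ((svalP (raysq l)).2 _ _ (cmf_Gk s k) hM).1.
Qed.

Lemma cutG_cvg l s k : Re s <= 2^-1 -> exists2 K : R, 0 <= K & forall w, Re w <= 2^-1 ->
  normc (w - s) <= 1 ->
  N2 (fun x => cut l x * Gk w k x - cut l x * Gk s k x) <= K * normc (w - s) ^+ 2.
Proof.
move=> hs; have [M hM] := Gk_lip k hs; have [J0 hJ] := svalP (raysq l).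
exists (M ^+ 2 * sval (raysq l)); first by rewrite mulr_ge0 ?sqr_ge0.
move=> w hw ws.
have := (hJ (fun x => Gk w k x - Gk s k x) _ (cmfB (cmf_Gk w k) (cmf_Gk s k)) (fun x => hM w x hw ws)).2.
rewrite exprMn mulrAC; apply: le_trans; rewrite le_eqVlt; apply/orP; left; apply/eqP.
by apply: eq_N2 => x; rewrite mulrBr.
Qed.

End Continuation.

(** * Transfer between []0, +oo[] and the line *)

Section Dictionary.
Variable R : realType.
Local Notation C := (R[i]).
Local Notation Re := (@complex.Re R).
Local Notation Im := (@complex.Im R).
Local Notation normc := (@Normc.normc R).
Local Notation mu := (@lebesgue_measure R).
Implicit Types (f g h F G : R -> C) (s z w : C) (t u v x y : R) (k n N : nat).
Local Notation posline := (@posline R).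

Lemma L2normE (D : set R) f :
  L2norm D f = ((nint (fun t => (normc (f t) * \1_D t) ^+ 2)%R) `^ 2^-1)%E.
Proof.
rewrite /L2norm unlock; congr (_ `^ _)%E; apply: eq_integral => t _.
by rewrite abse_EFin poweR_EFin powR_mulrn // real_normK ?num_real.
Qed.

(** The weight is the square root of the Jacobian of [t = exp x], which makes the map unitary onto
    L2 of the line and turns the Mellin transform on the critical line into [FT]. *)
Definition expT f x : C := (expR (2^-1 * x))%:C * f (expR x).
Definition expTinv h t : C := (expR (- 2^-1 * ln t))%:C * h (ln t).
Let ipos t : R := if 0 < t then t^-1 else 0.

Let ind_pos t : \1_posline t = (0 < t)%R%:R :> R.
Proof. by rewrite /posline indic_itvE in_itv /= andbT. Qed.

Lemma expTK h x : expT (expTinv h) x = h x.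
Proof.
rewrite /expT /expTinv expRK mulrA -rmorphM -expRD (_ : _ + _ = 0) ?expR0 ?mul1r //.
by rewrite mulNr subrr.
Qed.

Let expTpos f t : 0 < t -> expT f (ln t) = (expR (2^-1 * ln t))%:C * f t.
Proof. by move=> t0; rewrite /expT lnK ?posrE. Qed.

Let sq_half t : 0 < t -> expR (2^-1 * ln t) ^+ 2 = t.
Proof. by move=> t0; rewrite expr2 -expRD -mulrDl (_ : 2^-1 + 2^-1 = 1) ?mul1r ?lnK ?posrE //; field. Qed.

Let normT f t : normc (expT f (ln t)) ^+ 2 * ipos t = (normc (f t) * \1_posline t) ^+ 2.
Proof.
rewrite ind_pos /ipos; case: (ltP 0 t) => t0; last by rewrite !mulr0 expr0n.
rewrite mulr1 expTpos // normcMC exprMn real_normK ?num_real // sq_half // mulrAC divff ?mul1r //.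
by rewrite gt_eqF.
Qed.

Let mf_ln : mf (@ln R). Proof. exact: measurable_ln. Qed.

Lemma mf_pos_normc f : cmf (expT f) -> mf (fun t => (normc (f t) * \1_posline t) ^+ 2).
Proof.
move=> mT; have -> : (fun t => (normc (f t) * \1_posline t) ^+ 2) =
    (fun t => normc (expT f (ln t)) ^+ 2 * ipos t) by apply/funext => t; rewrite normT.
apply: mfM (@mf_inv_pos R); exact: (mf_comp (mf_sqr_normc mT) mf_ln).
Qed.

Lemma nint_expT f : cmf (expT f) ->
  nint (fun x => normc (expT f x) ^+ 2) = nint (fun t => (normc (f t) * \1_posline t) ^+ 2).
Proof.
move=> mT; rewrite nint_ln; [|exact: mf_sqr_normc|by move=> x; exact: sqr_ge0].
by apply: eq_nint => t; exact: normT.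
Qed.

Lemma L2norm_expT f : cL2 (expT f) -> L2norm posline f = (Num.sqrt (N2 (expT f)))%:E.
Proof.
move=> h; rewrite L2normE -nint_expT ?(N2E h).1; last exact: h.1.
by rewrite -(N2E h) poweR_EFin powR12_sqrt // N2_ge0.
Qed.

Lemma L2norm_setT F : cL2 F -> L2norm setT F = (Num.sqrt (N2 F))%:E.
Proof.
move=> h; rewrite L2normE (eq_nint (g := fun t => normc (F t) ^+ 2)).
  by rewrite -(N2E h) poweR_EFin powR12_sqrt // N2_ge0.
by move=> t; rewrite indicT mulr1.
Qed.

Lemma fin_sqrt (a : \bar R) : (a `^ 2^-1 < +oo)%E -> (a < +oo)%E.
Proof.
case: a => [r _|h|_]; [exact: ltry| |exact: ltNye].
by move: h; rewrite poweRyr // invr_eq0.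
Qed.

Let cmf_expT f : measurable_fun posline (fun t => Re (f t)) ->
  measurable_fun posline (fun t => Im (f t)) -> cmf (expT f).
Proof.
have h (g : R -> R) : measurable_fun posline g -> mf (fun x => g (expR x)).
  move=> mg; have sub : (@expR R) @` setT `<=` posline.
    by move=> t [x _ <-]; rewrite /posline /= in_itv /= expR_gt0.
  exact: measurable_comp (measurable_itv _) sub mg (@measurable_expR R).
move=> /h h1 /h h2; apply: cmfM; last by split.
by apply: cmf_real; apply: mf_expR; exact: mfM (mf_cst _) (@mf_id R).
Qed.

Let expTinvK f t : 0 < t -> f t = expTinv (expT f) t.
Proof.
move=> t0; rewrite /expTinv expTpos // mulrA -rmorphM -expRD (_ : _ + _ = 0) ?expR0 ?mul1r //.
by rewrite mulNr addrC subrr.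
Qed.

Let expT_cmf f : cmf (expT f) -> measurable_fun posline (Re \o f) /\ measurable_fun posline (Im \o f).
Proof.
move=> mT; have m : cmf (expTinv (expT f)).
  apply: cmfM; last exact: cmf_comp mT mf_ln.
  by apply: cmf_real; apply: mf_expR; exact: mfM (mf_cst _) mf_ln.
split.
- apply: (@eq_measurable_fun _ _ _ _ posline (fun t => Re (expTinv (expT f) t))).
    by move=> t; rewrite inE /posline /= in_itv /= andbT => t0; rewrite -expTinvK.
  by apply: measurable_funTS; exact: m.1.
- apply: (@eq_measurable_fun _ _ _ _ posline (fun t => Im (expTinv (expT f) t))).
    by move=> t; rewrite inE /posline /= in_itv /= andbT => t0; rewrite -expTinvK.
  by apply: measurable_funTS; exact: m.2.
Qed.

Lemma K_cL2 f : K f <-> cL2 (expT f).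
Proof.
split=> [[m1 m2 lt]|h].
  have mT : cmf (expT f) by exact: cmf_expT.
  split => //; apply: I1P0; [exact: mf_sqr_normc|by move=> x; exact: sqr_ge0|].
  by rewrite nint_expT //; apply: fin_sqrt; rewrite -L2normE.
have [m1 m2] := expT_cmf h.1; split => //.
by rewrite -/posline L2norm_expT // ltry.
Qed.

Lemma K_expTinv h : cL2 h -> K (expTinv h).
Proof. by move=> h2; apply/K_cL2; rewrite (_ : expT _ = h) //; apply/funext => x; exact: expTK. Qed.

Lemma expTB f g x : expT (fun t => f t - g t) x = expT f x - expT g x.
Proof. by rewrite /expT mulrBr. Qed.

(** Null sets are not transported themselves: both conditions say that the integral of the squared
    difference vanishes, and [nint_expT] equates these integrals. *)
Lemma ae_expT f g : cmf (expT f) -> cmf (expT g) ->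
  {ae mu, forall x, expT f x = expT g x} <-> ae_eq mu posline f g.
Proof.
move=> mff mg; pose d t := f t - g t.
have mT : cmf (expT d).
  have -> : expT d = (fun x => expT f x - expT g x) by apply/funext => x; exact: expTB.
  exact: cmfB.
have e := nint_expT mT; split=> h.
- have z : nint (fun t => (normc (d t) * \1_posline t) ^+ 2) = 0%E.
    rewrite -e -[RHS](integral0 mu setT); apply: (@ae_nint R _ (fun=> 0)); [exact: mf_sqr_normc|exact: mf_cst|].
    by apply: ae_S h => x hx _; rewrite expTB hx subrr Normc.normc0 expr0n.
  have := nint_eq0 (mf_pos_normc mT) (fun t => sqr_ge0 _) z.
  apply: ae_S => t /(_ Logic.I) /eqP; rewrite sqrf_eq0 mulf_eq0 => /orP[|].
    by rewrite normc_eq0 subr_eq0 => /eqP.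
  by rewrite ind_pos /posline /= in_itv /= andbT; case: (0 < t) => //; rewrite oner_eq0.
- have z : nint (fun x => normc (expT d x) ^+ 2) = 0%E.
    rewrite e -[RHS](integral0 mu setT); apply: (@ae_nint R _ (fun=> 0)); [exact: mf_pos_normc|exact: mf_cst|].
    apply: ae_S h => t ht _; rewrite ind_pos; case: (ltP 0 t) => t0; last by rewrite mulr0 expr0n.
    have -> : d t = 0 by rewrite /d ht ?subrr // /posline /= in_itv /= andbT.
    by rewrite Normc.normc0 mul0r expr0n.
  have := nint_eq0 (mf_sqr_normc mT) (fun t => sqr_ge0 _) z.
  apply: ae_S => x /(_ Logic.I) /eqP; rewrite sqrf_eq0 normc_eq0 expTB subr_eq0.
  by move=> /eqP.
Qed.

Lemma rint_ln (f : R -> R) : I1 f -> rint f = rint (fun t => f (ln t) * (if 0 < t then t^-1 else 0)).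
Proof.
move=> If; have key (p : R -> R) : I1 p -> (forall x, 0 <= p x) ->
    I1 (fun t => p (ln t) * ipos t) /\ rint p = rint (fun t => p (ln t) * ipos t).
  move=> Ip p0; have mp := I1_mf Ip.
  have ge0 t : 0 <= p (ln t) * ipos t.
    by rewrite mulr_ge0 // /ipos; case: ltP => // t0; rewrite invr_ge0 ltW.
  have m : mf (fun t => p (ln t) * ipos t) by exact: mfM (mf_comp mp mf_ln) (@mf_inv_pos R).
  have i : I1 (fun t => p (ln t) * ipos t) by apply: I1P0 => //; rewrite -nint_ln // I1_lty.
  split => //; have := nint_ln mp p0; rewrite -(rintE Ip) -(rintE i).
  by case.
have p1 x : 0 <= 2^-1 * (`|f x| + f x).
  by rewrite mulr_ge0 ?invr_ge0 // -[X in _ + X]opprK subr_ge0 -normrN ler_norm.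
have p2 x : 0 <= 2^-1 * (`|f x| - f x) by rewrite mulr_ge0 ?invr_ge0 // subr_ge0 ler_norm.
have [i1 e1] := key _ (I1Z 2^-1 (I1D (I1_norm If) If)) p1.
have [i2 e2] := key _ (I1Z 2^-1 (I1B (I1_norm If) If)) p2.
have -> : rint f = rint (fun x => 2^-1 * (`|f x| + f x)) - rint (fun x => 2^-1 * (`|f x| - f x)).
  rewrite -rintB; [|exact: I1Z (I1D (I1_norm If) If)|exact: I1Z (I1B (I1_norm If) If)].
  by apply: eq_rint => x; field.
by rewrite e1 e2 -rintB //; apply: eq_rint => t; rewrite /ipos; field.
Qed.

(** One substitution for two uses: [D] is the truncation segment in [mellin_truncE] and the
    half-line in [innerE]. *)
Lemma cint_ln (D : set R) g f : cL1 g ->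
  (forall t, 0 < t -> g (ln t) * (t^-1)%:C = f t * (\1_D t)%:C) ->
  (forall t, t <= 0 -> \1_D t = 0 :> R) -> cintegral D f = cint g.
Proof.
move=> [h1 h2] e e0; rewrite /cintegral /cint (rint_ln h1) (rint_ln h2) -!rint_in.
have [e1 e2] : (forall t, Re (f t) * \1_D t = Re (g (ln t)) * ipos t) /\
    (forall t, Im (f t) * \1_D t = Im (g (ln t)) * ipos t).
  split=> t; rewrite /ipos; (case: (ltP 0 t) => t0; last by rewrite e0 // !mulr0);
    have := e t t0; rewrite !(mulrC _ _%:C).
    by move=> /(congr1 Re); rewrite !ReMC !(mulrC _ (Re _)).
  by move=> /(congr1 Im); rewrite !ImMC !(mulrC _ (Im _)).
by congr (_ +i* _); apply: eq_rint.
Qed.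

End Dictionary.

(** * The operators [V] and [Vinv] on the transform side *)

Section UnitaryV.
Variable R : realType.
Local Notation C := (R[i]).
Local Notation Re := (@complex.Re R).
Local Notation Im := (@complex.Im R).
Local Notation normc := (@Normc.normc R).
Local Notation mu := (@lebesgue_measure R).
Implicit Types (f g h F G P : R -> C) (s z w : C) (t u v x y : R) (k n N : nat).
Local Notation posline := (@posline R).
Local Notation VF P := (fun t => Vsymbol (crit t) * P t).

Lemma mellin_truncE n f t : cL2 (expT f) -> mellin_trunc n f t = FT (tr n (expT f)) t.
Proof.
move=> h; have [l1 _ _] := tr_plancherel n h.
have n0 : 0 < n.+1%:R :> R by rewrite ltr0n.
apply: (cint_ln (cL1_cis t l1)) => u u0; last first.
  rewrite indic_itvE in_itv /=; case: (leP (n.+1%:R^-1) u) => // h1.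
  by have := lt_le_trans (_ : 0 < n.+1%:R^-1) h1; rewrite invr_gt0 n0 ltNge u0 => /(_ isT).
have un0 : u != 0 by rewrite gt_eqF.
rewrite /tr /expT lnK ?posrE //.
have -> : \1_(`[- ln n.+1%:R, ln n.+1%:R]) (ln u) = \1_(`[n.+1%:R^-1, n.+1%:R]) u :> R.
  rewrite !indic_itvE !in_itv /= -lnV ?posrE // !ler_ln ?posrE ?invr_gt0 //.
have -> : cpow u (crit t - 1) = (expR (2^-1 * ln u))%:C * cis (t * ln u) * (u^-1)%:C.
  have eR : Re (crit t - 1) = 2^-1 - 1 by rewrite ReB.
  have eI : Im (crit t - 1) = t by rewrite ImB subr0.
  rewrite /cpow cexpE ReMC ImMC eR eI (mulrC t) mulrAC -rmorphM; congr (_%:C * _).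
  have -> : u^-1 = expR (- ln u) by rewrite expRN lnK ?posrE.
  by rewrite -expRD; congr expR; ring.
by ring.
Qed.

Lemma is_mellinE f F : cL2 (expT f) -> is_mellin f F <-> is_fourier (expT f) F.
Proof.
move=> h; have e n : mellin_trunc n f = FT (tr n (expT f)) by apply/funext => t; exact: mellin_truncE.
have cT n : cL2 (FT (tr n (expT f))) by have [_ ] := tr_plancherel n h.
have L2P (G : R -> C) : L2 setT G <-> cL2 G.
  have ne : nint (fun t => (normc (G t) * \1_[set: R] t) ^+ 2)%R = nint (fun t => normc (G t) ^+ 2)%R.
    by apply: eq_nint => t; rewrite indicT mulr1.
  split=> [[m1 m2 lt]|hG].
    have mG : cmf G by split.
    split => //; apply: I1P0; [exact: mf_sqr_normc|by move=> x; exact: sqr_ge0|].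
    by rewrite -ne; apply: fin_sqrt; rewrite -L2normE.
  by split; [exact: hG.1.1|exact: hG.1.2|rewrite L2norm_setT // ltry].
have eL : cL2 F -> (fun n => L2norm setT (fun t => mellin_trunc n f t - F t)) =
    (fun n => (Num.sqrt (N2 (fun t => FT (tr n (expT f)) t - F t)))%:E).
  move=> hF; apply/funext => n; rewrite e L2norm_setT //; exact: (cL2B (cT n) hF).1.
split=> [[hF c]|[_ [_ hF c]]].
- have {}hF := (L2P F).1 hF; split => //; split => //.
  rewrite (eL hF) in c.
  have {}c' : Num.sqrt (N2 (fun t => FT (tr n (expT f)) t - F t)) @[n --> \oo] --> (0 : R).
    by have /fine_cvgP[] := c.
  pose a n := Num.sqrt (N2 (fun t => FT (tr n (expT f)) t - F t)).
  have c2 : a n * a n @[n --> \oo] --> (0 * 0 : R) by exact: (cvgM c' c').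
  rewrite mulr0 in c2; apply: eq_cvgn c2 => n.
  by rewrite -expr2 sqr_sqrtr // N2_ge0.
- split; first exact/L2P.
  rewrite (eL hF); apply: cvg_EFin2; rewrite -[X in _ --> X]sqrtr0.
  by apply: (cvg_comp _ _ c); exact: sqrt_continuous.
Qed.

(** Existence of a Plancherel transform makes the choice in [mellin] meet its specification; being
    unique up to a null set only, it is used through [is_fourier]. *)
Lemma mellinP f : cL2 (expT f) -> is_fourier (expT f) (mellin f).
Proof.
move=> h; have [F hF] := is_fourier_ex h.
by apply/(is_mellinE _ h); apply: xgetPex; exists F; apply/(is_mellinE _ h).
Qed.

(** The difference has transform 0, hence norm 0 by the norm identity, [planch] being positive. *)
Lemma is_fourier_inj f g F : is_fourier f F -> is_fourier g F -> {ae mu, forall x, f x = g x}.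
Proof.
move=> h1 h2; have h := is_fourierB h1 h2; have n := is_fourier_N2 h.
have z : N2 (fun x => f x - g x) = 0.
  apply/eqP; move/eqP: n; rewrite (_ : N2 (fun x => F x - F x) = 0).
    by rewrite eq_sym mulf_eq0 gt_eqF ?planch_gt0.
  by rewrite /N2 -(rint0 R); apply: eq_rint => x; rewrite subrr Normc.normc0 expr0n.
by apply: ae_S (N2_eq0 h.1 z) => x /eqP; rewrite subr_eq0 => /eqP.
Qed.

Lemma is_fourier_src f g F : is_fourier f F -> cmf g -> {ae mu, forall x, f x = g x} -> is_fourier g F.
Proof.
move=> hF mg fg; have [g2 _] := ae_N2 mg hF.1 fg; have [G hG] := is_fourier_ex g2.
have h := is_fourierB hF hG; have n := is_fourier_N2 h; have [_ [_ FG2 _]] := h.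
have z : N2 (fun x => f x - g x) = 0.
  have m0 : cmf (fun _ : R => 0 : C) by exact: cmf_cst.
  have z0 : {ae mu, forall x, f x - g x = 0} by apply: ae_S fg => x ->; exact: subrr.
  have [_ ->] := ae_N2 m0 h.1 z0.
  by rewrite /N2 -(rint0 R); apply: eq_rint => x; rewrite Normc.normc0 expr0n.
rewrite z mulr0 in n; have [_ [_ F2 _]] := hF; apply: is_fourier_ae hG F2.1 _.
by apply: ae_S (N2_eq0 FG2 n) => t /eqP; rewrite subr_eq0 => /eqP ->.
Qed.

Lemma unimod_cL2 (m : R -> C) P : cmf m -> {ae mu, forall t, normc (m t) = 1} -> cL2 P ->
  cL2 (fun t => m t * P t) /\ N2 (fun t => m t * P t) = N2 P.
Proof.
move=> mm m1 [mP iP].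
have e : ae_eq mu setT (fun t => normc (P t) ^+ 2) (fun t => normc (m t * P t) ^+ 2).
  by apply: ae_S m1 => t e _; rewrite normcM e mul1r.
have mP' : cmf (fun t => m t * P t) by exact: cmfM.
have m2 := mf_sqr_normc mP'; split; first by split => //; exact: ae_I1 m2 e iP.
by apply/esym; apply: ae_rint => //; exact: mf_sqr_normc.
Qed.

Lemma VF_cL2 P : cL2 P -> cL2 (VF P) /\ N2 (VF P) = N2 P.
Proof.
apply: unimod_cL2 (@cmf_Vsymbol R) _.
by apply: ae_S (@zeta_neq0_ae R) => t; exact: normc_Vsymbol.
Qed.

Lemma VF_cint P G : cL2 P -> cL2 G ->
  cint (fun t => VF P t * conjc (VF G t)) = cint (fun t => P t * conjc (G t)).
Proof.
move=> [mP _] [mG _]; apply: ae_cint.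
- by apply: cmfM; [|apply: cmfJ]; exact: cmfM (@cmf_Vsymbol R) _.
- by apply: cmfM mP _; exact: cmfJ.
apply: ae_S (@zeta_neq0_ae R) => t z0.
rewrite conjcM mulrACA mulc_conj normc_Vsymbol // expr1n mul1r //.
Qed.

(** The unimodular multiplier preserves square integrability and the transform is onto, so a
    function as required by [V] exists and [xget] returns one. *)
Lemma VE f : K f -> K (V f) /\ is_fourier (expT (V f)) (VF (mellin f)).
Proof.
move=> /K_cL2 h; have hF := mellinP h; have [_ [_ F2 _]] := hF.
have [G2 _] := VF_cL2 F2; have [p hp] := is_fourier_onto G2.
have ex : exists g, K g /\ ae_eq mu setT (mellin g) (VF (mellin f)).
  exists (expTinv p); split; first exact: K_expTinv hp.1.
  have e : expT (expTinv p) = p by apply/funext => x; exact: expTK.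
  have hq : is_fourier p (mellin (expTinv p)).
    by have := @mellinP (expTinv p); rewrite e => /(_ hp.1).
  by apply: ae_S (is_fourier_unique hq hp) => t et _.
have [K1 K2] : K (V f) /\ ae_eq mu setT (mellin (V f)) (VF (mellin f)) := xgetPex (fun=> 0) ex.
split; first exact: K1.
apply: is_fourier_ae (mellinP ((K_cL2 _).1 K1)) G2.1 _.
by apply: ae_S K2 => t /(_ Logic.I).
Qed.

Lemma V_fourier f F : K f -> is_fourier (expT f) F -> is_fourier (expT (V f)) (VF F).
Proof.
move=> Kf hF; have [_ h] := VE Kf; have [_ [_ F2 _]] := hF.
apply: is_fourier_ae h (VF_cL2 F2).1.1 _.
by apply: ae_S (is_fourier_unique (mellinP ((K_cL2 _).1 Kf)) hF) => t ->.
Qed.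

(** As the symbol is unimodular off the zeros of zeta, multiplying by its conjugate inverts it;
    surjectivity of the transform then gives a preimage under [V]. That [V] maps [Vinv g] to [g] is
    recorded through the transform [P]. *)
Lemma VinvE g : K g -> K (Vinv g) /\
  exists P, is_fourier (expT (Vinv g)) P /\ is_fourier (expT g) (VF P).
Proof.
move=> Kg; have h := (K_cL2 _).1 Kg; have hG := mellinP h; have [_ [_ G2 _]] := hG.
pose P t := conjc (Vsymbol (crit t)) * mellin g t.
have mP : cmf P by apply: cmfM (cmfJ (@cmf_Vsymbol R)) G2.1.
have e : {ae mu, forall t, VF P t = mellin g t}.
  apply: ae_S (@zeta_neq0_ae R) => t z0.
  by rewrite /P mulrA mulc_conj normc_Vsymbol // expr1n mul1r.
have P2 : cL2 P.
  apply: (unimod_cL2 (cmfJ (@cmf_Vsymbol R)) _ G2).1.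
  by apply: ae_S (@zeta_neq0_ae R) => t z0; rewrite normcJ normc_Vsymbol.
have [p hp] := is_fourier_onto P2.
have ep : expT (expTinv p) = p by apply/funext => x; exact: expTK.
have Kp := K_expTinv hp.1.
have hVp : is_fourier (expT (V (expTinv p))) (mellin g).
  by apply: is_fourier_ae (V_fourier Kp _) G2.1 e; rewrite ep.
have ex : exists f, K f /\ ae_eq mu posline (V f) g.
  exists (expTinv p); split => //.
  by apply/ae_expT; [exact: hVp.1.1|exact: h.1|exact: is_fourier_inj hVp hG].
have [K1 K2] : K (Vinv g) /\ ae_eq mu posline (V (Vinv g)) g := xgetPex (fun=> 0) ex.
split; first exact: K1.
have [KV hV] := VE K1; exists (mellin (Vinv g)); split; first exact: mellinP ((K_cL2 _).1 K1).
exact: is_fourier_src hV h.1 ((ae_expT ((K_cL2 _).1 KV).1 h.1).2 K2).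
Qed.

Lemma Vinv_isometry g g' : K g -> K g' ->
  N2 (fun x => expT (Vinv g) x - expT (Vinv g') x) = N2 (fun x => expT g x - expT g' x).
Proof.
move=> /VinvE[_ [P [h1 h2]]] /VinvE[_ [P' [h3 h4]]].
have e1 := is_fourier_N2 (is_fourierB h1 h3); have e2 := is_fourier_N2 (is_fourierB h2 h4).
have [_ [_ P2 _]] := is_fourierB h1 h3; have [_ e3] := VF_cL2 P2.
have p0 : @planch R != 0 by rewrite gt_eqF ?planch_gt0.
apply: (mulfI p0); rewrite -e1 -e2 -e3; apply: eq_N2 => t; exact: mulrBr.
Qed.

Lemma innerE f g : K f -> K g -> inner f g = cint (fun x => expT f x * conjc (expT g x)).
Proof.
move=> /K_cL2 h1 /K_cL2 h2; apply: cint_ln (cL2M h1 (cL2J h2).1) _ _ => t t0; last first.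
  by rewrite /posline indic_itvE in_itv /= andbT ltNge t0.
rewrite /posline indic_itvE in_itv /= andbT t0 /expT lnK ?posrE // conjcM conjcC.
rewrite mulrACA -rmorphM -expRD -mulrDl (_ : 2^-1 + 2^-1 = 1); last by field.
rewrite mul1r lnK ?posrE // mulrAC -rmorphM divff ?gt_eqF // rmorph1 mul1r.
by rewrite mulr1.
Qed.

(** The adjoint of the inverse of [V] is [V]: Parseval's identity is used on both sides and the
    symbol cancels against its conjugate. *)
Lemma inner_Vinv f g F : K f -> K g -> is_fourier (expT f) F ->
  inner f (Vinv g) = cint (fun x => expT (V f) x * conjc (expT g x)).
Proof.
move=> Kf Kg hF; have [K1 [Q [h1 h2]]] := VinvE Kg.
have p0 : (@planch R)%:C != 0 by rewrite -normc_eq0 normcC normr_eq0 gt_eqF ?planch_gt0.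
apply: (mulfI p0); rewrite innerE // -(is_fourier_parseval hF h1).
rewrite -(is_fourier_parseval (V_fourier Kf hF) h2).
have [_ [_ F2 _]] := hF; have [_ [_ Q2 _]] := h1; by rewrite VF_cint.
Qed.

End UnitaryV.

(** * Differentiation along the critical line *)

Section CriticalDerivative.
Variable R : realType.
Local Notation C := (R[i]).
Local Notation Re := (@complex.Re R).
Local Notation Im := (@complex.Im R).
Local Notation normc := (@Normc.normc R).
Local Notation mu := (@lebesgue_measure R).
Implicit Types (f g : R -> C) (s z w : C) (t u v x y : R) (k n : nat).

Lemma derive1_rint (f d : R -> R -> R) (G : R -> R) t : (forall u, I1 (f u)) ->
  (forall u x, is_derive u 1 (f ^~ x) (d u x)) -> I1 G -> (forall x, 0 <= G x) ->
  (forall u x, `|d u x| <= G x) -> derive1 (fun u => rint (f u)) t = rint (d t).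
Proof.
move=> If df IG G0 dG.
have e u x : derive1 (f ^~ x) u = d u x by rewrite derive1E; case: (df u x).
have := @differentiation_under_integral R _ _ mu f setT measurableT t (t - 1) (t + 1) _ _ _ G G0 _ _.
rewrite /rint => ->.
- by apply: eq_Rintegral => x _; rewrite /partial1of2 /= e.
- by rewrite /= in_itv /= ltrBlDr ltrDl ltr01.
- by move=> u _; exact: If.
- by move=> u x _ _; case: (df u x).
- exact: IG.
- by move=> u x _ _; rewrite /partial1of2 e.
Qed.

Lemma derive1_FT g t : cL1 g -> cL1 (fun x => x%:C * g x) ->
  derive1 (fun u => Re (FT g u)) t +i* derive1 (fun u => Im (FT g u)) t =
  (0 +i* 1) * FT (fun x => x%:C * g x) t.
Proof.
move=> lg lxg.
pose d u x : C := (0 +i* 1) * (x%:C * g x * cis (u * x)).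
have dE u x : cder (fun u => g x * cis (u * x)) u (d u x).
  have -> : (fun u => g x * cis (u * x)) = (fun u => g x * cis (x * u)).
    by apply/funext => v; rewrite (mulrC v).
  apply: cder_eq (cderM (cder_cst (g x) u) (cder_cis x u)) _.
  rewrite /d mul0r addr0 (mulrC u) (_ : 0 +i* x = (0 +i* 1) * x%:C); first by ring.
  by apply: ceq => /=; ring.
have bd u x : normc (d u x) <= normc (x%:C * g x).
  rewrite /d normcM normcM normc_cis mulr1 ler_piMl ?normc_ge0 //.
  by rewrite (_ : 0 +i* 1 = cis (pi / 2)) ?normc_cis // /cis cos_pihalf sin_pihalf.
have IG := I1_normc lxg; have G0 x : 0 <= normc (x%:C * g x) by exact: normc_ge0.
have h1 := @derive1_rint _ (fun u x => Re (d u x)) _ t (fun u => (cL1_cis u lg).1) (fun u x => (dE u x).1)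
  IG G0 (fun u x => le_trans (Re_le_normc _) (bd u x)).
have h2 := @derive1_rint _ (fun u x => Im (d u x)) _ t (fun u => (cL1_cis u lg).2) (fun u x => (dE u x).2)
  IG G0 (fun u x => le_trans (Im_le_normc _) (bd u x)).
rewrite /FT -(cintZ _ (cL1_cis t lxg)) -/(d t) /cint; apply: ceq => /=; [exact: h1|exact: h2].
Qed.

(** Differentiating in [tau] brings down [i x], and [d/ds] divides by [i]; thus [- d/ds] multiplies
    the integrand by [- x]. *)
Lemma iter_dds g (h : C -> C) k t : (forall u, h (crit u) = FT g u) ->
  (forall j, cL1 (fun x => ((- x) ^+ j)%:C * g x)) ->
  iter k (fun h z => - dds h z) h (crit t) = FT (fun x => ((- x) ^+ k)%:C * g x) t.
Proof.
move=> hg lg; elim: k t => [|k IH] t.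
  by rewrite /= hg; congr FT; apply/funext => x; rewrite expr0 mul1r.
pose gk x := ((- x) ^+ k)%:C * g x.
have lx : cL1 (fun x => x%:C * gk x).
  have := cL1N (lg k.+1); congr cL1; apply/funext => x.
  by rewrite /gk exprS !rmorphM rmorphN /=; ring.
rewrite iterS /dds.
have -> : (fun u => Re (iter k (fun h z => - dds h z) h (crit u))) = (fun u => Re (FT gk u)).
  by apply/funext => u; rewrite IH.
have -> : (fun u => Im (iter k (fun h z => - dds h z) h (crit u))) = (fun u => Im (FT gk u)).
  by apply/funext => u; rewrite IH.
rewrite (_ : Im (crit t) = t) // (derive1_FT t (lg k) lx).
have i0 : (0 +i* 1 : C) != 0.
  by rewrite -normc_eq0 (_ : 0 +i* 1 = cis (pi / 2)) ?normc_cis ?oner_eq0 // /cis cos_pihalf sin_pihalf.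
rewrite mulKf // -mulN1r -(cintZ _ (cL1_cis t lx)) /FT; apply: eq_cint => x.
by rewrite /gk exprS rmorphM rmorphN /=; ring.
Qed.

Lemma I1_pow_expR_abs k : I1 (fun x : R => `|x| ^+ k * expR (- 4^-1 * `|x|)).
Proof.
have q0 : 0 < 4^-1 :> R by rewrite invr_gt0.
have h := I1_pexp k q0; have h2 := I1_sub 0 h.
have m : mf (fun x : R => `|x| ^+ k * expR (- 4^-1 * `|x|)).
  have ma := mf_norm (@mf_id R); apply: mfM; first exact: mfX.
  by apply: mf_expR; exact: mfM (mf_cst _) ma.
apply: (le_I1 m (I1D h h2)) => x; rewrite ger0_norm ?mulr_ge0 ?exprn_ge0 ?expR_ge0 //.
rewrite !rayE sub0r oppr_ge0; case: (leP 0 x) => x0.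
  rewrite ger0_norm // mulr1 lerDl; case: (leP x 0) => x1; last by rewrite mulr0.
  by rewrite mulr1 mulr_ge0 ?expR_ge0 ?exprn_ge0 // oppr_ge0.
by rewrite ltr0_norm // (ltW x0) mulr0 add0r mulr1.
Qed.

Lemma cL1_pow_decay f k : decay f -> cL1 (fun x => ((- x) ^+ k)%:C * f x).
Proof.
move=> [mff [B hB]]; apply: (le_cL1 _ (I1Z B (I1_pow_expR_abs k))) => [|x].
  by apply: cmfM mff; apply: cmf_real; apply: mfX; exact: mfN (@mf_id R).
rewrite normcMC normrX normrN mulrCA ler_wpM2l ?exprn_ge0 //; exact: hB.
Qed.

Lemma decay_sub f c : decay f -> decay (fun x => f (c - x)).
Proof.
move=> [mff [B hB]]; split.
  by apply: cmf_comp mff _; apply: mfB; [exact: mf_cst|exact: (@mf_id R)].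
have B0 : 0 <= B by have := le_trans (normc_ge0 _) (hB 0); rewrite normr0 mulr0 expR0 mulr1.
exists (B * expR (4^-1 * `|c|)) => x; apply: (le_trans (hB _)).
rewrite -mulrA ler_wpM2l // -expRD ler_expR.
have : `|x| <= `|c| + `|c - x| by rewrite -{1}(subKr c x) ler_normB.
by move: (`|x|) (`|c|) (`|c - x|) => p q r; lra.
Qed.

End CriticalDerivative.

(** * The limit [Y] and its scalar products with dilates of [A] *)

Section MainTheorem.
Variable R : realType.
Local Notation C := (R[i]).
Local Notation Re := (@complex.Re R).
Local Notation Im := (@complex.Im R).
Local Notation normc := (@Normc.normc R).
Local Notation mu := (@lebesgue_measure R).
Implicit Types (f g F G P : R -> C) (s z w : C) (t u v x y c lambda theta : R) (k n : nat).
Local Notation hf := ((2^-1 : R)%:C : C).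

Lemma expT_psi w k x : expT (psi w k) x = psT w k x.
Proof.
rewrite /expT /psi /psT lnV ?posrE ?expR_gt0 // expRK rayE oppr_ge0.
have -> : \1_(`]0, 1]) (expR x) = (x <= 0)%R%:R :> R.
  by rewrite indic_itvE in_itv /= expR_gt0 expR_le1.
have e : (expR (2^-1 * x))%:C * cpow (expR x) (- w) = cexp ((- x)%:C * - (hf - w)).
  rewrite /cpow expRK (_ : (expR (2^-1 * x))%:C = cexp (x%:C * hf)).
    by rewrite -cexpD; congr cexp; rewrite rmorphN; ring.
  by rewrite -rmorphM cexpC mulrC.
rewrite /pexp -e; move: (cpow _ _) ((expR _)%:C) => a b; ring.
Qed.

Lemma cL2_psT w k : Re w < 2^-1 -> cL2 (psT w k).
Proof.
move=> hw; have a0 : 0 < 2 * (2^-1 - Re w) by rewrite mulr_gt0 // subr_gt0.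
have i := @I1_sub R 0 _ (I1_pexp (2 * k) a0).
apply: (le_cL2 (cL1_cmf (cL1_psT k hw)) i) => x; rewrite sub0r /psT mulrC normcMC rayE.
case: (leP 0 (- x)) => x0; last by rewrite normr0 mul0r expr0n mulr0.
rewrite normr1 mul1r mulr1 normc_pexp // exprMn -exprM mulnC expr2 -expRD.
have -> : Re (hf - w) = 2^-1 - Re w by rewrite ReB ReC.
by rewrite le_eqVlt; apply/orP; left; apply/eqP; congr (_ * expR _); ring.
Qed.

Lemma K_psi w k : Re w < 2^-1 -> K (psi w k).
Proof.
move=> hw; apply/K_cL2; have := cL2_psT k hw; congr cL2; apply/funext => x.
by rewrite expT_psi.
Qed.

Lemma expT_Q lambda f x : 0 < lambda -> expT (Q lambda f) x = cut (ln lambda) x * expT f x.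
Proof.
move=> l0; rewrite /expT /Q /cut mulrCA; congr (_%:C * _).
by rewrite !indic_itvE !in_itv /= !andbT -[in RHS]ler_expR lnK // posrE.
Qed.

Lemma cL2_cut l f : cL2 f -> cL2 (fun x => cut l x * f x).
Proof.
move=> hf; apply: (cL2_le (cmfM (cmf_cut l) hf.1) hf _).1 => x.
have /andP[h1 h2] := indic_le1 (`[l, +oo[) x.
by rewrite normcMC ger0_norm // ler_piMl ?normc_ge0.
Qed.

Lemma expT_Vpsi w k : Re w < 2^-1 -> {ae mu, forall x, expT (V (psi w k)) x = Gk w k x}.
Proof.
move=> hw; apply: is_fourier_inj (is_fourier_Gk k hw).
apply: V_fourier (K_psi k hw) _.
apply: eq_fourier (is_fourier_L1 (cL1_psT k hw) (cL2_psT k hw)) => x.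
by rewrite expT_psi.
Qed.

Lemma K_QVpsi lambda w k : 0 < lambda -> Re w < 2^-1 -> K (Q lambda (V (psi w k))).
Proof.
move=> l0 hw; apply/K_cL2; have [KV _] := VE (K_psi k hw).
have := cL2_cut (ln lambda) ((K_cL2 _).1 KV); congr cL2; apply/funext => x.
by rewrite expT_Q.
Qed.

Lemma expT_QVpsi lambda w k : 0 < lambda -> Re w < 2^-1 ->
  {ae mu, forall x, expT (Q lambda (V (psi w k))) x = cut (ln lambda) x * Gk w k x}.
Proof. by move=> l0 hw; apply: ae_S (expT_Vpsi k hw) => x e; rewrite expT_Q // e. Qed.

Lemma Ylim_exists lambda s k : 0 < lambda -> Re s = 2^-1 -> exists Y, is_Ylim lambda s k Y.
Proof.
move=> l0 hs; have hs' : Re s <= 2^-1 by rewrite hs.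
have c2 := @cL2_cutG R (ln lambda) s k hs'.
(* The limit is the inverse image of the continued function at [w = s] itself. *)
pose g0 := expTinv (fun x => cut (ln lambda) x * Gk s k x).
have Kg0 : K g0 by exact: K_expTinv.
have eg0 x : expT g0 x = cut (ln lambda) x * Gk s k x by rewrite expTK.
have [KY _] := VinvE Kg0; exists (Vinv g0); split; first exact: KY.
have [B B0 hB] := cutG_cvg (ln lambda) k hs'.
move=> eps eps0; have B1 : 0 < B + 1 by rewrite ltr_wpDl.
(* The bound 1 keeps [w] in the range of [cutG_cvg]; the other one is chosen so that
   [B (eps / (B + 1)) ^+ 2 < eps ^+ 2]. *)
exists (Num.min 1 (eps / (B + 1))); first by rewrite lt_min ltr01 divr_gt0.
move=> w hw; rewrite lt_min => /andP[w1 w2].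
have Kg := K_QVpsi k l0 hw; have [KV _] := VinvE Kg.
have cd : cL2 (expT (fun t => Vinv (Q lambda (V (psi w k))) t - Vinv g0 t)).
  have := (cL2B ((K_cL2 _).1 KV) ((K_cL2 _).1 KY)).1; congr cL2; apply/funext => x.
  by rewrite expTB.
rewrite L2norm_expT // lte_fin.
have -> : N2 (expT (fun t => Vinv (Q lambda (V (psi w k))) t - Vinv g0 t)) =
    N2 (fun x => cut (ln lambda) x * Gk w k x - cut (ln lambda) x * Gk s k x).
  rewrite (eq_N2 (fun x => expTB _ _ x)) (Vinv_isometry Kg Kg0).
  have hd := (cL2B ((K_cL2 _).1 Kg) ((K_cL2 _).1 Kg0)).1.
  apply: (ae_N2 _ hd _).2.
    by apply: cmfB; apply: cmfM (cmf_cut _) (cmf_Gk _ _).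
  by apply: ae_S (expT_QVpsi k l0 hw) => x e; rewrite e eg0.
rewrite -[ltRHS](gtr0_norm eps0) -sqrtr_sqr ltr_sqrt ?exprn_gt0 //.
apply: (le_lt_trans (hB w (ltW hw) (ltW w1))).
have n0 := normc_ge0 (w - s).
apply: (@le_lt_trans _ _ (B * (eps / (B + 1)) ^+ 2)).
  have e0 : 0 <= eps / (B + 1) by rewrite divr_ge0 // ltW.
  by rewrite ler_wpM2l // lerXn2r ?nnegrE //; exact: ltW.
rewrite expr_div_n mulrCA -[ltRHS]mulr1 ltr_pM2l ?exprn_gt0 // ltr_pdivrMr ?exprn_gt0 // mul1r.
by rewrite expr2 mulrDr mulr1 mulrDl; have := mulr_ge0 B0 B0; lra.
Qed.

(** [hA] is [A] read in the variable [- ln t], whence the reflection of [x]. *)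
Lemma expT_dilation theta x : 0 < theta ->
  expT (dilation theta (@A R)) x = @hA R (ln theta - x).
Proof.
move=> t0; have e : expR x / theta = expR (- (ln theta - x)).
  by rewrite opprB expRB lnK // posrE.
have sq : (Num.sqrt theta)^-1 = expR (- 2^-1 * ln theta).
  have e2 : expR (2^-1 * ln theta) ^+ 2 = theta.
    by rewrite expr2 -expRD -mulrDl (_ : 2^-1 + 2^-1 = 1) ?mul1r ?lnK ?posrE //; field.
  by rewrite mulNr expRN -{1}e2 sqrtr_sqr ger0_norm // expR_ge0.
rewrite /expT /dilation /A e hAE expRK -expRN opprK sq mulrA -rmorphM -expRD -rmorphM.
congr ((expR _ * _)%:C); by ring.
Qed.

Lemma hA_lt0 x : x < 0 -> @hA R x = 0.
Proof.
move=> x0; rewrite hAE (@truncn_def _ _ 0) ?expR_ge0 ?expR_lt1 //=.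
by rewrite fact0 ln1 mul0r !addr0 mulr0.
Qed.

Section FixedDilation.
Variable theta : R.
Hypothesis theta_gt0 : 0 < theta.
Let c := ln theta.
Let fA := dilation theta (@A R).
(** By [hA_lt0] this vanishes for [x > c]; its reflection [bT] about [c] vanishes for [x < c]. *)
Let aT x := @hA R (c - x).

Let fAE : expT fA = aT. Proof. by apply/funext => x; exact: expT_dilation. Qed.

Let decay_aT : decay aT. Proof. exact: decay_sub c (@decay_hA R). Qed.

Let K_fA : K fA. Proof. by apply/K_cL2; rewrite fAE; exact: decay_cL2 decay_aT. Qed.

Let decay_opp : decay (fun x => @hA R (- x)).
Proof.
have -> : (fun x => @hA R (- x)) = (fun x => @hA R (0 - x)) by apply/funext => x; rewrite sub0r.
exact: decay_sub 0 (@decay_hA R).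
Qed.

Let FT_aT t : FT aT t = cis (t * c) * Z (crit t).
Proof.
have -> : aT = (fun x => @hA R (- (x - c))) by apply/funext => x; rewrite opprB.
by rewrite (FT_shift c t (decay_cL1 decay_opp)) (FT_opp t (decay_cL1 (@decay_hA R))) FT_hA critN opprK.
Qed.

Let cis_cpow t : cis (t * c) = cpow theta (crit t - 2^-1).
Proof.
rewrite /cpow cexpE ReMC ImMC.
have -> : crit t - 2^-1 = 0 +i* t.
  rewrite critE (_ : hf = 2^-1); first by rewrite addrAC subrr add0r.
  by rewrite fmorphV rmorph_nat.
by rewrite !reimE mulr0 expR0 mul1r mulrC.
Qed.

Let bT x := @hA R (x - c).
Let decay_bT : decay bT.
Proof.
have -> : bT = (fun x => (fun y => @hA R (- y)) (c - x)).
  by apply/funext => x; rewrite /bT opprB.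
exact: decay_sub c decay_opp.
Qed.

Let FT_bT t : FT bT t = cis (t * c) * Z (1 - crit t).
Proof. rewrite -FT_hA; exact: FT_shift c t (decay_cL1 (@decay_hA R)). Qed.

(** The factor [cis (t * c)] of the translation is common to both transforms, so [V] acts on the
    dilate of [A] as the reflection about [c]. *)
Let expT_VfA : {ae mu, forall x, expT (V fA) x = bT x}.
Proof.
have h1 : is_fourier (expT fA) (FT aT).
  by rewrite fAE; exact: is_fourier_L1 (decay_cL1 decay_aT) (decay_cL2 decay_aT).
have h2 := V_fourier K_fA h1; have h3 := is_fourier_L1 (decay_cL1 decay_bT) (decay_cL2 decay_bT).
have [_ [_ VF2 _]] := h2.
apply: (is_fourier_inj h2); apply: (is_fourier_ae h3 VF2.1).
apply: ae_S (@zeta_neq0_ae R) => t z0.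
apply: (etrans (FT_bT t)); rewrite FT_aT /Z /Vsymbol.
have s0 := crit_neq0 t; have s1 : 1 - crit t != 0 by rewrite critN crit_neq0.
move: (cis _) => q; by field; rewrite s0 s1 z0.
Qed.

Lemma inner_dilation_QV lambda w k : 0 < lambda -> lambda <= theta -> Re w < 2^-1 ->
  inner fA (Vinv (Q lambda (V (psi w k)))) = cint (fun x => aT x * conjc (psT w k x)).
Proof.
move=> l0 lt hw; have Kg := K_QVpsi k l0 hw; have g2 := (K_cL2 _).1 Kg.
have h1 : is_fourier (expT fA) (FT aT).
  by rewrite fAE; exact: is_fourier_L1 (decay_cL1 decay_aT) (decay_cL2 decay_aT).
have [KV _] := VE K_fA; have v2 := (K_cL2 _).1 KV.
have p0 : (@planch R)%:C != 0 by rewrite -normc_eq0 normcC normr_eq0 gt_eqF ?planch_gt0.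
have hG := is_fourier_Gk k hw; have hV := V_fourier K_fA h1.
have hp := is_fourier_L1 (cL1_psT k hw) (cL2_psT k hw).
have -> : inner fA (Vinv (Q lambda (V (psi w k)))) = cint (fun x => expT (V fA) x * conjc (Gk w k x)).
  rewrite (inner_Vinv K_fA Kg h1); apply: ae_cint.
  - by apply: cmfM v2.1 _; exact: cmfJ g2.1.
  - by apply: cmfM v2.1 _; exact: cmfJ (cmf_Gk w k).
  apply: ae_S (ae_I expT_VfA (expT_QVpsi k l0 hw)) => x [e1 e2].
  (* Where [bT] does not vanish, [x >= ln theta >= ln lambda] and the cut equals 1. *)
  rewrite e1 e2 /bT; case: (ltP x c) => xc; first by rewrite hA_lt0 ?subr_lt0 // !mul0r.
  have lx : ln lambda <= x by apply: le_trans xc; rewrite ler_ln ?posrE.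
  by rewrite /cut indic_itvE in_itv /= lx mul1r.
apply: (mulfI p0); rewrite -(is_fourier_parseval hV hG).
have [_ [_ F2 _]] := h1; have [_ [_ P2 _]] := hp.
by rewrite (VF_cint F2 P2) (is_fourier_parseval h1 hp) fAE.
Qed.

(** For [theta <= 1] the support of [aT] lies in [x <= 0], where the indicator in [psT] is 1 and the
    modulus of [psT] is at most [|x| ^ k] up to the critical line; so [|x| ^ k |aT x|] dominates.
    The points [s - 1 / (n + 1)] approach [s] from the left, and at [s] the exponential becomes
    [cis]. *)
Lemma cint_psT_cvg s k : theta <= 1 -> Re s = 2^-1 ->
  ccvg (fun n => cint (fun x => aT x * conjc (psT (s - (harmonic n)%:C) k x)))
    (FT (fun x => ((- x) ^+ k)%:C * aT x) (Im s)).
Proof.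
move=> t1 hs.
have c0 : c <= 0 by rewrite /c -ln1 ler_ln ?posrE.
have a0 x : 0 < x -> aT x = 0.
  by move=> x0; rewrite /aT hA_lt0 // subr_lt0 (le_lt_trans c0).
have mps w : cmf (psT w k).
  have m : cmf (fun x => pexp k (hf - w) x * (ray x)%:C) by apply: cmfM (cmf_pexp _ _) (cmf_real (@mf_ray R)).
  by have := cmf_comp m (mfN (@mf_id R)).
have hRe n : 0 <= Re (hf - (s - (harmonic n)%:C)).
  rewrite !ReB !ReC hs opprB addrC subrK; exact: ltW (harmonic_gt0 _).
have e x : aT x * conjc (psT s k x) = ((- x) ^+ k)%:C * aT x * cis (Im s * x).
  case: (leP x 0) => x0; last by rewrite a0 // mulr0 !mul0r.
  rewrite /psT rayE oppr_ge0 x0 mulr1 /pexp conjcM conjcC mulrCA mulrA; congr (_ * _).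
  have -> : hf - s = 0 +i* (- Im s) by apply: ceq; rewrite !reimE ?hs ?subrr ?sub0r.
  rewrite -cexpJ cexpE ReJ ImJ ReMC ImMC !reimE oppr0 mulr0 expR0 mul1r.
  by congr cis; ring.
rewrite /FT -(eq_cint e).
have ld := cL1_pow_decay k decay_aT.
apply: (@cdct R (fun n x => aT x * conjc (psT (s - (harmonic n)%:C) k x)) _ _ _ _ (I1_normc ld) _ _).2.
- by move=> n; apply: cmfM decay_aT.1 _; exact: cmfJ (mps _).
- by apply: cmfM decay_aT.1 _; exact: cmfJ (mps _).
- apply: aeW => x.
  apply: (@ccvgM R (fun _ => aT x) (fun n => conjc (psT (s - (harmonic n)%:C) k x)) _ _ (ccvg_cst _)).
  apply: (@ccvg_dist R _ (fun n => `|x| ^+ k * (2 * `|x|) * harmonic n)).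
    rewrite -[X in _ --> X](mulr0 (`|x| ^+ k * (2 * `|x|))).
    by apply: cvgM; [exact: cvg_cst|exact: cvg_harmonic].
  move=> n; rewrite -conjcN -conjcD normcJ /psT rayE oppr_ge0.
  case: (leP x 0) => x0; last first.
    by rewrite !mulr0 subrr Normc.normc0 !mulr_ge0 ?exprn_ge0 //; exact: ltW (harmonic_gt0 _).
  rewrite !mulr1 /pexp -mulrBr normcMC normrX normrN -[leRHS]mulrA ler_wpM2l ?exprn_ge0 //.
  have r z : 0 <= Re (hf - z) -> Re ((- x)%:C * - (hf - z)) <= 0.
    by move=> hz; rewrite ReMC ReN mulrN oppr_le0 mulr_ge0 // oppr_ge0.
  have rs : 0 <= Re (hf - s) by rewrite ReB ReC hs subrr.
  apply: (le_trans (cexp_lip (r _ (hRe n)) (r _ rs))).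
  rewrite -mulrBr (_ : - (hf - (s - (harmonic n)%:C)) - - (hf - s) = - (harmonic n)%:C); last by ring.
  rewrite normcMC normcN normcC normrN mulrA (ger0_norm (x := harmonic n)) //.
  exact: ltW (harmonic_gt0 _).
- move=> n x; rewrite !normcM normcJ normcC mulrC ler_wpM2r ?normc_ge0 //.
  rewrite /psT mulrC normcMC rayE oppr_ge0; case: (leP x 0) => x0; last by rewrite normr0 mul0r.
  rewrite normr1 mul1r normc_pexp ?oppr_ge0 // (ger0_norm (x := (- x) ^+ k)); last by rewrite exprn_ge0 // oppr_ge0.
  rewrite ler_piMr ?exprn_ge0 ?oppr_ge0 // -[leRHS]expR0 ler_expR mulNr oppr_le0 mulr_ge0 ?oppr_ge0 //.
Qed.

(** The definition of the limit, restricted to one sequence of points [w], gives convergence in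
    norm, hence of scalar products; so the value is the same for every representative [Y]. *)
Lemma inner_Ylim lambda s k Y : 0 < lambda -> lambda <= theta -> theta <= 1 -> Re s = 2^-1 ->
  is_Ylim lambda s k Y -> inner fA Y = FT (fun x => ((- x) ^+ k)%:C * aT x) (Im s).
Proof.
move=> l0 lt t1 hs [KY hY].
pose w n := s - (harmonic n)%:C.
have hw n : Re (w n) < 2^-1 by rewrite /w ReB ReC hs ltrBlDr ltrDl; exact: harmonic_gt0.
pose u n := Vinv (Q lambda (V (psi (w n) k))).
have Ku n : K (u n) by have [] := VinvE (K_QVpsi k l0 (hw n)).
have Y2 := (K_cL2 _).1 KY; have u2 n := (K_cL2 _).1 (Ku n).
have cu : L2cvg (fun n => expT (u n)) (expT Y).
  split => //; apply/cvgrPdist_lt => e e0.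
  (* [N2] is the square of the norm in [is_Ylim], hence the threshold [Num.sqrt e]. *)
  have se0 : 0 < Num.sqrt e by rewrite sqrtr_gt0.
  have [d d0 hd] := hY _ se0.
  have := @cvg_harmonic R; move/cvgrPdist_lt => /(_ d d0); apply: filterS => n.
  rewrite !sub0r !normrN ger0_norm ?(ltW (harmonic_gt0 _)) // => hn.
  rewrite ger0_norm ?N2_ge0 //.
  have wd : normc (w n - s) < d.
    by rewrite /w addrAC subrr add0r normcN normcC ger0_norm // ltW // harmonic_gt0.
  have cd : cL2 (expT (fun t => u n t - Y t)).
    by have := (cL2B (u2 n) Y2).1; congr cL2; apply/funext => x; rewrite expTB.
  have := hd (w n) (hw n) wd; rewrite (L2norm_expT cd) lte_fin ltr_sqrt //.
  by rewrite (eq_N2 (fun x => expTB _ _ x)).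
have ca : L2cvg (fun _ : nat => expT fA) (expT fA).
  have f2 := (K_cL2 _).1 K_fA; split => //.
  have z : N2 (fun x => expT fA x - expT fA x) = 0.
    by rewrite /N2 -(rint0 R); apply: eq_rint => x; rewrite subrr Normc.normc0 expr0n.
  by rewrite z; exact: cvg_cst.
have c1 := L2cvg_pairing ca (L2cvgJ cu).
rewrite (innerE K_fA KY); apply: ccvg_unique c1 _.
have := cint_psT_cvg k t1 hs; congr ccvg; apply/funext => n.
by rewrite -(inner_dilation_QV k l0 lt (hw n)) (innerE K_fA (Ku n)).
Qed.

Lemma inner_Ylim_dds lambda s k Y : 0 < lambda -> lambda <= theta -> theta <= 1 -> Re s = 2^-1 ->
  is_Ylim lambda s k Y ->
  inner fA Y = iter k (fun h z => - dds h z) (fun z => cpow theta (z - 2^-1) * Z z) s.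
Proof.
move=> l0 lt t1 hs hY; rewrite (inner_Ylim l0 lt t1 hs hY).
have -> : s = crit (Im s) by apply: ceq; rewrite ?hs.
by apply/esym; apply: (iter_dds k) => [u|j]; [rewrite FT_aT cis_cpow|exact: cL1_pow_decay].
Qed.

End FixedDilation.
End MainTheorem.

Theorem mainTheorem3 (R : realType) (lambda : R) (s : R[i]) (k : nat)
    (lambda_gt0 : 0 < lambda) (lambda_le1 : lambda <= 1)
    (s_crit : complex.Re s = 2^-1) :
  (exists Y : R -> R[i], is_Ylim lambda s k Y) /\
  (forall Y : R -> R[i], is_Ylim lambda s k Y ->
    forall theta : R, lambda <= theta -> theta <= 1 ->
      inner (dilation theta (@A R)) Y =
      iter k (fun h z => - dds h z)
        (fun z => cpow theta (z - 2^-1) * Z z) s).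
Proof.
split=> [|Y hY theta lt t1]; first exact: Ylim_exists.
exact: (@inner_Ylim_dds R theta (lt_le_trans lambda_gt0 lt) lambda s k Y lambda_gt0 lt t1 s_crit hY).
Qed.
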